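(* Let $d\ge 3$ and let $K\subset\mathbb S^d$ be a proper spherical convex body with GHS-center $\mathbf o=\mathbf o(K)$ such that $K\subset C_{\mathbf o}(\alpha_d)$, where $\alpha_d\in(0,\frac{\pi}{2})$ is given by $\tan\alpha_d=\sqrt{d(d-2)}$. Then there is a constant $C=C(K)>0$ such that $$\Omega_1^s(K)\le\bigl(1-C\,\Delta(K)^2\bigr)\,\Omega_1^s(C_K),$$ where $\Delta(K)=\mathrm{vol}_d^s(K\triangle C_K(\mathbf o))$.
   Context: $\mathbb S^d=\{\mathbf u\in\mathbb R^{d+1}:\mathbf u\cdot\mathbf u=1\}$, with geodesic distance $d_s$, $\cos d_s(\mathbf u,\mathbf v)=\mathbf u\cdot\mathbf v$, and spherical volume $\mathrm{vol}_d^s$ ($d$-dimensional Hausdorff measure). A spherical convex body is a closed set $K\subset\mathbb S^d$ with non-empty interior that contains, with any two non-antipodal points, the minimal geodesic arc joining them; it is proper if it is contained in an open half-sphere. $C_{\mathbf o}(\alpha)=\{\mathbf u\in\mathbb S^d: d_s(\mathbf o,\mathbf u)\le\alpha\}$ is the geodesic ball with center $\mathbf o$ and radius $\alpha$. $C_K(\mathbf o)$ is the geodesic ball centered at $\mathbf o$ with the same spherical volume as $K$; $C_K$ is written when the center is irrelevant. $A\triangle B=(A\setminus B)\cup(B\setminus A)$. Dual body: $K^*=\{\mathbf v\in\mathbb S^d:\mathbf v\cdot\mathbf u\ge 0\ \forall \mathbf u\in K\}$. Gnomonic projection around $\mathbf o\in\mathbb S^d$: $g_{\mathbf o}(\mathbf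 u)=\frac{\mathbf u}{\mathbf u\cdot\mathbf o}-\mathbf o\in\mathbf o^\perp\cong\mathbb R^d$, for $\mathbf u\cdot\mathbf o>0$. GHS-center: for a proper spherical convex body $K$, $\mathbf o(K)$ is the uniquely determined point of $\operatorname{int}K\cap\operatorname{int}K^*$ such that $g_{\mathbf o}(K)\subset\mathbb R^d$ has its (Euclidean) centroid at the origin. Floating area: $\Omega_1^s(K)=\int_{\partial K}H_{d-1}^s(K,\mathbf u)^{\frac{1}{d+1}}\,\mathrm{vol}_{\partial K}^s(d\mathbf u)$, where $H_{d-1}^s(K,\cdot)\ge0$ is the generalized spherical Gauss–Kronecker curvature of $\partial K$ (which exists almost everywhere, at the boundary points that are twice differentiable in the sense of Aleksandrov, as the product of the generalized principal curvatures in $\mathbb S^d$), and $\mathrm{vol}_{\partial K}^s$ is the $(d-1)$-dimensional Hausdorff measure on $\partial K$. *)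

(* Defs.v *)
From HB Require Import structures.
From mathcomp Require Import all_boot all_order all_algebra.
From mathcomp Require Import all_classical all_reals all_analysis.

Set Implicit Arguments.
Unset Strict Implicit.
Unset Printing Implicit Defensive.
Import Order.TTheory GRing.Theory Num.Theory.
Import numFieldNormedType.Exports.

Local Open Scope classical_set_scope.
Local Open Scope ring_scope.

(* The library norm on 'rV[R]_n is the sup norm: it gives the right topology,
   but lengths, diameters and angles need the Euclidean one. *)
Section euclidean.
Context {R : realType} {n : nat}.
Implicit Types u v : 'rV[R]_n.

Definition dot u v : R := \sum_(i < n) u 0 i * v 0 i.

Definition enorm u : R := Num.sqrt (dot u u).

Definition ediam (U : set 'rV[R]_n) : \bar R :=
  ereal_sup [set (enorm (x - y))%:E | x in U & y in U].

End euclidean.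

(* Volume pi^(s/2) / Gamma(s/2 + 1) of the Euclidean unit ball of R^s. *)
Fixpoint unit_ball_volume (R : realType) (s : nat) : R :=
  match s with
  | 0%N => 1
  | 1%N => 2
  | (s'.+1 as s1).+1 => 2 * pi / s1.+1%:R * unit_ball_volume R s'
  end.

Section hausdorff.
Context (R : realType) (n : nat).
Local Notation V := 'rV[R]_n.
Local Open Scope ereal_scope.

(* Weight of a covering set; sets of diameter larger than delta have infinite
   weight, so that they never contribute to the infimum below. *)
Definition hausdorff_weight (s : nat) (delta : R) (U : set V) : \bar R :=
  if U == set0 then 0
  else if ediam U <= delta%:E
  then (unit_ball_volume R s / 2 ^+ s)%:E * ediam U ^+ s
  else +oo.

(* [mu_ext] takes the infimum over countable covers by measurable sets; in the
   sigma-algebra generated by all sets, these are all countable covers. *)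
Definition hausdorff_premeasure (s : nat) (delta : R) : set V -> \bar R :=
  mu_ext (hausdorff_weight s delta :
    set (g_sigma_algebraType [set: set V]) -> \bar R).

(* Normalised so as to coincide with Lebesgue measure on s-dimensional
   subspaces. *)
Definition hausdorff (s : nat) (A : set V) : \bar R :=
  ereal_sup [set hausdorff_premeasure s delta A |
             delta in [set delta : R | (0 < delta)%R]].

Lemma unit_ball_volume_gt0 s : (0 < unit_ball_volume R s)%R.
Proof.
suff: (0 < unit_ball_volume R s)%R && (0 < unit_ball_volume R s.+1)%R.
  by case/andP.
elim: s => [|s /andP[h0 h1]]; first by rewrite /= ltr01 ltr0n.
rewrite h1 /=; apply: mulr_gt0 => //.
by apply: divr_gt0 => //; apply: mulr_gt0 => //; exact: pi_gt0.
Qed.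

Lemma hausdorff_weight0 s delta : hausdorff_weight s delta set0 = 0.
Proof. by rewrite /hausdorff_weight eqxx. Qed.

Lemma hausdorff_weight_ge0 s delta U : 0 <= hausdorff_weight s delta U.
Proof.
rewrite /hausdorff_weight; case: eqVneq => // /set0P[x Ux].
case: ifP => // _; apply: mule_ge0.
  by rewrite lee_fin divr_ge0 // ltW // unit_ball_volume_gt0.
apply: expe_ge0; apply: (@le_trans _ _ (enorm (x - x))%:E).
  by rewrite lee_fin sqrtr_ge0.
by apply: ereal_sup_ubound; exists x => //; exists x.
Qed.

Lemma hausdorff_premeasure_ge0 s delta A : 0 <= hausdorff_premeasure s delta A.
Proof.
apply: (@mu_ext_ge0 _ (g_sigma_algebraType [set: set V]) R
  (hausdorff_weight s delta)); exact: hausdorff_weight_ge0.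
Qed.

Lemma hausdorff0 s : hausdorff s set0 = 0.
Proof.
have h0 delta : hausdorff_premeasure s delta set0 = 0.
  apply: (@mu_ext0 _ (g_sigma_algebraType [set: set V]) R
    (hausdorff_weight s delta)); first exact: hausdorff_weight0.
  exact: hausdorff_weight_ge0.
rewrite /hausdorff (_ : [set _ | _ in _] = [set 0]) ?ereal_sup1 //.
apply/seteqP; split => [_ [e _ <-]|_ ->] /=; first exact: h0.
by exists 1%R => //=.
Qed.

Lemma hausdorff_ge0 s A : 0 <= hausdorff s A.
Proof.
apply: (@le_trans _ _ (hausdorff_premeasure s 1 A)).
  exact: hausdorff_premeasure_ge0.
by apply: ereal_sup_ubound; exists 1%R => //=.
Qed.

Lemma le_hausdorff s : {homo hausdorff s : A B / A `<=` B >-> A <= B}.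
Proof.
move=> A B AB; apply: ge_ereal_sup => _ [e e0 <-].
apply: (@le_trans _ _ (hausdorff_premeasure s e B)).
  exact: (@le_mu_ext _ (g_sigma_algebraType [set: set V]) R
    (hausdorff_weight s e) A B AB).
by apply: ereal_sup_ubound; exists e.
Qed.

Lemma hausdorff_sigma_subadditive s : sigma_subadditive (hausdorff s).
Proof.
move=> F; apply: ge_ereal_sup => _ [e e0 <-].
apply: (le_trans (@mu_ext_sigma_subadditive _
  (g_sigma_algebraType [set: set V]) R (hausdorff_weight s e)
  (hausdorff_weight_ge0 s e) F)).
apply: lee_nneseries => [i _ _|i _].
  exact: hausdorff_premeasure_ge0.
by apply: ereal_sup_ubound; exists e.
Qed.

HB.instance Definition _ s := isOuterMeasure.Build R V (hausdorff s)
  (hausdorff0 s) (hausdorff_ge0 s) (@le_hausdorff s)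
  (@hausdorff_sigma_subadditive s).

Definition hausdorff_outer (s : nat) : {outer_measure set V -> \bar R} :=
  hausdorff s.

(* The measure on the (complete) sigma-algebra of Caratheodory measurable sets. *)
Definition hausdorff_measure (s : nat) :
    {measure set (caratheodory_type (hausdorff_outer s)) -> \bar R} :=
  (hausdorff_outer s : set (caratheodory_type (hausdorff_outer s)) -> \bar R).

End hausdorff.

Section sphere.
Context {R : realType} {d : nat}.
Local Notation V := 'rV[R]_d.+1.
Implicit Types (u v o c w : V) (K A B : set V).

Definition sphere : set V := [set u | dot u u = 1].

Definition sdist u v : R := acos (dot u v).

Definition svol : set V -> \bar R := hausdorff d.

(* Topological notions are relative to the sphere. *)
Definition sinterior K : set V :=
  [set u | sphere u /\ within sphere (nbhs u) K].

Definition sboundary K : set V := closure K `\` sinterior K.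

(* Since 0^-1 = 0, sexp u 0 = u. *)
Definition sexp u w : V :=
  cos (enorm w) *: u + (sin (enorm w) / enorm w) *: w.

Definition minimal_arc u v : set V :=
  [set p | exists w, [/\ dot u w = 0, enorm w = sdist u v, sexp u w = v &
     exists2 t : R, 0 <= t <= 1 & p = sexp u (t *: w)]].

Definition spherical_convex_body K : Prop :=
  [/\ K `<=` sphere, closed K, sinterior K !=set0 &
      forall u v, K u -> K v -> v != - u -> minimal_arc u v `<=` K].

Definition proper_body K : Prop :=
  exists2 c, sphere c & forall u, K u -> 0 < dot u c.

Definition geodesic_ball o (alpha : R) : set V :=
  [set u | sphere u /\ sdist o u <= alpha].

Definition equivolume_ball K o : set V :=
  geodesic_ball o
    (xget 0 [set beta | 0 <= beta <= pi /\
                        svol (geodesic_ball o beta) = svol K]).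

Definition symdiff A B : set V := (A `\` B) `|` (B `\` A).

Definition dual_body K : set V :=
  [set v | sphere v /\ forall u, K u -> 0 <= dot v u].

Definition gnomonic o u : V := (dot u o)^-1 *: u - o.

(* Centroid of a d-dimensional set; on a hyperplane of R^(d+1), the measure
   hausdorff d is d-dimensional Lebesgue measure. *)
Definition centroid (X : set V) : V :=
  \row_i (Rintegral (hausdorff_measure R d.+1 d) X (fun x : V => x 0 i)
          / fine (hausdorff d X)).

Definition GHS_center K o : Prop :=
  [/\ sinterior K o, sinterior (dual_body K) o &
      centroid (gnomonic o @` K) = 0].

(* Point at signed geodesic distance t, on the side of - nu, from the point
   sexp u w of the great hypersphere orthogonal to nu. *)
Definition normal_coord u nu w (t : R) : V :=
  cos t *: sexp u w - sin t *: nu.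

(* Near u, the boundary is the graph of a height function f over the supporting
   great hypersphere orthogonal to the outer unit normal nu, f is twice
   differentiable in the sense of Aleksandrov at the point of contact, with
   vanishing gradient, and its Hessian has eigenvalues kappa for an orthonormal
   basis e of principal directions. *)
Definition principal_curvatures K u (kappa : 'I_d.-1 -> R) : Prop :=
  exists (nu : V) (e : 'I_d.-1 -> V) (f : V -> R),
  [/\ [/\ dot nu nu = 1, dot u nu = 0 & forall v, K v -> dot v nu <= 0],
      forall i, [/\ dot u (e i) = 0, dot nu (e i) = 0 &
                    forall j, dot (e i) (e j) = (i == j)%:R],
      exists2 r : R, 0 < r & forall w t, dot u w = 0 -> dot nu w = 0 ->
        enorm w < r -> `|t| < r ->
        (sboundary K (normal_coord u nu w t) <-> t = f w) &
      forall eps : R, 0 < eps -> exists2 delta : R, 0 < delta &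
        forall w, dot u w = 0 -> dot nu w = 0 -> enorm w < delta ->
        `|f w - 2^-1 * \sum_i kappa i * dot w (e i) ^+ 2|
          <= eps * enorm w ^+ 2].

(* Equal to 0 where the curvatures do not exist. *)
Definition gauss_kronecker K u : R :=
  xget 0 [set \prod_i kappa i | kappa in principal_curvatures K u].

Definition floating_area K : \bar R :=
  (\int[hausdorff_measure R d.+1 d.-1]_(u in sboundary K)
     (gauss_kronecker K u `^ (d.+1%:R^-1))%:E)%E.

End sphere.

(* Main.v *)
Require Import Defs.
From HB Require Import structures.
From mathcomp Require Import all_boot all_order all_algebra.
From mathcomp Require Import all_classical all_reals all_analysis.
From mathcomp Require Import measurable_realfun.
From mathcomp Require Import zify ring lra.
Import Order.TTheory GRing.Theory Num.Theory.
Import numFieldNormedType.Exports.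
Local Open Scope classical_set_scope.
Local Open Scope ring_scope.
Set Implicit Arguments.
Unset Strict Implicit.
Unset Printing Implicit Defensive.


(** Write d = n + 1 for the dimension of the sphere, X for the gnomonic image of K around o, and
    w(y) = (1 + |y|^2)^(-(d+1)/2) for the density of spherical volume in that chart. A boundary
    point x with inner unit normal nu and curvature H contributes H^(1/(d+1)) times its area
    element. The weighted inequality (a^d b)^(1/(d+1)) <= d/(d+1) lam a + lam^(-d)/(d+1) b
    ([weighted_amgm]), with a^d b = H and with a, b built from the cosines x.o and nu.o, splits this
    contribution. The first term is F(rho) times the solid angle under which the area element is
    seen from o, where rho is the radial function of X and F is [frad]. The second term is the
    volume of the part of the polar body of X swept out by the normals, because H is the Jacobian of
    the Gauss map. Hence the floating area is at most a constant times d/(d+1) lam int F(rho) +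
    lam^(-d)/(d+1) vol(polar X), for every lam > 0.

    Both terms are largest for a ball. As a function of the weighted volume of a centred ball, F has
    derivative [crad], which decreases as long as r^2 <= d(d-2). That is what containment in the
    ball of radius alpha_d provides, so Jensen's inequality in tangent form ([frad_tangent]) bounds
    the first term by its value for the centred ball B with the weighted volume of X, that is, for
    the image of C_K(o). Since w decreases radially, B has the least Lebesgue volume for its
    weighted volume ([leb_bathtub]). Since X has its centroid at the origin, [blaschke_santalo]
    gives vol(polar X) <= vol(unit ball)^2 / vol(X) <= vol(polar B). With the right lam
    ([optimal_multiplier]) the bound obtained for B is a lower bound for the floating area of the
    cap ([floating_area_cap]).

    The constant C may depend on K, so it is enough to have strict inequality when Delta(K) is
    nonzero: equality of volumes in the bathtub step forces X = B up to a null set, hence Delta(K) =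
    0; otherwise C is read off from the gap ([choose_constant]).

    Two parts need real work. First, the curvature comes from a choice, so nothing is known about
    its measurability. The boundary points of nonzero curvature are distributed over countably many
    cells on which point, normal, frame and curvatures are nearly constant. The cells are closed up
    as sets of pairs (point, normal); these are compact, their projections are Borel, and the
    expansion of the Gauss map at Aleksandrov points ([gauss_near], [gauss_transfer]) holds
    uniformly on them. [piece_bound] is the inequality on one piece up to a factor near 1, and
    [area_le] sums the pieces and concludes with Fatou's lemma. Second, the Santalo inequality is
    proved in functional form by induction on the dimension: a hyperplane halves the mass, and both
    functions are integrated along half-lines adapted to the barycentres of the halves ([half_step],
    [santalo_center]). Hausdorff and Lebesgue measure are related only through the unevaluated
    factor [hratio], which is common to both sides. *)

Ltac pos := by repeat first [done | by apply: ltW | rewrite lee_fin | rewrite lte_fin | rewrite nnegrE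
  | rewrite posrE | rewrite gt_eqF | apply: mulr_gt0 | apply: mulr_ge0 | rewrite invr_gt0
  | rewrite invr_ge0 | apply: exprn_gt0 | apply: sqr_ge0 | apply: exprn_ge0 | apply: addr_gt0
  | apply: addr_ge0 | rewrite sqrtr_gt0 | apply: sqrtr_ge0 | apply: expR_gt0 | apply: expR_ge0 | rewrite subr_gt0 | rewrite subr_ge0
  | rewrite lt_min; apply/andP; split].
Ltac seteq := apply/seteqP; split.
Ltac bsplit := apply/andP; split.
Ltac eqle := rewrite le_eqVlt; apply/orP; left; apply/eqP.
Local Notation mfunT f := (measurable_fun setT f).
Local Notation mEFP := measurable_EFinP.
Local Notation mcomp := measurableT_comp.

Lemma measTI d (T: measurableType d) (A: set T) : measurable (setT `&` A)=measurable A.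
Proof. by rewrite setTI. Qed.

(** * Euclidean algebra of row vectors *)

Section Dot.
Context {R: realType}.
Implicit Types (n: nat).

Lemma dotC n (u v: 'rV[R]_n): dot u v = dot v u.
Proof. by apply: eq_bigr=> i _; rewrite mulrC. Qed.

Lemma dotDl n (u v w: 'rV[R]_n): dot (u+v) w = dot u w+dot v w.
Proof. by rewrite /dot -big_split; apply: eq_bigr=> i _; rewrite mxE mulrDl. Qed.

Lemma dotZl n a (u v: 'rV[R]_n): dot (a*:u) v = a*dot u v.
Proof. by rewrite /dot mulr_sumr; apply: eq_bigr=> i _; rewrite mxE mulrA. Qed.

Lemma dotDr n (u v w: 'rV[R]_n): dot w (u+v) = dot w u+dot w v.
Proof. by rewrite dotC dotDl !(dotC w). Qed.

Lemma dotZr n a (u v: 'rV[R]_n): dot u (a*:v) = a*dot u v.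
Proof. by rewrite dotC dotZl dotC. Qed.

Lemma dotNl n (u v: 'rV[R]_n): dot (- u) v = - dot u v.
Proof. by rewrite -scaleN1r dotZl mulN1r. Qed.

Lemma dotNr n (u v: 'rV[R]_n): dot u (- v) = - dot u v.
Proof. by rewrite dotC dotNl dotC. Qed.

Lemma dotBl n (u v w: 'rV[R]_n): dot (u-v) w = dot u w-dot v w.
Proof. by rewrite dotDl dotNl. Qed.

Lemma dotBr n (u v w: 'rV[R]_n): dot w (u-v) = dot w u-dot w v.
Proof. by rewrite dotDr dotNr. Qed.

Lemma dot0l n (u: 'rV[R]_n): dot 0 u = 0.
Proof. by rewrite -(scale0r 0) dotZl mul0r. Qed.

Lemma dot0r n (u: 'rV[R]_n): dot u 0 = 0.
Proof. by rewrite dotC dot0l. Qed.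

Lemma dot_suml n I (r: seq I) P (F: I -> 'rV[R]_n) v :
 dot (\sum_(i <- r | P i) F i) v = \sum_(i <- r | P i) dot (F i) v.
Proof. by elim/big_rec2: _=> [|i y x _ <-]; rewrite ?dot0l ?dotDl. Qed.

Lemma dot_sumr n I (r: seq I) P (F: I -> 'rV[R]_n) v :
 dot v (\sum_(i <- r | P i) F i) = \sum_(i <- r | P i) dot v (F i).
Proof. by rewrite dotC dot_suml; apply: eq_bigr=> i _; rewrite dotC. Qed.

Lemma dot_ge0 n (u: 'rV[R]_n): 0<=dot u u.
Proof. by apply: sumr_ge0=> i _; rewrite -expr2 sqr_ge0. Qed.

Lemma dot_eq0 n (u: 'rV[R]_n): (dot u u == 0) = (u == 0).
apply/idP/eqP=> [|->]; last by rewrite dot0l.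
rewrite psumr_eq0=> [/allP h|i _]; last by rewrite -expr2 sqr_ge0.
apply/rowP=> i; rewrite mxE; have:=h i (mem_index_enum i).
by rewrite -expr2 sqrf_eq0=> /eqP.
Qed.

Lemma enorm_ge0 n (u: 'rV[R]_n): 0<=enorm u.
Proof. exact: sqrtr_ge0. Qed.

Lemma enormE n (u: 'rV[R]_n): enorm u^+2 = dot u u.
Proof. by rewrite sqr_sqrtr// dot_ge0. Qed.

Lemma enorm0 n: enorm (0: 'rV[R]_n) = 0.
Proof. by rewrite /enorm dot0l sqrtr0. Qed.

Lemma enorm_eq0 n (u: 'rV[R]_n): (enorm u == 0) = (u == 0).
Proof. by rewrite -dot_eq0 -enormE sqrf_eq0. Qed.

Lemma enorm_gt0 n (u: 'rV[R]_n): (0<enorm u) = (u != 0).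
Proof. by rewrite lt_neqAle enorm_ge0 andbT eq_sym enorm_eq0. Qed.

Lemma enormZ n a (u: 'rV[R]_n): enorm (a*:u) = `|a| * enorm u.
Proof. by rewrite /enorm dotZl dotZr mulrA -expr2 sqrtrM ?sqr_ge0// sqrtr_sqr. Qed.

Lemma enormN n (u: 'rV[R]_n): enorm (- u) = enorm u.
Proof. by rewrite /enorm dotNl dotNr opprK. Qed.

Lemma enormB n (u v: 'rV[R]_n): enorm (u-v) = enorm (v-u).
Proof. by rewrite -enormN opprB. Qed.

Lemma dot_sqr_le n (u v: 'rV[R]_n): dot u v^+2<=dot u u*dot v v.
have [->|v0]:=eqVneq v 0; first by rewrite !dot0r expr0n mulr0.
have vv: 0<dot v v by rewrite lt_neqAle dot_ge0 eq_sym dot_eq0 v0.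
have:=dot_ge0 (dot v v*:u-dot u v*:v).
rewrite dotBl !dotBr !dotZl !dotZr (dotC v u).
rewrite (_: _-_ = dot v v*(dot u u*dot v v-dot u v^+2)); last by ring.
by rewrite pmulr_rge0// subr_ge0.
Qed.

Lemma dot_le n (u v: 'rV[R]_n): `|dot u v| <= enorm u*enorm v.
rewrite -sqrtr_sqr /enorm -sqrtrM ?dot_ge0//.
by rewrite ler_wsqrtr// dot_sqr_le.
Qed.

Lemma dot_le_enorm n (u v: 'rV[R]_n): dot u v<=enorm u*enorm v.
Proof. exact: le_trans (ler_norm _) (dot_le _ _). Qed.

Lemma enormD n (u v: 'rV[R]_n): enorm (u+v)<=enorm u+enorm v.
rewrite -(@ler_pXn2r _ 2)// ?nnegrE ?addr_ge0 ?enorm_ge0//.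
rewrite enormE dotDl !dotDr (dotC v u) sqrrD !enormE.
have:=dot_le_enorm u v; lra.
Qed.

Lemma enorm_triangle n (u v w: 'rV[R]_n) : enorm (u-w)<=enorm (u-v)+enorm (v-w).
Proof. by rewrite -[u-w](subrKA v) enormD. Qed.

Lemma lerB_enorm n (u v: 'rV[R]_n): enorm u-enorm v<=enorm (u-v).
Proof. by rewrite lerBlDr -{1}(subrK v u) enormD. Qed.

Lemma coord_le_enorm n (u: 'rV[R]_n) i: `|u 0 i| <= enorm u.
rewrite -sqrtr_sqr ler_wsqrtr// /dot (bigD1 i)//= -expr2 lerDl.
by apply: sumr_ge0=> j _; rewrite -expr2 sqr_ge0.
Qed.

Lemma enorm_le_sum n (u: 'rV[R]_n): enorm u <= \sum_i `|u 0 i|.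
rewrite -(@ler_pXn2r _ 2)// ?nnegrE ?enorm_ge0 ?sumr_ge0//.
rewrite enormE expr2 mulr_suml; apply: ler_sum=> i _.
rewrite -expr2 -real_normK ?num_real// expr2 ler_wpM2l//.
by rewrite (bigD1 i)//= lerDl sumr_ge0.
Qed.

Lemma enorm_unit n (u: 'rV[R]_n): dot u u = 1 -> enorm u = 1.
Proof. by rewrite /enorm=> ->; rewrite sqrtr1. Qed.

End Dot.

(** * Splitting off the first coordinate *)

Section Cons.
Context {R: realType}.
Implicit Types (n: nat).

Definition consv n (s: R) (y: 'rV[R]_n): 'rV[R]_n.+1 :=
 \row_i (if unlift ord0 i is Some j then y 0 j else s).
Definition headv n (x: 'rV[R]_n.+1): R:=x 0 ord0.
Definition tailv n (x: 'rV[R]_n.+1): 'rV[R]_n := \row_i x 0 (lift ord0 i).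

Lemma consvK n (x: 'rV[R]_n.+1): consv (headv x) (tailv x) = x.
Proof. by apply/rowP=> i; rewrite mxE; case: unliftP=> [j ->|->]; rewrite ?mxE. Qed.

Lemma headv_cons n s (y: 'rV[R]_n): headv (consv s y) = s.
Proof. by rewrite /headv mxE unlift_none. Qed.

Lemma tailv_cons n s (y: 'rV[R]_n): tailv (consv s y) = y.
Proof. by apply/rowP=> i; rewrite !mxE liftK. Qed.

Lemma consv0 n s (y: 'rV[R]_n): consv s y 0 ord0 = s.
Proof. by rewrite mxE unlift_none. Qed.

Lemma consvS n s (y: 'rV[R]_n) i: consv s y 0 (lift ord0 i) = y 0 i.
Proof. by rewrite mxE liftK. Qed.

Lemma consvD n s t (y z: 'rV[R]_n): consv s y+consv t z = consv (s+t) (y+z).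
Proof. by apply/rowP=> i; rewrite !mxE; case: unlift=> // j; rewrite mxE. Qed.

Lemma consvZ n a s (y: 'rV[R]_n): a*:consv s y = consv (a*s) (a*:y).
Proof. by apply/rowP=> i; rewrite !mxE; case: unlift=> // j; rewrite mxE. Qed.

Lemma consvN n s (y: 'rV[R]_n): - consv s y = consv (- s) (- y).
Proof. by rewrite -scaleN1r consvZ mulN1r scaleN1r. Qed.

Lemma consv00 n: consv 0 (0: 'rV[R]_n) = 0.
Proof. by rewrite -[RHS](scale0r (consv 0 0)) consvZ mul0r scale0r. Qed.

Lemma dot_consv n s t (y z: 'rV[R]_n) : dot (consv s y) (consv t z) = s*t+dot y z.
Proof. by rewrite /dot big_ord_recl !consv0; congr (_+_); apply: eq_bigr=> i _; rewrite !consvS. Qed.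

Lemma dot_headtail n (x y: 'rV[R]_n.+1) : dot x y = headv x*headv y+dot (tailv x) (tailv y).
Proof. by rewrite -{1}(consvK x) -{1}(consvK y) dot_consv. Qed.

End Cons.

(** * Borel structure on row vectors *)

Definition rV_display: measure_display.
Proof. exact: default_measure_display. Qed.

Section MeasurableRV.
Context {R: realType} (n: nat).
Let coor (i: 'I_n) (x: 'rV[R]_n): R:=x 0 i.

Let s0: g_sigma_preimage coor set0.
Proof. exact: sigma_algebra0. Qed.
Let sC A: g_sigma_preimage coor A -> g_sigma_preimage coor (~` A).
Proof. exact: sigma_algebraC. Qed.
Let sU (F: _^nat): (forall i, g_sigma_preimage coor (F i)) -> g_sigma_preimage coor (\bigcup_i (F i)).
Proof. exact: sigma_algebra_bigcup. Qed.

HB.instance Definition _:=@isMeasurable.Build rV_display 'rV[R]_n (g_sigma_preimage coor) s0 sC sU.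

Lemma meas_coord (i: 'I_n) : measurable_fun [set: 'rV[R]_n] (fun x: 'rV[R]_n=> x 0 i).
move=> _ Y mY; rewrite setTI; apply: sub_sigma_algebra=> /=.
rewrite -bigcup_seq/=; exists i=> /=; first by rewrite mem_index_enum.
by exists Y=> //; rewrite setTI.
Qed.

Lemma meas_fun_rV d (T: measurableType d) (f: T -> 'rV[R]_n) :
 (forall i, measurable_fun [set: T] (fun x=> f x 0 i)) -> measurable_fun [set: T] f.
move=> mf _ A mA; rewrite setTI.
pose S := [set B: set 'rV[R]_n | measurable (f @^-1` B)].
suff: g_sigma_preimage coor `<=` S by apply.
apply: smallest_sub.
 split=> /=; first by rewrite /S/= preimage_set0.
 - by move=> B; rewrite /S/= setTD preimage_setC=> mB; exact: measurableC.
 - by move=> F mF; rewrite /S/= preimage_bigcup; apply: bigcupT_measurable.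
rewrite -bigcup_seq=> B [i _ [C mC]]; rewrite setTI=> <-.
by have:=mf i measurableT _ mC; rewrite setTI.
Qed.
End MeasurableRV.

Section MeasurableCons.
Context {R: realType}.
Implicit Types (n: nat).

Lemma meas_headv n: measurable_fun [set: 'rV[R]_n.+1] (@headv R n).
Proof. exact: meas_coord. Qed.

Lemma meas_tailv n: measurable_fun [set: 'rV[R]_n.+1] (@tailv R n).
apply: meas_fun_rV=> i.
under eq_fun do rewrite mxE.
exact: meas_coord.
Qed.

Lemma meas_consv d (T: measurableType d) n (f: T -> R) (g: T -> 'rV[R]_n) :
 measurable_fun [set: T] f -> measurable_fun [set: T] g ->
 measurable_fun [set: T] (fun x=> consv (f x) (g x)).
move=> mf mg; apply: meas_fun_rV=> i.
case: (unliftP ord0 i)=> [j ->|->].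
 under eq_fun do rewrite consvS. exact: (mcomp (meas_coord j)).
by under eq_fun do rewrite consv0.
Qed.

Lemma meas_rVD d (T: measurableType d) n (f g: T -> 'rV[R]_n) :
 measurable_fun [set: T] f -> measurable_fun [set: T] g -> measurable_fun [set: T] (fun x=> f x+g x).
move=> mf mg; apply: meas_fun_rV=> i; under eq_fun do rewrite mxE.
by apply: measurable_funD; exact: (mcomp (meas_coord i)).
Qed.

Lemma meas_rVZ d (T: measurableType d) n (f: T -> R) (g: T -> 'rV[R]_n) :
 measurable_fun [set: T] f -> measurable_fun [set: T] g -> measurable_fun [set: T] (fun x=> f x*:g x).
move=> mf mg; apply: meas_fun_rV=> i; under eq_fun do rewrite mxE.
by apply: measurable_funM=> //; exact: (mcomp (meas_coord i)).
Qed.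

Lemma meas_rVN d (T: measurableType d) n (f: T -> 'rV[R]_n) :
 measurable_fun [set: T] f -> measurable_fun [set: T] (fun x=> - f x).
move=> mf; under eq_fun do rewrite -scaleN1r.
exact: meas_rVZ.
Qed.

Lemma meas_rVB d (T: measurableType d) n (f g: T -> 'rV[R]_n) :
 measurable_fun [set: T] f -> measurable_fun [set: T] g -> measurable_fun [set: T] (fun x=> f x-g x).
Proof. by move=> mf mg; apply: meas_rVD=> //; exact: meas_rVN. Qed.

Lemma meas_dot d (T: measurableType d) n (f g: T -> 'rV[R]_n) :
 measurable_fun [set: T] f -> measurable_fun [set: T] g ->
 measurable_fun [set: T] (fun x=> dot (f x) (g x)).
move=> mf mg; apply: measurable_sum=> i.
by apply: measurable_funM; exact: (mcomp (meas_coord i)).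
Qed.

Lemma meas_enorm d (T: measurableType d) n (f: T -> 'rV[R]_n) :
 measurable_fun [set: T] f -> measurable_fun [set: T] (fun x=> enorm (f x)).
move=> mf; apply: (@mcomp _ _ _ _ _ _ (@Num.sqrt R)).
 by apply: continuous_measurable_fun; exact: sqrt_continuous.
exact: meas_dot.
Qed.

Lemma meas_mulmx d (T: measurableType d) n p (M: 'M[R]_(n, p)) (f: T -> 'rV[R]_n) :
 measurable_fun [set: T] f -> measurable_fun [set: T] (fun x=> f x *m M).
move=> mf; apply: meas_fun_rV=> i; under eq_fun do rewrite mxE.
apply: measurable_sum=> j; apply: measurable_funM=> //.
exact: (mcomp (meas_coord j)).
Qed.

(** An open set is the union of the boxes with rational centre and half-side 1/(k+1) that it
    contains. There are countably many of them, enumerated through [pickle]. *)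
Lemma open_meas_rV n (U: set 'rV[R]_n): open U -> measurable U.
move=> oU.
pose box (c: 'rV[rat]_n) (k: nat): set 'rV[R]_n := [set x | forall i, `|x 0 i-ratr (c 0 i)| < k.+1%:R^-1].
have mbox c k: measurable (box c k).
 rewrite (_: box c k = \bigcap_(i in [set: 'I_n])
   ((fun x: 'rV[R]_n=> x 0 i) @^-1` (ball (ratr (c 0 i): R) k.+1%:R^-1))).
  apply: fin_bigcap_measurable=> [|i _]; first exact: finite_finset.
  rewrite -measTI; apply: meas_coord=> //. exact: measurable_ball.
 seteq=> x /= h i; first by move=> _; rewrite /ball/= distrC; exact: h.
 by have:=h i I; rewrite /ball/= distrC.
pose D: set ('rV[rat]_n*nat) := [set p | box p.1 p.2 `<=` U].
pose F k:=if (unpickle k: option ('rV[rat]_n*nat)) is Some p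
 then if `[< D p >] then box p.1 p.2 else set0 else set0.
rewrite (_: U = \bigcup_k F k).
 apply: bigcupT_measurable=> k; rewrite /F; case: unpickle=> // p. by case: ifP=> // _; exact: mbox.
seteq=> [x Ux|x [k _]]; last first.
 rewrite /F; case: unpickle=> // p; case: ifPn=> // /asboolP pU; exact: pU.
have /nbhs_ballP[e /= e0 eU]: nbhs x U by exact: open_nbhs_nbhs.
have [k ke]: exists k: nat, k.+1%:R^-1<e/2.
 have e20: 0<e/2 by rewrite divr_gt0. by have [k]:=ltr_add_invr e20; rewrite add0r=> ke; exists k.
have /choice[c xc]: forall i, exists q: rat, `|x 0 i-ratr q| < k.+1%:R^-1.
 move=> i; have kp: (0: R)<k.+1%:R^-1 by [].
 have [|y [+ [q _ yq]]]:=@dense_rat R (ball (x 0 i: R) k.+1%:R^-1) _ (ball_open _ _).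
  by exists (x 0 i); exact: ballxx. by rewrite -yq; exists q.
pose C := \row_i c i.
exists (pickle (C, k))=> //; rewrite /F pickleK.
have -> : `[< D (C, k) >] = true.
 apply/asboolP=> y yC; apply: eU; split=> // i j; rewrite (ord1 i) /ball/=.
 have:=yC j; have:=xc j; rewrite mxE=> h1 h2.
 rewrite -(subrKA (ratr (c j))); apply: (le_lt_trans (ler_normD _ _)).
 by rewrite (splitr e) ltrD ?(lt_trans _ ke)// distrC.
by move=> i; rewrite mxE; exact: xc.
Qed.

Lemma measV_closed n (U: set 'rV[R]_n): closed U -> measurable U.
by move=> cU; rewrite -(setCK U); apply: measurableC; apply: open_meas_rV; exact: closed_openC.
Qed.

End MeasurableCons.

(** * Lebesgue measure in dimension n and its invariances *)

Section LebStep.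
Context {R: realType} (n: nat).
Variable mu: {sigma_finite_measure set 'rV[R]_n -> \bar R}.
Local Open Scope ereal_scope.

Let cons2 (p: R * 'rV[R]_n): 'rV[R]_n.+1:=consv p.1 p.2.
Let mcons: measurable_fun [set: R * 'rV[R]_n] cons2.
Proof. exact: meas_consv. Qed.

Definition lebS (A: set 'rV[R]_n.+1): \bar R := (@lebesgue_measure R \x mu) (cons2 @^-1` A).

Let lebS0: lebS set0 = 0.
Proof. by rewrite /lebS preimage_set0 measure0. Qed.

Let lebS_ge0 A: 0<=lebS A.
Proof. exact: measure_ge0. Qed.

Let lebS_additive: semi_sigma_additive lebS.
move=> F mF tF mUF; rewrite /lebS preimage_bigcup.
apply: measure_semi_sigma_additive.
- by move=> k; rewrite -measTI; exact: mcons.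
- apply/trivIsetP=> /= i j _ _ ij; rewrite -preimage_setI.
 by move/trivIsetP: tF=> /(_ _ _ _ _ ij) ->//; rewrite preimage_set0.
- by rewrite -preimage_bigcup -measTI; exact: mcons.
Qed.

HB.instance Definition _:=isMeasure.Build _ _ _ lebS lebS0 lebS_ge0 lebS_additive.

Lemma int_lebS (f: 'rV[R]_n.+1 -> \bar R) : mfunT f -> (forall x, 0<=f x) ->
 \int[lebS]_x f x = \int[lebesgue_measure]_s \int[mu]_y f (consv s y).
move=> mf f0.
have -> : \int[lebS]_x f x = \int[pushforward (@lebesgue_measure R \x mu) cons2]_x f x.
 by apply: eq_measure_integral.
rewrite ge0_integral_pushforward//=.
rewrite preimage_setT fubini_tonelli1//=; exact: mcomp.
Qed.

Let lebS_sigma_finite: sigma_finite setT lebS.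
have /sigma_finiteP[/= F [UF ndF mF]]:=@sigma_finiteT _ _ _ mu.
have /sigma_finiteP[/= G [UG ndG mG]]:=@sigma_finiteT _ _ _ (@lebesgue_measure R).
pose H k := [set x: 'rV[R]_n.+1 | G k (headv x) /\ F k (tailv x)].
exists H.
 seteq=> // x _. have [i _ Gi]: (\bigcup_i G i) (headv x) by rewrite -UG.
 have [j _ Fj]: (\bigcup_i F i) (tailv x) by rewrite -UF. exists (maxn i j)=> //; split.
  by move: Gi; apply/subsetPset; apply: ndG; exact: leq_maxl.
 by move: Fj; apply/subsetPset; apply: ndF; exact: leq_maxr.
move=> k; split.
 rewrite (_: H k = (@headv R n @^-1` G k) `&` (@tailv R n @^-1` F k))//.
 apply: measurableI; rewrite -measTI.
  by apply: meas_headv=> //; exact: (mG k).1. by apply: meas_tailv=> //; exact: (mF k).1.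
rewrite /lebS (_: _ @^-1` _ = G k `*` F k); last first.
 seteq=> -[s y] /=; rewrite /H/cons2/= ?headv_cons ?tailv_cons//.
have [[mGk Gk] [mFk Fk]]:=(mG k, mF k).
rewrite product_measure1E//.
by apply: lte_mul_pinfty=> //; rewrite ge0_fin_numE.
Qed.

HB.instance Definition _:=Measure_isSigmaFinite.Build _ _ _ lebS lebS_sigma_finite.

Definition lebSm: {sigma_finite_measure set 'rV[R]_n.+1 -> \bar R}:=lebS.

End LebStep.

Section Leb.
Context {R: realType}.

(** Iterated products starting from the unit mass on the one-point space, so that Tonelli's theorem
    in the first coordinate holds by construction. Invariance under rotations is not visible from
    this form and comes later from Hausdorff measure. *)
Fixpoint leb (n: nat): {sigma_finite_measure set 'rV[R]_n -> \bar R} :=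
 if n is n'.+1 then lebSm (leb n') else dirac (0: 'rV[R]_0).

End Leb.
Arguments leb {R} n.

Section LebTheory.
Context {R: realType}.
Implicit Types (n: nat).
Local Open Scope ereal_scope.

Lemma int_leb0 (f: 'rV[R]_0 -> \bar R): mfunT f -> \int[leb 0]_x f x = f 0%R.
Proof. by move=> mf; rewrite integral_dirac// diracT mul1e. Qed.

Lemma int_lebS1 n (f: 'rV[R]_n.+1 -> \bar R) : mfunT f -> (forall x, 0<=f x) ->
 \int[leb n.+1]_x f x = \int[lebesgue_measure]_s \int[leb n]_y f (consv s y).
Proof. exact: int_lebS. Qed.

Lemma int_lebS2 n (f: 'rV[R]_n.+1 -> \bar R) : mfunT f -> (forall x, 0<=f x) ->
 \int[leb n.+1]_x f x = \int[leb n]_y \int[lebesgue_measure]_s f (consv s y).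
move=> mf f0; rewrite int_lebS1//.
have mfc: mfunT (fun p: R * 'rV[R]_n=> f (consv p.1 p.2)).
 by apply: mcomp=> //; exact: meas_consv.
exact: (@fubini_tonelli _ _ _ _ _ (@lebesgue_measure R) (leb n) _ mfc).
Qed.

Lemma meas_leb_inner n (f: 'rV[R]_n.+1 -> \bar R) : mfunT f -> (forall x, 0<=f x) ->
 mfunT (fun s=> \int[leb n]_y f (consv s y)).
move=> mf f0.
have mfc: mfunT (fun p: R * 'rV[R]_n=> f (consv p.1 p.2)).
 by apply: mcomp=> //; exact: meas_consv.
exact: (@measurable_fun_fubini_tonelli_F _ _ _ _ _ (leb n) _ mfc).
Qed.

Lemma meas_leb_outer n (f: 'rV[R]_n.+1 -> \bar R) : mfunT f -> (forall x, 0<=f x) ->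
 mfunT (fun y=> \int[@lebesgue_measure R]_s f (consv s y)).
move=> mf f0.
have mfc: mfunT (fun p: R * 'rV[R]_n=> f (consv p.1 p.2)).
 by apply: mcomp=> //; exact: meas_consv.
exact: (@measurable_fun_fubini_tonelli_G _ _ _ _ _ (@lebesgue_measure R) _ mfc).
Qed.

(** The translated measure has the right value on half-open intervals, and these determine Lebesgue
    measure. *)
Lemma lebesgue_measureD (c: R) (A: set R): measurable A ->
 pushforward lebesgue_measure ((fun s=> s+c)%R: R -> measurableTypeR R) A = lebesgue_measure A.
move=> mA.
have mD: mfunT ((fun s=> s+c)%R: measurableTypeR R -> measurableTypeR R).
 exact: measurable_funD.
apply/esym/lebesgue_measure_unique=> //= _ [[a b]] _ <-; rewrite /pushforward.
rewrite (_: _ @^-1` _ = `]a-c, b-c]%classic)%R; last first.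
 by seteq=> x /=; rewrite !in_itv/= ltrBlDr lerBrDr.
by rewrite !lebesgue_measure_itv/= !lte_fin ltrD2r -!EFinB; case: ifP=> // _; congr EFin; ring.
Qed.

Lemma int_lebesgueD (c: R) (f: R -> \bar R): mfunT f -> (forall x, 0<=f x) ->
 \int[lebesgue_measure]_s f (s+c)%R = \int[lebesgue_measure]_s f s.
move=> mf f0.
have mD: mfunT ((fun s=> s+c)%R: measurableTypeR R -> measurableTypeR R).
 exact: measurable_funD.
rewrite -[LHS](@ge0_integral_pushforward _ _ _ _ _ _ mD (@lebesgue_measure R) setT f)//.
by apply: eq_measure_integral=> A mA _; exact: lebesgue_measureD.
Qed.

Lemma lebesgue_measureM (c: R) (A: set R): (0<c)%R -> measurable A ->
 c%:E * pushforward lebesgue_measure ((fun s=> c*s)%R: R -> measurableTypeR R) A = lebesgue_measure A.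
move=> c0 mA.
have mM: mfunT ((fun s=> c*s)%R: measurableTypeR R -> measurableTypeR R).
 exact: measurable_funM.
pose m: {measure set (measurableTypeR R) -> \bar R} :=
 mscale (NngNum (ltW c0)) (pushforward lebesgue_measure ((fun s=> c*s)%R: R -> measurableTypeR R)).
suff: lebesgue_measure A = m mM A by move=> ->.
apply: lebesgue_measure_unique=> //.
move=> _ [[a b]] _ <-; rewrite /m /= /mscale/= /pushforward.
rewrite (_: _ @^-1` _ = `]a/c, b/c]%classic)%R; last first.
 by seteq=> x /=; rewrite !in_itv/= ltr_pdivrMr// ler_pdivlMr// !(mulrC c).
rewrite !lebesgue_measure_itv/= !lte_fin ltr_pM2r ?invr_gt0// -!EFinB.
by case: ifP=> // _; rewrite ?mule0// -EFinM; congr EFin; field; rewrite gt_eqF.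
Qed.

Lemma int_lebesgueM (c: R) (f: R -> \bar R): (0<c)%R -> mfunT f ->  (forall x, 0<=f x) ->
 c%:E * \int[lebesgue_measure]_s f (c*s)%R = \int[lebesgue_measure]_s f s.
move=> c0 mf f0.
have mM: mfunT ((fun s=> c*s)%R: measurableTypeR R -> measurableTypeR R).
 exact: measurable_funM.
rewrite -[X in _*X](@ge0_integral_pushforward _ _ _ _ _ _ mM (@lebesgue_measure R) setT f)//.
rewrite -[c]/((NngNum (ltW c0))%:num) -ge0_integral_mscale//.
by apply: eq_measure_integral=> A mA _; exact: lebesgue_measureM.
Qed.

Lemma int_lebesgueN (f: R -> \bar R): mfunT f -> (forall x, 0<=f x) ->
 \int[lebesgue_measure]_s f (- s)%R = \int[lebesgue_measure]_s f s.
move=> mf f0.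
have mN: mfunT ((fun s=> - s)%R: measurableTypeR R -> measurableTypeR R).
 exact: measurable_funN.
rewrite -[LHS](@ge0_integral_pushforward _ _ _ _ _ _ mN (@lebesgue_measure R) setT f)//.
by apply: eq_measure_integral=> A mA _; exact: lebesgue_measureN.
Qed.

End LebTheory.

Section LebInvariance.
Context {R: realType}.
Implicit Types (n: nat).
Local Open Scope ereal_scope.

Lemma meas_leb_fix n (f: 'rV[R]_n.+1 -> \bar R) s : mfunT f -> mfunT (fun y: 'rV[R]_n=> f (consv s y)).
Proof. by move=> mf; apply: mcomp=> //; exact: meas_consv. Qed.

Lemma leb_translate n (f: 'rV[R]_n -> \bar R) c : mfunT f -> (forall x, 0<=f x) ->
 \int[leb n]_x f (x+c)%R = \int[leb n]_x f x.
elim: n f c=> [|n IH] f c mf f0.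
 rewrite !int_leb0//; first by congr f; apply/rowP=> -[]. by apply: mcomp=> //; exact: meas_rVD.
have mfc: mfunT (fun x: 'rV[R]_n.+1=> f (x+c)%R).
 by apply: mcomp=> //; exact: meas_rVD.
rewrite !int_lebS1//.
under eq_integral=> s _.
 under eq_integral=> y _ do rewrite -{1}(consvK c) consvD.
 rewrite (IH (fun y=> f (consv (s+headv c)%R y)))//; last exact: meas_leb_fix. over.
apply: (int_lebesgueD (headv c) (f:=fun s=> \int[leb n]_y f (consv s y))).
 exact: (meas_leb_inner mf f0).
by move=> s; exact: integral_ge0.
Qed.

Lemma leb_opp n (f: 'rV[R]_n -> \bar R) : mfunT f -> (forall x, 0<=f x) ->
 \int[leb n]_x f (- x)%R = \int[leb n]_x f x.
elim: n f=> [|n IH] f mf f0.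
 rewrite !int_leb0//; first by congr f; apply/rowP=> -[]. by apply: mcomp=> //; exact: meas_rVN.
have mfc: mfunT (fun x: 'rV[R]_n.+1=> f (- x)%R).
 by apply: mcomp=> //; exact: meas_rVN.
rewrite !int_lebS1//.
under eq_integral=> s _.
 under eq_integral=> y _ do rewrite consvN.
 rewrite (IH (fun y=> f (consv (- s)%R y)))//; last exact: meas_leb_fix. over.
apply: (int_lebesgueN (f:=fun s=> \int[leb n]_y f (consv s y))).
 exact: (meas_leb_inner mf f0).
by move=> s; exact: integral_ge0.
Qed.

Definition dilate n (k x: 'rV[R]_n): 'rV[R]_n := \row_i (k 0 i*x 0 i)%R.

Lemma dilate_cons n k0 (k: 'rV[R]_n) s x : dilate (consv k0 k) (consv s x) = consv (k0*s)%R (dilate k x).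
Proof. by apply/rowP=> i; rewrite !mxE; case: unlift=> // j; rewrite mxE. Qed.

Lemma meas_dilate n (k: 'rV[R]_n): mfunT (dilate k).
apply: meas_fun_rV=> i; under eq_fun do rewrite mxE.
by apply: measurable_funM=> //; exact: meas_coord.
Qed.

(** Change of variables for diagonal maps. It is applied to the linear part of the Gauss map, which
    is diagonal in a principal frame. *)
Lemma leb_dilate n (k: 'rV[R]_n) (f: 'rV[R]_n -> \bar R) :
 (forall i, (0<k 0 i)%R) -> mfunT f -> (forall x, 0<=f x) ->
 (\prod_i k 0 i)%:E * \int[leb n]_x f (dilate k x) = \int[leb n]_x f x.
elim: n k f=> [|n IH] k f k0 mf f0.
 rewrite big_ord0 mul1e !int_leb0//; first by congr f; apply/rowP=> -[].
 by apply: mcomp=> //; exact: meas_dilate.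
have mfc: mfunT (fun x: 'rV[R]_n.+1=> f (dilate k x)).
 by apply: mcomp=> //; exact: meas_dilate.
rewrite !int_lebS1// big_ord_recl EFinM -muleA.
have p0: (0 <= \prod_(i<n) k 0 (lift ord0 i))%R by apply: prodr_ge0=> i _; rewrite ltW.
rewrite -ge0_integralZl//; last 2 first.
- exact: (meas_leb_inner mfc (fun x=> f0 _)).
- by move=> s _; exact: integral_ge0.
under eq_integral=> s _.
 under eq_integral=> y _ do rewrite -{1}(consvK k) dilate_cons.
 rewrite (_: (\prod_(i<n) k 0 (lift ord0 i))%R = (\prod_i tailv k 0 i)%R); last first.
  by apply: eq_bigr=> i _; rewrite mxE.
 rewrite (IH (tailv k) (fun y=> f (consv (headv k*s)%R y)))//; last 2 first.
 - by move=> i; rewrite mxE.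
 - exact: meas_leb_fix.
 over.
apply: (int_lebesgueM (f:=fun s=> \int[leb n]_y f (consv s y)))=> //.
 exact: (meas_leb_inner mf f0).
by move=> s; exact: integral_ge0.
Qed.

Lemma leb_scale n (r: R) (f: 'rV[R]_n -> \bar R) : (0<r)%R -> mfunT f -> (forall x, 0<=f x) ->
 (r^+n)%:E * \int[leb n]_x f (r*:x)%R = \int[leb n]_x f x.
move=> r0 mf f0.
have k0 i: (0<(const_mx r: 'rV[R]_n) 0 i)%R by rewrite mxE.
rewrite -(leb_dilate k0 mf f0).
under eq_bigr do rewrite mxE.
rewrite prodr_const card_ord; congr (_*_); apply: eq_integral=> x _; congr f.
by apply/rowP=> i; rewrite !mxE.
Qed.

Lemma leb_indic n (A: set 'rV[R]_n): measurable A -> leb n A = \int[leb n]_x (\1_A x)%:E.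
Proof. by move=> mA; rewrite integral_indic// setIT. Qed.

Lemma leb_indic_preimage n (A: set 'rV[R]_n) (g: 'rV[R]_n -> 'rV[R]_n) : mfunT g -> measurable A ->
 leb n (g @^-1` A) = \int[leb n]_x (\1_A (g x))%:E.
move=> mg mA; rewrite leb_indic; last by rewrite -measTI; exact: mg.
by [].
Qed.

Let mindic n (A: set 'rV[R]_n): measurable A -> mfunT (fun x: 'rV[R]_n=> (\1_A x)%:E: \bar R).
Proof. by move=> mA; apply/mEFP; exact: measurable_indic. Qed.

Let indic0 n (A: set 'rV[R]_n) x: 0<=(\1_A x)%:E :> \bar R.
Proof. by rewrite lee_fin. Qed.

Lemma leb_setD n (A: set 'rV[R]_n) c: measurable A -> leb n ((fun x=> x+c)%R @^-1` A) = leb n A.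
move=> mA; rewrite leb_indic_preimage//; last exact: meas_rVD.
by rewrite (leb_translate _ (mindic mA))// -leb_indic.
Qed.

Lemma leb_setN n (A: set 'rV[R]_n): measurable A -> leb n ((fun x=> - x)%R @^-1` A) = leb n A.
move=> mA; rewrite leb_indic_preimage//; last exact: meas_rVN.
by rewrite (leb_opp (mindic mA))// -leb_indic.
Qed.

Lemma leb_setdilate n (k: 'rV[R]_n) (A: set 'rV[R]_n) : (forall i, (0<k 0 i)%R) -> measurable A ->
 (\prod_i k 0 i)%:E * leb n (dilate k @^-1` A) = leb n A.
move=> k0 mA; rewrite leb_indic_preimage//; last exact: meas_dilate.
by rewrite (leb_dilate k0 (mindic mA))// -leb_indic.
Qed.

Lemma leb_setZ n r (A: set 'rV[R]_n): (0<r)%R -> measurable A ->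
 (r^+n)%:E * leb n ((fun x=> r*:x)%R @^-1` A) = leb n A.
move=> r0 mA; rewrite leb_indic_preimage//; last exact: meas_rVZ.
by rewrite (leb_scale r0 (mindic mA))// -leb_indic.
Qed.

Definition cube n (a: 'rV[R]_n) (r: R): set 'rV[R]_n := [set x | forall i, (`|x 0 i-a 0 i| <= r)%R].

Lemma meas_cube n (a: 'rV[R]_n) r: measurable (cube a r).
rewrite (_: cube a r = \bigcap_(i in [set: 'I_n])
  ((fun x: 'rV[R]_n=> x 0 i) @^-1` `[a 0 i-r, a 0 i+r]%classic)%R).
 apply: fin_bigcap_measurable=> [|i _]; first exact: finite_finset. rewrite -measTI; apply: meas_coord=> //.
seteq=> x /= h i; first by move=> _; rewrite /= in_itv/= -ler_distl.
by have:=h i Logic.I; rewrite /= in_itv/= -ler_distl.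
Qed.

Lemma leb_cube n (a: 'rV[R]_n) r: (0<=r)%R -> leb n (cube a r) = ((2*r)^+n)%:E.
move=> r0; elim: n a=> [|n IH] a.
 rewrite /= /dirac indicE expr0 mem_set//. by move=> -[].
rewrite /= /lebS (_: _ @^-1` _ = `[headv a-r, headv a+r]%classic%R `*` cube (tailv a) r); last first.
 seteq=> -[s y] /= h.
  split=> [|i]; last by have:=h (lift ord0 i); rewrite consvS mxE.
  by have:=h ord0; rewrite consv0 in_itv/= -ler_distl.
 move: h=> [h1 h2] i; case: (unliftP ord0 i)=> [j ->|->].
  by have:=h2 j; rewrite consvS mxE. by rewrite consv0; move: h1; rewrite in_itv/= -ler_distl.
have mc:=meas_cube (tailv a) r.
rewrite (@product_measure1E _ _ _ _ R (@lebesgue_measure R) (leb n))// IH exprS EFinM.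
congr (_*_); rewrite -[LHS]/(lebesgue_measure _) lebesgue_measure_itv/= lte_fin.
by rewrite -EFinB; case: ltP=> h; congr EFin; lra.
Qed.

End LebInvariance.

(** * Hausdorff measure: Lipschitz maps, Borel sets, comparison with Lebesgue measure *)

Section HausdorffLipschitz.
Context {R: realType}.
Local Open Scope ereal_scope.
Implicit Types N s: nat.

Lemma lee_expe N (x y: \bar R): 0<=x -> x<=y -> x^+N<=y^+N.
move=> x0 xy; elim: N=> [|N IH]; first by rewrite !expe0.
by rewrite !expeS; apply: lee_pmul=> //; exact: expe_ge0.
Qed.

Lemma expeMl N (r: R) (x: \bar R): (r%:E*x)^+N = (r^+N)%:E*x^+N.
elim: N=> [|N IH]; first by rewrite !expe0 mul1e.
by rewrite !expeS IH exprS EFinM muleACA.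
Qed.

Lemma ediam_ge0 N (U: set 'rV[R]_N): U !=set0 -> 0<=ediam U.
move=> [x Ux]; apply: (@le_trans _ _ (enorm (x-x)%R)%:E).
 by rewrite lee_fin enorm_ge0.
by apply: ereal_sup_ubound; exists x=> //; exists x.
Qed.

Lemma ediam_lip N N' (phi: 'rV[R]_N -> 'rV[R]_N') (A: set 'rV[R]_N) (L: R) : (0<=L)%R ->
 (forall x y, A x -> A y -> (enorm (phi x-phi y)<=L*enorm (x-y))%R) -> ediam (phi @` A)<=L%:E*ediam A.
move=> L0 lip; apply: ge_ereal_sup=> _ [_ [x Ax <-] [_ [y Ay <-]] <-].
apply: (@le_trans _ _ (L*enorm (x-y)%R)%:E); first by rewrite lee_fin lip.
rewrite EFinM lee_wpmul2l ?lee_fin//.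
by apply: ereal_sup_ubound; exists x=> //; exists y.
Qed.

Lemma ediamS N (A B: set 'rV[R]_N): A `<=` B -> ediam A<=ediam B.
Proof. by move=> AB; apply: ereal_sup_le=> _ [x Ax [y Ay <-]]; exists x; [exact: AB|exists y=> //; exact: AB]. Qed.

(** The scale on the right is [L^-1*e]: a set of finite weight at that scale has an image that is
    admissible at scale [e], and otherwise the right-hand side is infinite. *)
Lemma haus_weight_lip s N N' (phi: 'rV[R]_N -> 'rV[R]_N') (A: set 'rV[R]_N) (L e: R) : (0<L)%R ->
 (forall x y, A x -> A y -> (enorm (phi x-phi y)<=L*enorm (x-y))%R) ->
 hausdorff_weight s e (phi @` A)<=(L^+s)%:E*hausdorff_weight s (L^-1*e) A.
move=> L0 lip; have Ls0: (0<L^+s)%R by rewrite exprn_gt0.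
rewrite /hausdorff_weight; have [->|]:=eqVneq A set0.
 by rewrite image_set0 eqxx mule0.
move=> /set0P[x Ax]; rewrite ifF; last by apply/eqP=> h; have: set0 (phi x) by rewrite -h; exists x.
have dl:=ediam_lip (ltW L0) lip.
case: ifPn=> h1.
 case: ifPn=> h2.
  rewrite muleCA; apply: lee_wpmul2l.
   by rewrite lee_fin divr_ge0 ?exprn_ge0// ltW// unit_ball_volume_gt0.
  rewrite -expeMl; apply: lee_expe=> //. by apply: ediam_ge0; exists (phi x); exists x.
 by rewrite gt0_muley ?lte_fin// leey.
case: ifPn=> h2; last by rewrite gt0_muley ?lte_fin// leey.
exfalso; move/negP: h1; apply; apply: (le_trans dl).
by rewrite -lee_pdivlMl// -EFinM.
Qed.

Lemma haus_weightS s N (e: R) (A B: set 'rV[R]_N): A `<=` B ->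
 hausdorff_weight s e A<=hausdorff_weight s e B.
move=> AB; have [->|/set0P[x Ax]]:=eqVneq A set0.
 by rewrite hausdorff_weight0; exact: hausdorff_weight_ge0.
have nA: (A == set0) = false by apply/eqP=> h; have: set0 x by rewrite -h.
have nB: (B == set0) = false.
 by apply/eqP=> h; have: set0 x by rewrite -h; exact: AB.
rewrite /hausdorff_weight nA nB.
have dS: ediam A<=ediam B by exact: ediamS.
case: ifPn=> h1; case: ifPn=> h2; rewrite ?leey//.
 apply: lee_wpmul2l.
  by rewrite lee_fin divr_ge0 ?exprn_ge0// ltW// unit_ball_volume_gt0.
 by apply: lee_expe=> //; apply: ediam_ge0; exists x.
by exfalso; move/negP: h1; apply; exact: le_trans h2.
Qed.

Lemma haus_premeasure_cover s N (e: R) (A: set 'rV[R]_N) (F: (set 'rV[R]_N)^nat) : A `<=` \bigcup_k F k ->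
 hausdorff_premeasure s e A <= \sum_(k <oo) hausdorff_weight s e (F k).
move=> AF; apply: ereal_inf_lbound; exists F=> //; split=> // k.
exact: sub_sigma_algebra.
Qed.

Lemma le_haus_premeasure s N (e: R) (A: set 'rV[R]_N) c :
 (forall F: (set 'rV[R]_N)^nat, A `<=` \bigcup_k F k -> c <= \sum_(k <oo) hausdorff_weight s e (F k)) ->
 c<=hausdorff_premeasure s e A.
Proof. by move=> h; apply: le_ereal_inf_tmp=> _ [F [_ AF] <-]; exact: h. Qed.

(** Covering sets are cut down to [A] before being mapped, since [phi] is Lipschitz only there. The
    supremum over all scales absorbs the change of scale. *)
Lemma haus_lip s N N' (phi: 'rV[R]_N -> 'rV[R]_N') (A: set 'rV[R]_N) (L: R) : (0<L)%R ->
 (forall x y, A x -> A y -> (enorm (phi x-phi y)<=L*enorm (x-y))%R) ->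
 hausdorff s (phi @` A)<=(L^+s)%:E*hausdorff s A.
move=> L0 lip; have Ls0: (0<L^+s)%R by rewrite exprn_gt0.
apply: ge_ereal_sup=> _ [e /= e0 <-].
apply: (@le_trans _ _ ((L^+s)%:E*hausdorff_premeasure s (L^-1*e) A)); last first.
 apply: lee_wpmul2l; first by rewrite lee_fin ltW. apply: ereal_sup_ubound.
 by exists (L^-1*e)%R=> //=; rewrite mulr_gt0 ?invr_gt0.
rewrite -lee_pdivrMl//; apply: le_haus_premeasure=> F AF.
rewrite lee_pdivrMl//.
have cov: phi @` A `<=` \bigcup_k (phi @` (F k `&` A)).
 by move=> _ [x Ax <-]; have [k _ Fx]:=AF _ Ax; exists k=> //; exists x.
apply: (le_trans (haus_premeasure_cover s e cov)).
rewrite -nneseriesZl=> [|k _]; last exact: hausdorff_weight_ge0.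
apply: lee_nneseries=> [k _ _|k _]; first exact: hausdorff_weight_ge0.
apply: (le_trans (haus_weight_lip s e L0 _)).
 by move=> x y [_ Ax] [_ Ay]; exact: lip.
apply: lee_wpmul2l; first by rewrite lee_fin ltW.
by apply: haus_weightS=> x [].
Qed.

End HausdorffLipschitz.

Section HausdorffBorel.
Context {R: realType} (s N: nat).
Local Open Scope ereal_scope.
Local Notation V := 'rV[R]_N.
Local Notation H := (@hausdorff R N s).

Lemma haus_premeasure_le (e1 e2: R) (A: set V): (e1<=e2)%R ->
 hausdorff_premeasure s e2 A<=hausdorff_premeasure s e1 A.
move=> e12; apply: le_haus_premeasure=> F AF.
apply: (le_trans (haus_premeasure_cover s e2 AF)).
apply: lee_nneseries=> [k _ _|k _]; first exact: hausdorff_weight_ge0.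
rewrite /hausdorff_weight; case: eqP=> // _.
case: ifPn=> h1; case: ifPn=> h2; rewrite ?leey//.
by exfalso; move/negP: h1; apply; apply: (le_trans h2); rewrite lee_fin.
Qed.

(** A covering set of diameter at most [e] cannot meet both [A] and [B], so a cover of the union
    splits into a cover of each. *)
Lemma haus_premeasure_sep (e g: R) (A B: set V): (e<g)%R ->
 (forall x y, A x -> B y -> (g<=enorm (x-y))%R) -> hausdorff_premeasure s e A+hausdorff_premeasure s e B <=
 hausdorff_premeasure s e (A `|` B).
move=> eg sep; apply: le_haus_premeasure=> F ABF.
have cA: A `<=` \bigcup_k (F k `&` A).
 by move=> x Ax; have [k _ Fx]:=ABF _ (or_introl Ax); exists k.
have cB: B `<=` \bigcup_k (F k `&` B).
 by move=> x Bx; have [k _ Fx]:=ABF _ (or_intror Bx); exists k.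
apply: (le_trans (leeD (haus_premeasure_cover s e cA) (haus_premeasure_cover s e cB))).
rewrite -nneseriesD; [|by move=> *; exact: hausdorff_weight_ge0..].
apply: lee_nneseries=> [k _ _|k _].
 by apply: adde_ge0; exact: hausdorff_weight_ge0.
have wS (C: set V): hausdorff_weight s e (F k `&` C)<=hausdorff_weight s e (F k).
 by apply: haus_weightS=> x [].
have [->|/set0P[x [Fx Ax]]]:=eqVneq (F k `&` A) set0.
 by rewrite hausdorff_weight0 add0e.
have [->|/set0P[y [Fy By]]]:=eqVneq (F k `&` B) set0.
 by rewrite hausdorff_weight0 adde0.
rewrite [leRHS]/hausdorff_weight ifF; last by apply/eqP=> h; have: set0 x by rewrite -h.
rewrite ifF ?leey//; apply/negbTE; rewrite -ltNge.
apply: (@lt_le_trans _ _ g%:E); first by rewrite lte_fin.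
apply: (@le_trans _ _ (enorm (x-y)%R)%:E); first by rewrite lee_fin sep.
by apply: ereal_sup_ubound; exists x=> //; exists y.
Qed.

Lemma haus_sep (g: R) (A B: set V): (0<g)%R -> (forall x y, A x -> B y -> (g<=enorm (x-y))%R) ->
 H A+H B<=H (A `|` B).
move=> g0 sep.
have [->|HABoo]:=eqVneq (H (A `|` B)) +oo; first by rewrite leey.
have HA: H A \is a fin_num.
 rewrite ge0_fin_numE ?hausdorff_ge0//; apply: (@le_lt_trans _ _ (H (A `|` B))).
  exact: le_hausdorff. by rewrite ltey.
rewrite -leeBrDl//; apply: ge_ereal_sup=> _ [e1 /= e10 <-].
rewrite leeBrDl// addeC.
have HB1: hausdorff_premeasure s e1 B \is a fin_num.
 rewrite ge0_fin_numE ?hausdorff_premeasure_ge0//.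
 apply: (@le_lt_trans _ _ (H (A `|` B))); last by rewrite ltey.
 apply: (@le_trans _ _ (H B)); last exact: le_hausdorff. by apply: ereal_sup_ubound; exists e1.
rewrite -leeBrDl//; apply: ge_ereal_sup=> _ [e2 /= e20 <-].
rewrite leeBrDl// addeC.
pose e:=Num.min (g/2)%R (Num.min e1 e2).
have e0: (0<e)%R by rewrite !lt_min divr_gt0//= e10.
apply: (@le_trans _ _ (hausdorff_premeasure s e A+hausdorff_premeasure s e B)).
 by apply: leeD; apply: haus_premeasure_le; rewrite !ge_min lexx ?orbT.
apply: (@le_trans _ _ (hausdorff_premeasure s e (A `|` B))); last first.
 by apply: ereal_sup_ubound; exists e.
apply: (haus_premeasure_sep (g:=g))=> //.
by rewrite gt_min ltr_pdivrMr// ltr_pMr// ltr1n.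
Qed.

End HausdorffBorel.

Section HausdorffCaratheodory.
Context {R: realType} (s N: nat).
Local Open Scope ereal_scope.
Local Notation V := 'rV[R]_N.
Local Notation H := (@hausdorff R N s).

Let t (k: nat): R:=k.+1%:R^-1.
Let t_gt0 k: (0<t k)%R. Proof. by rewrite invr_gt0. Qed.
Let t_lt k: (t k.+1<t k)%R.
Proof. by rewrite ltf_pV2 ?posrE// ltr_nat. Qed.

(** Caratheodory's criterion for metric outer measures. Outside the sublevel set [B], the test set
    [X] is cut into shells [D j] that accumulate at level [a]. The shells have summable measure, so
    what lies between [B] and the separated set [Y k] becomes negligible as [k] grows. *)
Lemma haus_caratheodory_lip (f: V -> R) a : (forall x y, (`|f x-f y| <= enorm (x-y))%R) ->
 (@hausdorff_outer R N s).-caratheodory [set x | f x<=a]%R.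
move=> lipf; set B := [set x | _].
apply: le_caratheodory_measurable=> X; rewrite /hausdorff_outer/=.
have [->|HXoo]:=eqVneq (H X) +oo; first by rewrite leey.
pose Y k:=X `&` [set x | a+t k<f x]%R.
pose D j:=X `&` [set x | a+t j.+2<f x<=a+t j.+1]%R.
have sepY k: H (X `&` B)+H (Y k)<=H X.
 apply: (@le_trans _ _ (H ((X `&` B) `|` Y k))).
  apply: (@haus_sep _ _ _ (t k))=> // x y [_ fx] [_ fy].
  apply: le_trans (lipf x y); rewrite distrC; apply: le_trans (ler_norm _).
  by move: fx fy; rewrite /B/=; lra. by apply: le_hausdorff=> x [[]|[]].
(* Two shells whose indices have the same parity [b] are separated by the shell between them, so
   measures of shells of one parity add up to at most [H X]. *)
have step b n: \sum_(j<n) H (D (j.*2+b)%N)<=H (Y (n.*2+b)%N).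
 elim: n=> [|n IH]; first by rewrite big_ord0 hausdorff_ge0.
 rewrite big_ord_recr/=; apply: (le_trans (leeD2r _ IH)).
 apply: (@le_trans _ _ (H (Y (n.*2+b)%N `|` D (n.*2+b)%N))).
  apply: (@haus_sep _ _ _ (t (n.*2+b)-t (n.*2+b).+1)%R).
   by rewrite subr_gt0. move=> x y [_ fx] [_ /= /andP[_ fy]].
  apply: le_trans (lipf x y); apply: le_trans (ler_norm _). by move: fx fy=> /=; lra.
 have h1:=t_lt (n.*2+b); have h2:=t_lt (n.*2+b).+1.
 apply: le_hausdorff=> x [[Xx fx]|[Xx /= /andP[fx _]]]; split=> //; rewrite /Y/= !addSn.
 by move: fx=> /=; lra.
have par n: \sum_(0<=j<n) H (D j)<=H X+H X.
 apply: (@le_trans _ _ (\sum_(j<n) (H (D (j.*2+0)%N)+H (D (j.*2+1)%N)))); last first.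
  by rewrite big_split/=; apply: leeD; apply: (le_trans (step _ _)); apply: le_hausdorff=> x [].
 rewrite (_: \sum_(j<n) _ = \sum_(0<=j<n.*2) H (D j)); last first.
  elim: n=> [|n IH]; first by rewrite big_ord0 big_nil.
  by rewrite big_ord_recr/= IH !big_nat_recr//= addeA addn0 addn1.
 by apply: lee_sum_nneg_natr=> //; [move=> *; exact: hausdorff_ge0|rewrite -addnn leq_addr].
have DH0 k: 0<=H (D k) by exact: hausdorff_ge0.
have fin: \sum_(0<=j <oo) H (D j) < +oo.
 apply: (@le_lt_trans _ _ (H X+H X)).
  by apply: lime_le; [exact: is_cvg_nneseries|exact: nearW]. by rewrite lte_add_pinfty// ltey.
have tail:=nneseries_tail_cvg fin (fun k _=> DH0 k).
(* [X] outside [B] is covered by [Y k.+1] and the shells from index [k] on. The tail of the shell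
   series tends to 0. *)
have main k: H (X `&` B)+H (X `&` ~` B)<=H X + \sum_(k<=j <oo) H (D j).
 apply: (@le_trans _ _ (H (X `&` B)+(H (Y k.+1) + \sum_(k<=j <oo) H (D j)))); last first.
  by rewrite addeA leeD2r. rewrite leeD2l//.
 apply: (@le_trans _ _ (H (Y k.+1 `|` \bigcup_(j in ~` `I_k) D j))); last first.
  apply: (le_trans (outer_measureU2 (@hausdorff_outer R N s) _ _)).
  rewrite leeD2l//; exact: (outer_measure_sigma_subadditive_tail (@hausdorff_outer R N s)).
 apply: le_hausdorff=> x [Xx /negP]; rewrite /B/= -ltNge=> fx.
 have [fk|fk]:=ltP (a+t k.+1)%R (f x); first by left. right. have ex: exists n, (a+t n<f x)%R.
  have [n]:=ltr_add_invr fx; by exists n. case: (ex_minnP ex)=> n fn nmin. have kn: (k.+1<n)%N.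
  rewrite ltnNge; apply/negP=> nk; move: fk; rewrite leNgt=> /negP; apply.
  apply: le_lt_trans fn; rewrite lerD2l /t lef_pV2 ?posrE// ler_nat//.
 case: n kn fn nmin=> // -[//|n] kn fn nmin. exists n=> /=; first by apply/negP; rewrite -leqNgt.
 split=> //=; rewrite fn/= leNgt; apply/negP=> /nmin. by rewrite ltnn.
have cv: (H X + \sum_(k<=j <oo) H (D j)) @[k --> \oo] --> H X+0.
 apply: cvgeD; [|exact: cvg_cst|exact: tail]. by rewrite fin_num_adde_defl.
rewrite adde0 in cv; rewrite -(cvg_lim _ cv)//.
apply: lime_ge; first by apply/cvg_ex; exists (H X).
by apply: nearW.
Qed.

Lemma haus_coord_le (i: 'I_N) a : (@hausdorff_outer R N s).-caratheodory [set x: V | x 0 i<=a]%R.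
have lip (x y: V): (`|x 0 i-y 0 i| <= enorm (x-y))%R.
 by have:=coord_le_enorm (x-y) i; rewrite !mxE.
exact: (haus_caratheodory_lip a lip).
Qed.

Lemma caratheodory_rV (A: set V): measurable A -> (@hausdorff_outer R N s).-caratheodory A.
move=> mA.
suff: g_sigma_preimage (fun (i: 'I_N) (x: V)=> x 0%R i: R) `<=`
  (@hausdorff_outer R N s).-caratheodory by apply.
have sig: sigma_algebra setT ((@hausdorff_outer R N s).-caratheodory).
 split.
 - exact: caratheodory_measurable_set0.
 - by move=> B mB; rewrite setTD; exact: caratheodory_measurable_setC.
 - exact: caratheodory_measurable_bigcup.
apply: smallest_sub=> //.
rewrite -bigcup_seq=> B [i _ [C mC]]; rewrite setTI=> <-.
pose T1:=caratheodory_type (@hausdorff_outer R N s).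
suff mi: measurable_fun [set: T1] ((fun x: V=> x 0%R i): T1 -> R).
 by have:=mi measurableT _ mC; rewrite setTI.
apply: (measurability _ (RGenOInfty.measurableE R))=> // _ [_ [a ->] <-].
rewrite setTI preimage_itvoy.
rewrite (_: [set _ | _] = ~` [set x: V | x 0 i<=a]%R).
 by apply: caratheodory_measurable_setC; exact: haus_coord_le.
by seteq=> x /=; rewrite ltNge=> /negP.
Qed.

End HausdorffCaratheodory.

Section HausdorffExpand.
Context {R: realType}.
Local Open Scope ereal_scope.

(* The inverse of an expanding map is Lipschitz *)
Lemma haus_expand s N N' (phi: 'rV[R]_N -> 'rV[R]_N') (A: set 'rV[R]_N) (L: R) : (0<L)%R ->
 (forall x y, A x -> A y -> (enorm (x-y)<=L*enorm (phi x-phi y))%R) ->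
 hausdorff s A<=(L^+s)%:E*hausdorff s (phi @` A).
move=> L0 ex.
pose psi z:=xget 0%R (A `&` [set x | phi x = z]).
have psiK x: A x -> psi (phi x) = x.
 move=> Ax; rewrite /psi; case: xgetP=> [y -> [Ay /= pyx]|/(_ x)]; last by case.
 have:=ex _ _ Ay Ax; rewrite pyx subrr enorm0 mulr0=> h.
 apply/eqP; rewrite -subr_eq0 -enorm_eq0; apply/eqP/le_anti. by rewrite h enorm_ge0.
rewrite [X in hausdorff s X<=_](_: A = psi @` (phi @` A)).
 apply: haus_lip=> // _ _ [x Ax <-] [y Ay <-]. by rewrite !psiK//; exact: ex.
seteq=> [x Ax|_ [_ [x Ax <-] <-]]; last by rewrite psiK.
by exists (phi x); [exists x|exact: psiK].
Qed.

Lemma haus_isometry s N N' (phi: 'rV[R]_N -> 'rV[R]_N') (A: set 'rV[R]_N) :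
 (forall x y, A x -> A y -> enorm (phi x-phi y) = enorm (x-y)) -> hausdorff s (phi @` A) = hausdorff s A.
move=> iso; apply/eqP; rewrite eq_le; bsplit.
 have /= := @haus_lip R s N N' phi A 1 ltr01. rewrite expr1n mul1e; apply=> x y Ax Ay; by rewrite mul1r iso.
have /= := @haus_expand s N N' phi A 1 ltr01.
rewrite expr1n mul1e; apply=> x y Ax Ay; by rewrite mul1r iso.
Qed.

End HausdorffExpand.

Section HausdorffBorelMeasure.
Context {R: realType} (s n: nat).
Local Open Scope ereal_scope.

Definition hausB (A: set 'rV[R]_n): \bar R:=hausdorff s A.

Let hausB0: hausB set0 = 0. Proof. exact: hausdorff0. Qed.
Let hausB_ge0 A: 0<=hausB A. Proof. exact: hausdorff_ge0. Qed.
Let hausB_additive: semi_sigma_additive hausB.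
move=> F mF tF mUF.
apply: (@measure_semi_sigma_additive _ _ _ (@hausdorff_measure R n s))=> //.
 by move=> i; exact: caratheodory_rV.
exact: caratheodory_rV.
Qed.

HB.instance Definition _:=isMeasure.Build _ _ _ hausB hausB0 hausB_ge0 hausB_additive.

End HausdorffBorelMeasure.

Section HausdorffLebesgue.
Context {R: realType}.
Local Open Scope ereal_scope.
Implicit Types n: nat.

Lemma haus_premeasure_fin s n (e: R) (A: set 'rV[R]_n) (T: finType)
  (U: T -> set 'rV[R]_n): (forall x, A x -> exists t, U t x) ->
 hausdorff_premeasure s e A <= \sum_(t: T) hausdorff_weight s e (U t).
move=> AU; pose F (k: nat): set 'rV[R]_n :=
 if (insub k: option 'I_#|T|) is Some i then U (enum_val i) else set0.
have AF: A `<=` \bigcup_k F k.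
 move=> x /AU[t Ut]; exists (enum_rank t)=> //. by rewrite /F valK enum_rankK.
apply: (le_trans (haus_premeasure_cover s e AF)).
have w0 k: 0<=hausdorff_weight s e (F k) by exact: hausdorff_weight_ge0.
apply: lime_le; first exact: is_cvg_nneseries.
apply: nearW=> m /=.
apply: (@le_trans _ _ (\sum_(0<=k<m + #|T|) hausdorff_weight s e (F k))).
 by apply: lee_sum_nneg_natr=> //; rewrite leq_addr.
rewrite addnC (big_cat_nat _ (n := #|T|))// ?leq_addr//= big_mkord.
rewrite [X in _+X]big_nat_cond [X in _+X]big1 ?adde0; last first.
 move=> i; rewrite andbT=> /andP[Ti _]; rewrite /F insubN -?leqNgt//. exact: hausdorff_weight0.
rewrite (reindex (@enum_val T T)) /=; last first.
 by exists enum_rank=> i _; rewrite ?enum_valK ?enum_rankK.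
by apply: lee_sum=> i _; rewrite /F valK.
Qed.

Lemma ediam_cube n (a: 'rV[R]_n) (r: R): (0<=r)%R -> ediam (cube a r)<=(2*n%:R*r)%:E.
move=> r0; apply: ge_ereal_sup=> _ [x cx [y cy <-]]; rewrite lee_fin.
apply: (le_trans (enorm_le_sum _)).
apply: (@le_trans _ _ (\sum_(i<n) 2*r)%R).
 apply: ler_sum=> i _; rewrite !mxE. by have:=cx i; have:=cy i; rewrite !ler_norml; lra.
by rewrite sumr_const card_ord -[leLHS]mulr_natr mulrAC.
Qed.

Lemma grid_cell (m: nat) (h y: R): (0<=h)%R -> (0<=y)%R -> (y<=2*h * m.+1%:R)%R ->
 exists2 j: nat, (j<m.+1)%N & (2*j%:R*h<=y<=2*(j%:R+1)*h)%R.
move=> h0 y0; elim: m=> [|m IH] ym.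
 by exists 0%N=> //; move: ym; rewrite mulr1=> ym; rewrite mulr0 mul0r y0/=; lra.
have [/IH[j jm jy]|ym1]:=leP y (2*h * m.+1%:R)%R.
 by exists j=> //; rewrite ltnS ltnW.
exists m.+1=> //; bsplit; first by rewrite mulrAC ltW.
by move: ym; rewrite -(natr1 m.+1); lra.
Qed.

(** The cube is cut into [M.+1] to the power n cubes of half-side [r/M.+1]. The number of cells
    times the n-th power of their size does not depend on [M], so one bound serves at every
    scale. *)
Lemma haus_cube_lty n (a: 'rV[R]_n) (r: R): (0<=r)%R -> hausdorff n (cube a r) < +oo.
move=> r0; pose w: R:=(unit_ball_volume R n/2^+n)%R.
apply: (@le_lt_trans _ _ (w*(2*n%:R*r)^+n)%:E); last by rewrite ltry.
apply: ge_ereal_sup=> _ [e /= e0 <-].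
have [M [M0 Me]]: exists M, (2*n%:R*(r/M.+1%:R)<=e)%R /\ True.
 have [M hM]:=ltr_add_invr (divr_gt0 e0 (ltr_pwDl ltr01 (mulr_ge0 (mulr_ge0 (ler0n R 2) (ler0n R n)) r0))).
 exists M; split=> //; move: hM; rewrite add0r=> hM.
 rewrite mulrA; apply: (@le_trans _ _ ((1+2*n%:R*r)/M.+1%:R)%R).
  by rewrite ler_pM2r// ?invr_gt0// lerDr. rewrite mulrC -ler_pdivlMr ?(ltW hM)//.
 by rewrite ltr_pwDl// !mulr_ge0.
pose U (t: {ffun 'I_n -> 'I_M.+1}): set 'rV[R]_n :=
 cube (\row_i (a 0 i-r+(2*(t i)%:R+1)*(r/M.+1%:R)))%R (r/M.+1%:R)%R.
have M1: (0<M.+1%:R :> R)%R by [].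
apply: (@le_trans _ _ (\sum_(t: {ffun 'I_n -> 'I_M.+1}) hausdorff_weight n e (U t))).
 apply: haus_premeasure_fin=> x cx. have /choice[t ht]: forall i, exists j: 'I_M.+1,
   (`|x 0%R i-(a 0%R i-r+(2*j%:R+1)*(r/M.+1%:R))| <= r/M.+1%:R)%R.
  move=> i; have:=cx i; rewrite ler_norml=> /andP[h1 h2]. have y0: (0<=x 0 i-a 0 i+r)%R by lra.
  have yM: (x 0 i-a 0 i+r<=2*(r/M.+1%:R)*M.+1%:R)%R.
   by rewrite -mulrA divfK//; lra.
  have [j jM /andP[j1 j2]]:=@grid_cell M (r/M.+1%:R)%R (x 0%R i-a 0%R i+r)%R (divr_ge0 r0 (ltW M1)) y0 yM.
  exists (Ordinal jM); rewrite ler_norml/=; move: j1 j2; set h:=(r/_)%R=> j1 j2.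
  have E1: (2*j%:R*h = 2*(j%:R*h))%R by rewrite mulrA. have E2: (2*(j%:R+1)*h = 2*(j%:R*h)+2*h)%R by ring.
  have E3: ((2*j%:R+1)*h = 2*(j%:R*h)+h)%R by ring.
  rewrite E1 in j1; rewrite E2 in j2; rewrite E3; bsplit; lra.
 exists [ffun i=> t i]=> i; rewrite mxE ffunE; exact: ht.
apply: (@le_trans _ _ (\sum_(t: {ffun 'I_n -> 'I_M.+1}) (w*(2*n%:R*(r/M.+1%:R))^+n)%:E)).
 have wp: (0<=w)%R by rewrite divr_ge0 ?exprn_ge0// ltW// unit_ball_volume_gt0.
 have rM: (0<=r/M.+1%:R)%R by rewrite divr_ge0.
 apply: lee_sum=> t _; rewrite /hausdorff_weight; case: eqVneq=> [_|].
  by rewrite lee_fin mulr_ge0// exprn_ge0// !mulr_ge0. move=> /set0P U0.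
 have dU: ediam (U t)<=(2*n%:R*(r/M.+1%:R))%:E by exact: ediam_cube.
 rewrite ifT; last by apply: (le_trans dU); rewrite lee_fin.
 rewrite -/w [leRHS]EFinM lee_wpmul2l ?lee_fin// EFin_expe; apply: lee_expe=> //. exact: ediam_ge0.
rewrite sumEFin lee_fin sumr_const card_ffun !card_ord -[leLHS]mulr_natr -[leLHS]mulrA ler_wpM2l//.
 by rewrite divr_ge0 ?exprn_ge0// ltW// unit_ball_volume_gt0.
rewrite natrX -exprMn -!mulrA mulVf ?mulr1//.
Qed.

(** A set of diameter D lies in the cube of half-side D about any of its points, and the constant
    converts the volume of that cube into the normalised weight. A set of diameter larger than 1 has
    infinite weight, so the whole space can be taken. *)
Lemma haus_weight_cube n (U: set 'rV[R]_n) : exists2 C: set 'rV[R]_n, U `<=` C & measurable C /\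
  leb n C<=(4^+n/unit_ball_volume R n)%:E*hausdorff_weight n 1 U.
have c0: (0<4^+n/unit_ball_volume R n :> R)%R.
 by rewrite divr_gt0// ?exprn_gt0// unit_ball_volume_gt0.
have [->|U0]:=eqVneq U set0.
 by exists set0=> //; split=> //; rewrite measure0 hausdorff_weight0 mule0.
have [d1|d1]:=boolP (ediam U<=1); last first.
 exists setT=> //; split=> //.
 by rewrite /hausdorff_weight (negbTE U0) (negbTE d1) gt0_muley ?lte_fin// leey.
move/set0P: (U0)=> [x Ux].
have d0: 0<=ediam U by apply: ediam_ge0; exists x.
have [D DE]: exists D: R, ediam U = D%:E.
 by exists (fine (ediam U)); rewrite fineK// ge0_fin_numE// (le_lt_trans d1)// ltry.
rewrite DE lee_fin in d0.
exists (cube x D).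
 move=> y Uy i; have:=coord_le_enorm (y-x)%R i; rewrite !mxE=> /le_trans; apply.
 by rewrite -lee_fin -DE; apply: ereal_sup_ubound; exists y=> //; exists x.
split; first exact: meas_cube.
rewrite leb_cube// /hausdorff_weight (negbTE U0) d1 DE -EFin_expe -!EFinM lee_fin.
eqle.
rewrite (_: 4 = 2*2 :> R)%R; last by ring.
rewrite !exprMn; field.
bsplit; rewrite gt_eqF ?unit_ball_volume_gt0 ?exprn_gt0//.
Qed.

(** A crude comparison, whose purpose is to see that [hratio] is positive. *)
Lemma leb_le_hausdorff n (A: set 'rV[R]_n): measurable A ->
 leb n A<=(4^+n/unit_ball_volume R n)%:E*hausdorff n A.
move=> mA.
have c0: (0<4^+n/unit_ball_volume R n :> R)%R.
 by rewrite divr_gt0// ?exprn_gt0// unit_ball_volume_gt0.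
apply: (@le_trans _ _ ((4^+n/unit_ball_volume R n)%:E*hausdorff_premeasure n 1 A)); last first.
 apply: lee_wpmul2l; first by rewrite lee_fin ltW. by apply: ereal_sup_ubound; exists 1%R=> /=.
rewrite -lee_pdivrMl//; apply: le_haus_premeasure=> F AF.
rewrite lee_pdivrMl//.
have /choice[C hC] k: exists C: set 'rV[R]_n, [/\ F k `<=` C, measurable C &
  leb n C<=(4^+n/unit_ball_volume R n)%:E*hausdorff_weight n 1 (F k)].
 by have [C ? []]:=haus_weight_cube (F k); exists C.
apply: (@le_trans _ _ (\sum_(k <oo) leb n (C k))).
 apply: (@measure_sigma_subadditive _ _ _ (leb n))=> //.
  by move=> k; have []:=hC k. by move=> x /AF[k _ Fx]; exists k=> //; have [h _ _]:=hC k; exact: h.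
rewrite -nneseriesZl=> [|k _]; last exact: hausdorff_weight_ge0.
apply: lee_nneseries=> [k _ _|k _]; first exact: measure_ge0.
by have []:=hC k.
Qed.

End HausdorffLebesgue.

Section HausdorffLebesgueEq.
Context {R: realType}.
Local Open Scope ereal_scope.
Implicit Types n: nat.

Let hausB_sigma_finite n: sigma_finite setT (@hausB R n n).
exists (fun k=> cube 0%R k%:R).
 seteq=> // x _. exists (Num.bound (enorm x))=> // i; rewrite mxE subr0.
 apply: (le_trans (coord_le_enorm x i)). by apply: ltW; apply: archi_boundP; exact: enorm_ge0.
move=> k; split; first exact: meas_cube.
exact: haus_cube_lty.
Qed.

HB.instance Definition _ n:=Measure_isSigmaFinite.Build _ _ _ (@hausB R n n) (hausB_sigma_finite n).

Definition hausN n: {sigma_finite_measure set 'rV[R]_n -> \bar R}:=@hausB R n n.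

Lemma hausN_reflect n (y: 'rV[R]_n) (f: 'rV[R]_n -> \bar R) : mfunT f -> (forall x, 0<=f x) ->
 \int[hausN n]_x f (y-x)%R = \int[hausN n]_x f x.
move=> mf f0.
have mB: mfunT (fun x: 'rV[R]_n=> (y-x)%R).
 exact: meas_rVB.
rewrite -[LHS](@ge0_integral_pushforward _ _ _ _ _ _ mB (hausN n) setT f)//.
apply: eq_measure_integral=> A mA _; rewrite /pushforward /hausN /=.
have iso: forall x z, A x -> A z -> enorm ((y-x)-(y-z))%R = enorm (x-z).
 by move=> x z _ _; rewrite opprB addrC subrKA enormB.
rewrite -[RHS](@haus_isometry _ _ _ _ (fun x=> y-x)%R A iso); congr hausdorff.
seteq=> [x /= Ax|_ [x Ax <-]] /=; last by rewrite subKr.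
by exists (y-x)%R=> //; rewrite subKr.
Qed.

(** Uniqueness of the invariant measure. The double integral of 1_A(x) 1_B(y - x) factorises when
    [leb] is integrated first, by translation invariance. The reflection x -> y - x is an isometry,
    hence preserves Hausdorff measure, and exchanges the roles of [A] and [B]. *)
Lemma haus_leb_cross n (A B: set 'rV[R]_n): measurable A -> measurable B ->
 hausN n A * leb n B = hausN n B * leb n A.
move=> mA mB.
pose f C D (p: 'rV[R]_n * 'rV[R]_n): \bar R:=(\1_C p.1 * \1_D (p.2-p.1)%R)%:E.
have mf C D: measurable C -> measurable D -> mfunT (f C D).
 move=> mC mD; apply/mEFP; apply: measurable_funM.
  by apply: (@mcomp _ _ _ _ _ _ (\1_C: 'rV[R]_n -> R))=> //.
 apply: (@mcomp _ _ _ _ _ _ (\1_D: 'rV[R]_n -> R))=> //. exact: meas_rVB.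
have f0 C D p: 0<=f C D p by rewrite lee_fin mulr_ge0.
have main C D: measurable C -> measurable D ->
  \int[leb n]_y \int[hausN n]_x f C D (x, y) = hausN n C * leb n D.
 move=> mC mD; rewrite -(@fubini_tonelli _ _ _ _ _ (hausN n) (leb n) (f C D))//; last exact: mf.
 have -> : \int[hausN n]_x \int[leb n]_y f C D (x, y) = \int[hausN n]_x ((\1_C x)%:E * leb n D).
  apply: eq_integral=> x _; rewrite /f/=. under eq_integral=> y _ do rewrite EFinM.
  rewrite ge0_integralZl//; last first.
   apply/mEFP/mcomp=> //; exact: meas_rVD.
  rewrite (leb_translate (- x)%R (f:=fun y=> (\1_D y)%:E))//; last exact/mEFP. by rewrite -leb_indic.
 rewrite ge0_integralZr//; last exact/mEFP. by rewrite integral_indic// setIT.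
rewrite -main// -(main B A)//; apply: eq_integral=> y _.
have mg: mfunT (fun x=> f A B (x, y)).
 exact: (mcomp (mf _ _ mA mB) (measurable_pair2 y)).
rewrite -(hausN_reflect y mg)//.
by apply: eq_integral=> x _; rewrite /f/= subKr mulrC.
Qed.

(* Since [leb n (cube 0 1) = 2 ^ n] *)
Definition hratio n: R:=(fine (hausdorff n (cube (0: 'rV[R]_n) 1))/2^+n)%R.

Let hcube_fin n: hausdorff n (cube (0: 'rV[R]_n) 1) \is a fin_num.
Proof. by rewrite ge0_fin_numE ?hausdorff_ge0// haus_cube_lty. Qed.

Lemma hratio_gt0 n: (0<hratio n)%R.
apply: divr_gt0; last by rewrite exprn_gt0.
rewrite fine_gt0// (haus_cube_lty _ ler01) andbT.
have:=leb_le_hausdorff (meas_cube (0: 'rV[R]_n) 1).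
rewrite leb_cube// mulr1=> h; rewrite lt_neqAle hausdorff_ge0 andbT eq_sym.
apply/negP=> /eqP h0; move: h; rewrite h0 mule0 lee_fin leNgt=> /negP; apply.
exact: exprn_gt0.
Qed.

(** The cross relation against the unit cube. The value of [hratio] is never computed: the same
    positive factor enters both sides of the final comparison. *)
Lemma haus_leb n (A: set 'rV[R]_n): measurable A -> hausdorff n A = (hratio n)%:E * leb n A.
move=> mA; have:=haus_leb_cross mA (meas_cube (0: 'rV[R]_n) 1).
rewrite leb_cube// mulr1=> h.
have: hausdorff n A*(2^+n)%:E = hausdorff n (cube (0: 'rV[R]_n) 1) * leb n A by [].
rewrite -(fineK (hcube_fin n))=> {}h.
have p2: (0<2^+n :> R)%R by rewrite exprn_gt0.
rewrite /hratio mulrC EFinM -muleA -h (muleC (hausdorff n A)) muleA -EFinM.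
by rewrite mulVf ?mul1e// gt_eqF.
Qed.

(** Isometry invariance of [leb] is inherited from Hausdorff measure, to which it is
    proportional. *)
Lemma leb_isometry n (phi psi: 'rV[R]_n -> 'rV[R]_n) (A: set 'rV[R]_n) :
 mfunT psi -> cancel phi psi -> cancel psi phi -> (forall x y, enorm (phi x-phi y) = enorm (x-y)) ->
 measurable A -> leb n (psi @^-1` A) = leb n A.
move=> mpsi phiK psiK iso mA.
have mpA: measurable (psi @^-1` A) by rewrite -measTI; exact: mpsi.
have:=haus_leb mpA.
have -> : psi @^-1` A = phi @` A.
 seteq=> [x /= Ax|_ [x Ax <-]/=]; last by rewrite phiK. by exists (psi x).
rewrite haus_isometry// haus_leb//.
have c0:=hratio_gt0 n.
move=> /(congr1 (fun z=> ((hratio n)^-1)%:E*z)); rewrite !muleA -EFinM mulVf ?gt_eqF//.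
by rewrite !mul1e=> ->.
Qed.

End HausdorffLebesgueEq.

(** * Functional Santalo inequality on the half-line *)

Section IntegralInv.
Context {R: realType}.

Lemma meas_funV d (T: measurableType d) (f: T -> R) : mfunT f -> mfunT (fun x=> (f x)^-1).
move=> mf; rewrite (_: (fun _=> _) = fun x=> f x*((f x^+2) `^ (-1))).
 apply: measurable_funM=> //. by apply: (@mcomp _ _ _ _ _ _ (@powR R ^~ (-1)))=> //; exact: measurable_funX.
apply/funext=> x; rewrite powR_inv1 ?sqr_ge0//.
have [->|f0]:=eqVneq (f x) 0; first by rewrite invr0 mul0r.
by rewrite expr2 invfM mulrA divff// mul1r.
Qed.

Local Open Scope ereal_scope.
Local Notation mu := (@lebesgue_measure R).

Lemma int_inv (a b: R): (0<a)%R -> (a<=b)%R -> \int[mu]_(s in `[a, b]) (s^-1)%:E = (ln b-ln a)%:E.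
move=> a0; rewrite le_eqVlt=> /predU1P[<-|ab].
 by rewrite set_itv1 integral_set1 subrr.
rewrite EFinB; apply: continuous_FTC2=> //.
- apply/continuous_within_itvP=> //; split.
 + move=> x /[!in_itv]/= /andP[ax _]; apply: inv_continuous.
  by rewrite gt_eqF// (lt_trans a0).
 + by apply: cvg_at_right_filter; apply: inv_continuous; rewrite gt_eqF.
 + by apply: cvg_at_left_filter; apply: inv_continuous; rewrite gt_eqF// (lt_trans a0).
- split.
 + move=> x /[!in_itv]/= /andP[ax _].
  by have []:=is_derive1_ln (lt_trans a0 ax).
 + by apply: cvg_at_right_filter; apply: continuous_ln.
 + by apply: cvg_at_left_filter; apply: continuous_ln; rewrite (lt_trans a0).
- move=> x /[!in_itv]/= /andP[ax _]; rewrite derive1E.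
 by have [_ ->]:=is_derive1_ln (lt_trans a0 ax).
Qed.

End IntegralInv.

Section HalfLine.
Context {R: realType}.
Local Notation mu := (@lebesgue_measure R).

(** The Gaussian as a density with respect to dr/r: the half-line is treated as a multiplicative
    group. *)
Let u (r: R): R:=r*expR (- r^+2).

Let u_le r: 0<r -> u r<=r.
move=> r0; rewrite /u ger_pMr// -expR0 ler_expR.
by rewrite oppr_le0 sqr_ge0.
Qed.

Let u_leV r: 0<r -> u r<=r^-1.
move=> r0; rewrite /u expRN -[leRHS]mulr1 -ler_pdivrMl ?invr_gt0// invrK mulrA -expr2.
rewrite ler_pdivrMr ?expR_gt0// mul1r; apply: le_trans (expR_ge1Dx _).
by rewrite lerDr.
Qed.

(** [u] increases while 2 r^2 <= 1 and decreases afterwards. On each branch the comparison follows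
    from exp(x) >= 1 + x. *)
Let u_unimodal r1 r r2 t: 0<r1 -> r1<=r -> r<=r2 -> t<u r1 -> t<u r2 -> t<u r.
move=> r10 r1r rr2; have r0: 0<r by exact: lt_le_trans r1r.
have [rs|rs]:=leP (2*r^+2) 1.
 move=> h1 _; apply: lt_le_trans h1 _. have E: expR (- r^+2) = expR (r1^+2-r^+2)*expR (- r1^+2).
  by rewrite -expRD; congr expR; ring. rewrite /u E mulrA ler_pM2r ?expR_gt0//.
 apply: le_trans (ler_wpM2l (ltW r0) (expR_ge1Dx _)). have: 0<=(r-r1)*(1-r*(r+r1)) by apply: mulr_ge0; nra.
 by nra.
move=> _ h2; apply: lt_le_trans h2 _.
have E: expR (- r^+2) = expR (r2^+2-r^+2)*expR (- r2^+2).
 by rewrite -expRD; congr expR; ring.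
rewrite /u E mulrA ler_pM2r ?expR_gt0//.
apply: le_trans (ler_wpM2l (ltW r0) (expR_ge1Dx _)).
have: 0<=(r2-r)*(r*(r2+r)-1) by apply: mulr_ge0; nra.
by nra.
Qed.

Let meas_u t: measurable [set r: R | 0<r /\ t<u r].
rewrite (_: [set _ | _] = `]0, +oo[%classic `&` u @^-1` `]t, +oo[%classic); last first.
 by seteq=> x /=; rewrite !in_itv/= !andbT.
apply: measurableI=> //; rewrite -measTI.
have mu_: mfunT u.
 apply: measurable_funM=> //; apply: mcomp=> //. apply: measurable_funN; exact: measurable_funX.
exact: mu_.
Qed.

(** The one-dimensional Prekopa-Leindler argument in logarithmic variables. [S] and [T] are enlarged
    to their hulls [a, b] and [c, e]. The interval from sqrt(ac) to sqrt(be) has half the sum of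
    their logarithmic lengths, and each of its points lies between two geometric means where [u]
    exceeds [t], so unimodality applies. *)
Lemma halfline_levels (S T: set R) (t: R): 0<t -> measurable S -> measurable T ->
 (forall s, S s -> 0<s) -> (forall s, T s -> 0<s) -> (forall x y, S x -> T y -> t<u (Num.sqrt (x*y))) ->
 S !=set0 -> T !=set0 -> (\int[mu]_(s in S) (s^-1)%:E + \int[mu]_(s in T) (s^-1)%:E <=
  2%:E * \int[mu]_(s in [set r | 0<r /\ t<u r]%R) (s^-1)%:E)%E.
move=> t0 mS mT S0 T0 STu Sne Tne.
(* The bounds u(r) <= r and u(r) <= 1/r keep the products xy away from 0 and from infinity, so both
   sets have positive infimum and finite supremum. *)
have bnd x y: S x -> T y -> t^+2<x*y<(t^+2)^-1.
 move=> Sx Ty; have xy: 0<x*y by apply: mulr_gt0; [exact: S0|exact: T0].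
 have s0: 0<Num.sqrt (x*y) by rewrite sqrtr_gt0. have h1:=lt_le_trans (STu x y Sx Ty) (u_le s0).
 have h2:=lt_le_trans (STu x y Sx Ty) (u_leV s0).
 have E:=sqr_sqrtr (ltW xy); set r:=Num.sqrt (x*y) in E s0 h1 h2.
 rewrite -E -exprVn !ltr_pXn2r// ?nnegrE ?invr_ge0 ?(ltW t0) ?(ltW s0)//.
 bsplit=> //; rewrite -(invrK r) ltf_pV2 ?posrE ?invr_gt0//.
have [s1 Ss1]:=Sne; have [t1 Tt1]:=Tne.
have lbd (A B: set R) x y: (forall x y, A x -> B y -> t^+2<x*y<(t^+2)^-1) ->
  B y -> 0<y -> A x -> t^+2/y<x /\ x<(t^+2)^-1/y.
 by move=> h By y0 Ax; rewrite ltr_pdivrMr// ltr_pdivlMr//; apply/andP; exact: h.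
have bndC x y: T x -> S y -> t^+2<x*y<(t^+2)^-1.
 by move=> Tx Sy; rewrite mulrC; exact: bnd.
have infS: has_inf S.
 by split=> //; exists (t^+2/t1)=> x Sx; have [/ltW]:=lbd _ _ _ _ bnd Tt1 (T0 _ Tt1) Sx.
have supS: has_sup S.
 by split=> //; exists ((t^+2)^-1/t1)=> x Sx; have [_ /ltW]:=lbd _ _ _ _ bnd Tt1 (T0 _ Tt1) Sx.
have infT: has_inf T.
 by split=> //; exists (t^+2/s1)=> x Sx; have [/ltW]:=lbd _ _ _ _ bndC Ss1 (S0 _ Ss1) Sx.
have supT: has_sup T.
 by split=> //; exists ((t^+2)^-1/s1)=> x Sx; have [_ /ltW]:=lbd _ _ _ _ bndC Ss1 (S0 _ Ss1) Sx.
set a:=inf S; set b:=sup S; set c:=inf T; set e:=sup T.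
have a0: 0<a.
 apply: (@lt_le_trans _ _ (t^+2/t1)); first by apply: divr_gt0; [exact: exprn_gt0|exact: T0].
 by apply: lb_le_inf=> // x Sx; have [/ltW]:=lbd _ _ _ _ bnd Tt1 (T0 _ Tt1) Sx.
have c0: 0<c.
 apply: (@lt_le_trans _ _ (t^+2/s1)); first by apply: divr_gt0; [exact: exprn_gt0|exact: S0].
 by apply: lb_le_inf=> // x Sx; have [/ltW]:=lbd _ _ _ _ bndC Ss1 (S0 _ Ss1) Sx.
have Sab x: S x -> a<=x<=b.
 by move=> Sx; bsplit; [apply: ge_inf=> //; exact: (proj2 infS)|apply: ub_le_sup=> //; exact: (proj2 supS)].
have Tce x: T x -> c<=x<=e.
 by move=> Tx; bsplit; [apply: ge_inf=> //; exact: (proj2 infT)|apply: ub_le_sup=> //; exact: (proj2 supT)].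
have ab: a<=b by have /andP[h /(le_trans h)]:=Sab _ Ss1.
have ce: c<=e by have /andP[h /(le_trans h)]:=Tce _ Tt1.
have b0:=lt_le_trans a0 ab; have e0:=lt_le_trans c0 ce.
have ac0: 0<a*c by rewrite mulr_gt0.
have be0: 0<b*e by rewrite mulr_gt0.
have acbe: a*c<=b*e by rewrite ler_pM// ltW.
have hull (A: set R) p q: measurable A -> 0<p -> p<=q ->
  (forall x, A x -> p<=x<=q) -> (\int[mu]_(s in A) (s^-1)%:E<=(ln q-ln p)%:E)%E.
 move=> mA p0 pq Apq; rewrite -int_inv//; apply: ge0_subset_integral=> //.
  by apply/mEFP; apply: (@measurable_funS _ _ _ _ setT)=> //; exact: meas_funV.
 by move=> x /=; rewrite in_itv/= => /andP[px _]; rewrite lee_fin invr_ge0 (le_trans _ px)// ltW.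
apply: (le_trans (leeD (hull S a b mS a0 ab Sab) (hull T c e mT c0 ce Tce))).
have -> : ((ln b-ln a)%:E+(ln e-ln c)%:E =
  2%:E * \int[mu]_(s in `]Num.sqrt (a*c), Num.sqrt (b*e)[) (s^-1)%:E)%E.
 rewrite -(@integral_itv_bndoo _ _ _ _ true false); last first.
  by apply/mEFP; apply: (@measurable_funS _ _ _ _ setT)=> //; exact: meas_funV.
 have s1': 0<Num.sqrt (a*c) by rewrite sqrtr_gt0. rewrite int_inv//; last by rewrite ler_wsqrtr.
 rewrite -EFinM -EFinD; congr EFin. have lnsq x: 0<x -> 2 * ln (Num.sqrt x) = ln x.
  by move=> x0; rewrite mulrC mulr_natr -lnXn ?sqrtr_gt0// sqr_sqrtr// ltW.
 by rewrite mulrBr !lnsq// !lnM ?posrE//; ring.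
apply: lee_wpmul2l; first by rewrite lee_fin.
apply: ge0_subset_integral=> //.
- exact: meas_u.
- apply/mEFP; apply: (@measurable_funS _ _ _ _ setT)=> //; exact: meas_funV.
- by move=> x [x0 _]; rewrite lee_fin invr_ge0 ltW.
move=> r /=; rewrite in_itv/= => /andP[r1 r2].
have sac: 0<Num.sqrt (a*c) by rewrite sqrtr_gt0.
have r0:=lt_trans sac r1; split=> //.
have [x1 [y1 [Sx1 Ty1 xy1]]]: exists x y, [/\ S x, T y & x*y<r^+2].
 have h: a<r^+2/c.
  rewrite ltr_pdivlMr// -(sqr_sqrtr (ltW ac0)) ltr_pXn2r// nnegrE ltW//. have [x Sx xa]:=inf_lt Sne h.
 have x0:=S0 _ Sx. have {}h: c<r^+2/x by rewrite ltr_pdivlMr// mulrC -ltr_pdivlMr.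
 have [y Ty yc]:=inf_lt Tne h. by exists x, y; split=> //; rewrite mulrC -ltr_pdivlMr.
have [x2 [y2 [Sx2 Ty2 xy2]]]: exists x y, [/\ S x, T y & r^+2<x*y].
 have h: r^+2/e<b.
  rewrite ltr_pdivrMr// -(sqr_sqrtr (ltW be0)) ltr_pXn2r// nnegrE; first exact: ltW. exact: sqrtr_ge0.
 have [x Sx xa]:=sup_gt Sne h. have x0:=S0 _ Sx.
 have {}h: r^+2/x<e by rewrite ltr_pdivrMr// mulrC -ltr_pdivrMr. have [y Ty yc]:=sup_gt Tne h.
 by exists x, y; split=> //; rewrite mulrC -ltr_pdivrMr.
have p1: 0<x1*y1 by apply: mulr_gt0; [exact: S0|exact: T0].
have rE: r = Num.sqrt (r^+2) by rewrite sqrtr_sqr gtr0_norm.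
apply: (u_unimodal (r1:=Num.sqrt (x1*y1)) (r2:=Num.sqrt (x2*y2))).
- by rewrite sqrtr_gt0.
- by rewrite rE ler_wsqrtr// ltW.
- by rewrite {1}rE ler_wsqrtr// ltW.
- exact: STu.
- exact: STu.
Qed.

End HalfLine.

Section HalfLineSantalo.
Context {R: realType}.
Local Notation mu := (@lebesgue_measure R).

(** Layer-cake formula for s phi(s) with respect to ds/s. *)
Lemma layer_inv (phi: R -> R): mfunT phi -> (forall s, 0<s -> 0<=phi s) ->
 (\int[mu]_(s in `]0%R, +oo[) (phi s)%:E =
  \int[mu]_(t in `]0%R, +oo[) \int[mu]_(s in [set s | 0<s /\ t<s * phi s]%R) (s^-1)%:E)%E /\
 measurable_fun (`]0%R, +oo[%classic: set R)
  (fun t: R=> \int[mu]_(s in [set s | 0<s /\ t<s * phi s]%R) (s^-1)%:E)%E.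
move=> mphi phi0.
pose D: set (R*R) := [set p | 0<p.1] `&` [set p | 0<p.2] `&` [set p | p.2<p.1 * phi p.1].
have mD: measurable D.
 apply: measurableI; first apply: measurableI.
 - rewrite (_: [set _ | _] = (fst: R*R -> R) @^-1` (`]0%R, +oo[%classic: set R)); last first.
   by seteq=> x /=; rewrite in_itv/= andbT. by rewrite -measTI; apply: measurable_fst.
 - rewrite (_: [set _ | _] = (snd: R*R -> R) @^-1` (`]0%R, +oo[%classic: set R)); last first.
   by seteq=> x /=; rewrite in_itv/= andbT. by rewrite -measTI; apply: measurable_snd.
 - rewrite (_: [set _ | _] = (fun p: R*R=> p.1 * phi p.1-p.2) @^-1` (`]0%R, +oo[%classic: set R)); last first.
   by seteq=> x /=; rewrite in_itv/= andbT subr_gt0. rewrite -measTI; apply: (_: mfunT _)=> //.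
  apply: measurable_funB=> //; apply: measurable_funM=> //. exact: mcomp.
pose F (p: R*R): \bar R:=(p.1^-1 * \1_D p)%:E.
have mF: mfunT F.
 apply/mEFP; apply: measurable_funM=> //. by apply: meas_funV.
have F0 p: (0<=F p)%E.
 rewrite lee_fin indicE; have [|_]:=boolP (p \in D); last by rewrite mulr0.
 by rewrite inE=> -[[/= p0 _] _]; rewrite mulr1 invr_ge0 ltW.
have L: (\int[mu]_(s in `]0%R, +oo[) (phi s)%:E = \int[mu]_s \int[mu]_t F (s, t))%E.
 rewrite integral_mkcond; apply: eq_integral=> s _; rewrite patchE. case: ifPn=> [|/negP].
  rewrite inE/= in_itv/= andbT=> s0.
  have -> : (fun t=> F (s, t)) = (fun t=> (s^-1)%:E*(\1_(`]0, s * phi s[%classic) t)%:E)%E.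
   apply/funext=> t; rewrite /F -EFinM; congr (_*_)%:E; rewrite !indicE; congr ((nat_of_bool _)%:R).
   apply/idP/idP; rewrite !inE.
    by move=> [[_ /= h1] /= h2]; rewrite in_itv/= h1 h2.
   by rewrite /= in_itv/= => /andP[h1 h2]; split=> //; split. rewrite ge0_integralZl//; last 2 first.
  - by apply/mEFP; exact: measurable_indic.
  - by rewrite lee_fin invr_ge0 ltW.
  rewrite integral_indic// setIT.
  transitivity ((s^-1)%:E * lebesgue_measure [set` `]0%R, (s * phi s)%R[])%E=> //.
  rewrite lebesgue_measure_itv/= lte_fin.
  case: ltP=> h; first by rewrite -EFinB subr0 -EFinM mulKf// gt_eqF.
  rewrite mule0; congr EFin; apply/le_anti; rewrite phi0// andbT. by move: h; rewrite pmulr_rle0.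
 rewrite inE/= in_itv/= andbT=> s0; rewrite integral0_eq// => t _.
 rewrite /F indicE memNset ?mulr0// => -[[]]; contradiction.
have Rt t: 0<t -> (\int[mu]_(s in [set s | 0<s /\ t<s * phi s]%R) (s^-1)%:E = \int[mu]_s F (s, t))%E.
 move=> t0; rewrite integral_mkcond; apply: eq_integral=> s _; rewrite patchE /F indicE/=.
 have [|/negP]:=boolP (s \in _).
  by rewrite inE/= => -[s0 ts]; rewrite mem_set ?mulr1.
 rewrite inE/= => h; rewrite memNset ?mulr0// => -[[/= s0 _] ts]; exact: h.
have mG: mfunT (fun t=> \int[mu]_s F (s, t))%E.
 exact: (@measurable_fun_fubini_tonelli_G _ _ _ _ _ mu _ mF).
split; last first.
 apply: (@eq_measurable_fun _ _ _ _ _ (fun t=> \int[mu]_s F (s, t))%E).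
  by move=> t; rewrite inE/= in_itv/= andbT=> t0; rewrite Rt. exact: measurable_funS mG.
have Rr: (\int[mu]_(t in `]0%R, +oo[) \int[mu]_(s in [set s | 0<s /\ t<s * phi s]%R) (s^-1)%:E =
  \int[mu]_t \int[mu]_s F (s, t))%E. rewrite integral_mkcond; apply: eq_integral=> t _; rewrite patchE.
 case: ifPn=> [|/negP].
  by rewrite inE/= in_itv/= andbT=> t0; rewrite Rt.
 rewrite inE/= in_itv/= andbT=> s0; rewrite integral0_eq// => t' _.
 rewrite /F indicE memNset ?mulr0// => -[[]]; contradiction.
by rewrite L Rr; exact: fubini_tonelli.
Qed.

Let J:=(\int[mu]_(r in `]0%R, +oo[) (gauss_fun r)%:E)%E.

Let JE: J = (Num.sqrt pi/2)%:E.
rewrite -integral0y_gauss /J; apply: integral_itv_obnd_cbnd.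
by apply/mEFP; apply: (@measurable_funS _ _ _ _ setT)=> //; exact: measurable_gauss_fun.
Qed.

Let meas_level (phi: R -> R) t: mfunT phi -> measurable [set s | 0<s /\ t<s * phi s].
move=> mphi.
rewrite (_: [set _ | _] = (`]0%R, +oo[%classic: set R) `&` (fun s=> s * phi s) @^-1` (`]t, +oo[%classic: set R)); last first.
 by seteq=> x /=; rewrite !in_itv/= !andbT.
apply: measurableI=> //; rewrite -measTI.
by apply: (_: mfunT _)=> //; exact: measurable_funM.
Qed.

(** The condition on levels makes the two superlevel sets empty simultaneously; [halfline_levels]
    says nothing when exactly one of them is empty. *)
Let halfline_norm (phi psi: R -> R) : mfunT phi -> mfunT psi ->
 (forall s, 0<s -> 0<=phi s) -> (forall s, 0<s -> 0<=psi s) ->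
 (forall s t, 0<s -> 0<t -> phi s * psi t<=expR (- (2*(s*t)))) ->
 (forall t, 0<t -> (exists2 s, 0<s & t<s * phi s) <-> (exists2 s, 0<s & t<s * psi s)) ->
 (\int[mu]_(s in `]0%R, +oo[) (phi s)%:E + \int[mu]_(s in `]0%R, +oo[) (psi s)%:E<=2%:E*J)%E.
move=> mphi mpsi phi0 psi0 pp lev.
have [Ephi Mphi]:=layer_inv mphi phi0; have [Epsi Mpsi]:=layer_inv mpsi psi0.
have [Eg Mg]:=layer_inv (@measurable_gauss_fun R) (fun s _=> gauss_fun_ge0 s).
rewrite /J Ephi Epsi Eg.
have I0 (f: R -> R) t: (0 <= \int[mu]_(s in [set s | 0<s /\ t<s*f s]%R) (s^-1)%:E)%E.
 by apply: integral_ge0=> s [s0 _]; rewrite lee_fin invr_ge0 ltW.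
rewrite -ge0_integralD//.
rewrite -ge0_integralZl//.
apply: ge0_le_integral=> //.
- by move=> t _; exact: adde_ge0.
- exact: emeasurable_funD.
- by apply: measurable_funeM.
move=> t; rewrite /= in_itv/= andbT=> t0.
have [[s0 s00 ts0]|ns]:=pselect (exists2 s, 0<s & t<s * phi s); last first.
 have nt: ~ (exists2 s, 0<s & t<s * psi s) by move=> /lev h; exact: (ns (h t0)).
 rewrite (_: [set s | _] = set0); last by seteq=> // x [x0 tx]; apply: ns; exists x.
 rewrite (_: [set s | 0<s /\ t<s * psi s] = set0); last first.
  by seteq=> // x [x0 tx]; apply: nt; exists x. by rewrite !integral_set0 adde0 mule_ge0.
have [t1 t10 tt1]:=(lev t t0).1 (ex_intro2 _ _ s0 s00 ts0).
apply: halfline_levels=> //.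
- exact: meas_level.
- exact: meas_level.
- by move=> s [].
- by move=> s [].
- move=> x y [x0 tx] [y0 ty].
 have xy0: 0<x*y by rewrite mulr_gt0.
 rewrite -(@ltr_pXn2r _ 2)// ?nnegrE ?ltW//; last by rewrite mulr_gt0 ?expR_gt0// sqrtr_gt0.
 have -> : (Num.sqrt (x*y)*expR (- Num.sqrt (x*y)^+2))^+2 = x*y*expR (- (2*(x*y))).
  rewrite exprMn sqr_sqrtr ?ltW// expr2 -expRD; congr (_*expR _); ring.
 apply: (@lt_le_trans _ _ ((x * phi x)*(y * psi y))).
  by rewrite expr2; apply: ltr_pM=> //; exact: ltW. by rewrite mulrACA ler_pM2l//; exact: pp.
- by exists s0.
- by exists t1.
Qed.

(** Scaling [phi] by k and [psi] by 1/k leaves the hypothesis and the product of the integrals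
    unchanged, and the right k gives s phi(s) and s psi(s) the same supremum, as [halfline_norm]
    requires. The bound on the sum then gives the bound on the product by the arithmetic-geometric
    mean inequality. *)
Lemma halfline_santalo (phi psi: R -> R) : mfunT phi -> mfunT psi ->
 (forall s, 0<s -> 0<=phi s) -> (forall s, 0<s -> 0<=psi s) ->
 (forall s t, 0<s -> 0<t -> phi s * psi t<=expR (- (2*(s*t)))) ->
 (\int[mu]_(s in `]0%R, +oo[) (phi s)%:E * \int[mu]_(s in `]0%R, +oo[) (psi s)%:E<=(pi/4)%:E)%E.
move=> mphi mpsi phi0 psi0 pp.
have pi4: (0<=(pi/4)%:E :> \bar R)%E by rewrite lee_fin divr_ge0// pi_ge0.
have [[s0 s00 ps0]|ns]:=pselect (exists2 s, 0<s & 0<phi s); last first.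
 rewrite (@integral0_eq _ _ _ mu)// ?mul0e// => s; rewrite /= in_itv/= andbT=> s0.
 congr EFin; apply/le_anti; rewrite phi0// andbT leNgt; apply/negP=> h; apply: ns; by exists s.
have [[t0 t00 pt0]|ns]:=pselect (exists2 s, 0<s & 0<psi s); last first.
 rewrite muleC (@integral0_eq _ _ _ mu)// ?mul0e// => s; rewrite /= in_itv/= andbT=> s0'.
 congr EFin; apply/le_anti; rewrite psi0// andbT leNgt; apply/negP=> h; apply: ns; by exists s.
pose S := [set s * phi s | s in [set s | 0<s]]; pose T := [set s * psi s | s in [set s | 0<s]].
have pq x y: 0<x -> 0<y -> (x * phi x)*(y * psi y)<=1.
 move=> x0 y0; have xy0: 0<x*y by rewrite mulr_gt0.
 rewrite mulrACA; apply: le_trans (ler_wpM2l (ltW xy0) (pp x y x0 y0)) _.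
 rewrite expRN ler_pdivrMr ?expR_gt0// mul1r; apply: le_trans (expR_ge1Dx _); lra.
have Sne: S !=set0 by exists (s0 * phi s0); exists s0.
have Tne: T !=set0 by exists (t0 * psi t0); exists t0.
have supS: has_sup S.
 split=> //; exists (t0 * psi t0)^-1=> _ [x x0 <-]. by rewrite -[leRHS]mul1r ler_pdivlMr ?mulr_gt0// pq.
have supT: has_sup T.
 split=> //; exists (s0 * phi s0)^-1=> _ [x x0 <-].
 by rewrite -[leRHS]mul1r ler_pdivlMr ?mulr_gt0// mulrC pq.
have P0: 0<sup S.
 apply: (@lt_le_trans _ _ (s0 * phi s0)); first by rewrite mulr_gt0.
 by apply: ub_le_sup; [exact: (proj2 supS)|exists s0].
have Q0: 0<sup T.
 apply: (@lt_le_trans _ _ (t0 * psi t0)); first by rewrite mulr_gt0.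
 by apply: ub_le_sup; [exact: (proj2 supT)|exists t0].
pose k:=Num.sqrt (sup T/sup S).
have k0: 0<k by rewrite sqrtr_gt0 divr_gt0.
have kPQ: k*sup S = sup T/k.
 have kn: k != 0 by rewrite gt_eqF.
 apply: (mulIf kn); rewrite (divfK kn) mulrAC -expr2 sqr_sqrtr; last by rewrite ltW// divr_gt0.
 by rewrite divfK// gt_eqF.
have lev1 (c: R) (f: R -> R) t: 0<c -> has_sup [set s*f s | s in [set s | 0<s]] ->
  (exists2 s, 0<s & t<s*(c*f s)) <-> t<c*sup [set s*f s | s in [set s | 0<s]].
 move=> c0 hs; split=> [[s s0' ts]|].
  apply: (lt_le_trans ts); rewrite mulrCA ler_pM2l//. by apply: ub_le_sup; [exact: (proj2 hs)|exists s].
 rewrite -ltr_pdivrMl// => /(sup_gt (proj1 hs))[_ [s s0' <-]].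
 by rewrite ltr_pdivrMl// mulrCA=> ts; exists s.
have:=@halfline_norm (fun s=> k * phi s) (fun s=> k^-1 * psi s).
have mk1: mfunT (fun s=> k * phi s) by exact: measurable_funM.
have mk2: mfunT (fun s=> k^-1 * psi s) by exact: measurable_funM.
have kV0: 0<k^-1 by rewrite invr_gt0.
move=> /(_ mk1 mk2 (fun s s0=> mulr_ge0 (ltW k0) (phi0 s s0)) (fun s s0=> mulr_ge0 (ltW kV0) (psi0 s s0))).
have pp' s t: 0<s -> 0<t -> k * phi s*(k^-1 * psi t)<=expR (- (2*(s*t))).
 by move=> ? ?; rewrite mulrACA divff ?gt_eqF// mul1r pp.
have lv t: 0<t -> (exists2 s, 0<s & t<s*(k * phi s)) <-> (exists2 s, 0<s & t<s*(k^-1 * psi s)).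
 by move=> _; apply: (iff_trans (lev1 k phi t k0 supS)); rewrite kPQ mulrC; apply: iff_sym; exact: lev1.
move=> /(_ pp' lv).
under eq_integral do rewrite EFinM.
rewrite ge0_integralZl//; last 3 first.
- by apply/mEFP; exact: measurable_funS mphi.
- by move=> s; rewrite /= in_itv/= andbT=> s0'; rewrite lee_fin phi0.
- by rewrite lee_fin ltW.
under [X in (_+X<=_)%E]eq_integral do rewrite EFinM.
rewrite ge0_integralZl//; last 3 first.
- by apply/mEFP; exact: measurable_funS mpsi.
- by move=> s; rewrite /= in_itv/= andbT=> s0'; rewrite lee_fin psi0.
- by rewrite lee_fin ltW.
set A:=(\int[mu]_(s in _) (phi s)%:E)%E; set B:=(\int[mu]_(s in _) (psi s)%:E)%E.
rewrite JE=> AB.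
have A0: (0<=A)%E by apply: integral_ge0=> s; rewrite /= in_itv/= andbT=> s0'; rewrite lee_fin phi0.
have B0: (0<=B)%E by apply: integral_ge0=> s; rewrite /= in_itv/= andbT=> s0'; rewrite lee_fin psi0.
have kA0: (0<=k%:E*A)%E by rewrite mule_ge0// lee_fin ltW.
have kB0: (0<=k^-1%:E*B)%E by rewrite mule_ge0// lee_fin ltW.
have fA: A \is a fin_num.
 rewrite ge0_fin_numE// ltey; apply/negP=> /eqP Aoo; move: AB; rewrite Aoo gt0_muley ?lte_fin//.
 rewrite addye; last by rewrite gt_eqF// (lt_le_trans _ kB0). by rewrite -EFinM leye_eq.
have fB: B \is a fin_num.
 rewrite ge0_fin_numE// ltey; apply/negP=> /eqP Boo; move: AB; rewrite Boo gt0_muley ?lte_fin//.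
 rewrite addey; last by rewrite gt_eqF// (lt_le_trans _ kA0). by rewrite -EFinM leye_eq.
have [a aE]: exists a, A = a%:E by exists (fine A); rewrite fineK.
have [b bE]: exists b, B = b%:E by exists (fine B); rewrite fineK.
move: A0 B0 AB; rewrite aE bE -!EFinM -EFinD !lee_fin=> A0 B0 AB.
have E: a*b = (k*a)*(k^-1*b) by rewrite mulrACA divff ?gt_eqF// mul1r.
rewrite E; move: (mulr_ge0 (ltW k0) A0) (mulr_ge0 (ltW kV0) B0) AB.
set x:=k*a; set y:=k^-1*b=> x0 y0 xy.
have sp:=sqr_sqrtr (pi_ge0 R); have sp0:=sqrtr_ge0 (pi: R).
set w:=Num.sqrt pi in sp sp0 xy *; rewrite -sp.
have {}xy: x+y<=w by move: xy; lra.
have: (x+y)^+2<=w^+2 by rewrite ler_pXn2r// nnegrE ?addr_ge0.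
have:=sqr_ge0 (x-y); rewrite sqrrB sqrrD; lra.
Qed.

End HalfLineSantalo.

(** * Functions dominated by a Gaussian and their fibre integrals *)

Section GaussBounded.
Context {R: realType}.
Local Notation mu := (@lebesgue_measure R).

Lemma ge0_le_integralT d (T: measurableType d) (m: {measure set T -> \bar R}) (f g: T -> \bar R) :
 mfunT f -> mfunT g -> (forall x, 0<=f x)%E -> (forall x, f x<=g x)%E -> (\int[m]_x f x <= \int[m]_x g x)%E.
by move=> mf mg f0 fg; apply: ge0_le_integral.
Qed.

Lemma ge0_integralZl_real d (T: measurableType d) (m: {measure set T -> \bar R}) (D: set T) (k: R) (f: T -> R) :
 measurable D -> 0<=k -> mfunT f -> (forall x, 0<=f x) ->
 (\int[m]_(x in D) (k*f x)%:E = k%:E * \int[m]_(x in D) (f x)%:E)%E.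
move=> mD k0 mf f0; under eq_integral do rewrite EFinM.
apply: ge0_integralZl=> //.
- by apply/mEFP; exact: measurable_funS mf.
- by move=> x _; rewrite lee_fin.
Qed.

(** The class in which the induction runs: all integrals are finite, and it is stable under
    restriction, affine shears, exponential twists and integration along a half-line. *)
Definition gaussb n (f: 'rV[R]_n -> R): Prop := [/\ mfunT f, forall x, 0<=f x &
  exists M a: R, 0<a /\ forall x, f x<=M*expR (- (a*dot x x))].

Lemma meas_expdot n (a: R) : mfunT (fun x: 'rV[R]_n=> expR (- (a*dot x x))).
apply: mcomp=> //; apply: measurable_funN; apply: measurable_funM=> //.
exact: meas_dot.
Qed.

Lemma int_gauss1 (a: R): 0<a -> (\int[mu]_s (expR (- (a*s^+2)))%:E = (Num.sqrt (pi/a))%:E)%E.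
move=> a0; have s0: 0<Num.sqrt a by rewrite sqrtr_gt0.
have:=@int_lebesgueM R (Num.sqrt a) (fun s=> (gauss_fun s)%:E) s0.
rewrite integralT_gauss=> h.
have {}h: ((Num.sqrt a)%:E * \int[mu]_s (expR (- (a*s^+2)))%:E = (Num.sqrt pi)%:E)%E.
 rewrite -h; last 2 first.
 - by apply/mEFP; exact: measurable_gauss_fun.
 - by move=> x; rewrite lee_fin gauss_fun_ge0.
 congr (_*_)%E; apply: eq_integral=> s _; congr EFin. by rewrite /gauss_fun exprMn sqr_sqrtr// ltW.
move: h=> /(congr1 (fun z=> ((Num.sqrt a)^-1%:E*z)%E)); rewrite muleA -!EFinM mulVf ?gt_eqF// mul1e=> ->.
by rewrite sqrtrM ?pi_ge0// sqrtrV ?ltW// mulrC.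
Qed.

Lemma int_gaussn n (a: R): 0<a -> (\int[leb n]_x (expR (- (a*dot x x)))%:E = (Num.sqrt (pi/a)^+n)%:E)%E.
move=> a0; elim: n=> [|n IH].
 rewrite int_leb0; last by apply/mEFP; exact: meas_expdot. by rewrite dot0l mulr0 oppr0 expR0 expr0.
rewrite int_lebS1//; last first.
 by apply/mEFP; exact: meas_expdot.
under eq_integral=> s _.
 under eq_integral=> y _ do rewrite dot_consv mulrDr opprD expRD EFinM.
 rewrite ge0_integralZl//; last by apply/mEFP; exact: meas_expdot. rewrite IH -expr2. over.
rewrite ge0_integralZr//.
- by rewrite int_gauss1// -EFinM exprS.
- apply/mEFP; apply: mcomp=> //; apply: measurable_funN.
 by apply: measurable_funM=> //; exact: measurable_funX.
Qed.

Lemma gaussb_lty n (f: 'rV[R]_n -> R): gaussb f -> (\int[leb n]_x (f x)%:E < +oo)%E.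
move=> [mf f0 [M [a [a0 fM]]]].
have M0: 0<=M by have:=le_trans (f0 0) (fM 0); rewrite pmulr_lge0 ?expR_gt0.
apply: (@le_lt_trans _ _ (\int[leb n]_x (M%:E*(expR (- (a*dot x x)))%:E))%E).
 apply: ge0_le_integralT=> [| |x|x].
 - exact/mEFP.
 - by apply: measurable_funeM; apply/mEFP; exact: meas_expdot.
 - by rewrite lee_fin.
 - by rewrite -EFinM lee_fin.
rewrite ge0_integralZl//; last first.
 by apply/mEFP; exact: meas_expdot.
by rewrite int_gaussn// -EFinM ltry.
Qed.

Lemma gaussb_integrable n (f: 'rV[R]_n -> R): gaussb f -> (leb n).-integrable setT (EFin \o f).
move=> gf; have [mf f0 _]:=gf; apply/integrableP; split; first exact/mEFP.
under eq_integral do rewrite gee0_abs ?lee_fin//.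
exact: gaussb_lty.
Qed.

Lemma gaussb_fin n (f: 'rV[R]_n -> R): gaussb f -> (\int[leb n]_x (f x)%:E)%E \is a fin_num.
move=> gf; have [mf f0 _]:=gf; rewrite ge0_fin_numE ?gaussb_lty//.
by apply: integral_ge0=> x _; rewrite lee_fin.
Qed.

Lemma gaussb_le n (f g: 'rV[R]_n -> R): gaussb g -> mfunT f ->
 (forall x, 0<=f x) -> (forall x, f x<=g x) -> gaussb f.
move=> [_ g0 [M [a [a0 gM]]]] mf f0 fg; split=> //; exists M, a; split=> // x.
exact: le_trans (fg x) (gM x).
Qed.

Lemma gaussbZ n (f: 'rV[R]_n -> R) (k: R): 0<=k -> gaussb f -> gaussb (fun x=> k*f x).
move=> k0 [mf f0 [M [a [a0 fM]]]]; split.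
- exact: measurable_funM.
- by move=> x; rewrite mulr_ge0.
- by exists (k*M), a; split=> // x; rewrite -mulrA ler_wpM2l.
Qed.

Lemma gaussb_indic n (f: 'rV[R]_n -> R) (D: set 'rV[R]_n): measurable D -> gaussb f ->
 gaussb (fun x=> \1_D x*f x).
move=> mD gf; have [mf f0 _]:=gf; apply: (gaussb_le gf).
- by apply: measurable_funM=> //; exact: measurable_indic.
- by move=> x; rewrite mulr_ge0.
- by move=> x; rewrite indicE; case: (x \in D); rewrite ?mul1r// mul0r.
Qed.

Lemma gaussb_linear n (f: 'rV[R]_n -> R): gaussb f -> gaussb (fun x=> (1+enorm x)*f x).
move=> [mf f0 [M [a [a0 fM]]]]; split.
- apply: measurable_funM=> //; apply: measurable_funD=> //; exact: meas_enorm.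
- by move=> x; rewrite mulr_ge0// addr_ge0// enorm_ge0.
(* Half of the decay rate pays for 1 + u <= exp((2a)^-1 + a u^2 / 2). *)
exists (expR ((2*a)^-1)*M), (a/2); split; first by rewrite divr_gt0.
move=> x; have M0: 0<=M by have:=le_trans (f0 0) (fM 0); rewrite pmulr_lge0 ?expR_gt0.
apply: (le_trans (ler_wpM2l _ (fM x))); first by rewrite addr_ge0// enorm_ge0.
set u:=enorm x; have uD: u^+2 = dot x x:=enormE x.
have K: 1+u<=expR ((2*a)^-1+a/2*u^+2).
 apply: (le_trans (expR_ge1Dx _)); rewrite ler_expR. have: 0<=(2*a)^-1*(a*u-1)^+2.
  by rewrite mulr_ge0 ?sqr_ge0// invr_ge0 mulr_ge0// ltW. rewrite (_: _*_ = (2*a)^-1-u+a/2*u^+2); first lra.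
 by field; rewrite gt_eqF.
apply: (le_trans (ler_wpM2r _ K)); first by rewrite mulr_ge0// expR_ge0.
rewrite mulrCA -expRD [leRHS]mulrAC [leRHS]mulrC -expRD uD ler_wpM2l// ler_expR.
by eqle; field; rewrite gt_eqF.
Qed.

Lemma gaussb_exp n (f: 'rV[R]_n -> R) z: gaussb f -> gaussb (fun x=> f x*expR (2*dot x z)).
move=> [mf f0 [M [a [a0 fM]]]]; split.
- apply: measurable_funM=> //; apply: mcomp=> //.
 by apply: measurable_funM=> //; exact: meas_dot.
- by move=> x; rewrite mulr_ge0// expR_ge0.
exists (M*expR (2/a*dot z z)), (a/2); split; first by rewrite divr_gt0.
move=> x; have M0: 0<=M by have:=le_trans (f0 0) (fM 0); rewrite pmulr_lge0 ?expR_gt0.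
have K: 2*dot x z<=a/2*dot x x+2/a*dot z z.
 rewrite -subr_ge0 (_: _-_ = (2*a)^-1*dot (a*:x-2*:z) (a*:x-2*:z)).
  by rewrite mulr_ge0 ?dot_ge0// invr_ge0 mulr_ge0// ltW.
 by rewrite dotBl !dotBr !dotZl !dotZr (dotC z x); field; rewrite gt_eqF.
apply: (le_trans (ler_wpM2r (expR_ge0 _) (fM x))).
move: K; set t:=2/a*dot z z=> K.
by rewrite -[leLHS]mulrA -[leRHS]mulrA; apply: ler_wpM2l=> //; rewrite -!expRD ler_expR; lra.
Qed.

(** Quadratic coercivity up to an additive constant is enough to keep Gaussian decay; the affine
    shears below have it. *)
Lemma gaussb_comp n p (f: 'rV[R]_n -> R) (Phi: 'rV[R]_p -> 'rV[R]_n) (L C: R) : 0<L -> mfunT Phi ->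
 (forall x, dot x x<=L*dot (Phi x) (Phi x)+C) -> gaussb f -> gaussb (f \o Phi).
move=> L0 mPhi hL [mf f0 [M [a [a0 fM]]]]; split.
- exact: mcomp.
- by move=> x /=.
exists (M*expR (a/L*C)), (a/L); split; first by rewrite divr_gt0.
move=> x /=; have M0: 0<=M by have:=le_trans (f0 0) (fM 0); rewrite pmulr_lge0 ?expR_gt0.
apply: (le_trans (fM _)); rewrite -mulrA; apply: ler_wpM2l=> //.
rewrite -expRD ler_expR.
have K: 0<=a/L*(L*dot (Phi x) (Phi x)+C-dot x x).
 by rewrite mulr_ge0 ?subr_ge0// divr_ge0 ?ltW.
have E: a/L*(L*dot (Phi x) (Phi x)+C-dot x x) =
  a*dot (Phi x) (Phi x)+a/L*C-a/L*dot x x by field; rewrite gt_eqF.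
move: K; rewrite E; set t:=a/L*C; set t':=a/L*dot x x=> K; lra.
Qed.

Definition fibre n (f: 'rV[R]_n.+1 -> R) (y: 'rV[R]_n): R :=
 fine (\int[mu]_(s in `]0%R, +oo[) (f (consv s y))%:E)%E.

Lemma gaussb_slice n (f: 'rV[R]_n.+1 -> R): gaussb f ->
 exists M a: R, [/\ 0<a, 0<=M & forall s y, f (consv s y)<=M*expR (- (a*dot y y))*expR (- (a*s^+2))].
move=> [mf f0 [M [a [a0 fM]]]]; exists M, a; split=> //.
 by have:=le_trans (f0 0) (fM 0); rewrite pmulr_lge0 ?expR_gt0.
move=> s y; apply: le_trans (fM _) _; rewrite dot_consv -mulrA -expRD -expr2.
by rewrite mulrDr opprD addrC.
Qed.

Lemma meas_slice n (f: 'rV[R]_n.+1 -> R) y: mfunT f -> mfunT (fun s=> f (consv s y)).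
Proof. by move=> mf; apply: mcomp=> //; exact: meas_consv. Qed.

Lemma fibreE n (f: 'rV[R]_n.+1 -> R) y: gaussb f ->
 ((fibre f y)%:E = \int[mu]_(s in `]0%R, +oo[) (f (consv s y))%:E)%E.
move=> gf; have [M [a [a0 M0 fM]]]:=gaussb_slice gf; have [mf f0 _]:=gf.
rewrite fineK// ge0_fin_numE; last by apply: integral_ge0=> s _; rewrite lee_fin.
have mfs:=meas_slice y mf.
apply: (@le_lt_trans _ _ (\int[mu]_s (f (consv s y))%:E)%E).
 by apply: ge0_subset_integral=> //; [exact/mEFP|move=> s _; rewrite lee_fin].
apply: (@le_lt_trans _ _ (\int[mu]_s ((M*expR (- (a*dot y y)))%:E*(expR (- (a*s^+2)))%:E))%E).
 apply: ge0_le_integralT=> [| |x|x].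
 - exact/mEFP.
 - apply: measurable_funeM; apply/mEFP; apply: mcomp=> //; apply: measurable_funN.
  by apply: measurable_funM=> //; exact: measurable_funX.
 - by rewrite lee_fin.
 - by rewrite -EFinM lee_fin.
rewrite ge0_integralZl//; last 2 first.
- apply/mEFP; apply: mcomp=> //; apply: measurable_funN.
 by apply: measurable_funM=> //; exact: measurable_funX.
- by rewrite lee_fin mulr_ge0// expR_ge0.
by rewrite int_gauss1// -EFinM ltry.
Qed.

Lemma fibre_indic n (f: 'rV[R]_n.+1 -> R) y: gaussb f ->
 ((fibre f y)%:E = \int[mu]_s (\1_[set s | 0<s]%R s*f (consv s y))%:E)%E.
move=> gf; rewrite fibreE// integral_mkcond; apply: eq_integral=> s _.
rewrite patchE indicE; case: ifPn=> [|/negP].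
 by rewrite inE/= in_itv/= andbT=> s0; rewrite mem_set// mul1r.
by rewrite inE/= in_itv/= andbT=> s0; rewrite memNset// mul0r.
Qed.

Lemma meas_pos: measurable [set s: R | 0<s].
rewrite (_: [set _ | _] = `]0, +oo[%classic)//.
by seteq=> x /=; rewrite in_itv/= andbT.
Qed.

Lemma meas_pos_head n: measurable [set x: 'rV[R]_n.+1 | 0<headv x].
rewrite (_: [set _ | _] = @headv R n @^-1` [set s | 0<s])//.
by rewrite -measTI; apply: meas_headv=> //; exact: meas_pos.
Qed.

(* Tonelli for the half-space integral of [f x*h (tailv x)] *)
Lemma int_fibre n (f: 'rV[R]_n.+1 -> R) (h: 'rV[R]_n -> R): gaussb f -> mfunT h -> (forall y, 0<=h y) ->
 (\int[leb n]_y (fibre f y*h y)%:E = \int[leb n.+1]_x (\1_[set x | 0<headv x]%R x*f x*h (tailv x))%:E)%E.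
move=> gf mh h0; have [mf f0 _]:=gf.
rewrite int_lebS2; last 2 first.
- apply/mEFP; apply: measurable_funM.
  by apply: measurable_funM=> //; apply: measurable_indic; exact: meas_pos_head.
 by apply: mcomp=> //; exact: meas_tailv.
- by move=> x; rewrite lee_fin !mulr_ge0.
apply: eq_integral=> y _; rewrite EFinM fibre_indic//.
rewrite -ge0_integralZr//; last 3 first.
- apply/mEFP; apply: measurable_funM; last exact: meas_slice.
 by apply: measurable_indic; exact: meas_pos.
- by move=> s _; rewrite lee_fin mulr_ge0.
- by rewrite lee_fin.
apply: eq_integral=> s _; rewrite -EFinM tailv_cons; congr (_*_*_)%:E.
by rewrite !indicE; congr ((nat_of_bool _)%:R); apply/idP/idP; rewrite !inE/= headv_cons.
Qed.

Lemma gaussb_fibre n (f: 'rV[R]_n.+1 -> R): gaussb f -> gaussb (fibre f).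
move=> gf; have [M [a [a0 M0 fM]]]:=gaussb_slice gf; have [mf f0 _]:=gf.
have mfs y:=meas_slice y mf.
split.
- apply/mEFP.
 pose k (x: 'rV[R]_n.+1):=(\1_[set x: 'rV[R]_n.+1 | 0<headv x]%R x*f x)%:E. have mk: mfunT k.
  apply/mEFP; apply: measurable_funM=> //; apply: measurable_indic. exact: meas_pos_head.
 have k0 x: (0<=k x)%E by rewrite lee_fin mulr_ge0.
 rewrite (_: EFin \o _ = fun y=> \int[mu]_s k (consv s y))%E.
  exact: meas_leb_outer mk k0. apply/funext=> y /=; rewrite fibre_indic//; apply: eq_integral=> s _.
 congr (_*_)%:E. by rewrite !indicE; congr ((nat_of_bool _)%:R); apply/idP/idP; rewrite !inE/= headv_cons.
- by move=> y; rewrite fine_ge0//; apply: integral_ge0=> s _; rewrite lee_fin.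
exists (M*Num.sqrt (pi/a)), a; split=> // y.
have {}mfs:=mfs y.
rewrite -lee_fin fibreE//.
apply: (@le_trans _ _ (\int[mu]_s (f (consv s y))%:E)%E).
 by apply: ge0_subset_integral=> //; [exact/mEFP|move=> s _; rewrite lee_fin].
apply: (@le_trans _ _ (\int[mu]_s ((M*expR (- (a*dot y y)))%:E*(expR (- (a*s^+2)))%:E))%E).
 apply: ge0_le_integralT=> [| |x|x].
 - exact/mEFP.
 - apply: measurable_funeM; apply/mEFP; apply: mcomp=> //; apply: measurable_funN.
  by apply: measurable_funM=> //; exact: measurable_funX.
 - by rewrite lee_fin.
 - by rewrite -EFinM lee_fin.
rewrite ge0_integralZl//; last 2 first.
- apply/mEFP; apply: mcomp=> //; apply: measurable_funN.
 by apply: measurable_funM=> //; exact: measurable_funX.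
- by rewrite lee_fin mulr_ge0// expR_ge0.
by rewrite int_gauss1// -EFinM lee_fin [leLHS]mulrAC lexx.
Qed.

End GaussBounded.

(** * Functional Santalo inequality: induction on the dimension *)

Section HalfStep.
Context {R: realType}.
Local Notation mu := (@lebesgue_measure R).

Lemma int_lebesgue_sign (sg: R) (h: R -> \bar R): sg = 1 \/ sg = -1 -> mfunT h -> (forall s, 0<=h s)%E ->
 (\int[mu]_s h (sg*s)%R = \int[mu]_s h s)%E.
move=> [->|->] mh h0; first by under eq_integral do rewrite mul1r.
by under eq_integral do rewrite mulN1r; exact: int_lebesgueN.
Qed.

(** [shear_s] sends the first axis to the line through (m, zeta) in direction (1, c), with [sg] = 1
    or -1 selecting the side of the hyperplane headv = m. [shear_t] is dual to it: relative to (m,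
    zeta), the pairing of the images of (s, y) and (t, y') is again st + y.y'. *)
Definition shear_s n (sg m: R) (zeta c: 'rV[R]_n) (x: 'rV[R]_n.+1): 'rV[R]_n.+1 :=
 consv (m+sg*headv x) (zeta+tailv x+(sg*headv x)*:c).

Definition shear_t n (sg: R) (c: 'rV[R]_n) (x: 'rV[R]_n.+1): 'rV[R]_n.+1 :=
 consv (sg*headv x-dot c (tailv x)) (tailv x).

Lemma meas_shear_s n sg m (zeta c: 'rV[R]_n): mfunT (shear_s sg m zeta c).
have mh: mfunT (fun x: 'rV[R]_n.+1=> sg*headv x).
 by apply: measurable_funM=> //; exact: meas_headv.
apply: meas_consv; first exact: measurable_funD.
apply: meas_rVD; first by apply: meas_rVD=> //; exact: meas_tailv.
exact: meas_rVZ.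
Qed.

Lemma meas_shear_t n sg (c: 'rV[R]_n): mfunT (shear_t sg c).
have mh: mfunT (fun x: 'rV[R]_n.+1=> sg*headv x).
 by apply: measurable_funM=> //; exact: meas_headv.
apply: meas_consv; last exact: meas_tailv.
by apply: measurable_funB=> //; apply: meas_dot=> //; exact: meas_tailv.
Qed.

Lemma leb_shear_s n sg m (zeta c: 'rV[R]_n) (k: 'rV[R]_n.+1 -> \bar R) :
 sg = 1 \/ sg = -1 -> mfunT k -> (forall x, 0<=k x)%E ->
 (\int[leb n.+1]_x k (shear_s sg m zeta c x) = \int[leb n.+1]_x k x)%E.
move=> hsg mk k0.
rewrite !int_lebS1//; last exact: (mcomp mk (meas_shear_s _ _ _ _)).
pose K s:=(\int[leb n]_y k (consv s y))%E.
have mK: mfunT K by exact: meas_leb_inner.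
have K0 s: (0<=K s)%E by exact: integral_ge0.
transitivity (\int[mu]_s K (m+sg*s)%R)%E.
 apply: eq_integral=> s _.
 rewrite -[RHS](@leb_translate _ n (fun y=> k (consv (m+sg*s) y)) (zeta+(sg*s)*:c))//; last first.
  exact: meas_leb_fix. by apply: eq_integral=> y _; rewrite /shear_s headv_cons tailv_cons addrA (addrC y).
rewrite (@int_lebesgue_sign sg (fun s=> K (m+s)))//; last first.
 by apply: mcomp=> //; exact: measurable_funD.
under eq_integral do rewrite addrC.
exact: int_lebesgueD.
Qed.

Lemma leb_shear_t n sg (c: 'rV[R]_n) (k: 'rV[R]_n.+1 -> \bar R) :
 sg = 1 \/ sg = -1 -> mfunT k -> (forall x, 0<=k x)%E ->
 (\int[leb n.+1]_x k (shear_t sg c x) = \int[leb n.+1]_x k x)%E.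
move=> hsg mk k0.
rewrite !int_lebS2//; last exact: (mcomp mk (meas_shear_t _ _)).
apply: eq_integral=> y _.
have mky: mfunT (fun s=> k (consv s y)).
 by apply: mcomp=> //; exact: meas_consv.
transitivity (\int[mu]_s k (consv (sg*s-dot c y)%R y))%E.
 by apply: eq_integral=> s _; rewrite /shear_t headv_cons tailv_cons.
rewrite (@int_lebesgue_sign sg (fun s=> k (consv (s-dot c y) y)))//; last first.
 by apply: (mcomp mky); exact: measurable_funD.
exact: (@int_lebesgueD _ (- dot c y) (fun s=> k (consv s y))).
Qed.

Lemma gaussb_shear_s n sg m (zeta c: 'rV[R]_n) (f: 'rV[R]_n.+1 -> R) :
 sg = 1 \/ sg = -1 -> gaussb f -> gaussb (f \o shear_s sg m zeta c).
move=> hsg; have cc0:=dot_ge0 c.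
apply: (@gaussb_comp _ _ _ _ _ (3+6*dot c c) (2 * m^+2+3*dot zeta zeta+6 * m^+2*dot c c)).
- by rewrite ltr_wpDr// mulr_ge0.
- exact: meas_shear_s.
move=> x; rewrite /shear_s dot_consv dot_headtail.
set s:=headv x; set y:=tailv x; set q:=zeta+y+(sg*s)*:c; set p:=m+sg*s.
have Ep: p-m = sg*s by rewrite /p addrC addKr.
have -> : y = q-zeta-(p-m)*:c.
 by rewrite Ep /q (addrAC _ _ (- zeta)) (addrC zeta y) addrK addrK.
have -> : s*s = (p-m)*(p-m).
 by rewrite Ep; case: hsg=> ->; ring.
clear Ep.
clearbody p q; clear s y.
have h1:=dot_ge0 (q+zeta); have h2:=dot_ge0 (q+(p-m)*:c).
have h3:=dot_ge0 (zeta-(p-m)*:c).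
move: h1 h2 h3; rewrite !(dotDl, dotDr, dotBl, dotBr, dotNl, dotNr, dotZl, dotZr).
rewrite (dotC zeta q) (dotC c q) (dotC c zeta).
have: 0<=(p+m)^+2*(1+3*dot c c) by rewrite mulr_ge0 ?sqr_ge0// addr_ge0// mulr_ge0.
have:=sqr_ge0 p; have:=dot_ge0 q.
nra.
Qed.

Lemma gaussb_shear_t n sg (c: 'rV[R]_n) (g: 'rV[R]_n.+1 -> R) :
 sg = 1 \/ sg = -1 -> gaussb g -> gaussb (g \o shear_t sg c).
move=> hsg; have cc0:=dot_ge0 c.
apply: (@gaussb_comp _ _ _ _ _ (3+2*dot c c) 0).
- by rewrite ltr_wpDr// mulr_ge0.
- exact: meas_shear_t.
move=> x; rewrite /shear_t dot_consv dot_headtail.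
set s:=headv x; set y:=tailv x; set p:=sg*s-dot c y.
have -> : s*s = (p+dot c y)^+2.
 by rewrite /p subrK; case: hsg=> ->; ring.
have:=dot_sqr_le c y; have:=dot_ge0 y; have:=sqr_ge0 (p-dot c y).
have: 0<=dot c c * p^+2 by rewrite mulr_ge0 ?sqr_ge0.
nra.
Qed.

Definition halfsp n (sg: R) (c: 'rV[R]_n) (b: R): set 'rV[R]_n.+1 :=
 [set x | 0<sg*(headv x+dot c (tailv x)-b)].

Lemma meas_hyper n (c: 'rV[R]_n) (b: R) : mfunT (fun x: 'rV[R]_n.+1=> headv x+dot c (tailv x)-b).
apply: measurable_funB=> //; apply: measurable_funD; first exact: meas_headv.
by apply: meas_dot=> //; exact: meas_tailv.
Qed.

Lemma meas_halfsp n sg (c: 'rV[R]_n) b: measurable (halfsp sg c b).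
rewrite (_: halfsp sg c b = (fun x=> sg*(headv x+dot c (tailv x)-b)) @^-1` [set s | 0<s])//.
rewrite -measTI; apply: (_: mfunT _)=> //; last exact: meas_pos.
by apply: measurable_funM=> //; exact: meas_hyper.
Qed.

(** The condition in [w] stands for a barycentre at the origin. It follows from a vanishing first
    moment by convexity of exp ([gint_exp_ge]), and it is the form in which [santalo_functional]
    uses centring. *)
Definition santalo_bar (n: nat): Prop:=forall f g: 'rV[R]_n -> R, gaussb f -> gaussb g ->
 (forall w, \int[leb n]_x (f x)%:E <= \int[leb n]_x (f x*expR (2*dot x w))%:E)%E ->
 (forall x y, f x*g y<=expR (- (2*dot x y))) ->
 (\int[leb n]_x (f x)%:E * \int[leb n]_x (g x)%:E<=(pi^+n)%:E)%E.

(** After the dual shears, f and g on corresponding half-spaces are integrated along half-lines to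
    functions of n variables. The half-line inequality makes these satisfy the duality hypothesis
    with a factor pi/4, and the centring hypothesis says that the fibre integral of f is centred.
    The induction hypothesis then gives pi^n times pi/4. *)
Lemma half_step n (f g: 'rV[R]_n.+1 -> R) sg m (zeta c: 'rV[R]_n) :
 sg = 1 \/ sg = -1 -> gaussb f -> gaussb g -> santalo_bar n ->
 (forall x y, f (consv m zeta+x)*g y<=expR (- (2*dot x y))) ->
 (forall w, \int[leb n.+1]_x (\1_(halfsp sg 0 m) x*f x)%:E <= \int[leb n.+1]_x (\1_(halfsp sg 0 m) x*f x *
    expR (2*dot (tailv x-zeta-(headv x-m)*:c) w))%:E)%E -> (\int[leb n.+1]_x (\1_(halfsp sg 0 m) x*f x)%:E *
  \int[leb n.+1]_x (\1_(halfsp sg c 0) x*g x)%:E<=(pi^+n.+1/4)%:E)%E.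
move=> hsg gf gg Bn fg cen.
have sg2: sg*sg = 1 by case: hsg=> ->; ring.
pose f1:=f \o shear_s sg m zeta c; pose g1:=g \o shear_t sg c.
have gf1: gaussb f1 by exact: gaussb_shear_s.
have gg1: gaussb g1 by exact: gaussb_shear_t.
have [mf f0 _]:=gf; have [mg g0 _]:=gg.
have [mf1 f10 _]:=gf1; have [mg1 g10 _]:=gg1.
have gF:=gaussb_fibre gf1; have gG:=gaussb_fibre gg1.
have [mF F0 _]:=gF; have [mG G0 _]:=gG.
have pi0: 0<pi :> R by exact: pi_gt0.
(* For fixed y and y' the half-line inequality applies to the two slices, with exp(2 y.y') moved
   into the first factor. *)
have FG y y': fibre f1 y*fibre g1 y'<=pi/4*expR (- (2*dot y y')).
 have e0:=expR_gt0 (2*dot y y').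
 have:=@halfline_santalo R (fun s=> expR (2*dot y y')*f1 (consv s y)) (fun t=> g1 (consv t y')).
 have m1:=meas_slice y mf1; have m2:=meas_slice y' mg1.
 move=> /(_ (measurable_funM (measurable_cst _) m1) m2).
 move=> /(_ (fun s _=> mulr_ge0 (ltW e0) (f10 _)) (fun s _=> g10 _)).
 have -> : (\int[mu]_(s in `]0%R, +oo[) (expR (2*dot y y')*f1 (consv s y))%:E =
   (expR (2*dot y y'))%:E * \int[mu]_(s in `]0%R, +oo[) (f1 (consv s y))%:E)%E.
  by apply: (@ge0_integralZl_real _ _ _ mu _ _ (fun s=> f1 (consv s y)))=> //; exact: ltW.
 rewrite -!fibreE// -!EFinM lee_fin expRN=> h. rewrite ler_pdivlMr// mulrC mulrA; apply: h=> s t s0 t0.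
 rewrite -mulrA -ler_pdivlMl// -expRN -expRD.
 have -> : f1 (consv s y) = f (consv m zeta+consv (sg*s) (y+(sg*s)*:c)).
  by rewrite /f1/= /shear_s headv_cons tailv_cons consvD addrA.
 apply: le_trans (fg _ _) _; rewrite ler_expR /shear_t headv_cons tailv_cons dot_consv.
 rewrite dotDl dotZl le_eqVlt; apply/orP; left; apply/eqP.
 have -> : sg*s*(sg*t-dot c y') = s*t-sg*s*dot c y'.
  by rewrite mulrBr mulrACA sg2 mul1r. by ring.
have IF (h: 'rV[R]_n -> R): mfunT h -> (forall y, 0<=h y) ->
  (\int[leb n]_y (fibre f1 y*h y)%:E = \int[leb n.+1]_x (\1_(halfsp sg 0 m) x*f x *
    h (tailv x-zeta-(headv x-m)*:c))%:E)%E. move=> mh h0; rewrite int_fibre//.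
 rewrite -[RHS](@leb_shear_s n sg m zeta c)//; last 2 first.
 - apply/mEFP; apply: measurable_funM.
   by apply: measurable_funM=> //; apply: measurable_indic; exact: meas_halfsp.
  apply: mcomp=> //; apply: meas_rVB.
   by apply: meas_rVB=> //; exact: meas_tailv.
  apply: meas_rVZ=> //; apply: measurable_funB=> //; exact: meas_headv.
 - by move=> x; rewrite lee_fin !mulr_ge0.
 apply: eq_integral=> x _; congr (_*_*_)%:E.
  rewrite !indicE; congr ((nat_of_bool _)%:R); apply/idP/idP; rewrite !inE/= /halfsp/= /shear_s headv_cons dot0l addr0 (addrC m) addrK mulrA sg2 mul1r//.
 congr h; rewrite /shear_s headv_cons tailv_cons (addrC m) addrK.
 by rewrite (addrAC _ _ (- zeta)) addrK (addrC zeta) addrK.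
have IG: (\int[leb n]_y (fibre g1 y)%:E = \int[leb n.+1]_x (\1_(halfsp sg c 0) x*g x)%:E)%E.
 transitivity (\int[leb n]_y (fibre g1 y*1)%:E)%E.
  by apply: eq_integral=> y _; rewrite mulr1. rewrite (@int_fibre _ _ g1 (cst 1))//.
 rewrite -[RHS](@leb_shear_t n sg c)//; last 2 first.
 - apply/mEFP; apply: measurable_funM=> //; apply: measurable_indic; exact: meas_halfsp.
 - by move=> x; rewrite lee_fin mulr_ge0.
 apply: eq_integral=> x _; rewrite mulr1; congr (_*_)%:E.
 rewrite !indicE; congr ((nat_of_bool _)%:R); apply/idP/idP; rewrite !inE/= /halfsp/= /shear_t headv_cons tailv_cons subr0 subrK mulrA sg2 mul1r//.
have IF1: (\int[leb n]_y (fibre f1 y)%:E = \int[leb n.+1]_x (\1_(halfsp sg 0 m) x*f x)%:E)%E.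
 transitivity (\int[leb n]_y (fibre f1 y*1)%:E)%E.
  by apply: eq_integral=> y _; rewrite mulr1.
 by rewrite (@IF (cst 1))//; apply: eq_integral=> x _; rewrite mulr1.
rewrite -IG -IF1.
(* The factor 4/pi normalises the fibre bound to the constant 1 required by [santalo_bar]. *)
have k0: 0<4/pi :> R by rewrite divr_gt0.
have:=Bn (fun y=> 4/pi*fibre f1 y) (fibre g1) (gaussbZ (ltW k0) gF) gG.
have scal: (\int[leb n]_x (4/pi*fibre f1 x)%:E = (4/pi)%:E * \int[leb n]_x (fibre f1 x)%:E)%E.
 exact: (ge0_integralZl_real _ measurableT (ltW k0) mF F0).
have me w: mfunT (fun y: 'rV[R]_n=> expR (2*dot y w)).
 by apply: mcomp=> //; apply: measurable_funM=> //; exact: meas_dot.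
rewrite scal=> H.
have {}H: ((4/pi)%:E * \int[leb n]_x (fibre f1 x)%:E * \int[leb n]_x (fibre g1 x)%:E<=(pi^+n)%:E)%E.
 apply: H=> [w|x y]; last first.
  rewrite /= -[leLHS]mulrA. apply: le_trans (ler_wpM2l (ltW k0) (FG x y)) _.
  by rewrite mulrA -invf_div mulVf ?mul1r// gt_eqF// divr_gt0.
 have -> : (\int[leb n]_y (4/pi*fibre f1 y*expR (2*dot y w))%:E =
   (4/pi)%:E * \int[leb n]_y (fibre f1 y*expR (2*dot y w))%:E)%E.
  transitivity (\int[leb n]_y (4/pi*(fibre f1 y*expR (2*dot y w)))%:E)%E.
   by apply: eq_integral=> y _; rewrite -[X in X%:E]mulrA.
  apply: (@ge0_integralZl_real _ _ _ (leb n) _ _ (fun y=> fibre f1 y*expR (2*dot y w)))=> //.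
  - exact: ltW.
  - exact: measurable_funM.
  - by move=> y; rewrite mulr_ge0// expR_ge0.
 apply: lee_wpmul2l; first by rewrite lee_fin ltW. rewrite IF1 (IF _ (me w)); first exact: cen.
 by move=> y; exact: expR_ge0.
move: H; rewrite -muleA -lee_pdivlMl// => /le_trans; apply.
rewrite -EFinM lee_fin invf_div exprS.
by eqle; rewrite mulrAC.
Qed.

End HalfStep.

Section SantaloInduction.
Context {R: realType}.
Local Notation mu := (@lebesgue_measure R).

Definition gint n (f: 'rV[R]_n -> R): R:=fine (\int[leb n]_x (f x)%:E)%E.

Lemma gintE n (f: 'rV[R]_n -> R): gaussb f -> (\int[leb n]_x (f x)%:E = (gint f)%:E)%E.
Proof. by move=> gf; rewrite /gint fineK//; exact: gaussb_fin. Qed.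

Lemma gint_ge0 n (f: 'rV[R]_n -> R): gaussb f -> 0<=gint f.
Proof. by move=> [_ f0 _]; apply: fine_ge0; apply: integral_ge0=> x _; rewrite lee_fin. Qed.

Lemma gaussbD n (f g: 'rV[R]_n -> R): gaussb f -> gaussb g -> gaussb (fun x=> f x+g x).
move=> [mf f0 [M [a [a0 fM]]]] [mg g0 [N [b [b0 gN]]]]; split.
- exact: measurable_funD.
- by move=> x; rewrite addr_ge0.
have M0: 0<=M by have:=le_trans (f0 0) (fM 0); rewrite pmulr_lge0 ?expR_gt0.
have N0: 0<=N by have:=le_trans (g0 0) (gN 0); rewrite pmulr_lge0 ?expR_gt0.
exists (M+N), (Num.min a b); split; first by rewrite lt_min a0.
move=> x; rewrite mulrDl; apply: lerD.
 apply: le_trans (fM x) _; rewrite ler_wpM2l// ler_expR lerN2 ler_wpM2r ?dot_ge0//. by rewrite ge_min lexx.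
apply: le_trans (gN x) _; rewrite ler_wpM2l// ler_expR lerN2 ler_wpM2r ?dot_ge0//.
by rewrite ge_min lexx orbT.
Qed.

Lemma gintD n (f g: 'rV[R]_n -> R): gaussb f -> gaussb g -> gint (fun x=> f x+g x) = gint f+gint g.
move=> gf gg; have [mf f0 _]:=gf; have [mg g0 _]:=gg.
apply: EFin_inj; rewrite -(gintE (gaussbD gf gg)) EFinD -(gintE gf) -(gintE gg).
rewrite -ge0_integralD//.
- by move=> x _; rewrite lee_fin.
- exact/mEFP.
- by move=> x _; rewrite lee_fin.
- exact/mEFP.
Qed.

Lemma gintZ n (f: 'rV[R]_n -> R) k: 0<=k -> gaussb f -> gint (fun x=> k*f x) = k*gint f.
move=> k0 gf; have [mf f0 _]:=gf; apply: EFin_inj.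
by rewrite -(gintE (gaussbZ k0 gf)) EFinM -(gintE gf) ge0_integralZl_real.
Qed.

Lemma le_gint n (f g: 'rV[R]_n -> R): gaussb f -> gaussb g -> (forall x, f x<=g x) -> gint f<=gint g.
move=> gf gg fg; have [mf f0 _]:=gf; have [mg g0 _]:=gg.
rewrite -lee_fin -(gintE gf) -(gintE gg); apply: ge0_le_integralT=> [| |x|x].
- exact/mEFP.
- exact/mEFP.
- by rewrite lee_fin.
- by rewrite lee_fin.
Qed.

Lemma eq_gint n (f g: 'rV[R]_n -> R): f =1 g -> gint f = gint g.
Proof. by move=> fg; congr gint; exact/funext. Qed.

Definition hyper n (c: 'rV[R]_n) (b: R): set 'rV[R]_n.+1 := [set x | headv x+dot c (tailv x)-b = 0].

Lemma meas_hyper_set n (c: 'rV[R]_n) b: measurable (hyper c b).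
rewrite (_: hyper c b = (fun x=> headv x+dot c (tailv x)-b) @^-1` [set 0])//.
by rewrite -measTI; apply: meas_hyper.
Qed.

Lemma int_hyper n (c: 'rV[R]_n) b (f: 'rV[R]_n.+1 -> R): gaussb f ->
 gint (fun x=> \1_(hyper c b) x*f x) = 0.
move=> gf; have [mf f0 _]:=gf; rewrite /gint int_lebS2; last 2 first.
- apply/mEFP; apply: measurable_funM=> //; apply: measurable_indic.
 exact: meas_hyper_set.
- by move=> x; rewrite lee_fin mulr_ge0.
rewrite (_: (\int[leb n]_y _)%E = 0%E)//; apply: integral0_eq=> y _.
transitivity (\int[mu]_(s in [set (b-dot c y)%R]) (f (consv s y))%:E)%E; last exact: integral_set1.
rewrite [RHS]integral_mkcond; apply: eq_integral=> s _; rewrite patchE indicE.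
have -> : (consv s y \in hyper c b) = (s \in [set b-dot c y]).
 apply/idP/idP; rewrite !inE /hyper/= headv_cons tailv_cons=> h; lra.
by case: ifP; rewrite ?mul1r// mul0r.
Qed.

Lemma gint_split n (c: 'rV[R]_n) b (f: 'rV[R]_n.+1 -> R): gaussb f ->
 gint f = gint (fun x=> \1_(halfsp 1 c b) x*f x)+gint (fun x=> \1_(halfsp (-1) c b) x*f x).
move=> gf; have gi D: measurable D -> gaussb (fun x=> \1_D x*f x) by move=> ?; exact: gaussb_indic.
have g1:=gi _ (meas_halfsp 1 c b); have g2:=gi _ (meas_halfsp (-1) c b).
have g3:=gi _ (meas_hyper_set c b).
rewrite -(addr0 (gint _+_)) -(int_hyper c b gf) -!gintD//; last exact: gaussbD.
apply: eq_gint=> x; rewrite -!mulrDl -[LHS]mul1r; congr (_*_).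
rewrite !indicE; set u:=headv x+dot c (tailv x)-b.
have -> : (x \in halfsp 1 c b) = (0<u).
 by apply/idP/idP; rewrite inE /halfsp/= mul1r.
have -> : (x \in halfsp (-1) c b) = (u<0).
 by apply/idP/idP; rewrite inE /halfsp/= mulN1r oppr_gt0.
have -> : (x \in hyper c b) = (u == 0).
 by apply/idP/eqP; rewrite inE /hyper/=.
by case: ltgtP=> _; rewrite ?addr0 ?add0r.
Qed.

Definition slabh n (a b: R): set 'rV[R]_n.+1 := [set x | a<=headv x<=b].
Arguments slabh: clear implicits.

Lemma meas_slabh n a b: measurable (slabh n a b).
rewrite (_: slabh n a b = @headv R n @^-1` `[a, b]%classic).
 by rewrite -measTI; apply: meas_headv.
by seteq=> x /=; rewrite /slabh/= in_itv.
Qed.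

(** The mass of a slab is at most linear in its width. This gives continuity of the half-space mass
    and keeps the barycentres of the two halves apart. *)
Lemma gint_slabh n (f: 'rV[R]_n.+1 -> R): gaussb f -> exists2 B: R, 0<=B &
 forall a b, a<=b -> gint (fun x=> \1_(slabh n a b) x*f x)<=B*(b-a).
move=> gf; have [M [e [e0 M0 fM]]]:=gaussb_slice gf; have [mf f0 _]:=gf.
have B0: 0<=M*Num.sqrt (pi/e)^+n by rewrite mulr_ge0// exprn_ge0// sqrtr_ge0.
exists (M*Num.sqrt (pi/e)^+n)=> // a b ab.
have gi: gaussb (fun x=> \1_(slabh n a b) x*f x) by apply: gaussb_indic=> //; exact: meas_slabh.
have [mi i0 _]:=gi.
rewrite -lee_fin -gintE// int_lebS1//; last exact/mEFP.
apply: (@le_trans _ _ (\int[mu]_s ((M*Num.sqrt (pi/e)^+n) * \1_(`[a, b]%classic) s)%:E)%E).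
 apply: ge0_le_integralT=> [| |s|s].
 - apply: (@meas_leb_inner _ n (fun x=> (\1_(slabh n a b) x*f x)%:E))=> //; exact/mEFP.
 - by apply/mEFP; apply: measurable_funM=> //; exact: measurable_indic.
 - by apply: integral_ge0=> y _; rewrite lee_fin.
 apply: (@le_trans _ _ (\int[leb n]_y ((M * \1_(`[a, b]%classic) s)*expR (- (e*dot y y)))%:E)%E).
  apply: ge0_le_integralT=> [| |y|y].
  - by apply: (@meas_leb_fix _ n (fun x=> (\1_(slabh n a b) x*f x)%:E)); exact/mEFP.
  - by apply/mEFP; apply: measurable_funM=> //; exact: meas_expdot.
  - by rewrite lee_fin.
  rewrite lee_fin !indicE. have -> : (consv s y \in slabh n a b) = (s \in `[a, b]%classic).
   by apply/idP/idP; rewrite !inE /slabh/= headv_cons in_itv.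
  case: (s \in _); rewrite ?mul0r ?mulr0 ?mul0r// mul1r mulr1.
  apply: le_trans (fM s y) _; rewrite ler_piMr ?mulr_ge0 ?expR_ge0// -expR0 ler_expR oppr_le0.
  by rewrite mulr_ge0 ?sqr_ge0// ltW.
 rewrite (@ge0_integralZl_real _ _ _ (leb n) _ _ (fun y=> expR (- (e*dot y y))))//.
 - by rewrite int_gaussn// -EFinM lee_fin mulrAC.
 - by rewrite mulr_ge0.
 - exact: meas_expdot.
rewrite (@ge0_integralZl_real _ _ _ mu _ _ (\1_(`[a, b]%classic)))// integral_indic// setIT.
have E: lebesgue_measure [set` `[a, b]] = (b-a)%:E.
 rewrite lebesgue_measure_itv/= lte_fin -EFinB; case: ltP=> // ba.
 by congr EFin; apply/eqP; rewrite eq_sym subr_eq0 eq_le ba.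
by rewrite [X in (_*X<=_)%E](_: _ = (b-a)%:E)// -EFinM.
Qed.

Definition absh n (f: 'rV[R]_n.+1 -> R): 'rV[R]_n.+1 -> R:=fun x=> `|headv x| * f x.

Lemma gaussb_absh n (f: 'rV[R]_n.+1 -> R): gaussb f -> gaussb (absh f).
move=> gf; have [mf f0 _]:=gf; apply: (gaussb_le (gaussb_linear gf)).
- apply: measurable_funM=> //; apply: mcomp=> //; exact: meas_headv.
- by move=> x; rewrite mulr_ge0.
move=> x; rewrite /absh ler_wpM2r//; apply: (le_trans (coord_le_enorm x ord0)).
by rewrite lerDr.
Qed.

(** Intermediate value theorem for the mass of {headv > t}, which is Lipschitz in t by the slab
    bound; the endpoints come from Markov's inequality. *)
Lemma exists_median n (f: 'rV[R]_n.+1 -> R): gaussb f -> 0<gint f ->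
 exists m, gint (fun x=> \1_(halfsp 1 0 m) x*f x) = gint f/2.
move=> gf I0; have [mf f0 _]:=gf.
have [B B0 hB]:=gint_slabh gf.
pose A t:=gint (fun x=> \1_(halfsp 1 (0: 'rV[R]_n) t) x*f x).
have gi D: measurable D -> gaussb (fun x=> \1_D x*f x) by move=> ?; exact: gaussb_indic.
have gA t:=gi _ (meas_halfsp 1 (0: 'rV[R]_n) t).
have gA' t:=gi _ (meas_halfsp (-1) (0: 'rV[R]_n) t).
have inA t x: (x \in halfsp 1 (0: 'rV[R]_n) t) = (t<headv x).
 by apply/idP/idP; rewrite inE /halfsp/= mul1r dot0l addr0 subr_gt0.
have inA' t x: (x \in halfsp (-1) (0: 'rV[R]_n) t) = (headv x<t).
 by apply/idP/idP; rewrite inE /halfsp/= mulN1r dot0l addr0 oppr_gt0 subr_lt0.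
have mono t t': t<=t' -> A t'<=A t.
 move=> tt; apply: le_gint=> // x; rewrite ler_wpM2r// !indicE !inA ler_nat.
 by case: (ltP t' (headv x))=> // h; rewrite (le_lt_trans tt h).
have lip t t': t<=t' -> A t<=A t'+B*(t'-t).
 move=> tt; apply: le_trans (lerD (lexx _) (hB _ _ tt)). have gs:=gi _ (@meas_slabh n t t').
 rewrite -gintD//; apply: le_gint=> //; first exact: gaussbD.
 move=> x; rewrite -mulrDl ler_wpM2r// !indicE !inA -natrD ler_nat.
 case: (ltP t (headv x))=> // h; case: (ltP t' (headv x))=> // h'. by rewrite mem_set// /slabh/= (ltW h).
have cA: continuous A.
 move=> t; apply/cvgrPdist_le=> e e0. have B1: 0<B+1 by rewrite ltr_wpDl. near=> s. have: `|t-s| <= e/(B+1).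
  near: s; apply/nbhs_ballP; exists (e/(B+1)); first by rewrite /= divr_gt0. by move=> s /= /ltW.
 move=> hs; have {}hs: (B+1) * `|t-s| <= e by rewrite mulrC -ler_pdivlMr. have [ts|ts]:=leP t s.
  have h1:=lip _ _ ts; have h2:=mono _ _ ts. rewrite [leLHS]ger0_norm ?subr_ge0//; apply: le_trans hs.
  by rewrite ler0_norm ?subr_le0//; lra. have h1:=lip _ _ (ltW ts); have h2:=mono _ _ (ltW ts).
 rewrite [leLHS]ler0_norm ?subr_le0//; apply: le_trans hs. by rewrite gtr0_norm ?subr_gt0//; lra.
pose K:=gint (absh f); have K0: 0<=K by apply: gint_ge0; exact: gaussb_absh.
(* The mass beyond height N, on either side, is at most K/N, hence at most half of the total. *)
pose N:=2*K/gint f+1.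
have N0: 0<N by rewrite ltr_wpDl// divr_ge0 ?mulr_ge0// ltW.
have KN: K<=N*(gint f/2).
 have -> : N*(gint f/2) = K+gint f/2 by rewrite /N; field; rewrite gt_eqF. by rewrite lerDl divr_ge0// ltW.
have AN: A N<=gint f/2.
 rewrite -(ler_pM2l N0); apply: le_trans KN; rewrite -gintZ//; last exact: ltW.
 apply: le_gint=> //; [exact: gaussbZ (ltW N0) (gA N)|exact: gaussb_absh|].
 move=> x; rewrite /absh mulrA ler_wpM2r// indicE inA; case: ltP=> h; rewrite ?mulr0// mulr1.
 exact: le_trans (ltW h) (ler_norm _).
have AmN: gint f/2<=A (- N).
 rewrite (gint_split (0: 'rV[R]_n) (- N) gf) -/(A (- N)). set A1:=gint _; suff: A1<=gint f/2.
  have:=gint_split (0: 'rV[R]_n) (- N) gf; rewrite -/(A (- N)) -/A1; lra.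
 rewrite -(ler_pM2l N0); apply: le_trans KN; rewrite -gintZ//; last exact: ltW.
 apply: le_gint=> //; [exact: gaussbZ (ltW N0) (gA' (- N))|exact: gaussb_absh|].
 move=> x; rewrite /absh mulrA ler_wpM2r// indicE inA'; case: ltP=> h; rewrite ?mulr0// mulr1.
 by rewrite -[`|_|]normrN; apply: le_trans (ler_norm _); rewrite lerNr ltW.
have NN: - N<=N by lra.
have [|m _ Am]:=@IVT R A (- N) N (gint f/2) NN (continuous_subspaceT cA).
 by rewrite ge_min AN orbT le_max AmN.
by exists m.
Unshelve. all: by end_near.
Qed.

Definition moment n (f: 'rV[R]_n -> R): 'rV[R]_n := \row_i \int[leb n]_x (f x*x 0 i).

Lemma integrable_coord n (f: 'rV[R]_n -> R) i: gaussb f ->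
 (leb n).-integrable setT (EFin \o (fun x=> f x*x 0 i)).
move=> gf; have [mf f0 _]:=gf.
apply: (@le_integrable _ _ _ (leb n) setT measurableT _ (EFin \o (fun x=> (1+enorm x)*f x))).
- apply/mEFP; apply: measurable_funM=> //; exact: meas_coord.
- move=> x _ /=; rewrite lee_fin normrM (ger0_norm (f0 x)) mulrC [leRHS]ger0_norm.
  by rewrite ler_wpM2r//; apply: (le_trans (coord_le_enorm x i)); rewrite lerDr.
 by rewrite mulr_ge0// addr_ge0// enorm_ge0.
- by apply: gaussb_integrable; exact: gaussb_linear.
Qed.

Lemma moment_dot n (f: 'rV[R]_n -> R) w: gaussb f ->
 (leb n).-integrable setT (EFin \o (fun x=> f x*dot x w)) /\ \int[leb n]_x (f x*dot x w) = dot (moment f) w.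
move=> gf; rewrite /dot.
have ic i: (leb n).-integrable setT (EFin \o (fun x: 'rV[R]_n=> f x*x 0 i*w 0 i)).
 rewrite (_: EFin \o _ = (fun x=> ((EFin \o (fun x=> f x*x 0 i)%R) x*(w 0%R i)%:E)%E)).
  by apply: integrableZr=> //; exact: integrable_coord. by apply/funext=> x /=; rewrite EFinM.
elim: (index_enum _)=> [|i s [IH1 IH2]].
 split.
  rewrite (_: _ \o _ = cst 0%E); first exact: integrable0. by apply/funext=> x /=; rewrite big_nil mulr0.
 rewrite big_nil (_: (fun x=> _) = cst 0); first by rewrite Rintegral_cst// mul0r.
 by apply/funext=> x; rewrite big_nil mulr0.
have E: (fun x: 'rV[R]_n=> f x * \sum_(j <- i :: s) x 0 j*w 0 j) =
 (fun x=> f x*x 0 i*w 0 i+f x * \sum_(j <- s) x 0 j*w 0 j).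
 by apply/funext=> x; rewrite big_cons mulrDr mulrA.
rewrite E; split.
 rewrite (_: _ \o _ = (EFin \o (fun x=> f x*x 0%R i*w 0%R i)%R) \+
   (EFin \o (fun x=> f x * \sum_(j <- s) x 0%R j*w 0%R j)%R))%E//. exact: integrableD.
rewrite (RintegralD measurableT (ic i) IH1).
by rewrite IH2 big_cons mxE RintegralZr//; exact: integrable_coord.
Qed.

(** Integrate exp(2(x.v + k)) >= 1 + 2(x.v + k); the linear term has integral 0. *)
Lemma gint_exp_ge n (f: 'rV[R]_n -> R) v k: gaussb f -> dot (moment f) v+gint f*k = 0 ->
 gint f<=gint (fun x=> f x*expR (2*(dot x v+k))).
move=> gf h; have [mf f0 _]:=gf.
have ge: gaussb (fun x=> f x*expR (2*(dot x v+k))).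
 have:=gaussbZ (expR_ge0 (2*k)) (gaussb_exp v gf).
 congr gaussb; apply/funext=> x; rewrite mulrCA -expRD; congr (_*expR _); ring.
have [i1 E1]:=moment_dot v gf.
have i0:=gaussb_integrable gf.
have i2: (leb n).-integrable setT (EFin \o (fun x=> (1+2*k)*f x)).
 rewrite (_: EFin \o _ = (fun x=> ((1+2*k)%:E*(EFin \o f) x)%E)).
  exact: integrableZl. by apply/funext=> x /=; rewrite EFinM.
have i3: (leb n).-integrable setT (EFin \o (fun x=> 2*(f x*dot x v))).
 rewrite (_: EFin \o _ = (fun x=> (2%:E*(EFin \o (fun x=> f x*dot x v)%R) x)%E)).
  exact: integrableZl. by apply/funext=> x /=; rewrite EFinM.
have -> : gint f = \int[leb n]_x ((1+2*k)*f x+2*(f x*dot x v)).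
 rewrite RintegralD// RintegralZl// RintegralZl// E1. rewrite -[\int[leb n]_x f x]/(gint f); move: h; lra.
rewrite -[gint _]/(\int[leb n]_x (f x*expR (2*(dot x v+k)))).
apply: le_Rintegral=> //.
- rewrite (_: _ \o _ = (EFin \o (fun x=> (1+2*k)*f x)%R) \+ (EFin \o (fun x=> 2*(f x*dot x v))%R))%E//.
 exact: integrableD.
- exact: gaussb_integrable.
move=> x _; have:=ler_wpM2l (f0 x) (expR_ge1Dx (2*(dot x v+k))).
by apply: le_trans; eqle; ring.
Qed.

Lemma gint_affine n (f: 'rV[R]_n -> R) v k: gaussb f -> (forall x, 0<=f x*(dot x v+k)) ->
 gaussb (fun x=> f x*(dot x v+k)) /\ gint (fun x=> f x*(dot x v+k)) = dot (moment f) v+k*gint f.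
move=> gf h; have [mf f0 _]:=gf; split.
 apply: (gaussb_le (gaussbD (gaussbZ (enorm_ge0 v) (gaussb_linear gf)) (gaussbZ (normr_ge0 k) gf)))=> //.
  apply: measurable_funM=> //; apply: measurable_funD=> //; exact: meas_dot.
 move=> x; rewrite mulrA -mulrDl mulrC ler_wpM2r//; apply: lerD; last exact: ler_norm.
 apply: le_trans (dot_le_enorm x v) _; rewrite mulrC ler_wpM2l ?enorm_ge0// lerDr//.
have [i1 E1]:=moment_dot v gf; have i0:=gaussb_integrable gf.
rewrite -[LHS]/(\int[leb n]_x (f x*(dot x v+k))).
have -> : \int[leb n]_x (f x*(dot x v+k)) = \int[leb n]_x (f x*dot x v+k*f x).
 by apply: eq_Rintegral=> x _; rewrite mulrDr (mulrC k).
rewrite RintegralD// ?E1 ?RintegralZl//.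
rewrite (_: EFin \o _ = (fun x=> (k%:E*(EFin \o f) x)%E)); first exact: integrableZl.
by apply/funext=> x /=; rewrite EFinM.
Qed.

(** The two halves have equal mass, so the difference of the two first moments is the integral of
    |headv - m| f. It is positive because not all the mass lies in a thin slab around the
    hyperplane. *)
Lemma barycentre_gap n (f: 'rV[R]_n.+1 -> R) m: gaussb f -> 0<gint f ->
 gint (fun x=> \1_(halfsp 1 0 m) x*f x) = gint f/2 -> headv (moment (fun x=> \1_(halfsp (-1) 0 m) x*f x)) <
 headv (moment (fun x=> \1_(halfsp 1 0 m) x*f x)).
move=> gf I0 Ep; have [mf f0 _]:=gf.
have gi D: measurable D -> gaussb (fun x=> \1_D x*f x) by move=> ?; exact: gaussb_indic.
have gp:=gi _ (meas_halfsp 1 (0: 'rV[R]_n) m).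
have gm:=gi _ (meas_halfsp (-1) (0: 'rV[R]_n) m).
have Em:=gint_split (0: 'rV[R]_n) m gf.
set fp:=fun x=> _ in gp Ep Em *; set fm:=fun x=> _ in gm Em *.
have {}Em: gint fm = gint f/2 by lra.
have inp x: fp x = (m<headv x)%R%:R*f x.
 rewrite /fp indicE; congr ((nat_of_bool _)%:R*_).
 by apply/idP/idP; rewrite inE /halfsp/= mul1r dot0l addr0 subr_gt0.
have inm x: fm x = (headv x<m)%R%:R*f x.
 rewrite /fm indicE; congr ((nat_of_bool _)%:R*_).
 by apply/idP/idP; rewrite inE /halfsp/= mulN1r dot0l addr0 oppr_gt0 subr_lt0.
have [B B0 hB]:=gint_slabh gf.
(* With this half-width the slab around m carries less than half of the mass. *)
pose e:=gint f/(4*(B+1)).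
have B1: 0<4*(B+1) by rewrite mulr_gt0// ltr_wpDl.
have e0: 0<e by rewrite divr_gt0.
have Ee: e*(4*(B+1)) = gint f by rewrite /e mulfVK// gt_eqF.
have gs:=gi _ (@meas_slabh n (m-e) (m+e)).
have dh (x: 'rV[R]_n.+1) s: dot x (consv s 0) = headv x*s.
 by rewrite dot_headtail headv_cons tailv_cons dot0r addr0.
have [|gqp Eqp]:=@gint_affine _ fp (consv 1 0) (- m) gp.
 move=> x; rewrite dh mulr1 inp; case: ltP=> h; rewrite ?mul0r// mul1r. by rewrite mulr_ge0// subr_ge0 ltW.
have [|gqm Eqm]:=@gint_affine _ fm (consv (-1) 0) m gm.
 move=> x; rewrite dh mulrN1 inm; case: ltP=> h; rewrite ?mul0r// mul1r.
 by rewrite mulr_ge0// addrC subr_ge0 ltW.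
have le1: e*gint f<=gint (fun x=> fp x*(dot x (consv 1 0)-m)) +
  gint (fun x=> fm x*(dot x (consv (-1) 0)+m))+e*gint (fun x=> \1_(slabh n (m-e) (m+e)) x*f x).
 have ge0:=ltW e0. have gd:=gaussbD gqp gqm; have gz:=gaussbZ ge0 gs; have gzf:=gaussbZ ge0 gf.
 rewrite -(gintZ ge0 gf) -(gintZ ge0 gs) -(gintD gqp gqm) -(gintD gd gz).
 apply: (le_gint gzf (gaussbD gd gz)). move=> x; rewrite !dh mulr1 mulrN1 inp inm indicE.
 have -> : (x \in slabh n (m-e) (m+e)) = (m-e<=headv x<=m+e).
  by apply/idP/idP; rewrite inE. have fx:=f0 x; have eF: 0<=e*f x by rewrite mulr_ge0.
 set a:=headv x; set F:=f x in fx eF *. have [h1|h1]:=leP (m+e) a.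
  have p: 0<=F*(a-m-e) by rewrite mulr_ge0//; lra.
  rewrite (_: (m<a) = true) 1?(_: (a<m) = false); [|lra|lra].
  by case: (_ && _); rewrite mul1r !mul0r ?mul1r; lra. have [h2|h2]:=leP a (m-e).
  have p: 0<=F*(m-e-a) by rewrite mulr_ge0//; lra.
  rewrite (_: (m<a) = false) 1?(_: (a<m) = true); [|lra|lra].
  by case: (_ && _); rewrite mul1r !mul0r ?mul1r; lra. rewrite (ltW h2) (ltW h1)/= mul1r.
 case: (ltgtP m a)=> h; rewrite ?mul0r ?mul0r ?mul1r ?add0r ?addr0 ?lerDr//; apply: mulr_ge0=> //; lra.
have s1:=hB (m-e) (m+e).
move: le1 s1; rewrite Eqp Eqm !dh Ep Em mulr1 mulrN1=> le1 s1.
have {}s1:=s1 ltac:(lra).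
have h1:=ler_wpM2l (ltW e0) s1.
have h2: 0<e*(e*(2*B+4)).
 by apply: mulr_gt0=> //; apply: mulr_gt0=> //; rewrite ltr_wpDl// mulr_ge0.
move: le1 Ee h1 h2; clear; set P:=headv _; set M:=headv _; clearbody P M e.
move: (gint f) (gint (fun x=> \1_(slabh n _ _) x*f x))=> I S /[swap] <- le1 h1 h2.
lra.
Qed.

(** The hyperplane headv = m halves the mass of f, and by [barycentre_gap] the line through the
    barycentres of the halves crosses it, at z = (m, zeta) with direction (1, c). [half_step] on
    either side bounds half of the mass of f times the mass of g on a half-space by pi^(n+1)/4; the
    two bounds add up. The point z depends on f alone. *)
Lemma santalo_center n (f: 'rV[R]_n.+1 -> R): @santalo_bar R n -> gaussb f ->
 exists z, forall g, gaussb g -> (forall x y, f (z+x)*g y<=expR (- (2*dot x y))) -> gint f*gint g<=pi^+n.+1.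
move=> Bn gf; have [mf f0 _]:=gf.
have [I0|I0]:=eqVneq (gint f) 0.
 by exists 0=> g _ _; rewrite I0 mul0r exprn_ge0// pi_ge0.
have {}I0: 0<gint f by rewrite lt_neqAle eq_sym I0 gint_ge0.
have [m Em]:=exists_median gf I0.
have gap:=barycentre_gap gf I0 Em.
have gi D: measurable D -> gaussb (fun x=> \1_D x*f x) by move=> ?; exact: gaussb_indic.
have gp:=gi _ (meas_halfsp 1 (0: 'rV[R]_n) m).
have gm:=gi _ (meas_halfsp (-1) (0: 'rV[R]_n) m).
have Em':=gint_split (0: 'rV[R]_n) m gf.
set A:=gint f/2 in Em; have A0: 0<A by rewrite divr_gt0.
set fp:=fun x=> _ in gp Em Em' gap; set fm:=fun x=> _ in gm Em' gap.
have {}Em': gint fm = A by rewrite /A; move: Em'; rewrite Em /A; lra.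
pose bp:=A^-1*:moment fp; pose bm:=A^-1*:moment fm.
have hZ a (x: 'rV[R]_n.+1): headv (a*:x) = a*headv x by rewrite /headv mxE.
pose s:=headv bp-headv bm.
have s0: 0<s by rewrite /s /bp /bm !hZ -mulrBr mulr_gt0 ?invr_gt0// subr_gt0.
pose c:=s^-1*:(tailv bp-tailv bm).
pose zeta:=tailv bp-(headv bp-m)*:c.
have sc: tailv bp-tailv bm = s*:c by rewrite /c scalerA mulfV ?gt_eqF// scale1r.
have zm: zeta = tailv bm-(headv bm-m)*:c.
 rewrite /zeta -[tailv bp](subrK (tailv bm)) sc /s -addrA addrCA -scalerBl.
 by congr (_+_); rewrite -scaleNr; congr (_*:_); ring.
have zp: zeta = tailv bp-(headv bp-m)*:c by [].
clearbody zeta.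
exists (consv m zeta)=> g gg fg.
(* The barycentre of each half lies on the line (m, zeta) + R(1, c), so the affine form in the
   exponent has integral 0 against that half. *)
have cen fs b: gaussb fs -> gint fs = A -> moment fs = A*:b -> zeta = tailv b-(headv b-m)*:c -> forall w,
  (\int[leb n.+1]_x (fs x)%:E <= \int[leb n.+1]_x (fs x*expR (2*dot (tailv x-zeta-(headv x-m)*:c) w))%:E)%E.
 move=> gs Es Ms Ez w. pose v:=consv (- dot c w) w; pose k := - dot zeta w+m*dot c w.
 have E x: dot (tailv x-zeta-(headv x-m)*:c) w = dot x v+k.
  by rewrite dot_headtail /v headv_cons tailv_cons !dotBl dotZl /k; ring. have:=@gint_exp_ge _ fs v k gs.
 have -> : dot (moment fs) v+gint fs*k = 0.
  by rewrite Ms Es dotZl -mulrDr -E Ez (_: _-_-_ = 0) ?dot0l ?mulr0//; rewrite opprB addrCA subrr addr0 subrr.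
 move=> /(_ erefl); rewrite (gintE gs). have ge: gaussb (fun x=> fs x*expR (2*(dot x v+k))).
  have:=gaussbZ (expR_ge0 (2*k)) (gaussb_exp v gs).
  congr gaussb; apply/funext=> x; rewrite mulrCA -expRD; congr (_*expR _); ring.
 rewrite -lee_fin -(gintE ge)=> /le_trans; apply. by eqle; apply: eq_integral=> x _; rewrite E.
have Mb fs: moment fs = A*:(A^-1*:moment fs) by rewrite scalerA mulfV ?scale1r// gt_eqF.
have gj D: measurable D -> gaussb (fun x=> \1_D x*g x) by move=> ?; exact: gaussb_indic.
have g1:=gj _ (meas_halfsp 1 c 0); have g2:=gj _ (meas_halfsp (-1) c 0).
have h1:=@half_step R n f g 1 m zeta c (or_introl erefl) gf gg Bn fg (cen _ _ gp Em (Mb _ _) zp).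
have h2:=@half_step R n f g (-1) m zeta c (or_intror erefl) gf gg Bn fg (cen _ _ gm Em' (Mb _ _) zm).
move: h1 h2; rewrite (gintE gp) (gintE gm) (gintE g1) (gintE g2) -!EFinM !lee_fin Em Em'.
rewrite (gint_split c 0 gg).
have -> : gint f = 2*A by rewrite /A; field.
lra.
Qed.

(** The centre z is taken for g. Translating g by z is dual to multiplying f by exp(2 x.z), which by
    hypothesis does not decrease the integral of f. *)
Theorem santalo_functional n: santalo_bar (R:=R) n.
elim: n=> [|n IH] f g gf gg cen fg.
 have [mf _ _]:=gf; have [mg _ _]:=gg. rewrite !int_leb0; [|exact/mEFP|exact/mEFP].
 by rewrite expr0 -EFinM lee_fin; apply: le_trans (fg _ _) _; rewrite dot0l mulr0 oppr0 expR0.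
have [z hz]:=santalo_center IH gg.
have gf':=gaussb_exp z gf.
have:=hz _ gf'; rewrite (gintE gg).
move=> H; apply: le_trans (lee_wpmul2r _ (cen z)) _.
 by rewrite lee_fin gint_ge0.
rewrite (gintE gf') -EFinM lee_fin mulrC; apply: H=> x y.
have:=fg y (z+x); rewrite dotDr mulrDr opprD expRD=> h.
rewrite mulrA -ler_pdivlMr ?expR_gt0// -expRN mulrC.
by apply: le_trans h _; rewrite mulrC (dotC x).
Qed.

End SantaloInduction.

(** * Gauges, polar bodies and the Blaschke-Santalo inequality *)

Section Bodies.
Context {R: realType}.
Local Notation mu := (@lebesgue_measure R).

Lemma cont_dotr n (x: 'rV[R]_n): continuous (dot x).
have cadd: continuous (fun z: R*R=> z.1+z.2) by exact: add_continuous.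
have:=@continuous_big R 'I_n +%R 0 xpredT cadd 'rV[R]_n (index_enum _) (fun i z=> x 0 i*z 0 i).
by apply=> i _ y; apply: continuousM; [exact: cst_continuous|exact: coord_continuous].
Qed.

Lemma closed_dot_le n (x: 'rV[R]_n) a: closed [set y | dot x y<=a].
by apply: (@closed_comp _ _ (dot x) [set s | s<=a])=> [y _|]; [exact: cont_dotr|exact: closed_le].
Qed.

Lemma closed_dot_ge n (x: 'rV[R]_n) a: closed [set y | a<=dot x y].
by apply: (@closed_comp _ _ (dot x) [set s | a<=s])=> [y _|]; [exact: cont_dotr|exact: closed_ge].
Qed.

(** A radial Gaussian moment, kept as an extended real. It cancels against the same quantity for the
    Euclidean unit ball. *)
Definition radial_const (q: nat): \bar R :=
 (\int[mu]_s (\1_[set s | (0<s)%R] s*(2*s*expR (- s^+2))*s^+q)%:E)%E.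

Lemma int_gauss_tail (a: R): 0<=a ->
 (\int[mu]_s (\1_[set s | (0<s)%R && (a<=s)%R] s*(2*s*expR (- s^+2)))%:E = (expR (- a^+2))%:E)%E.
move=> a0.
have cE: continuous (fun s: R=> 2*s*expR (- s^+2)).
 move=> s; apply: cvgM; first by apply: cvgM; [exact: cvg_cst|exact: cvg_id].
 by apply: continuous_comp; [apply: cvgN; exact: exprn_continuous|exact: continuous_expR].
have dF (s: R): is_derive s 1 (fun s=> - expR (- s^+2)) (2*s*expR (- s^+2)).
 by apply: is_derive_eq; rewrite /GRing.scale/= ; ring.
transitivity (\int[mu]_(s in `[a, +oo[) (2*s*expR (- s^+2))%:E)%E.
 rewrite [RHS]integral_mkcond; apply: eq_integral=> s _; rewrite patchE indicE.
 rewrite (_: (s \in [set s | _]) = (0<s) && (a<=s)); last by apply/idP/idP; rewrite inE.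
 rewrite (_: (s \in `[a, +oo[%classic) = (a<=s)); last first.
  by apply/idP/idP; rewrite inE/= in_itv/= andbT. case: (leP a s)=> h; rewrite ?andbF ?mul0r// andbT.
 have:=le_trans a0 h; rewrite le_eqVlt=> /predU1P[<-|->]; last by rewrite mul1r.
 by rewrite ltxx mul0r mulr0 mul0r.
rewrite (@ge0_continuous_FTC2y _ _ (fun s=> - expR (- s^+2)) a 0).
- by rewrite sub0e EFinN oppeK.
- by move=> s /(le_trans a0) s0; rewrite !mulr_ge0// expR_ge0.
- exact: continuous_subspaceT.
- rewrite -oppr0; apply: cvgN.
 apply/cvgrPdist_le=> e e0; near=> s. rewrite sub0r normrN ger0_norm ?expR_ge0//.
 have s1: 1<=s by near: s; exact: nbhs_pinfty_ge.
 have s2: e^-1<=s by near: s; exact: (nbhs_pinfty_ge (num_real _)).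
 rewrite expRN invf_ple ?posrE ?expR_gt0//. apply: le_trans s2 _; apply: le_trans (expR_ge1Dx _).
 by rewrite expr2; nra.
- by move=> s _; have []:=dF s.
- apply: cvg_at_right_filter; apply: cvgN.
 by apply: continuous_comp; [apply: cvgN; exact: exprn_continuous|exact: continuous_expR].
- by move=> s _; rewrite derive1E; have [_ ->]:=dF s.
Unshelve. all: by end_near.
Qed.

(** Layer cake: exp(-N^2) is the integral of 2s exp(-s^2) over s >= N. Exchanging integrals and
    scaling {N <= s} to {N <= 1} leaves a radial factor. *)
Lemma int_homogeneous n (N w: 'rV[R]_n -> R) p : mfunT N -> (forall x, 0<=N x) ->
 (forall s x, 0<s -> N (s*:x) = s*N x) -> mfunT w -> (forall x, 0<=w x) ->
 (forall s x, 0<s -> w (s*:x) = s^+p*w x) -> (\int[leb n]_x (w x*expR (- N x^+2))%:E =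
  radial_const (n+p) * \int[leb n]_(x in [set x | (N x<=1)%R]) (w x)%:E)%E.
move=> mN N0 Nh mw w0 wh.
pose D := [set z: 'rV[R]_n.+1 | (0<headv z) && (N (tailv z)<=headv z)].
pose k (s: R):=2*s*expR (- s^+2).
have mk: mfunT k.
 apply: measurable_funM; first by apply: measurable_funM.
 by apply: mcomp=> //; apply: measurable_funN; exact: measurable_funX.
have mN1: measurable [set x | N x<=1].
 rewrite (_: [set x | N x<=1] = N @^-1` `]-oo, 1]%classic).
  by rewrite -measTI; exact: mN. by seteq=> x /=; rewrite in_itv.
have mD: measurable D.
 rewrite (_: D = (fun z=> (0<headv z) && (N (tailv z)<=headv z)) @^-1` [set true]).
  rewrite -measTI; apply: (_: mfunT _)=> //.
  apply: measurable_and; first by apply: measurable_fun_ltr=> //; exact: meas_headv.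
  apply: measurable_fun_ler; last exact: meas_headv. by apply: mcomp=> //; exact: meas_tailv. by seteq=> z.
pose phi (z: 'rV[R]_n.+1) := \1_D z*k (headv z)*w (tailv z).
have mphi: mfunT (EFin \o phi).
 apply/mEFP; apply: measurable_funM.
  by apply: measurable_funM=> //; apply: mcomp=> //; exact: meas_headv.
 by apply: mcomp=> //; exact: meas_tailv.
have D0 z: D z -> 0<=k (headv z).
 by move=> /andP[/ltW h _]; rewrite !mulr_ge0// expR_ge0.
have phi0 z: (0<=(EFin \o phi) z)%E.
 rewrite /= lee_fin /phi indicE; have [/set_mem h|_]:=boolP (z \in D); last by rewrite !mul0r.
 by rewrite mul1r mulr_ge0// D0.
have inD s x: (consv s x \in D) = (0<s) && (N x<=s).
 by apply/idP/idP; rewrite inE /D/= headv_cons tailv_cons.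
transitivity (\int[leb n.+1]_z (phi z)%:E)%E.
 rewrite (int_lebS2 mphi phi0); apply: eq_integral=> x _.
 transitivity ((w x)%:E * \int[mu]_s (\1_[set s | (0<s)%R && (N x<=s)%R] s*k s)%:E)%E.
  by rewrite int_gauss_tail. rewrite -ge0_integralZl//.
 - apply: eq_integral=> s _; rewrite -EFinM; congr EFin.
  rewrite /phi headv_cons tailv_cons mulrC !indicE inD.
  by rewrite (_: (s \in [set s | _]) = (0<s) && (N x<=s))//; apply/idP/idP; rewrite inE.
 - apply/mEFP; apply: measurable_funM=> //; apply: measurable_indic.
  rewrite (_: [set s | _] = `]0, +oo[ `&` `[N x, +oo[)%classic; first exact: measurableI.
  seteq=> s /=; rewrite !in_itv/= !andbT; first by move=> /andP[]. by move=> [-> ->].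
 - move=> s _; rewrite lee_fin indicE; have [/set_mem/= /andP[/ltW h _]|_]:=boolP (s \in _).
   by rewrite mul1r !mulr_ge0// expR_ge0. by rewrite mul0r.
 - by rewrite lee_fin.
rewrite (int_lebS1 mphi phi0).
have I0: (0 <= \int[leb n]_(x in [set x | (N x<=1)%R]) (w x)%:E)%E.
 by apply: integral_ge0=> x _; rewrite lee_fin.
rewrite /radial_const -ge0_integralZr//; last 2 first.
- apply/mEFP; apply: measurable_funM; last exact: measurable_funX.
 by apply: measurable_funM=> //; apply: measurable_indic; exact: meas_pos.
- move=> s _; rewrite lee_fin indicE; have [/set_mem/= /ltW h|_]:=boolP (s \in _).
  by rewrite mul1r mulr_ge0 ?exprn_ge0// !mulr_ge0// expR_ge0. by rewrite !mul0r.
apply: eq_integral=> s _; rewrite indicE.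
have [/set_mem/= s0|/negP s0]:=boolP (s \in [set s | 0<s]); last first.
 rewrite !mul0r mul0e; apply: integral0_eq=> x _. rewrite /= /phi indicE inD (_: (0<s) = false) ?mul0r//.
 by apply/negP=> h; apply: s0; rewrite inE.
rewrite mul1r.
pose h (x: 'rV[R]_n):=((k s*w x) * \1_[set x | N x<=s] x)%:E.
have mNs: measurable [set x | N x<=s].
 rewrite (_: [set x | N x<=s] = N @^-1` `]-oo, s]%classic).
  by rewrite -measTI; exact: mN. by seteq=> x /=; rewrite in_itv.
have ks0: 0<=k s by rewrite !mulr_ge0 ?expR_ge0// ltW.
transitivity (\int[leb n]_x h x)%E.
 apply: eq_integral=> x _; rewrite /h /= /phi headv_cons tailv_cons !indicE inD s0/=.
 have -> : (x \in [set x0 | N x0<=s]) = (N x<=s) by apply/idP/idP; rewrite inE.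
 by case: (N x<=s); rewrite ?mul1r ?mulr1 ?mul0r ?mulr0 ?mul0r.
rewrite -(@leb_scale _ n s h)//; last 2 first.
- apply/mEFP; apply: measurable_funM=> //; exact: measurable_funM.
- by move=> x; rewrite /h lee_fin mulr_ge0// mulr_ge0.
rewrite [X in (_*X = _)%E](_: _ = ((k s*s^+p)%:E * \int[leb n]_(x in [set x | (N x<=1)%R]) (w x)%:E)%E).
 by rewrite muleA -EFinM exprD; congr (_%:E*_)%E; rewrite mulrCA mulrC -!mulrA.
rewrite [in RHS]integral_mkcond -ge0_integralZl//.
- apply: eq_integral=> x _; rewrite patchE /h wh// mulrA indicE.
 rewrite (_: (s*:x \in [set x | N x<=s]) = (x \in [set x | N x<=1])).
  by case: ifP=> _; rewrite ?mulr1 ?mulr0 ?mule0// EFinM. apply/idP/idP; rewrite !inE/= Nh// ger_pMr//.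
- by apply/(measurable_restrictT _ mN1); apply: measurable_funTS; exact/mEFP.
- by move=> x _; rewrite patchE; case: ifP=> _ //; rewrite lee_fin.
- by rewrite lee_fin mulr_ge0// exprn_ge0// ltW.
Qed.

Definition starbody n (X: set 'rV[R]_n): Prop := [/\ closed X, forall x t, X x -> 0<=t<=1 -> X (t*:x),
   exists2 r, 0<r & forall x, enorm x<=r -> X x & exists rho, forall x, X x -> enorm x<=rho].

Definition gauge n (X: set 'rV[R]_n) (x: 'rV[R]_n): R := inf [set s | 0<s /\ X (s^-1*:x)].

Section gauge.
Variables (n: nat) (X: set 'rV[R]_n).
Hypothesis bX: starbody X.

Lemma gauge_nonempty x: [set s | 0<s /\ X (s^-1*:x)] !=set0.
have [_ _ [r r0 hr] _]:=bX; exists ((enorm x+1)/r)=> /=.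
have e1: 0<enorm x+1 by rewrite ltr_wpDl// enorm_ge0.
split; first by rewrite divr_gt0.
apply: hr; rewrite enormZ invf_div ger0_norm; last by rewrite divr_ge0// ltW.
by rewrite mulrAC ler_pdivrMr// ler_wpM2l ?(ltW r0)// lerDl.
Qed.

Lemma gauge_ge0 x: 0<=gauge X x.
Proof. by apply: lb_le_inf; [exact: gauge_nonempty|move=> s /= [/ltW]]. Qed.

Lemma gauge_le s x: 0<s -> (gauge X x<=s) = `[< X (s^-1*:x) >].
move=> s0; have [cX st _ _]:=bX; apply/idP/asboolP=> [h|h]; last first.
 by apply: ge_inf=> //; exists 0=> t /= [/ltW].
apply: (@closed_cvg R _ (s^'+) _ (fun t: R=> t^-1*:x) X cX _ (s^-1*:x)); last first.
 apply: cvgZr_tmp; apply: cvg_at_right_filter; apply: cvgV; first by rewrite gt_eqF. exact: cvg_id.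
near=> t; have st': s<t by [].
have [e [e0 Xe] et]:=inf_lt (gauge_nonempty x) (le_lt_trans h st').
have t0:=lt_trans s0 st'.
rewrite (_: t^-1*:x = (e/t)*:(e^-1*:x)).
 apply: st=> //; bsplit; first by rewrite divr_ge0// ltW. by rewrite ler_pdivrMr// mul1r ltW.
by rewrite scalerA mulrAC mulfV ?mul1r// gt_eqF.
Unshelve. all: by end_near.
Qed.

Lemma gaugeZ s x: 0<s -> gauge X (s*:x) = s*gauge X x.
have key t y: 0<t -> gauge X (t*:y)<=t*gauge X y.
 move=> t0; apply/ler_addgt0Pl=> e e0. have h: 0<gauge X y+e/t by rewrite ltr_wpDl ?gauge_ge0// divr_gt0.
 have p: 0<e+t*gauge X y by rewrite ltr_pwDl// mulr_ge0 ?gauge_ge0// ltW. rewrite gauge_le//; apply/asboolP.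
 have: gauge X y<=gauge X y+e/t by rewrite lerDl divr_ge0// ltW.
 rewrite gauge_le// => /asboolP; congr X; rewrite scalerA; congr (_*:_). by field; rewrite !gt_eqF// addrC.
move=> s0; apply/eqP; rewrite eq_le key//=.
have:=key s^-1 (s*:x); rewrite invr_gt0 scalerA mulVf ?gt_eqF// scale1r=> /(_ s0).
by rewrite mulrC ler_pdivlMr// mulrC.
Qed.

Lemma gauge_enorm rho x: (forall x, X x -> enorm x<=rho) -> enorm x<=rho*gauge X x.
move=> hr; have [_ _ [r r0 hr'] _]:=bX.
have rho0: 0<=rho by apply: le_trans (hr 0 _); rewrite ?enorm0//; apply: hr'; rewrite enorm0 ltW.
apply/ler_addgt0Pl=> e e0.
have h: 0<gauge X x+e/(rho+1).
 by rewrite ltr_wpDl ?gauge_ge0// divr_gt0// ltr_wpDl.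
have: gauge X x<=gauge X x+e/(rho+1) by rewrite lerDl divr_ge0 ?addr_ge0// ltW.
rewrite gauge_le// => /asboolP/hr; rewrite enormZ gtr0_norm ?invr_gt0//.
rewrite ler_pdivrMl// mulrDl=> /le_trans; apply; rewrite addrC (mulrC rho) lerD2r.
by rewrite mulrAC ler_pdivrMr ?ltr_wpDl// ler_wpM2l ?(ltW e0)// lerDl.
Qed.

Lemma meas_gauge: mfunT (gauge X).
have [cX _ _ _]:=bX.
have mle s: measurable [set x | gauge X x<=s].
 have pos t: 0<t -> measurable [set x | gauge X x<=t].
  move=> t0; rewrite (_: [set x | _] = (fun x=> t^-1*:x) @^-1` X).
   rewrite -measTI; apply: meas_rVZ=> //. exact: measV_closed.
  by seteq=> x /=; rewrite gauge_le// => /asboolP. have [s0|s0]:=ltP 0 s; first exact: pos.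
 have [->|s1]:=eqVneq s 0; last first.
  rewrite (_: [set x | _] = set0)//; seteq=> x //=.
  move=> /(le_trans (gauge_ge0 x)); rewrite leNgt lt_neqAle s1 s0//.
 rewrite (_: [set x | _] = \bigcap_k [set x | gauge X x<=k.+1%:R^-1]).
  by apply: bigcapT_measurable=> k; apply: pos; rewrite invr_gt0. seteq=> x /=.
  by move=> h k _ /=; rewrite (le_trans h)// invr_ge0. move=> h; apply/ler_addgt0Pr=> e e0; rewrite add0r.
 have [k _ hk]:=near_infty_natSinv_lt (PosNum e0). by apply: le_trans (h k I) _; apply: ltW; apply: hk=> /=.
apply: (measurability _ (RGenOInfty.measurableE R)).
move=> _ [_ [s ->] <-]; rewrite setTI.
rewrite (_: _ @^-1` _ = ~` [set x | gauge X x<=s]); first exact: measurableC.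
by seteq=> x /=; rewrite in_itv/= andbT ltNge=> /negP.
Qed.

Lemma gauge1: [set x | gauge X x<=1] = X.
by seteq=> x /=; rewrite gauge_le// invr1 scale1r=> /asboolP.
Qed.

Lemma starbody_rho: exists2 rho, 0<rho & forall x, X x -> enorm x<=rho.
have [_ _ _ [rho hr]]:=bX; exists (`|rho| + 1); first by rewrite ltr_wpDl.
by move=> x /hr h; rewrite (le_trans h)// (le_trans (ler_norm _))// lerDl.
Qed.

Lemma gaussb_gauge: gaussb (fun x=> expR (- gauge X x^+2)).
have [rho r0 hr]:=starbody_rho; split.
- apply: mcomp=> //; apply: measurable_funN; apply: measurable_funX.
 exact: meas_gauge.
- by move=> x; exact: expR_ge0.
exists 1, (rho^-2); split; first by rewrite invr_gt0 exprn_gt0.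
move=> x; rewrite mul1r ler_expR lerN2 -enormE -exprVn -exprMn.
rewrite ler_pXn2r ?nnegrE ?gauge_ge0//; last by rewrite mulr_ge0 ?enorm_ge0// invr_ge0 ltW.
by rewrite ler_pdivrMl//; exact: gauge_enorm.
Qed.

Lemma int_gauge (w: 'rV[R]_n -> R) p : mfunT w -> (forall x, 0<=w x) ->
 (forall s x, 0<s -> w (s*:x) = s^+p*w x) -> (\int[leb n]_x (w x*expR (- gauge X x^+2))%:E =
  radial_const (n+p) * \int[leb n]_(x in X) (w x)%:E)%E.
move=> mw w0 wh; rewrite (int_homogeneous meas_gauge gauge_ge0 _ mw w0 wh) ?gauge1//.
by move=> s x; exact: gaugeZ.
Qed.

End gauge.

Definition polar n (X: set 'rV[R]_n): set 'rV[R]_n := [set y | forall x, X x -> dot x y<=1].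

Lemma starbody_polar n (X: set 'rV[R]_n): starbody X -> starbody (polar X).
move=> bX; have [_ _ [r r0 hr] _]:=bX; have [rho p0 hp]:=starbody_rho bX; split.
- rewrite (_: polar X = \bigcap_(x in X) [set y | dot x y<=1]).
  by apply: closed_bigI=> x _; exact: closed_dot_le. by seteq=> y /= h x Xx; exact: h.
- move=> y t h /andP[t0 t1] x Xx; rewrite dotZr.
 have [d0|d0]:=leP (dot x y) 0; first by rewrite (le_trans (mulr_ge0_le0 t0 d0)).
 by rewrite (le_trans (ler_piMl (ltW d0) t1))// h.
- exists rho^-1; first by rewrite invr_gt0.
 move=> y hy x Xx; apply: le_trans (dot_le_enorm _ _) _.
 by apply: le_trans (ler_pM (enorm_ge0 _) (enorm_ge0 _) (hp _ Xx) hy) _; rewrite mulfV// gt_eqF.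
exists r^-1=> y hy; have [->|y0]:=eqVneq y 0; first by rewrite enorm0 invr_ge0 ltW.
have e0: 0<enorm y by rewrite enorm_gt0.
have:=hy ((r/enorm y)*:y); rewrite dotZl -enormE expr2 mulrA mulfVK ?gt_eqF//.
rewrite -ler_pdivlMl// mulr1; apply; apply: hr.
by rewrite enormZ gtr0_norm ?divr_gt0// mulfVK// gt_eqF.
Qed.

Lemma dot_gauge n (X: set 'rV[R]_n) x y: starbody X -> dot x y<=gauge X x*gauge (polar X) y.
move=> bX; have bP:=starbody_polar bX.
have z0 (Y: set 'rV[R]_n) u: starbody Y -> gauge Y u = 0 -> u = 0.
 move=> bY g0; have [rho _ /(gauge_enorm bY u)]:=starbody_rho bY.
 by rewrite g0 mulr0=> h; apply/eqP; rewrite -enorm_eq0 eq_le h enorm_ge0.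
have [/(z0 _ _ bX) ->|gx]:=eqVneq (gauge X x) 0.
 by rewrite dot0l mulr_ge0// gauge_ge0.
have [/(z0 _ _ bP) ->|gy]:=eqVneq (gauge (polar X) y) 0.
 by rewrite dot0r mulr_ge0// gauge_ge0.
have {}gx: 0<gauge X x by rewrite lt_neqAle eq_sym gx gauge_ge0.
have {}gy: 0<gauge (polar X) y by rewrite lt_neqAle eq_sym gy gauge_ge0.
have /asboolP hx: `[< X ((gauge X x)^-1*:x) >] by rewrite -gauge_le.
have /asboolP hy: `[< polar X ((gauge (polar X) y)^-1*:y) >] by rewrite -gauge_le.
have:=hy _ hx; rewrite dotZl dotZr ler_pdivrMl// mulr1 ler_pdivrMl// mulrC.
by rewrite mulrC.
Qed.

Lemma meas_maxcoord n (i: 'I_n) (s: R) : mfunT (fun x: 'rV[R]_n=> Num.max (s*x 0 i) 0).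
apply: measurable_maxr=> //; apply: measurable_funM=> //; exact: meas_coord.
Qed.

(** The positive and negative parts of a coordinate are homogeneous of degree 1, so their integrals
    against exp(-gauge^2) are the same multiple of their integrals over X. A balanced X therefore
    gives a vanishing first moment. *)
Lemma moment_gauge n (X: set 'rV[R]_n): starbody X ->
 (forall i, \int[leb n]_(x in X) (Num.max (1*x 0%R i) 0)%:E =
       \int[leb n]_(x in X) (Num.max (-1*x 0%R i) 0)%:E)%E -> moment (fun x=> expR (- gauge X x^+2)) = 0.
move=> bX cX; have gX:=gaussb_gauge bX; have [mf f0 _]:=gX.
apply/rowP=> i; rewrite !mxE /Rintegral.
have ii:=integrable_coord i gX.
have hom s (r: R) (x: 'rV[R]_n): 0<r -> Num.max (s*(r*:x) 0 i) 0 = r^+1*Num.max (s*x 0 i) 0.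
 by move=> r0; rewrite expr1 maxr_pMr ?(ltW r0)// mulr0 mxE mulrCA.
have hp s:=@int_gauge _ _ bX _ 1 (meas_maxcoord i s) (fun x=> ltac:(by rewrite le_max lexx orbT)) (hom s).
set F:=fun x: 'rV[R]_n=> _ in ii *.
have Ep: (\int[leb n]_x (EFin \o F)^\+ x = \int[leb n]_x (Num.max (1*x 0%R i) 0*expR (- gauge X x^+2))%:E)%E.
 apply: eq_integral=> x _; rewrite funeposE /= /F -EFin_max; congr EFin.
 by rewrite mul1r [RHS]mulrC maxr_pMr ?expR_ge0// mulr0.
have En: (\int[leb n]_x (EFin \o F)^\- x = \int[leb n]_x (Num.max (-1*x 0%R i) 0*expR (- gauge X x^+2))%:E)%E.
 apply: eq_integral=> x _; rewrite funenegE /= /F -EFin_max; congr EFin.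
 by rewrite mulN1r [RHS]mulrC maxr_pMr ?expR_ge0// mulr0 mulrN.
have:=integrable_fin_num measurableT ii.
rewrite integralE; rewrite [X in (X-_)%E]Ep [X in (_-X)%E]En !hp cX.
by move=> h; rewrite subee//; move: h; case: (_*_)%E.
Qed.

(** The functional inequality for exp(-gauge^2) of X and of its polar: with p and q the two gauges,
    exp(-p^2 - q^2) <= exp(-2pq) <= exp(-2 x.y). The bound pi^n is the square of the same integral
    for the Euclidean norm. *)
Theorem blaschke_santalo n (X: set 'rV[R]_n): starbody X ->
 (forall i, \int[leb n]_(x in X) (Num.max (1*x 0%R i) 0)%:E =
       \int[leb n]_(x in X) (Num.max (-1*x 0%R i) 0)%:E)%E ->
 (leb n X * leb n (polar X)<=leb n [set x | (enorm x<=1)%R] * leb n [set x | (enorm x<=1)%R])%E.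
move=> bX cX; have bP:=starbody_polar bX.
have gX:=gaussb_gauge bX; have gP:=gaussb_gauge bP.
have one Y: measurable Y -> (\int[leb n]_(x in Y) (cst (1: R) x)%:E = leb n Y)%E.
 by move=> mY; rewrite -[LHS]/(\int[leb n]_(x in Y) cst 1%:E x)%E integral_cst// mul1e.
have vol Y: starbody Y -> (\int[leb n]_x (expR (- gauge Y x^+2))%:E = radial_const n * leb n Y)%E.
 move=> bY; have [cY _ _ _]:=bY. transitivity (\int[leb n]_x (cst 1 x*expR (- gauge Y x^+2))%:E)%E.
  by apply: eq_integral=> x _; rewrite /= mul1r. rewrite -one; last exact: measV_closed.
 rewrite -[X in radial_const X]addn0; apply: int_gauge=> //. by move=> s x _; rewrite expr0 mul1r.
have volB: ((Num.sqrt pi^+n)%:E = radial_const n * leb n [set x | (enorm x<=1)%R])%E.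
 transitivity (\int[leb n]_x (cst (1: R) x*expR (- enorm x^+2))%:E)%E.
  rewrite -[pi]divr1 -int_gaussn//. by apply: eq_integral=> x _; rewrite /= mul1r mul1r enormE.
 rewrite -one; last first.
  rewrite (_: mkset _ = (@enorm R n) @^-1` `]-oo, 1]%classic).
   by rewrite -measTI; apply: meas_enorm. by seteq=> x /=; rewrite in_itv.
 rewrite -[X in radial_const X]addn0; apply: int_homogeneous=> //.
 - exact: meas_enorm.
 - by move=> x; exact: enorm_ge0.
 - by move=> s x s0; rewrite enormZ gtr0_norm.
 - by move=> s x _; rewrite expr0 mul1r.
have p0: 0<Num.sqrt pi^+n :> R by rewrite exprn_gt0// sqrtr_gt0 pi_gt0.
have c0: (0<=radial_const n)%E.
 apply: integral_ge0=> s _; rewrite lee_fin indicE; have [/set_mem/= /ltW h|_]:=boolP (s \in _).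
  by rewrite mul1r mulr_ge0 ?exprn_ge0// !mulr_ge0// expR_ge0. by rewrite !mul0r.
have:=@santalo_functional R n _ _ gX gP.
rewrite (vol _ bX) (vol _ bP)=> H.
have {}H: (radial_const n * leb n X*(radial_const n * leb n (polar X))<=(pi^+n)%:E)%E.
 apply: H=> [w|x y]; last first.
  rewrite -expRD ler_expR; have:=dot_gauge x y bX. have:=sqr_ge0 (gauge X x-gauge (polar X) y); nra.
 have:=@gint_exp_ge _ n _ w 0 gX; rewrite mulr0 addr0 moment_gauge// dot0l=> /(_ erefl).
 rewrite -lee_fin -(gintE gX).
 rewrite (_: (fun x=> _) = (fun x=> expR (- gauge X x^+2)*expR (2*dot x w))); last first.
  by apply/funext=> x; rewrite addr0. by rewrite -(gintE (gaussb_exp w gX)) -(vol _ bX).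
have {}H: (radial_const n * leb n X*(radial_const n * leb n (polar X)) <=
 radial_const n * leb n [set x | (enorm x<=1)%R]*(radial_const n * leb n [set x | (enorm x<=1)%R]))%E.
 by rewrite -volB -EFinM -expr2 -exprM mulnC exprM sqr_sqrtr ?pi_ge0.
(* The product of [radial_const n] with the volume of the unit ball is a positive real, so the
   constant is neither 0 nor infinite and cancels. *)
move: volB c0 H; case: (radial_const n)=> [c| |] //.
- rewrite lee_fin le_eqVlt=> hc /predU1P[c00|c1] H.
  by move: hc; rewrite -c00 mul0e=> -[] h; move: p0; rewrite h ltxx.
 move: H; rewrite muleACA [leRHS]muleACA -EFinM lee_pmul2l// lte_fin. exact: mulr_gt0.
- move=> h _ _; exfalso; move: h.
 have: (0<=leb n [set x: 'rV[R]_n | (enorm x<=1)%R])%E by []. rewrite le_eqVlt=> /predU1P[<-|l0].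
  by rewrite mule0=> -[] h; move: p0; rewrite h ltxx. by rewrite gt0_mulye.
Qed.

End Bodies.

(** * Orthonormal frames, oblique projections and bi-Lipschitz comparison *)

Section Frames.
Context {R: realType}.
Local Notation mu := (@lebesgue_measure R).

Lemma dot_mx n (x y: 'rV[R]_n): dot x y = (x *m y^T) 0 0.
Proof. by rewrite mxE /dot; apply: eq_bigr=> i _; rewrite mxE. Qed.

Lemma dot_mulmx n p (x: 'rV[R]_n) (M: 'M[R]_(n, p)) y: dot (x *m M) y = dot x (y *m M^T).
Proof. by rewrite !dot_mx trmx_mul trmxK mulmxA. Qed.

(** The columns of [T] form an orthonormal basis of the hyperplane orthogonal to the unit vector
    [u]; [x *m T] are the coordinates of the projection of x. *)
Definition splits n (u: 'rV[R]_n.+1) (T: 'M[R]_(n.+1, n)): Prop :=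
 [/\ dot u u = 1, u *m T = 0 & T^T *m T = 1%:M].

Lemma splits_id n (u: 'rV[R]_n.+1) T: splits u T -> T *m T^T = 1%:M-u^T *m u.
move=> [uu uT TT]; pose M: 'M[R]_(1+n, n.+1):=col_mx u T^T.
have E: M *m M^T = 1%:M.
 rewrite /M tr_col_mx trmxK mul_col_row uT TT -[T^T *m u^T]trmx_mul uT trmx0.
 rewrite scalar_mx_block; congr block_mx. by apply/matrixP=> i j; rewrite !ord1 -dot_mx uu mxE.
have:=mulmx1C E; rewrite /M tr_col_mx trmxK mul_row_col=> <-.
by rewrite addrC addKr.
Qed.

Lemma splitsE n (u: 'rV[R]_n.+1) T x: splits u T -> x = dot x u*:u+(x *m T) *m T^T.
move=> sT; rewrite -mulmxA (splits_id sT) mulmxBr mulmx1 mulmxA.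
rewrite [x *m u^T](_: _ = (dot x u)%:M); last first.
 by apply/matrixP=> i j; rewrite !ord1 -dot_mx mxE.
by rewrite mul_scalar_mx addrC subrK.
Qed.

Lemma splits_dot n (u: 'rV[R]_n.+1) T x y: splits u T -> dot x y = dot x u*dot y u+dot (x *m T) (y *m T).
move=> sT; rewrite {1}(splitsE x sT) dotDl dotZl (dotC u); congr (_+_).
by rewrite dot_mulmx trmxK.
Qed.

Lemma splits_perp n (u: 'rV[R]_n.+1) T (y: 'rV[R]_n): splits u T -> dot (y *m T^T) u = 0.
Proof. by move=> [_ uT _]; rewrite dot_mulmx trmxK uT dot0r. Qed.

Lemma splits_tr n (u: 'rV[R]_n.+1) T (y: 'rV[R]_n): splits u T -> (y *m T^T) *m T = y.
Proof. by move=> [_ _ TT]; rewrite -mulmxA TT mulmx1. Qed.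

(** The Householder reflection that exchanges u and the first basis vector, with its first column
    removed. If u is that vector, then v = 0 and the reflection degenerates to the identity. *)
Lemma splits_exists n (u: 'rV[R]_n.+1): dot u u = 1 -> exists T, splits u T.
move=> uu; pose e: 'rV[R]_n.+1:=consv 1 0.
have ee: dot e e = 1 by rewrite dot_consv dot0l addr0 mulr1.
pose v:=u-e; pose k:=2/dot v v.
pose H:=1%:M-k*:(v^T *m v).
have HT: H^T = H by rewrite /H linearB/= linearZ/= trmx1 trmx_mul trmxK.
have vT x: x *m v^T = (dot x v)%:M.
 by apply/matrixP=> i j; rewrite !ord1 -dot_mx mxE.
have xH x: x *m H = x-(k*dot x v)*:v.
 by rewrite /H mulmxBr mulmx1 -scalemxAr mulmxA vT mul_scalar_mx scalerA.
have HH: H *m H = 1%:M.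
 apply/row_matrixP=> i; rewrite row_mul xH row1; set w:=row i H.
 have -> : w = delta_mx 0 i-(k*dot (delta_mx 0 i) v)*:v by rewrite /w rowE xH.
 set d:=delta_mx 0 i; rewrite dotBl dotZl -addrA -opprD -scalerDl.
 have [v0|v0]:=eqVneq v 0; first by rewrite v0 scaler0 subr0. have b0: dot v v != 0 by rewrite dot_eq0.
 rewrite /k; move: (dot d v) (dot v v) b0=> a b b0.
 by rewrite (_: 2/b*a+2/b*(a-2/b*a*b) = 0) ?scale0r ?subr0//; field.
have uH: u *m H = e.
 rewrite xH; have [v0|v0]:=eqVneq v 0.
  by rewrite v0 scaler0 subr0; apply/eqP; rewrite -subr_eq0 -/v v0. have -> : k*dot u v = 1.
  have hv: dot v v = 2*dot u v.
   by rewrite /v !dotBl !dotBr uu ee (dotC e); ring. rewrite /k {1}hv; field; apply: contraNneq v0=> h.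
  by rewrite -dot_eq0 hv h mulr0. by rewrite scale1r /v opprB addrC subrK.
exists (\matrix_(i, j) H i (lift ord0 j)); split=> //.
 apply/rowP=> j; rewrite !mxE; transitivity ((u *m H) 0 (lift ord0 j)).
  by rewrite mxE; apply: eq_bigr=> i _; rewrite mxE. by rewrite uH consvS mxE.
apply/matrixP=> i j; rewrite !mxE; transitivity ((H^T *m H) (lift ord0 i) (lift ord0 j)).
 by rewrite mxE; apply: eq_bigr=> l _; rewrite !mxE.
by rewrite HT HH mxE (inj_eq lift_inj).
Qed.

Lemma enorm_splits n (u: 'rV[R]_n.+1) T x: splits u T -> enorm (x *m T)<=enorm x.
move=> sT; rewrite /enorm ler_wsqrtr// (splits_dot x x sT) lerDr.
by rewrite -expr2 sqr_ge0.
Qed.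

Lemma enorm_splits_tr n (u: 'rV[R]_n.+1) T (y: 'rV[R]_n): splits u T -> enorm (y *m T^T) = enorm y.
by move=> sT; rewrite /enorm (splits_dot _ _ sT) splits_perp// mul0r add0r (splits_tr _ sT).
Qed.

Definition unsplit_rV n (u: 'rV[R]_n.+1) (T: 'M[R]_(n.+1, n)) (w: 'rV[R]_n.+1) := headv w*:u+tailv w *m T^T.

Lemma meas_unsplit_rV n (u: 'rV[R]_n.+1) T: mfunT (unsplit_rV u T).
apply: meas_rVD; first by apply: meas_rVZ=> //; exact: meas_headv.
by apply: meas_mulmx; exact: meas_tailv.
Qed.

Lemma leb_unsplit n (u: 'rV[R]_n.+1) T (A: set 'rV[R]_n.+1): splits u T -> measurable A ->
 leb n.+1 A = (\int[leb n.+1]_w (\1_A (unsplit_rV u T w))%:E)%E.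
move=> sT mA; have [uu uT TT]:=sT.
rewrite -leb_indic_preimage//; last exact: meas_unsplit_rV.
apply/esym; apply: (@leb_isometry _ _ (fun x=> consv (dot x u) (x *m T)))=> //.
- exact: meas_unsplit_rV.
- by move=> x; rewrite /unsplit_rV headv_cons tailv_cons -splitsE.
- move=> w; rewrite /unsplit_rV dotDl dotZl uu mulr1 splits_perp// addr0.
 by rewrite mulmxDl -scalemxAl uT scaler0 add0r (splits_tr _ sT) consvK.
move=> x y; rewrite consvN consvD -dotBl -mulmxBl /enorm dot_consv.
by rewrite -(splits_dot _ _ sT).
Qed.

Lemma int_indic_itv (a b: R): a<=b -> (\int[mu]_s (\1_(`[a, b]%classic) s)%:E = (b-a)%:E)%E.
move=> ab; rewrite integral_indic// setIT.
have E: lebesgue_measure [set` `[a, b]] = (b-a)%:E.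
 rewrite lebesgue_measure_itv/= lte_fin -EFinB; case: ltP=> // ba.
 by congr EFin; apply/eqP; rewrite eq_sym subr_eq0 eq_le ba.
exact: E.
Qed.

(* Both sides are the volume of the slab of all z with z *m To in B and
  0<=dot z nu<=dot o nu, cut along o or along nu. *)
Lemma leb_oblique n (o nu: 'rV[R]_n.+1) To T1 (B: set 'rV[R]_n) :
 splits o To -> splits nu T1 -> 0<dot o nu -> measurable B ->
 ((dot o nu)%:E * leb n ((fun y: 'rV[R]_n=> (y *m T1^T) *m To) @^-1` B) = leb n B)%E.
move=> so s1 c0 mB; set c:=dot o nu.
pose Z := [set z | B (z *m To) /\ 0<=dot z nu<=c].
have mTo: mfunT (fun z: 'rV[R]_n.+1=> z *m To) by exact: meas_mulmx.
have mZ: measurable Z.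
 apply: measurableI; first by rewrite -measTI; exact: mTo.
 rewrite [X in measurable X](_: _ = (dot^~ nu) @^-1` `[0, c]%classic).
  by rewrite -measTI; apply: meas_dot. by [].
have mL: mfunT (fun y: 'rV[R]_n=> (y *m T1^T) *m To).
 by apply: meas_mulmx; exact: meas_mulmx.
set L:=fun y=> _ in mL *.

have [oo oT _]:=so; have [nn nT _]:=s1.
have mI u T: mfunT (fun w=> (\1_Z (@unsplit_rV n u T w))%:E).
 apply/mEFP; apply: mcomp=> //; exact: meas_unsplit_rV.
have E1:=leb_unsplit so mZ; have E2:=leb_unsplit s1 mZ.
have: leb n.+1 Z = leb n B.
 rewrite E1 int_lebS2// leb_indic//; apply: eq_integral=> y _. pose k:=dot (y *m To^T) nu.
 transitivity (\int[mu]_s (\1_B y * \1_(`[- k/c, 1-k/c]%classic) s)%:E)%E; last first.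
  rewrite (@ge0_integralZl_real _ _ _ mu _ _ (\1_(`[- k/c, 1-k/c]%classic)))//.
  rewrite int_indic_itv; last by rewrite mulNr; lra. by rewrite mulNr opprK subrK mule1.
 apply: eq_integral=> s _; congr EFin; rewrite /unsplit_rV headv_cons tailv_cons.
 rewrite !indicE -natrM mulnb; congr ((nat_of_bool _)%:R).
 have e1: dot (s*:o+y *m To^T) nu = s*c+k by rewrite dotDl dotZl. have e2: (s*:o+y *m To^T) *m To = y.
  by rewrite mulmxDl -scalemxAl oT scaler0 add0r (splits_tr _ so).
 have e3: (- k/c<=s<=1-k/c) = (0<=s*c+k<=c).
  rewrite ler_pdivrMr// lerBrDr; congr andb; first by apply/idP/idP; lra.
  rewrite -(ler_pM2r c0) mulrDl mul1r -[k/c*c]mulrA mulVf ?mulr1 1?gt_eqF//.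
 apply/idP/idP; rewrite inE /Z/= e1 e2.
  by move=> [h1 h2]; rewrite mem_set//= mem_set//= in_itv/= e3.
 by move=> /andP[/set_mem h1 /set_mem]; rewrite /= in_itv/= e3.
have: leb n.+1 Z = (c%:E * leb n (L @^-1` B))%E.
 rewrite E2 int_lebS1//.
 transitivity (\int[mu]_s ((fine 1%E * \1_(`[0, c]%classic) s)%:E * leb n (L @^-1` B)))%E; last first.
  rewrite ge0_integralZr//; last first.
   by apply/mEFP; apply: measurable_funM. congr (_*_)%E; rewrite -[c in RHS]subr0 -int_indic_itv ?ltW//.
  by apply: eq_integral=> s _; rewrite mul1r. apply: eq_integral=> s _; rewrite mul1r.
 have e1 y: dot (s*:nu+y *m T1^T) nu = s by rewrite dotDl dotZl nn mulr1 splits_perp// addr0.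
 have [sc|sc]:=boolP (0<=s<=c); last first.
  rewrite indicE memNset ?mul0e; last by rewrite /= in_itv/=; exact/negP.
  apply: integral0_eq=> y _; rewrite indicE memNset// /Z/= /unsplit_rV headv_cons tailv_cons e1.
  by move=> [_ h]; move: sc; rewrite h. rewrite indicE mem_set ?mul1e; last by [].
 rewrite leb_indic_preimage// -[RHS](@leb_translate _ n (fun y=> (\1_B (L y))%:E) (- (s/c)*:(o *m T1))); last 2 first.
 - by apply/mEFP; apply: mcomp.
 - by [].
 apply: eq_integral=> y _; congr EFin; rewrite !indicE; congr ((nat_of_bool _)%:R).
 rewrite /unsplit_rV headv_cons tailv_cons. have e2: (s*:nu+y *m T1^T) *m To = L (y + - (s/c)*:(o *m T1)).
  rewrite /L !mulmxDl -!scalemxAl addrC; congr (_+_).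
  have: (c*:nu+(o *m T1) *m T1^T) *m To = 0 by rewrite -(splitsE o s1).
  rewrite mulmxDl -scalemxAl=> /eqP; rewrite addr_eq0=> /eqP h.
  rewrite scaleNr -scalerN -h scalerA mulfVK// gt_eqF//.
 by apply/idP/idP; rewrite !inE /Z/= e1 e2; [move=> []|].
by move=> -> .
Qed.

(** Both sets are images of the same index set, and the Lipschitz bound makes [g] factor through
    [f], whether or not [f] is injective. *)
Lemma haus_compare k a b (T: choiceType) (D: set T) (f: T -> 'rV[R]_a) (g: T -> 'rV[R]_b) (L: R) : 0<L ->
 (forall s t, D s -> D t -> enorm (g s-g t)<=L*enorm (f s-f t)) ->
 (hausdorff k (g @` D)<=(L^+k)%:E*hausdorff k (f @` D))%E.
move=> L0 fg; have [->|/set0P[t0 Dt0]]:=eqVneq D set0.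
 by rewrite !image_set0 !hausdorff0 mule0.
pose psi z:=xget t0 (D `&` [set t | f t = z]).
have psiP t: D t -> D (psi (f t)) /\ f (psi (f t)) = f t.
 by move=> Dt; rewrite /psi; case: xgetP=> [s _ []|/(_ t)] //=; case.
have E: g @` D = (g \o psi) @` (f @` D).
 seteq=> z.
  move=> [t Dt <-]; exists (f t); first by [].
  have [h1 h2]:=psiP _ Dt; apply/eqP; rewrite -subr_eq0 -enorm_eq0 eq_le enorm_ge0 andbT.
  by apply: le_trans (fg _ _ h1 Dt) _; rewrite h2 subrr enorm0 mulr0.
 by move=> [_ [t Dt <-] <-]; exists (psi (f t))=> //; have []:=psiP _ Dt.
rewrite E; apply: haus_lip=> // _ _ [s Ds <-] [t Dt <-] /=.
have [h1 h2]:=psiP _ Ds; have [h3 h4]:=psiP _ Dt.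
by apply: le_trans (fg _ _ h1 h3) _; rewrite h2 h4.
Qed.

Lemma leb_compare n (T: choiceType) (D: set T) (f g: T -> 'rV[R]_n) (L: R) :
 0<L -> measurable (f @` D) -> measurable (g @` D) ->
 (forall s t, D s -> D t -> enorm (g s-g t)<=L*enorm (f s-f t)) ->
 (leb n (g @` D)<=(L^+n)%:E * leb n (f @` D))%E.
move=> L0 mf mg /(haus_compare n L0); rewrite !haus_leb// muleCA lee_pmul2l//.
by rewrite lte_fin hratio_gt0.
Qed.

Lemma le_compare_lower n (T: Type) (D: set T) (f h: T -> 'rV[R]_n) (e: R): e<1 ->
 (forall s t, D s -> D t -> enorm ((h s-h t)-(f s-f t))<=e*enorm (f s-f t)) ->
 forall s t, D s -> D t -> enorm (f s-f t)<=(1-e)^-1*enorm (h s-h t).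
move=> e1 H s t Ds Dt; rewrite ler_pdivlMl ?subr_gt0//.
have:=H _ _ Ds Dt; have:=lerB_enorm (f s-f t) (h s-h t).
rewrite [enorm (_-_-(h s-h t))]enormB; lra.
Qed.

Lemma le_compare_upper n (T: Type) (D: set T) (f h: T -> 'rV[R]_n) (e: R) :
 (forall s t, D s -> D t -> enorm ((h s-h t)-(f s-f t))<=e*enorm (f s-f t)) ->
 forall s t, D s -> D t -> enorm (h s-h t)<=(1+e)*enorm (f s-f t).
move=> H s t Ds Dt.
have:=H _ _ Ds Dt; have:=lerB_enorm (h s-h t) (f s-f t); lra.
Qed.

Definition ccons n p (u: 'rV[R]_n) (E: 'M[R]_(n, p)): 'M[R]_(n, p.+1) :=
 \matrix_(i, j) if unlift ord0 j is Some k then E i k else u 0 i.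

Lemma mul_ccons n p (u: 'rV[R]_n) (E: 'M[R]_(n, p)) x : x *m ccons u E = consv (dot x u) (x *m E).
apply/rowP=> j; rewrite !mxE; case: unliftP=> [k|] ->.
 by rewrite mxE; apply: eq_bigr=> i _; rewrite mxE liftK.
by rewrite /dot; apply: eq_bigr=> i _; rewrite mxE unlift_none.
Qed.

(** A point u of the sphere, a unit normal nu at u, and an orthonormal basis, the columns of [E], of
    the directions orthogonal to both. *)
Definition tframe n (u nu: 'rV[R]_n.+2) (E: 'M[R]_(n.+2, n)): Prop :=
 [/\ dot u u = 1, dot nu nu = 1, dot u nu = 0, u *m E = 0 & nu *m E = 0 /\ E^T *m E = 1%:M].

Lemma tframe_splits n (u nu: 'rV[R]_n.+2) E: tframe u nu E -> splits nu (ccons u E).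
move=> [uu nn un uE [nE EE]]; split=> //.
 by rewrite mul_ccons dotC un nE consv00.
apply/matrixP=> i j.
have -> : ((ccons u E)^T *m ccons u E) i j = ((row i (ccons u E)^T) *m ccons u E) 0 j.
 by rewrite -row_mul [RHS]mxE.
rewrite mul_ccons.
have rowi: row i (ccons u E)^T = if unlift ord0 i is Some k then row k E^T else u.
 by apply/rowP=> l; rewrite !mxE; case: unliftP=> [k|] _ //; rewrite !mxE.
rewrite rowi [RHS]mxE; case: (unliftP ord0 i)=> [k|] ->.
 have -> : dot (row k E^T) u = 0.
  transitivity ((u *m E) 0 k); last by rewrite uE mxE.
  by rewrite mxE /dot; apply: eq_bigr=> l _; rewrite !mxE mulrC.
 case: (unliftP ord0 j)=> [l|] ->; last by rewrite consv0 eq_sym (negbTE (neq_lift _ _)).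
 by rewrite consvS -row_mul EE !mxE (inj_eq lift_inj).
rewrite uu uE; case: (unliftP ord0 j)=> [l|] ->; last by rewrite consv0 eqxx.
by rewrite consvS mxE (negbTE (neq_lift _ _)).
Qed.

Lemma tframe_swap n (u nu: 'rV[R]_n.+2) E: tframe u nu E -> tframe nu u E.
Proof. by move=> [? ? h ? []]; split=> //; rewrite dotC. Qed.

Lemma tframe_dot n (u nu: 'rV[R]_n.+2) E x y: tframe u nu E ->
 dot x y = dot x u*dot y u+dot x nu*dot y nu+dot (x *m E) (y *m E).
move=> tE; rewrite (splits_dot x y (tframe_splits tE)) !mul_ccons dot_consv addrA.
by rewrite (addrC (dot x u*_)).
Qed.

Lemma tframeE n (u nu: 'rV[R]_n.+2) E x: tframe u nu E -> x = dot x u*:u+dot x nu*:nu+(x *m E) *m E^T.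
move=> tE; have [uu nn un uE [nE EE]]:=tE.
apply/eqP; rewrite -subr_eq0 -dot_eq0; set z:=x-_.
have zu: dot z u = 0.
 by rewrite /z dotBl !dotDl !dotZl uu (dotC nu) un dot_mulmx trmxK uE dot0r; ring.
have zn: dot z nu = 0.
 by rewrite /z dotBl !dotDl !dotZl nn un dot_mulmx trmxK nE dot0r; ring.
have zE: z *m E = 0.
 by rewrite /z mulmxBl !mulmxDl -!scalemxAl uE nE !scaler0 !add0r -(mulmxA (x *m E)) EE mulmx1 subrr.
by rewrite (tframe_dot z z tE) zu zn zE dot0l !mulr0 !addr0.
Qed.

Lemma tframe_exists n (u nu: 'rV[R]_n.+2): dot u u = 1 -> dot nu nu = 1 -> dot u nu = 0 ->
 exists E, tframe u nu E.
move=> uu nn un; have [T sT]:=splits_exists nn; have [_ nT TT]:=sT.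
pose u':=u *m T.
have uu': dot u' u' = 1 by have:=splits_dot u u sT; rewrite uu un mul0r add0r.
have [T' [_ uT' TT']]:=splits_exists uu'.
exists (T *m T'); split=> //; first by rewrite mulmxA.
split; first by rewrite mulmxA nT mul0mx.
by rewrite trmx_mul -mulmxA (mulmxA T^T) TT mul1mx.
Qed.

Lemma enorm_tframe n (u nu: 'rV[R]_n.+2) E x: tframe u nu E -> enorm (x *m E)<=enorm x.
move=> tE; rewrite /enorm ler_wsqrtr// (tframe_dot x x tE) lerDr.
by rewrite -!expr2 addr_ge0// sqr_ge0.
Qed.

End Frames.

(** * Volume of cones over small, nearly flat sets *)

Section Slab.
Context {R: realType}.
Local Notation mu := (@lebesgue_measure R).

Definition rcone n p (T: 'M[R]_(n, p)) (A: set 'rV[R]_n): set 'rV[R]_p :=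
 [set z | exists x (s: R), [/\ A x, 0<s, s<=1 & z = s*:(x *m T)]].

Variables (n: nat) (o u nu: 'rV[R]_n.+2) (To: 'M[R]_(n.+2, n.+1)) (E: 'M[R]_(n.+2, n)).
Variables (A: set 'rV[R]_n.+2) (eta: R).
Hypotheses (so: splits o To) (tE: tframe u nu E) (c0: 0<dot o nu).
Hypotheses (eta0: 0<eta) (eta1: eta<=1/2).
Hypotheses (AS: forall x, A x -> dot x x = 1) (Au: forall x, A x -> enorm (x-u)<=eta).
Hypothesis Anu: forall x y, A x -> A y -> `|dot (x-y) nu| <= eta*enorm (x-y).

(** On the sphere x - y is orthogonal to x + y, so u may be replaced by its difference from the
    midpoint of x and y, which has norm at most [eta]. *)
Lemma flat_dot_base x y: A x -> A y -> `|dot (x-y) u| <= eta*enorm (x-y).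
move=> Ax Ay.
have -> : dot (x-y) u = dot (x-y) (2^-1*:(u-x)+2^-1*:(u-y)).
 by rewrite dotDr !dotZr !dotBl !dotBr (AS Ax) (AS Ay) (dotC y x); field.
apply: le_trans (dot_le _ _) _; rewrite mulrC ler_wpM2r ?enorm_ge0//.
apply: le_trans (enormD _ _) _; rewrite !enormZ ger0_norm// !(enormB u).
by have:=Au Ax; have:=Au Ay; lra.
Qed.

(** Pythagoras in the frame: the components of a chord along u and nu are both at most [eta] times
    its length. With q = eta^2 <= 1/4 the constant comes from (1 + 4q)^2 (1 - 2q) >= 1. *)
Lemma flat_expand x y: A x -> A y -> enorm (x-y)<=(1+4*eta^+2)*enorm ((x-y) *m E).
move=> Ax Ay; set a:=enorm (x-y); set b:=enorm (_ *m E).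
have a0: 0<=a by exact: enorm_ge0.
have b0: 0<=b by exact: enorm_ge0.
have h: a^+2 = dot (x-y) u^+2+dot (x-y) nu^+2+b^+2.
 by rewrite /a /b !enormE (tframe_dot _ _ tE) !expr2.
have h1: dot (x-y) u^+2<=(eta*a)^+2.
 by rewrite -[X in X<=_]real_normK ?num_real// ler_sqr ?nnegrE ?mulr_ge0 ?(ltW eta0)// flat_dot_base.
have h2: dot (x-y) nu^+2<=(eta*a)^+2.
 by rewrite -[X in X<=_]real_normK ?num_real// ler_sqr ?nnegrE ?mulr_ge0 ?(ltW eta0)// Anu.
have e2: 0<=eta^+2 by exact: sqr_ge0.
have e4: eta^+2<=1/4.
 have: eta*eta<=1/2*(1/2) by apply: ler_pM=> //; exact: ltW. by rewrite -expr2; lra.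
have p0: 0<=1+4*eta^+2 by rewrite addr_ge0// mulr_ge0.
rewrite -ler_sqr ?nnegrE ?mulr_ge0// exprMn.
have b2: 0<=b^+2 by exact: sqr_ge0.
have a2: a^+2*(1-2*eta^+2)<=b^+2 by move: h1 h2; rewrite !exprMn h; lra.
set q:=eta^+2 in e2 e4 p0 a2 *; clearbody q.
have k1: 1<=(1+4*q)^+2*(1-2*q).
 have: 0<=q*(1-4*q) by rewrite mulr_ge0//; lra. have: 0<=q*q*(1-4*q) by rewrite !mulr_ge0//; lra.
 have: 0<=q*q by rewrite mulr_ge0. by rewrite expr2; lra.
apply: le_trans (ler_wpM2l (sqr_ge0 (1+4*q)) a2).
by rewrite mulrCA ler_peMr// sqr_ge0.
Qed.

Lemma haus_flat: measurable ((fun x=> x *m E) @` A) ->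
 (hausdorff n A<=((1+4*eta^+2)^+n * @hratio R n)%:E * leb n ((fun x=> x *m E) @` A))%E /\
 ((@hratio R n)%:E * leb n ((fun x=> x *m E) @` A)<=hausdorff n A)%E.
move=> mA; have p0: 0<1+4*eta^+2 by rewrite ltr_pwDl// mulr_ge0// sqr_ge0.
split.
 rewrite EFinM -muleA -haus_leb//; apply: haus_expand=> // x y Ax Ay.
 by rewrite -mulmxBl; exact: flat_expand.
rewrite -haus_leb//.
have:=@haus_lip R n _ _ (fun x=> x *m E) A 1 ltr01.
rewrite expr1n mul1e; apply=> x y Ax Ay; rewrite mul1r -mulmxBl.
exact: enorm_tframe tE.
Qed.

Hypothesis Ainj: forall x y s, A x -> A y -> 0<s -> x *m To = s*:(y *m To) -> x = y.
Hypothesis Ane: forall x, A x -> x *m To != 0.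
Hypothesis mtA: measurable ((fun x=> x *m E) @` A).
Hypothesis mD: measurable (rcone To A).

Let c:=dot o nu.
Let e:=8*eta*(1+c^-1).

(** [G] is the volume of the thin shell between the cone over A and its dilate by 1 + eta. The shell
    is parametrised by (x, b) -> b x with 1 < b <= 1 + eta. Up to a linear map of Jacobian c = o.nu,
    this parametrisation is a perturbation of relative Lipschitz size e of the product of the flat
    image of A with an interval of length eta. *)
Lemma slab: e<1 ->
 exists G: \bar R, [/\ (leb n.+1 (rcone To A)+G = ((1+eta)^+n.+1)%:E * leb n.+1 (rcone To A))%E,
  ((c*eta)%:E * leb n ((fun x=> x *m E) @` A)<=((1-e)^-1^+n.+1)%:E*G)%E &
  (G<=((1+e)^+n.+1*(c*eta))%:E * leb n ((fun x=> x *m E) @` A))%E].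
move=> e1; pose T1:=ccons u E.
have s1: splits nu T1:=tframe_splits tE.
have [oo oT _]:=so; have [nn nT _]:=s1.
have c0': 0<c by [].
pose D := [set p: 'rV[R]_n.+2*R | A p.1 /\ 0<p.2-1<=eta].
pose g (p: 'rV[R]_n.+2*R): 'rV[R]_n.+1:=p.2*:(p.1 *m To).
pose f (p: 'rV[R]_n.+2*R): 'rV[R]_n.+1:=consv (p.2-1) (p.1 *m E).
(* [Lam] projects along o onto the hyperplane orthogonal to nu and reads coordinates in the frame.
   [L] goes back to the hyperplane orthogonal to o, so that [L (h p) = g p] and [leb_oblique] gives
   the Jacobian. *)
pose Lam z:=(z-(dot z nu/c)*:o) *m T1.
pose h (p: 'rV[R]_n.+2*R): 'rV[R]_n.+1:=Lam (p.2*:p.1).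
pose L (y: 'rV[R]_n.+1):=(y *m T1^T) *m To.
have eta1': 0<1+eta by rewrite ltr_pwDl// ltW.
have Dinj: g @` D `&` rcone To A = set0.
 seteq=> // z [[[x b] /= [Ax /andP[/= b1 _]] <-] [y [s [Ay s0 s1' E2]]]]. move: E2; rewrite /g/= => E2.
 have b0: 0<b by lra. have xy: x = y.
  apply: (Ainj (s:=s/b))=> //; first by rewrite divr_gt0.
  by rewrite mulrC -scalerA -E2 scalerA mulVf ?scale1r// gt_eqF.
 move/eqP: E2; rewrite xy -subr_eq0 -scalerBl scaler_eq0 (negbTE (Ane Ay)) orbF. by move=> /eqP; lra.
have DU: rcone To A `|` g @` D = (fun z=> (1+eta)^-1*:z) @^-1` rcone To A.
 seteq=> z /=.
  move=> [[x [s [Ax s0 s1' ->]]]|[[x b] /= [Ax /andP[/= b1 /= b2]] <-]].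
   exists x, ((1+eta)^-1*s); split=> //; first by rewrite mulr_gt0// invr_gt0.
    by rewrite ler_pdivrMl// mulr1 (le_trans s1')// lerDl ltW. by rewrite scalerA.
  exists x, ((1+eta)^-1*b); split=> //; first by rewrite mulr_gt0 ?invr_gt0//; lra.
   by rewrite ler_pdivrMl// mulr1; lra. by rewrite /g/= scalerA. move=> [x [s [Ax s0 s1' E2]]].
 have {E2}-> : z = ((1+eta)*s)*:(x *m To).
  by rewrite -scalerA -E2 scalerA mulfV ?scale1r// gt_eqF. have [h1|h1]:=leP ((1+eta)*s) 1.
  by left; exists x, ((1+eta)*s); split=> //; rewrite mulr_gt0.
 right; exists (x, (1+eta)*s)=> //=; split=> //; rewrite subr_gt0 h1/=.
 by have:=ler_wpM2l (ltW eta1') s1'; lra.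
have mS: measurable ((fun z: 'rV[R]_n.+1=> (1+eta)^-1*:z) @^-1` rcone To A).
 by rewrite -measTI; apply: meas_rVZ.
have mg: measurable (g @` D).
 have -> : g @` D = ((fun z=> (1+eta)^-1*:z) @^-1` rcone To A) `\` rcone To A.
  by rewrite -DU setDUl setDv set0U; apply/esym/setDidl. exact: measurableD.
have fE: f @` D = [set w | (0<headv w<=eta) /\ ((fun x=> x *m E) @` A) (tailv w)].
 seteq=> w /=.
  move=> [[x b] /= [Ax hb] <-]; rewrite /f headv_cons tailv_cons; split=> //. by exists x.
 move=> [hw [x Ax xE]]; exists (x, headv w+1); first by rewrite /D/= addrK. by rewrite /f/= addrK xE consvK.
have mf: measurable (f @` D).
 rewrite fE; apply: measurableI.
  rewrite [X in measurable X](_: _ = @headv R n @^-1` `]0, eta]%classic).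
   by rewrite -measTI; apply: meas_headv. by seteq=> w /=; rewrite in_itv.
 by rewrite -measTI; apply: (@meas_tailv R n).
have lf: leb n.+1 (f @` D) = (eta%:E * leb n ((fun x=> x *m E) @` A))%E.
 rewrite leb_indic// int_lebS2; last 2 first.
 - by apply/mEFP; apply: measurable_indic.
 - by move=> w; rewrite lee_fin.
 rewrite leb_indic// -ge0_integralZl//; last 2 first.
 - by apply/mEFP; apply: measurable_indic.
 - by rewrite lee_fin ltW.
 apply: eq_integral=> y _; set tA:=_ @` A.
 transitivity (\int[mu]_s (\1_tA y * \1_(`]0%R, eta]%classic) s)%:E)%E.
  apply: eq_integral=> s _; congr EFin; rewrite fE !indicE -natrM mulnb; congr ((nat_of_bool _)%:R).
  apply/idP/idP; rewrite inE/= headv_cons tailv_cons -/tA.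
   by move=> [h1 h2]; rewrite mem_set//= mem_set//= in_itv.
  by move=> /andP[/set_mem h1 /set_mem]; rewrite /= in_itv/=.
 rewrite (@ge0_integralZl_real _ _ _ mu _ _ (\1_(`]0%R, eta]%classic)))//.
 rewrite integral_indic// setIT -EFinM mulrC EFinM; congr (_*_)%E.
 have E': lebesgue_measure [set` `]0, eta]] = eta%:E.
  by rewrite lebesgue_measure_itv/= lte_fin eta0 -EFinB subr0. exact: E'.
have Lh p: L (h p) = g p.
 rewrite /L /h /Lam /g; set z:=p.2*:p.1; set z':=z-_.
 have zn: dot z' nu = 0 by rewrite /z' dotBl dotZl -/c mulfVK ?gt_eqF// subrr.
 have <- : z' = (z' *m T1) *m T1^T by rewrite {1}(splitsE z' s1) zn scale0r add0r.
 by rewrite /z' /z mulmxBl -!scalemxAl oT scaler0 subr0.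
have Linj y: L y = 0 -> y = 0.
 move=> Ly; have:=splitsE (y *m T1^T) so; rewrite -/(L y) Ly mul0mx addr0=> Ey.
 have:=splits_perp y s1; rewrite Ey dotZl -/c=> /eqP. rewrite mulf_eq0 (gt_eqF c0') orbF=> /eqP h0.
 by rewrite -(splits_tr y s1) Ey h0 scale0r mul0mx.
have hE: h @` D = L @^-1` (g @` D).
 seteq=> y /= [p Dp].
  by move=> <-; exists p=> //; rewrite Lh.
 move=> gL; exists p=> //; apply/eqP; rewrite -subr_eq0; apply/eqP; apply: Linj.
 by rewrite /L !mulmxBl -/(L (h p)) -/(L y) Lh gL subrr.
have mh: measurable (h @` D).
 rewrite hE -measTI. by apply: (meas_mulmx To (meas_mulmx T1^T (@measurable_id _ _ setT))).
have lh: (c%:E * leb n.+1 (h @` D) = leb n.+1 (g @` D))%E.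
 by rewrite hE; exact: leb_oblique.
have LamB z z': Lam z-Lam z' = Lam (z-z').
 rewrite /Lam -mulmxBl; congr (_ *m T1); apply/rowP=> i; rewrite !mxE dotBl; ring.
have LamN z: enorm (Lam z)<=(1+c^-1)*enorm z.
 apply: le_trans (enorm_splits _ s1) _; apply: le_trans (enormD _ _) _.
 rewrite enormN enormZ (enorm_unit oo) mulr1 mulrDl mul1r lerD2l normrM.
 rewrite (gtr0_norm (_: 0<c^-1)) ?invr_gt0// mulrC ler_wpM2l//; first by rewrite invr_ge0 ltW.
 by apply: le_trans (dot_le _ _) _; rewrite (enorm_unit nn) mulr1.
have LamT w: dot w nu = 0 -> Lam w = w *m T1.
 by move=> wn; rewrite /Lam wn mul0r scale0r subr0.
(* To first order b x moves by (b - b') u plus the tangential part of x - x'. The remainder consists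
   of four terms, each at most [eta] times a displacement controlled by [F]. *)
have key p q: D p -> D q -> enorm ((h p-h q)-(f p-f q))<=e*enorm (f p-f q).
 move: p q=> [x b] [x' b'] [/= Ax /andP[b1 b2]] [/= Ax' /andP[b1' b2']]. set F:=f _-f _.
 have Fe: F = consv (b-b') ((x-x') *m E).
  rewrite /F /f/= consvN consvD mulmxBl; congr consv; ring. pose w:=(b-b')*:u+((x-x') *m E) *m E^T.
 have [uu _ un uE [nE EE]]:=tE. have wn: dot w nu = 0.
  by rewrite /w dotDl dotZl un mulr0 add0r dot_mulmx trmxK nE dot0r. have wT: w *m T1 = F.
  rewrite /T1 mul_ccons Fe; congr consv.
   by rewrite /w dotDl dotZl uu mulr1 dot_mulmx trmxK uE dot0r addr0.
  by rewrite /w mulmxDl -scalemxAl uE scaler0 add0r -(mulmxA (_ *m E)) EE mulmx1.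
 rewrite /h/= LamB -wT -(LamT _ wn) LamB.
 apply: le_trans (LamN _) _; rewrite (_: e*_ = (1+c^-1)*(8*eta*enorm F)); last first.
  by rewrite /e (LamT _ wn) wT; ring. apply: ler_wpM2l. by rewrite addr_ge0// invr_ge0 ltW. set r:=_-_-w.
 have rE: r = (b-1)*:(x-x')+(b-b')*:(x'-u)+dot (x-x') u*:u+dot (x-x') nu*:nu.
  rewrite /r /w; have:=tframeE (x-x') tE; set tt:=_ *m E^T=> Ett.
  have -> : tt = (x-x')-(dot (x-x') u*:u+dot (x-x') nu*:nu).
   by rewrite {1}Ett addrC addKr. by apply/rowP=> i; rewrite !mxE; ring. set a:=enorm (x-x').
 have a0: 0<=a by exact: enorm_ge0. have F1: `|b-b'| <= enorm F.
  by have:=coord_le_enorm F ord0; rewrite Fe consv0. have F2: a<=2*enorm F.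
  apply: le_trans (flat_expand Ax Ax') _. apply: ler_pM; rewrite ?enorm_ge0//.
  - by rewrite addr_ge0// mulr_ge0// sqr_ge0.
  - have: eta*eta<=1/2*(1/2) by apply: ler_pM=> //; exact: ltW.
   by rewrite expr2; lra. rewrite /enorm ler_wsqrtr// Fe dot_consv lerDr -expr2 sqr_ge0//. rewrite rE.
 apply: (@le_trans _ _ (eta*a + `|b-b'| * eta+eta*a+eta*a)).
  apply: le_trans (enormD _ _) _; apply: lerD; last first.
   by rewrite enormZ (enorm_unit nn) mulr1; exact: Anu.
  apply: le_trans (enormD _ _) _; apply: lerD; last first.
   by rewrite enormZ (enorm_unit uu) mulr1; exact: flat_dot_base.
  apply: le_trans (enormD _ _) _; apply: lerD.
   by rewrite enormZ ler_wpM2r// gtr0_norm. by rewrite enormZ ler_wpM2l//; exact: Au.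
 have:=ler_wpM2l (ltW eta0) F1; have:=ler_wpM2l (ltW eta0) F2.
 have: 0<=eta*enorm F by rewrite mulr_ge0 ?enorm_ge0// ltW. lra.
have e0: 0<=e by rewrite /e !mulr_ge0// ?ltW// addr_gt0// invr_gt0.
exists (leb n.+1 (g @` D)); split.
- rewrite -measureU//; last by rewrite setIC.
 rewrite DU -[LHS](leb_setZ eta1' mS); congr (_ * leb _ _)%E; seteq=> z /=.
  by rewrite scalerA mulVf ?scale1r// gt_eqF. by rewrite scalerA mulVf ?scale1r// gt_eqF.
- rewrite -lh muleCA EFinM -muleA -lf lee_pmul2l ?lte_fin//.
 apply: leb_compare=> //; first by rewrite invr_gt0 subr_gt0. exact: le_compare_lower.
rewrite -lh (_: ((1+e)^+n.+1*(c*eta))%:E = (c%:E*((1+e)^+n.+1)%:E*eta%:E)%E); last first.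
 by rewrite -!EFinM; congr EFin; rewrite mulrCA mulrA.
rewrite -!muleA -lf lee_pmul2l ?lte_fin//.
apply: leb_compare=> //; first by rewrite ltr_pwDl.
exact: le_compare_upper.
Qed.

End Slab.

Section SlabBounds.
Context {R: realType}.

Lemma bernoulli_bounds (a: R) k: 0<=a -> a*k%:R<=(1+a)^+k-1<=a*k%:R*(1+a)^+k.
move=> a0; have p k': 1<=(1+a)^+k' by rewrite exprn_ege1// lerDl.
elim: k=> [|k /andP[h1 h2]]; first by rewrite expr0 subrr mulr0 mul0r lexx.
have:=p k; have:=p k.+1; rewrite !exprS -natr1; set X:=(1+a)^+k in h1 h2 * => p1 p2.
have X0: 0<=a*(X-1) by rewrite mulr_ge0// subr_ge0.
have h3: 0<=a*(a*k%:R*X) by rewrite !mulr_ge0// (le_trans ler01).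
have h4: 0<=a*(a*X) by rewrite !mulr_ge0// (le_trans ler01).
bsplit; lra.
Qed.

Lemma leb_lty n (A: set 'rV[R]_n) (r: R): (forall x, A x -> enorm x<=r) -> measurable A ->
 (leb n A < +oo)%E.
move=> Ar mA; have [r0|r0]:=leP 0 r; last first.
 rewrite (_: A = set0) ?measure0//; seteq=> // x /Ar /(le_trans (enorm_ge0 x)). by rewrite leNgt r0.
apply: (@le_lt_trans _ _ (leb n (cube 0 r))); last by rewrite leb_cube// ltry.
apply: le_measure; rewrite ?inE//; first exact: meas_cube.
move=> x /Ar xr i; rewrite mxE.
by rewrite subr0; exact: le_trans (coord_le_enorm x i) xr.
Qed.

Lemma adde_scale_inj (q x: R) (G: \bar R): (q%:E+G = x%:E*q%:E)%E -> G = ((x-1)*q)%:E.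
by case: G=> [g| |]// -[h]; congr EFin; rewrite mulrBl mul1r -h addrAC subrr add0r.
Qed.

Variables (n: nat) (o u nu: 'rV[R]_n.+2) (To: 'M[R]_(n.+2, n.+1)) (E: 'M[R]_(n.+2, n)).
Variables (A: set 'rV[R]_n.+2) (eta: R).
Hypotheses (so: splits o To) (tE: tframe u nu E) (c0: 0<dot o nu).
Hypotheses (eta0: 0<eta) (eta1: eta<=1/2).
Hypotheses (AS: forall x, A x -> dot x x = 1) (Au: forall x, A x -> enorm (x-u)<=eta).
Hypothesis Anu: forall x y, A x -> A y -> `|dot (x-y) nu| <= eta*enorm (x-y).
Hypothesis Ainj: forall x y s, A x -> A y -> 0<s -> x *m To = s*:(y *m To) -> x = y.
Hypothesis Ane: forall x, A x -> x *m To != 0.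
Hypothesis mtA: measurable ((fun x=> x *m E) @` A).
Hypothesis mD: measurable (rcone To A).

Let c:=dot o nu.
Let e:=8*eta*(1+c^-1).
Let M:=(1-e)^-1.
Hypothesis e1: e<1.

Lemma rcone_lty: (leb n.+1 (rcone To A) < +oo)%E.
apply: (@leb_lty _ _ 1)=> // _ [x [s [Ax s0 s1 ->]]].
rewrite enormZ gtr0_norm//; apply: (le_trans (ler_pM (ltW s0) (enorm_ge0 _) s1 (enorm_splits x so))).
by rewrite mul1r enorm_unit// AS.
Qed.

Let e8: 8*eta<=e.
Proof. by rewrite /e ler_peMr ?mulr_ge0 ?(ltW eta0)// lerDl invr_ge0 ltW. Qed.

Let M0: 0<M. Proof. by rewrite invr_gt0 subr_gt0. Qed.

Let Mbound (a: R): 0<=a -> a<=e -> 1+a<=M.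
move=> a0 ae; rewrite /M -[leRHS]mul1r ler_pdivlMr ?subr_gt0//.
have: 0<=a*e by rewrite mulr_ge0// (le_trans a0 ae).
lra.
Qed.

(** The volume of a cone is base times height over dimension: ((1 + eta)^(n+1) - 1)/eta is close to
    n + 1, which turns the shell volume of [slab] into the cone volume. The base is the flat image
    of A and c accounts for its inclination to o. *)
Lemma slab_upper: (c%:E * leb n ((fun x=> x *m E) @` A) <=
 (M^+(n.+1+n.+1)*n.+1%:R)%:E * leb n.+1 (rcone To A))%E.
have [G [h1 h2 _]]:=slab so tE c0 eta0 eta1 AS Au Anu Ainj Ane mtA mD e1.
have:=rcone_lty; move: h1; have: (0<=leb n.+1 (rcone To A))%E by [].
move: (leb n.+1 (rcone To A))=> [q| |]// q0 /adde_scale_inj GE _.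
have /andP[_ b2]:=@bernoulli_bounds eta n.+1 (ltW eta0).
have le1: (1+eta)^+n.+1<=M^+n.+1.
 by rewrite ler_pXn2r ?nnegrE ?addr_ge0 ?(ltW eta0) ?(ltW M0)// Mbound ?ltW//; move: e8 eta0; lra.
rewrite -(@lee_pmul2l _ eta%:E) ?lte_fin// muleA -EFinM (mulrC eta); apply: le_trans h2 _.
rewrite GE -!EFinM lee_fin.

have Mn: 0<=M^+n.+1 by rewrite exprn_ge0// ltW.
apply: (@le_trans _ _ (M^+n.+1*(eta*n.+1%:R*M^+n.+1*q))).
 apply: ler_wpM2l=> //; apply: ler_wpM2r=> //; apply: le_trans b2 _.
 by apply: ler_wpM2l=> //; rewrite mulr_ge0// ltW.
by rewrite exprD le_eqVlt; apply/orP; left; apply/eqP; ring.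
Qed.

Lemma slab_lower: (n.+1%:R%:E * leb n.+1 (rcone To A) <= (M^+n.+1*c)%:E * leb n ((fun x=> x *m E) @` A))%E.
have [G [h1 _ h2]]:=slab so tE c0 eta0 eta1 AS Au Anu Ainj Ane mtA mD e1.
have:=rcone_lty; move: h1; have: (0<=leb n.+1 (rcone To A))%E by [].
move: (leb n.+1 (rcone To A))=> [q| |]// q0 /adde_scale_inj GE _.
have /andP[b1 _]:=@bernoulli_bounds eta n.+1 (ltW eta0).
have e0: 0<=e by apply: le_trans e8; rewrite mulr_ge0// ltW.
have le1: (1+e)^+n.+1<=M^+n.+1.
 by rewrite ler_pXn2r ?nnegrE ?addr_ge0 ?(ltW M0)// Mbound.
rewrite -(@lee_pmul2l _ eta%:E) ?lte_fin// !muleA -!EFinM.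
apply: (@le_trans _ _ G).
 by rewrite GE lee_fin; apply: ler_wpM2r.
apply: le_trans h2 _; apply: lee_wpmul2r=> //; rewrite lee_fin -/c -/e mulrA (mulrC eta); apply: ler_wpM2r; first exact: ltW.
by apply: ler_wpM2r=> //; exact: ltW.
Qed.

Lemma haus_upper: (hausdorff n A<=(M^+n*hratio n)%:E * leb n ((fun x=> x *m E) @` A))%E.
have [h _]:=haus_flat tE eta0 eta1 AS Au Anu mtA.
apply: le_trans h _; apply: lee_wpmul2r=> //; rewrite lee_fin; apply: ler_wpM2r.
 exact/ltW/hratio_gt0.
have p: 0<=4*eta^+2 by rewrite mulr_ge0// sqr_ge0.
apply: lerXn2r; rewrite ?nnegrE ?addr_ge0 ?(ltW M0)//; apply: Mbound=> //; apply: le_trans e8.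
rewrite expr2 mulrA; apply: ler_wpM2r; first exact: ltW.
have h4: 4*eta<=4*(1/2) by rewrite ler_pM2l.
lra.
Qed.

Lemma haus_lower: ((hratio n)%:E * leb n ((fun x=> x *m E) @` A)<=hausdorff n A)%E.
Proof. by have [_]:=haus_flat tE eta0 eta1 AS Au Anu mtA. Qed.

End SlabBounds.

(** * Spherical volume as cone volume, and its density in the gnomonic chart *)

Section SphericalVolume.
Context {R: realType}.
Local Notation mu := (@lebesgue_measure R).
Variable n: nat.
Local Notation d := n.+1.
Local Notation V := 'rV[R]_d.+1.

Definition nrm (z: V): V:=(enorm z)^-1*:z.

Lemma nrm_unit z: z != 0 -> dot (nrm z) (nrm z) = 1.
move=> z0; rewrite /nrm dotZl dotZr -enormE; field.
by rewrite enorm_eq0.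
Qed.

Lemma nrmZ s z: 0<s -> nrm (s*:z) = nrm z.
move=> s0; have [->|z0]:=eqVneq z 0; first by rewrite scaler0.
rewrite /nrm enormZ gtr0_norm// scalerA; congr (_*:_); field.
by rewrite enorm_eq0 z0 gt_eqF.
Qed.

Lemma nrm_id z: dot z z = 1 -> nrm z = z.
Proof. by move=> h; rewrite /nrm enorm_unit// invr1 scale1r. Qed.

Lemma meas_nrm: mfunT nrm.
by apply: meas_rVZ=> //; apply: meas_funV; apply: meas_enorm.
Qed.

Definition cone1 (A: set V): set V := [set z | [/\ z != 0, enorm z<=1 & A (nrm z)]].

Lemma meas_cone1 A: measurable A -> measurable (cone1 A).
move=> mA; rewrite (_: cone1 A = ~` [set 0] `&` ((@enorm R _) @^-1` `]-oo, 1]%classic) `&` (nrm @^-1` A)).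
 apply: measurableI; first apply: measurableI.
 - apply: measurableC; rewrite (_: [set 0] = (@enorm R _) @^-1` [set 0]).
   by rewrite -measTI; apply: meas_enorm.
  by seteq=> z /=; [move=> ->; exact: enorm0|move/eqP; rewrite enorm_eq0=> /eqP].
 - by rewrite -measTI; apply: meas_enorm.
 - by rewrite -measTI; exact: meas_nrm.
seteq=> z /=; rewrite in_itv/=; first by move=> [/eqP].
by move=> [[/eqP]].
Qed.

Let e0: 'rV[R]_n.+3:=consv 1 0.
Let T0: 'M[R]_(n.+3, n.+2) := \matrix_(i, j) (i == lift ord0 j)%:R.

Let mulT0 (x: 'rV[R]_n.+3): x *m T0 = tailv x.
apply/rowP=> j; rewrite !mxE (bigD1 (lift ord0 j))//= big1.
 by rewrite addr0 mxE eqxx mulr1.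
by move=> i /negbTE h; rewrite mxE h mulr0.
Qed.

Let e0e0: dot e0 e0 = 1.
Proof. by rewrite dot_consv dot0l addr0 mulr1. Qed.

Let sT0: splits e0 T0.
split; [exact: e0e0|by rewrite mulT0 tailv_cons|].
apply/matrixP=> i j; rewrite !mxE (bigD1 (lift ord0 j))//= big1.
 by rewrite addr0 !mxE eqxx mulr1 (inj_eq lift_inj) eq_sym.
by move=> k /negbTE h; rewrite !mxE h mulr0.
Qed.

(** The slab estimates concern sets of codimension two. The sphere is therefore placed in a
    coordinate hyperplane of a space of one more dimension, whose unit normal e0 serves both as
    direction of projection and as normal; then c = 1 and the cone over the lifted set is
    [cone1 A]. *)
Lemma svol_small (A: set V) (eta: R): measurable A -> (forall x, A x -> dot x x = 1) ->
 (forall x y, A x -> A y -> enorm (x-y)<=eta) -> 0<eta -> 16*eta<1 -> let M:=(1-16*eta)^-1 in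
 (hausdorff d A<=(M^+(3*d.+1)*(hratio d*d.+1%:R))%:E * leb d.+1 (cone1 A))%E /\
 ((hratio d*d.+1%:R)%:E * leb d.+1 (cone1 A)<=(M^+(3*d.+1))%:E*hausdorff d A)%E.
move=> mA AS Ad eta0 eta1 M.
have [->|/set0P[u Au]]:=eqVneq A set0.
 rewrite hausdorff0 (_: cone1 set0 = set0) ?measure0 ?mule0//. by seteq=> z // [].
have uu:=AS _ Au; have [T sT]:=splits_exists uu; have [_ uT TT]:=sT.
pose uh: 'rV[R]_n.+3:=consv 0 u.
pose E: 'M[R]_(n.+3, d):=T0 *m T.
have mulE (x: 'rV[R]_n.+3): x *m E = tailv x *m T by rewrite /E mulmxA mulT0.
have tE: tframe uh e0 E.
 split.
 - by rewrite dot_consv mulr0 add0r.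
 - exact: e0e0.
 - by rewrite dot_consv dot0r mul0r addr0.
 - by rewrite mulE tailv_cons.
 split; first by rewrite mulE tailv_cons mul0mx. have [_ _ TT0]:=sT0.
 by rewrite /E trmx_mul -mulmxA (mulmxA T0^T) TT0 mul1mx.
pose Ah: set 'rV[R]_n.+3:=consv 0 @` A.
have AhS x: Ah x -> dot x x = 1.
 by move=> [y Ay <-]; rewrite dot_consv mulr0 add0r AS.
have ec (x y: V): enorm (consv 0 x-consv 0 y) = enorm (x-y).
 by rewrite consvN consvD oppr0 addr0 /enorm dot_consv mulr0 add0r.
have Ahu x: Ah x -> enorm (x-uh)<=eta.
 by move=> [y Ay <-]; rewrite ec Ad.
have Ahnu x y: Ah x -> Ah y -> `|dot (x-y) e0| <= eta*enorm (x-y).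
 move=> [x' _ <-] [y' _ <-]; rewrite consvN consvD oppr0 addr0 dot_consv mul0r dot0r addr0 normr0. pos.
have Ahinj x y s: Ah x -> Ah y -> 0<s -> x *m T0 = s*:(y *m T0) -> x = y.
 move=> [x' Ax <-] [y' Ay <-] s0; rewrite !mulT0 !tailv_cons=> h; congr consv.
 by rewrite -(nrm_id (AS _ Ax)) -(nrm_id (AS _ Ay)) h nrmZ.
have Ahne x: Ah x -> x *m T0 != 0.
 move=> [x' Ax <-]; rewrite mulT0 tailv_cons -dot_eq0 AS//; exact: oner_neq0.
have Epos x: A x -> 0<=dot x u.
 move=> Ax; have h: dot (x-u) (x-u)<=eta^+2.
  by rewrite -enormE ler_sqr ?nnegrE ?enorm_ge0 ?(ltW eta0)// Ad.
 move: h; rewrite dotBl !dotBr AS// uu (dotC u). have: eta^+2<=1 by rewrite expr_le1// ?ltW//; lra. by lra.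
have iE: (fun x=> x *m E) @` Ah = (fun t=> Num.sqrt (1-dot t t)*:u+t *m T^T) @^-1` A.
 seteq=> t /=.
  move=> [_ [x Ax <-] <-]; rewrite mulE tailv_cons. have:=splits_dot x x sT; rewrite AS// => h.
  rewrite (_: 1-_ = dot x u^+2); last by rewrite h expr2; ring.
  by rewrite sqrtr_sqr ger0_norm ?Epos// -splitsE.
 move=> At; exists (consv 0 (Num.sqrt (1-dot t t)*:u+t *m T^T)).
  by exists (Num.sqrt (1-dot t t)*:u+t *m T^T).
 by rewrite mulE tailv_cons mulmxDl -scalemxAl uT scaler0 add0r (splits_tr _ sT).
have mtA: measurable ((fun x=> x *m E) @` Ah).
 rewrite iE -measTI; apply: (_: mfunT _)=> //. apply: meas_rVD; last by apply: meas_mulmx.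
 apply: meas_rVZ=> //; apply: (@mcomp _ _ _ _ _ _ (@Num.sqrt R)).
  by apply: continuous_measurable_fun; exact: sqrt_continuous.
 by apply: measurable_funB=> //; exact: meas_dot.
have Dc: rcone T0 Ah = cone1 A.
 seteq=> z /=.
  move=> [_ [s [[x Ax <-] s0 s1 ->]]]; rewrite mulT0 tailv_cons.
  have x0: x != 0 by rewrite -dot_eq0 AS// oner_neq0. split; first by rewrite scaler_eq0 negb_or gt_eqF.
   by rewrite enormZ gtr0_norm// enorm_unit ?AS// mulr1. by rewrite nrmZ// nrm_id// AS.
 move=> [z0 z1 Az]; exists (consv 0 (nrm z)), (enorm z); split.
 - by exists (nrm z).
 - by rewrite enorm_gt0.
 - by [].
 by rewrite mulT0 tailv_cons /nrm scalerA mulfV ?scale1r// enorm_eq0.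
have mD: measurable (rcone T0 Ah) by rewrite Dc; exact: meas_cone1.
have HA: hausdorff d Ah = hausdorff d A.
 by apply: haus_isometry=> x y _ _; exact: ec.
have eta1': eta<=1/2 by lra.
have c0: 0<dot e0 e0 by rewrite e0e0.
have Ee: 8*eta*(1+(dot e0 e0)^-1) = 16*eta by rewrite e0e0 invr1; ring.
have e1: 8*eta*(1+(dot e0 e0)^-1)<1 by rewrite Ee.
have k3 m: (m+(m.+1+m.+1)<=3 * m.+1)%N by clear; lia.
have k4 m: (m<=3 * m)%N by rewrite leq_pmull.
have a1:=slab_upper sT0 tE c0 eta0 eta1' AhS Ahu Ahnu Ahinj Ahne mtA mD e1.
have a2:=slab_lower sT0 tE c0 eta0 eta1' AhS Ahu Ahnu Ahinj Ahne mtA mD e1.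
have a3:=haus_upper tE c0 eta0 eta1' AhS Ahu Ahnu mtA e1.
have a4:=haus_lower tE eta0 eta1' AhS Ahu Ahnu mtA.
have t0: (0<=leb d ((fun x=> x *m E) @` Ah))%E by [].
have q0: (0<=leb d.+1 (cone1 A))%E by [].
have H0:=hausdorff_ge0 d A.
move: a1 a2 a3 a4; rewrite Ee e0e0 HA Dc mul1e mulr1 -/M.
have M1: 1<=M by rewrite /M invf_ge1 ?subr_gt0//; lra.
have h0: 0 < @hratio R d:=hratio_gt0 _.
move: t0 q0 H0; move: (leb d _) (leb d.+1 _) (hausdorff d A)=> t q H t0 q0 H0 a1 a2 a3 a4.
have Mk k1 k2: (k1<=k2)%N -> M^+k1<=M^+k2 by move=> ?; exact: ler_weXn2l.
have M0 k: 0<=M^+k by rewrite exprn_ge0// (le_trans ler01).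
split.
 apply: le_trans a3 _. apply: le_trans (lee_wpmul2l _ a1) _; first pos.
 rewrite muleA -EFinM; apply: lee_wpmul2r=> //; rewrite lee_fin mulrACA -exprD. apply: ler_wpM2r; first pos.
 by apply: Mk; exact: k3.
rewrite EFinM -muleA.
apply: le_trans (lee_wpmul2l _ a2) _; first pos.
rewrite muleCA; apply: le_trans (lee_wpmul2l _ a4) _; first pos.
apply: lee_wpmul2r=> //.
by rewrite lee_fin; apply: Mk; exact: k4.
Qed.

End SphericalVolume.

Section SphericalVolumeFormula.
Context {R: realType}.
Local Notation mu := (@lebesgue_measure R).

Lemma exists_small_error m (L: R): 1<L -> exists2 x0, 0<x0<1 & forall x, 0<=x<=x0 -> (1-x)^-1^+m<=L.
move=> L1; have L0: 0<L by rewrite (lt_trans ltr01).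
have iL: L^-1<1 by rewrite invf_lt1.
have p: 0<(m+2)%:R :> R by [].
have m0: 0<1-L^-1 by rewrite subr_gt0.
have m2: 2<=(m+2)%:R :> R by rewrite ler_nat leq_addl.
have iL0: 0<L^-1 by rewrite invr_gt0.
exists ((1-L^-1)/(m+2)%:R).
 by rewrite divr_gt0//= ltr_pdivrMr//; lra.
move=> x /andP[x0]; rewrite ler_pdivlMr// => hx.
have x1: x<1.
 have: x*2<=x*(m+2)%:R by rewrite ler_wpM2l. lra.
have bern k: 1-k%:R*x<=(1-x)^+k.
 elim: k=> [|k IH]; first by rewrite expr0 mul0r subr0. rewrite exprS -natr1.
 have:=ler_wpM2l (_: 0<=1-x) IH; rewrite subr_ge0=> /(_ (ltW x1)). have: 0<=x*(k%:R*x) by rewrite !mulr_ge0.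
 lra.
rewrite exprVn -[leRHS]invrK lef_pV2 ?posrE ?exprn_gt0 ?subr_gt0//.
apply: le_trans (bern m).
have: m%:R*x<=x*(m+2)%:R by rewrite mulrC ler_wpM2l// ler_nat leq_addr.
lra.
Qed.

Lemma ler_mulgt1 (a b: R): 0<=b -> (forall L, 1<L -> a<=L*b) -> a<=b.
move=> b0 H; apply/ler_addgt0Pr=> e e0.
have b1: 0<b+1 by rewrite ltr_wpDl.
apply: le_trans (H (1+e/(b+1)) _) _; first by rewrite ltrDl divr_gt0.
by rewrite mulrDl mul1r lerD2l mulrAC ler_pdivrMr// ler_wpM2l ?(ltW e0)// lerDl.
Qed.

Lemma grid_partition N (A: set 'rV[R]_N) (eta: R): measurable A -> 0<eta ->
 exists F: (set 'rV[R]_N)^nat, [/\ forall k, measurable (F k), trivIset setT F,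
  A = \bigcup_k F k & forall k x y, F k x -> F k y -> enorm (x-y)<=eta].
move=> mA eta0; pose h: R:=eta/(2*N%:R+1).
have N1: 0<2*N%:R+1 :> R by [].
have h0: 0<h by rewrite divr_gt0.
pose C k: set 'rV[R]_N:=if (unpickle k: option {ffun 'I_N -> int}) is Some a
 then cube (\row_i ((a i)%:~R*h)) h else set0.
have mC k: measurable (C k).
 by rewrite /C; case: unpickle=> [a|]//; exact: meas_cube.
exists (fun k=> A `&` seqDU C k); split.
- move=> k; apply: measurableI=> //; apply: measurableD=> //.
 by apply: bigsetU_measurable=> i _.
- exact/trivIset_setIl/trivIset_seqDU.
- rewrite -setI_bigcupr -seqDU_bigcup_eq; seteq=> x //; last by move=> [].
 move=> Ax; split=> //; exists (pickle [ffun i=> Num.floor (x 0 i/h)])=> //.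
 rewrite /C pickleK=> i; rewrite !mxE ffunE. have /andP[]:=@real_floor_itv _ _ (num_real (x 0 i/h)).
 rewrite ler_pdivlMr// ltr_pdivrMr// intrD mulrDl mul1r=> l1 l2.
 by rewrite ger0_norm ?subr_ge0//; move: l1 l2; lra.
move=> k x y [_ [Cx _]] [_ [Cy _]]; move: Cx Cy; rewrite /C; case: unpickle=> [a|]// Cx Cy.
apply: le_trans (enorm_le_sum _) _; apply: (@le_trans _ _ (\sum_(i<N) (2*h))).
 apply: ler_sum=> i _; rewrite !mxE; have:=Cx i; have:=Cy i. by rewrite !ler_norml; lra.
rewrite sumr_const card_ord -[_ *+ N]mulr_natl mulrCA mulrA.
by rewrite /h mulrCA ler_piMr ?(ltW eta0)// ler_pdivrMr// mul1r mulrC lerDl.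
Qed.

Variable n: nat.
Local Notation d := n.+1.

Lemma cone1_unit_lty (A: set 'rV[R]_d.+1): measurable A -> (leb d.+1 (cone1 A) < +oo)%E.
Proof. by move=> mA; apply: (@leb_lty _ _ _ 1)=> [x []|]//; exact: meas_cone1. Qed.

(** Cut A into countably many pieces of small diameter, sum the estimates for small sets, and let
    the error factor L tend to 1. *)
Lemma svol_cone (A: set 'rV[R]_d.+1): measurable A -> (forall x, A x -> dot x x = 1) ->
 hausdorff d A = ((hratio d*d.+1%:R)%:E * leb d.+1 (cone1 A))%E.
move=> mA AS; set K:=hratio d*d.+1%:R; have K0: 0<=K by rewrite mulr_ge0// ltW// hratio_gt0.
have part L: 1<L -> (hausdorff d A<=(L*K)%:E * leb d.+1 (cone1 A))%E /\
  (K%:E * leb d.+1 (cone1 A)<=L%:E*hausdorff d A)%E.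
 move=> L1; have [x0 /andP[x00 x01] hx]:=exists_small_error (3*d.+1) L1. pose eta:=x0/16.
 have eta0: 0<eta by rewrite divr_gt0. have E16: 16*eta = x0 by rewrite /eta mulrC mulfVK.
 have [F [mF tF AF dF]]:=grid_partition mA eta0. have FA k: F k `<=` A by rewrite AF; exact: bigcup_sup.
 have small k:=@svol_small R n (F k) eta (mF k) (fun x h=> AS x (FA k x h)) (dF k) eta0
  (ltac:(by rewrite E16)). have cF: cone1 A = \bigcup_k cone1 (F k). rewrite AF; seteq=> z /=.
   by move=> [h1 h2 [k _ h3]]; exists k. by move=> [k _ [h1 h2 h3]]; split=> //; exists k.
 have tcF: trivIset setT (fun k=> cone1 (F k)).
  apply/trivIsetP=> i j _ _ ij; have /trivIsetP/(_ i j I I ij) t:=tF. seteq=> // z [[_ _ h1] [_ _ h2]].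
  by have: (F i `&` F j) (nrm z) by []; rewrite t.
 have mcF k: measurable (cone1 (F k)) by exact: meas_cone1.
 have HA: (hausdorff d A = \sum_(k <oo) hausdorff d (F k))%E.
  by rewrite AF; apply: (@measure_semi_bigcup _ _ _ (@hausB R d d.+1))=> //; rewrite -AF.
 have LA: (leb d.+1 (cone1 A) = \sum_(k <oo) leb d.+1 (cone1 (F k)))%E.
  by rewrite cF; apply: measure_semi_bigcup=> //; rewrite -cF; exact: meas_cone1.
 have ML: (1-16*eta)^-1^+(3*d.+1)<=L by apply: hx; rewrite E16 lexx ltW.

 rewrite HA LA; split.
  rewrite -nneseriesZl; last by []. apply: lee_nneseries=> [k _ _|k _]; first exact: hausdorff_ge0.
  have [h _]:=small k; apply: le_trans h _. by apply: lee_wpmul2r=> //; rewrite lee_fin ler_wpM2r.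
 rewrite -nneseriesZl; last by []. rewrite -nneseriesZl; last by move=> *; exact: hausdorff_ge0.
 apply: lee_nneseries=> [k _ _|k _]; first by rewrite mule_ge0// lee_fin.
 have [_ h]:=small k; apply: le_trans h _. by apply: lee_wpmul2r; [exact: hausdorff_ge0|rewrite lee_fin].
have:=cone1_unit_lty mA; have: (0<=leb d.+1 (cone1 A))%E by [].
move: part; case: (leb _ _)=> [q| |]// part q0 _.
have {}q0: 0<=q by [].
have Hf: hausdorff d A \is a fin_num.
 rewrite ge0_fin_numE; last exact: hausdorff_ge0.
 by have [h _]:=part 2 (ltac:(lra)); apply: le_lt_trans h _; rewrite -EFinM ltry.
move: part; rewrite -(fineK Hf) -EFinM=> part; congr EFin.
have H0: 0<=fine (hausdorff d A) by apply: fine_ge0; exact: hausdorff_ge0.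
apply/eqP; rewrite eq_le; bsplit; apply: ler_mulgt1=> //; first exact: mulr_ge0.
 by move=> L L1; have [h _]:=part L L1; rewrite mulrA -lee_fin EFinM.
by move=> L L1; have [_ h]:=part L L1; rewrite -lee_fin EFinM.
Qed.

Definition gno (o: 'rV[R]_d.+1) (T: 'M[R]_(d.+1, d)) (A: set 'rV[R]_d.+1): set 'rV[R]_d :=
 [set y | A (nrm (o+y *m T^T))].

(** The density of spherical volume in the gnomonic chart. *)
Definition wsph (y: 'rV[R]_d): R:=(Num.sqrt (1+dot y y))^-1^+d.+1.

Lemma meas_gno o T A: measurable A -> measurable (gno o T A).
move=> mA; rewrite (_: gno o T A = (fun y=> nrm (o+y *m T^T)) @^-1` A)//.
rewrite -measTI; apply: (_: mfunT _)=> //.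
apply: mcomp; first exact: meas_nrm.
by apply: meas_rVD=> //; exact: meas_mulmx.
Qed.

Lemma meas_wsph: mfunT wsph.
apply: measurable_funX; apply: meas_funV; apply: (@mcomp _ _ _ _ _ _ (@Num.sqrt R)).
 by apply: continuous_measurable_fun; exact: sqrt_continuous.
by apply: measurable_funD=> //; exact: meas_dot.
Qed.

Lemma wsph_ge0 y: 0<=wsph y.
Proof. by rewrite exprn_ge0// invr_ge0 sqrtr_ge0. Qed.

Lemma int_power (r: R): 0<r -> (\int[mu]_(s in `[0%R, r]) (s^+d)%:E = (r^+d.+1/d.+1%:R)%:E)%E.
move=> r0.
have dF (s: R): is_derive s 1 (fun s=> s^+d.+1/d.+1%:R) (s^+d).
 have h1: is_derive s 1 (fun s: R=> s^+d.+1) (d.+1%:R*s^+d).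
  by apply: DeriveDef; [exact: exprn_derivable|rewrite exp_derive /GRing.scale/= mulr1].
 have h2:=@is_deriveZ R R^o R^o _ (d.+1%:R^-1) s 1 _ h1.
 have -> : s^+d = d.+1%:R^-1*:(d.+1%:R*s^+d) by rewrite /GRing.scale/= mulKf// pnatr_eq0.
 have -> : (fun s: R=> s^+d.+1/d.+1%:R) = d.+1%:R^-1 \*: (fun s: R=> s^+d.+1).
  by apply/funext=> t; rewrite /= mulrC. exact: h2.
rewrite (@continuous_FTC2 _ _ (fun s=> s^+d.+1/d.+1%:R) 0 r)//.
- by rewrite expr0n/= mul0r sube0.
- by apply: continuous_subspaceT; exact: exprn_continuous.
- have cF: continuous (fun s: R=> s^+d.+1/d.+1%:R).
  by move=> s; apply: cvgM; [exact: exprn_continuous|exact: cvg_cst]. split.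
 + by [].
 + by apply: cvg_at_right_filter; exact: cF.
 + by apply: cvg_at_left_filter; exact: cF.
by move=> s _; rewrite derive1E; have [_ ->]:=dF s.
Qed.

(** At height s along o, the cone is s times the set of y in the chart with s sqrt(1 + |y|^2) <= 1.
    Integrating s^d over the admissible heights gives [wsph] divided by d + 1. *)
Lemma leb_cone1 o T (A: set 'rV[R]_d.+1): splits o T -> measurable A -> (forall x, A x -> 0<dot x o) ->
 (leb d.+1 (cone1 A) = (d.+1%:R^-1)%:E * \int[leb d]_(y in gno o T A) (wsph y)%:E)%E.
move=> so mA Ao; have [oo oT TT]:=so.
have mC:=meas_cone1 mA.
have mg:=meas_gno o T mA.
pose l (y: 'rV[R]_d):=Num.sqrt (1+dot y y).
have l0 y: 0<l y by rewrite sqrtr_gt0 ltr_pwDl// dot_ge0.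
have ml: mfunT l.
 apply: (@mcomp _ _ _ _ _ _ (@Num.sqrt R)).
  by apply: continuous_measurable_fun; exact: sqrt_continuous.
 by apply: measurable_funD=> //; exact: meas_dot.
have enl y: enorm (o+y *m T^T) = l y.
 rewrite /enorm /l; congr Num.sqrt; rewrite dotDl !dotDr oo (dotC o) splits_perp//.
 by rewrite addr0 add0r dot_mulmx trmxK (splits_tr _ so).
pose D := [set w: 'rV[R]_d.+1 | 0<headv w /\ (headv w * l (tailv w)<=1 /\ gno o T A (tailv w))].
have mD: measurable D.
 apply: measurableI; last apply: measurableI.
 - rewrite [X in measurable X](_: _ = @headv R d @^-1` `]0, +oo[%classic).
   by rewrite -measTI; apply: meas_headv. by seteq=> w /=; rewrite in_itv/= andbT.
 - rewrite [X in measurable X](_: _ = (fun w=> headv w * l (tailv w)) @^-1` `]-oo, 1]%classic).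
   rewrite -measTI; apply: (_: mfunT _)=> //. apply: measurable_funM; first exact: meas_headv.
   by apply: (mcomp ml); exact: meas_tailv. by [].
 - by rewrite -measTI; apply: (@meas_tailv R d).
pose psi (w: 'rV[R]_d.+1):=(\1_D w*headv w^+d)%:E.
have mpsi: mfunT psi.
 apply/mEFP; apply: measurable_funM=> //; apply: measurable_funX. exact: meas_headv.
have psi0 w: (0<=psi w)%E.
 rewrite lee_fin indicE; have [/set_mem[h _]|_]:=boolP (w \in D); last by rewrite mul0r. pos.
have inD s y: (consv s y \in D) = [&& 0<s, s * l y<=1 & y \in gno o T A].
 apply/idP/idP; rewrite inE /D/= headv_cons tailv_cons.
  by move=> [-> [-> h]]; rewrite mem_set. by move=> /and3P[-> -> /set_mem].
rewrite (leb_unsplit so mC) int_lebS1; last 2 first.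
- by apply/mEFP; apply: mcomp=> //; exact: meas_unsplit_rV.
- by [].
transitivity (\int[leb d.+1]_w psi w)%E.
 rewrite (int_lebS1 mpsi psi0); apply: eq_integral=> s _. have [s0|s0]:=leP s 0.
  transitivity (0: \bar R)%E; last first.
   by apply/esym/integral0_eq=> y _; rewrite /psi indicE inD ltNge s0/= mul0r.
  apply: integral0_eq=> y _; rewrite indicE memNset//= /unsplit_rV headv_cons tailv_cons.
  move=> [z0 _ /Ao]; rewrite /nrm dotZl dotDl dotZl oo mulr1 splits_perp// addr0.
  by rewrite pmulr_rgt0 ?invr_gt0 ?enorm_gt0// ltNge s0. rewrite -(@leb_scale _ d s); last 3 first.
 - exact: s0.
 - apply/mEFP; apply: mcomp=> //.
  apply: mcomp; first exact: meas_unsplit_rV. exact: meas_consv.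
 - by [].
 rewrite -ge0_integralZl//; last 2 first.
 - apply/mEFP; apply: mcomp=> //.
  apply: mcomp; first exact: meas_unsplit_rV. by apply: meas_consv=> //; exact: meas_rVZ.
 - pos.
 apply: eq_integral=> y _; rewrite -EFinM /psi headv_cons mulrC; congr (_*_)%:E.
 rewrite !indicE inD s0/=; congr ((nat_of_bool _)%:R).
 have E1: unsplit_rV o T (consv s (s*:y)) = s*:(o+y *m T^T).
  by rewrite /unsplit_rV headv_cons tailv_cons scalerDr scalemxAl.
 have ne: o+y *m T^T != 0 by rewrite -enorm_gt0 enl. apply/idP/idP.
  move=> /set_mem; rewrite E1=> -[_ h1]; rewrite nrmZ// => h2.
  by rewrite mem_set// andbT; move: h1; rewrite enormZ gtr0_norm// enl.
 move=> /andP[h1 /set_mem h2]; apply: mem_set; rewrite E1; split.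
 - by rewrite scaler_eq0 negb_or gt_eqF.
 - by rewrite enormZ gtr0_norm// enl.
 - by rewrite nrmZ.
rewrite (int_lebS2 mpsi psi0) [in RHS]integral_mkcond -ge0_integralZl//; last 2 first.
- by apply/(measurable_restrictT _ mg); apply: measurable_funTS; apply/mEFP; exact: meas_wsph.
- by move=> y _; rewrite patchE; case: ifP=> _ //; rewrite lee_fin wsph_ge0.
apply: eq_integral=> y _; rewrite patchE; have il0: 0<(l y)^-1 by rewrite invr_gt0.
transitivity (\int[mu]_s (((y \in gno o T A)%:R*(\1_(`[0%R, (l y)^-1]%classic) s*s^+d))%:E))%E.
 apply: eq_integral=> s _; rewrite /psi headv_cons !indicE inD mulrA; congr (_%:E).
 rewrite (_: (s \in `[0, (l y)^-1]%classic) = (0<=s<=(l y)^-1)); last first.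
  by apply/idP/idP; rewrite inE/= in_itv. rewrite -[X in s<=X]mul1r ler_pdivlMr//.
 have [->|s0]:=eqVneq s 0; first by rewrite expr0n/= !mulr0. rewrite lt_neqAle eq_sym s0/=; congr (_*_).
 by rewrite -natrM mulnb; congr ((nat_of_bool _)%:R); rewrite andbA andbC.
rewrite (@ge0_integralZl_real _ _ _ mu _ _ (fun s=> \1_(`[0%R, (l y)^-1]%classic) s*s^+d))//.
- transitivity (((y \in gno o T A)%:R: R)%:E * \int[mu]_(s in `[0%R, (l y)^-1%R]) (s^+d)%:E)%E.
  congr (_*_)%E; rewrite [RHS]integral_mkcond; apply: eq_integral=> s _.
  by rewrite patchE indicE; case: ifP; rewrite ?mul1r ?mul0r.
 rewrite int_power//; case: ifP=> _; last by rewrite mul0e mule0. by rewrite mul1e -EFinM /wsph mulrC.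
- by apply: measurable_funM=> //; exact: measurable_funX.
move=> s; rewrite indicE; have [/set_mem/=|_]:=boolP (s \in _); last by rewrite mul0r.
by rewrite in_itv/= => /andP[h _]; rewrite mul1r exprn_ge0.
Qed.

Lemma svol_gno o T (A: set 'rV[R]_d.+1): splits o T -> measurable A ->
 (forall x, A x -> dot x x = 1) -> (forall x, A x -> 0<dot x o) ->
 (hausdorff d A = (hratio d)%:E * \int[leb d]_(y in gno o T A) (wsph y)%:E)%E.
move=> so mA AS Ao; rewrite svol_cone// (leb_cone1 so)// muleA -EFinM; congr (_%:E*_)%E.
by rewrite mulfK.
Qed.

End SphericalVolumeFormula.

(** * Radial functions, concavity in the weighted volume, bathtub principle *)

Section RadialCalculus.
Context {R: realType}.

Lemma le_of_derive (f df: R -> R) (a b: R): a<=b -> (forall x: R, a<=x<=b -> is_derive x 1 f (df x)) ->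
 (forall x, a<=x<=b -> 0<=df x) -> f a<=f b.
rewrite le_eqVlt=> /predU1P[->//|ab] hf df0.
have [||c]:=@MVT R f df a b ab.
- by move=> x; rewrite in_itv/= => /andP[/ltW h1 /ltW h2]; apply: hf; rewrite h1.
- apply: derivable_within_continuous=> x; rewrite in_itv/= => h.
 by have []:=hf _ h.
rewrite in_itv/= => /andP[/ltW h1 /ltW h2] e.
by rewrite -subr_ge0 e mulr_ge0// ?subr_ge0 ?(ltW ab)// df0// h1.
Qed.

Definition wrad (d: nat) (r: R): R:=(Num.sqrt (1+r^+2))^-1^+d.+1.
Definition aexp (d: nat): R:=(d%:R^+2-1)/(2*d%:R).
Definition kexp (d: nat): R:=(d%:R-1)/(2*d%:R).
(** With r = tan(theta) this is sin(theta)^d cos(theta)^(-1/d): what a boundary point at polar angle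
    theta contributes to the first term of the arithmetic-geometric mean inequality, per unit of
    solid angle. *)
Definition frad (d: nat) (r: R): R:=r^+d*expR (- aexp d * ln (1+r^+2)).
(** The derivative of [frad] with respect to weighted volume, that is, with respect to the measure
    [wrad] d(r^d). *)
Definition crad (d: nat) (r: R): R := expR (- kexp d * ln (1+r^+2))*(1+r^+2/d%:R^+2).

Lemma onesqr_gt0 (r: R): 0<1+r^+2.
Proof. by rewrite ltr_pwDl// sqr_ge0. Qed.

Lemma invsqrt_exp (t: R) k: 0<t -> (Num.sqrt t)^-1^+k = expR (- (k%:R/2) * ln t).
move=> t0; have s0: 0<Num.sqrt t by rewrite sqrtr_gt0.
have -> : ln t = 2 * ln (Num.sqrt t).
 by rewrite -{1}(sqr_sqrtr (ltW t0)) expr2 lnM ?posrE// mulr2n mulrDl mul1r.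
rewrite mulNr mulrA divfK// expRN mulrC expRM_natr lnK ?posrE// exprVn//.
Qed.

Lemma wrad_exp d r: wrad d r = expR (- (d.+1%:R/2) * ln (1+r^+2)).
Proof. by rewrite /wrad invsqrt_exp// onesqr_gt0. Qed.

Lemma wrad_gt0 d r: 0<wrad d r. Proof. by rewrite wrad_exp expR_gt0. Qed.

Lemma crad_gt0 d r: 0<crad d r.
Proof. by rewrite mulr_gt0 ?expR_gt0// ltr_pwDl// divr_ge0 ?sqr_ge0. Qed.

Lemma wrad_le d r r': 0<=r -> r<=r' -> wrad d r'<=wrad d r.
move=> r0 rr; have r0':=le_trans r0 rr; rewrite !wrad_exp ler_expR.
apply: ler_wnM2l; first by rewrite oppr_le0 divr_ge0.
by rewrite ler_ln ?posrE ?onesqr_gt0// lerD2l ler_sqr ?nnegrE.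
Qed.

Lemma wrad_lt d r r': 0<=r -> r<r' -> wrad d r'<wrad d r.
move=> r0 rr; have r0':=le_trans r0 (ltW rr); rewrite !wrad_exp ltr_expR.
rewrite ltr_nM2l; last by rewrite oppr_lt0 divr_gt0.
by rewrite ltr_ln ?posrE ?onesqr_gt0// ltrD2l ltr_sqr ?nnegrE.
Qed.

Lemma cont_wrad d: continuous (wrad d).
move=> r; rewrite (_: wrad d = (fun x=> x^+d.+1) \o (fun x=> x^-1) \o (@Num.sqrt R) \o (fun r=> 1+r^+2))//.
apply: continuous_comp.
 by apply: cvgD; [exact: cvg_cst|exact: exprn_continuous].
apply: continuous_comp; first exact: sqrt_continuous.
apply: continuous_comp; last exact: exprn_continuous.
by apply: cvgV; rewrite ?gt_eqF ?sqrtr_gt0 ?onesqr_gt0//; exact: cvg_id.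
Qed.

Lemma is_derive_pow (d: nat) (s: R): is_derive s 1 (fun s: R=> s^+d.+1) (d.+1%:R*s^+d).
Proof. by apply: DeriveDef; [exact: exprn_derivable|rewrite exp_derive /GRing.scale/= mulr1]. Qed.

Lemma is_derive_ln1 (k r: R): is_derive r 1 (fun r=> k * ln (1+r^+2)) (k*((1+r^+2)^-1*(2*r))).
have h1: is_derive r 1 (fun r: R=> 1+r^+2) (2*r).
 have:=@is_deriveD R R^o R^o (cst 1) (fun r=> r^+2) r 1 0 _ (is_derive_cst _ _ _) (is_derive_pow 1 r).
 by rewrite add0r expr1.
have h2:=@is_derive1_comp R _ _ r _ _ (is_derive1_ln (onesqr_gt0 r)) h1.
have:=@is_deriveZ R R^o R^o _ k r 1 _ h2.
by [].
Qed.

Lemma is_derive_explin (k r: R): is_derive r 1 (fun r=> expR (k * ln (1+r^+2)))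
 (expR (k * ln (1+r^+2))*(k*((1+r^+2)^-1*(2*r)))).
Proof. exact: (is_derive1_comp (is_derive_expR _) (is_derive_ln1 k r)). Qed.

Lemma is_derive_frad n (r: R): is_derive r 1 (frad n.+1) (n.+1%:R*r^+n*wrad n.+1 r*crad n.+1 r).
set d:=n.+1; set L:=ln (1+r^+2).
have:=@is_deriveM R R^o (fun s=> s^+d) (fun r=> expR (- aexp d * ln (1+r^+2))) r 1 _ _
 (is_derive_pow n r) (is_derive_explin (- aexp d) r).
congr (is_derive _ _ _ _); rewrite /GRing.scale/= -/L -/d.
pose P:=expR (- (aexp d+1)*L).
have p0:=onesqr_gt0 r.
have d0: d%:R != 0 :> R by rewrite pnatr_eq0.
have EE: expR (- aexp d*L) = P*(1+r^+2).
 have e1: expR L = 1+r^+2 by rewrite /L lnK ?posrE.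
 by rewrite [in RHS](_: 1+r^+2 = expR L)// /P -expRD; congr expR; ring.
have EP: wrad d r*crad d r = P*(1+r^+2/d%:R^+2).
 rewrite wrad_exp /crad mulrA -expRD -/L; congr (expR _*_).
 by rewrite -mulrDl; congr (_*L); rewrite /aexp /kexp -natr1; field.
rewrite -[RHS]mulrA EP EE /aexp [r^+d]exprS.
have p1: 1+r^+2 != 0 by rewrite gt_eqF.
by field; rewrite ?d0 ?p1.
Qed.

(** The logarithmic derivative of [crad] has the sign of y^2 - d(d-2). This is the origin of the
    radius alpha_d. *)
Lemma crad_le n r r': (2<=n)%N -> 0<=r -> r<=r' -> r'^+2<=n%:R*(n%:R-2) -> crad n r'<=crad n r.
move=> n2 r0 rr h; have r0':=le_trans r0 rr.
have n2': 2<=n%:R :> R by rewrite ler_nat.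
have nn: 0<n%:R^+2 :> R by rewrite exprn_gt0//; lra.
pose q (y: R):=1+y^+2/n%:R^+2.
have q0 y: 0<q y by rewrite ltr_pwDl// divr_ge0 ?sqr_ge0.
pose g y:=kexp n * ln (1+y^+2)-ln (q y).
have cg y: crad n y = expR (- g y).
 by rewrite /crad /g opprB [in RHS]addrC expRD lnK ?posrE ?q0// mulNr.
rewrite !cg ler_expR lerN2.
apply: (@le_of_derive g (fun y=> kexp n*((1+y^+2)^-1*(2*y))-(q y)^-1*(2*y/n%:R^+2)) r r' rr)=> [y _|y /andP[ry yr]].
 have h1: is_derive y 1 q (2*y/n%:R^+2).
  have h3:=@is_deriveZ R R^o R^o _ (n%:R^-2) y 1 _ (is_derive_pow 1 y).
  have:=@is_deriveD R R^o R^o (cst 1) _ y 1 0 _ (is_derive_cst _ _ _) h3.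
  rewrite add0r expr1 /GRing.scale/= mulrC=> h4. rewrite (_: q = cst 1+n%:R^-2 \*: (fun s=> s^+2))//.
  by apply/funext=> t; rewrite /q /= /GRing.add/= mulrC.
 have h2:=@is_derive1_comp R _ _ y _ _ (is_derive1_ln (q0 y)) h1.
 exact: (@is_deriveB R R^o R^o _ _ y 1 _ _ (is_derive_ln1 (kexp n) y) h2).
have y0: 0<=y by exact: le_trans ry.
have yh: y^+2<=n%:R*(n%:R-2) by apply: le_trans h; rewrite ler_sqr ?nnegrE.
have p1:=onesqr_gt0 y.
have N0: 0<n%:R :> R by lra.
have p2: 0<n%:R^+2+y^+2 by rewrite ltr_pwDl// sqr_ge0.
have q0y:=q0 y.
rewrite (_: _-_ = 2*y*((n%:R+1)*(n%:R*(n%:R-2)-y^+2)) / (2*n%:R*(1+y^+2)*(n%:R^+2+y^+2))); last first.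
 have -> : q y = (n%:R^+2+y^+2)/n%:R^+2 by rewrite /q; field; rewrite gt_eqF.
 by rewrite /kexp; field; rewrite !gt_eqF.
apply: divr_ge0; last by rewrite !mulr_ge0 ?ltW.
rewrite mulr_ge0//; first by rewrite mulr_ge0.
by rewrite mulr_ge0 ?subr_ge0// addr_ge0// ltW.
Qed.

Section cone.
Variable n: nat.
Local Notation d := n.+1.
Variable S: set 'rV[R]_d.
Hypotheses (mS: measurable S) (cS: forall s x, 0<s -> S x -> S (s*:x)).

Let B (r: R): set 'rV[R]_d := [set x | enorm x<=r].

Lemma meas_eball (r: R): measurable (B r).
rewrite (_: B r = (@enorm R d) @^-1` `]-oo, r]%classic).
 by rewrite -measTI; apply: meas_enorm.
by seteq=> x /=; rewrite in_itv.
Qed.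

Let mSB r: measurable (S `&` B r).
Proof. by apply: measurableI=> //; exact: meas_eball. Qed.

Let fSB r: (leb d (S `&` B r) < +oo)%E.
Proof. by apply: (@leb_lty _ _ _ r)=> // x []. Qed.

Definition coneR: R:=fine (leb d (S `&` B 1)).
Definition coneW (r: R): R:=fine (\int[leb d]_(x in S `&` B r) (wsph x)%:E).

Lemma coneR_ge0: 0<=coneR. Proof. exact: fine_ge0. Qed.

Lemma coneRE: leb d (S `&` B 1) = coneR%:E.
Proof. by rewrite fineK// ge0_fin_numE. Qed.

Lemma leb_coneball (r: R): 0<r -> leb d (S `&` B r) = (r^+d*coneR)%:E.
move=> r0; rewrite EFinM -coneRE -(leb_setZ r0)//; congr (_ * leb _ _)%E.
have r1: 0<r^-1 by rewrite invr_gt0.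
seteq=> x [/= h1 h2]; split.
- by have:=cS r1 h1; rewrite scalerA mulVf ?scale1r// gt_eqF.
- by move: h2; rewrite /B/= enormZ gtr0_norm// ger_pMr.
- exact: cS.
- by rewrite /B/= enormZ gtr0_norm// ger_pMr.
Qed.

Lemma wsph_wrad (x: 'rV[R]_d): wsph x = wrad d (enorm x).
Proof. by rewrite /wsph /wrad enormE. Qed.

Lemma int_wsph_bounds (A: set 'rV[R]_d) a c1 c2: measurable A -> leb d A = a%:E ->
 0<=c1 -> 0<=c2 -> (forall x, A x -> c1<=wsph x<=c2) -> ((c1*a)%:E <= \int[leb d]_(x in A) (wsph x)%:E)%E /\
 (\int[leb d]_(x in A) (wsph x)%:E<=(c2*a)%:E)%E.
move=> mA Aa c10 c20 Ac; rewrite !EFinM -Aa -!integral_cst//.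
have mw D: measurable_fun D (fun x: 'rV[R]_d=> (wsph x)%:E).
 by apply: measurable_funTS; apply/mEFP; exact: meas_wsph.
split; apply: ge0_le_integral=> //.
- by move=> x Ax; rewrite lee_fin; have /andP[]:=Ac _ Ax.
- by move=> x Ax; rewrite lee_fin wsph_ge0.
- by move=> x Ax; rewrite lee_fin; have /andP[]:=Ac _ Ax.
Qed.

Lemma coneWE r: (\int[leb d]_(x in S `&` B r) (wsph x)%:E = (coneW r)%:E)%E.
rewrite fineK// ge0_fin_numE; last by apply: integral_ge0=> x _; rewrite lee_fin wsph_ge0.
have fa: leb d (S `&` B r) = (fine (leb d (S `&` B r)))%:E by rewrite fineK// ge0_fin_numE.
have [|_ h]:=@int_wsph_bounds _ _ 0 1 (mSB r) fa (lexx _) ler01.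
 move=> x _; rewrite wsph_ge0/= /wsph -[leRHS](expr1n _ d.+1).
 apply: lerXn2r; rewrite ?nnegrE ?invr_ge0 ?sqrtr_ge0//.
 rewrite invf_le1 ?sqrtr_gt0 ?ltr_pwDl ?dot_ge0// -{1}(sqrtr1) ler_wsqrtr// lerDl dot_ge0//.
by apply: le_lt_trans h _; rewrite ltry.
Qed.

Lemma coneW_ge0 r: 0<=coneW r.
Proof. by apply: fine_ge0; apply: integral_ge0=> x _; rewrite lee_fin wsph_ge0. Qed.

Lemma coneW_step r r': 0<r -> r<=r' ->
 wrad d r'*((r'^+d-r^+d)*coneR)<=coneW r'-coneW r<=wrad d r*((r'^+d-r^+d)*coneR).
move=> r0 rr; have r0':=lt_le_trans r0 rr.
pose A:=(S `&` B r') `\` (S `&` B r).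
have mA: measurable A by exact: measurableD.
have U: S `&` B r' = (S `&` B r) `|` A.
 seteq=> x; last by move=> [[h1 h2]|[]//]; split=> //; exact: le_trans rr.
 by move=> h; have [?|?]:=pselect ((S `&` B r) x); [left|right].
have dj0: (S `&` B r) `&` A = set0 by rewrite /A setIC setDKI.
have dj: [disjoint S `&` B r & A] by exact/disj_set2P.
have la: leb d A = ((r'^+d-r^+d)*coneR)%:E.
 have: leb d (S `&` B r') = (leb d (S `&` B r)+leb d A)%E by rewrite U measureU.
 rewrite !leb_coneball// => /esym. have: (0<=leb d A)%E by [].
 by case: (leb d A)=> [a| |]// _ [h]; congr EFin; rewrite mulrBl -h addrAC subrr add0r.
have iw: (coneW r')%:E = ((coneW r)%:E + \int[leb d]_(x in A) (wsph x)%:E)%E.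
 rewrite -!coneWE U ge0_integral_setU//.
 - by apply: measurable_funTS; apply/mEFP; exact: meas_wsph.
 - by move=> x _; rewrite lee_fin wsph_ge0.
have [|h1 h2]:=@int_wsph_bounds A _ (wrad d r') (wrad d r) mA la (ltW (wrad_gt0 _ _)) (ltW (wrad_gt0 _ _)).
 move=> x [[Sx xr'] xr]; have xr0: r<enorm x by rewrite ltNge; apply/negP=> h; apply: xr.
 by rewrite wsph_wrad !wrad_le ?enorm_ge0// ltW.
move: iw h1 h2; case: (\int[leb d]_(x in A) _)%E=> [i| |]// [->].
by rewrite !lee_fin=> h1 h2; rewrite addrAC subrr add0r h1.
Qed.

End cone.

(** The increments of f are w(x) times those of phi up to the oscillation of w. This yields the
    derivative of the weighted volume from the monotonicity of the density alone. *)
Lemma is_derive_sandwich (f phi w: R -> R) (x l delta: R): is_derive x 1 phi l ->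
 {for x, continuous w} -> 0<delta -> (forall y, `|y-x| < delta ->
  `|(f y-f x)-w x*(phi y-phi x)| <= `|w y-w x| * `|phi y-phi x|) -> is_derive x 1 f (w x * l).
move=> [dphi ephi] cw d0 H.
pose Q (h: R):=h^-1*:((phi \o shift x) (h*:(1: R))-phi x).
have cQ: Q h @[h --> 0^'] --> l by rewrite -ephi; exact: dphi.
have cs: h*:(1: R)+x @[h --> 0^'] --> x.
 have: h*:(1: R)+x @[h --> (0: R)] --> (0: R)*:(1: R)+x.
  by apply: cvgD; [apply: cvgZr_tmp; exact: cvg_id|exact: cvg_cst].
 by rewrite scale0r add0r=> c C /c; exact: nbhs_dnbhs.
have cwx: (w (h*:(1: R)+x)-w x) @[h --> 0^'] --> 0.
 have h1: w (h*:(1: R)+x) @[h --> 0^'] --> w x by exact: (cvg_comp _ _ cs cw).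
 suff: (w (h*:(1: R)+x)-w x) @[h --> 0^'] --> w x-w x by rewrite subrr. by apply: cvgB h1 _; exact: cvg_cst.
have cE: `|w (h*:(1: R)+x)-w x| * `|Q h| @[h --> 0^'] --> 0.
 suff: `|w (h*:(1: R)+x)-w x| * `|Q h| @[h --> 0^'] --> `|0: R| * `|l|.
  by rewrite normr0 mul0r. by apply: cvgM; exact: cvg_norm.
pose D (h: R):=h^-1*:((f \o shift x) (h*:(1: R))-f x).
have cD: D h-w x*Q h @[h --> 0^'] --> 0.
 apply/cvgr0Pnorm_le=> e e0. have:=cE; move/cvgr0Pnorm_le=> /(_ e e0) hE. near=> h.
 have h0: h != 0 by near: h; exact: nbhs_dnbhs_neq. have hd: `|h| < delta.
  near: h; apply: nbhs_dnbhs; apply/nbhs_ballP; exists delta=> // t /=.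
  by rewrite -ball_normE/= sub0r normrN. have: `|(`|w (h*:(1: R)+x)-w x| * `|Q h|)| <= e by near: h.
 apply: le_trans; rewrite normrM !normr_id.
 have:=H (h*:1+x); rewrite addrK /GRing.scale/= mulr1=> /(_ hd) K.
 rewrite /D /Q /GRing.scale/= mulr1 mulrCA -mulrBr !normrM mulrCA. by rewrite ler_wpM2l.
have cDl: D h @[h --> 0^'] --> w x * l.
 rewrite -[w x * l]add0r (_: D = fun h=> (D h-w x*Q h)+w x*Q h).
  by apply: cvgD=> //; apply: cvgM=> //; exact: cvg_cst. by apply/funext=> h; rewrite subrK.
by apply: DeriveDef; [apply/cvg_ex; exists (w x * l)|exact: cvg_lim cDl].
Unshelve. all: by end_near.
Qed.

Section cone_inequality.
Variables (n: nat) (S: set 'rV[R]_n.+1).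
Local Notation d := n.+1.
Hypotheses (mS: measurable S) (cS: forall s x, 0<s -> S x -> S (s*:x)).

Lemma is_derive_coneW (x: R): 0<x -> is_derive x 1 (coneW S) (wrad d x*(coneR S*(d%:R*x^+n))).
move=> x0; pose phi (y: R):=coneR S*y^+d.
have dphi: is_derive x 1 phi (coneR S*(d%:R*x^+n)).
 exact: (@is_deriveZ R R^o R^o _ (coneR S) x 1 _ (is_derive_pow n x)).
apply: (is_derive_sandwich dphi (@cont_wrad d x) x0)=> y yx.
have y0: 0<y by move: yx; rewrite ltr_norml=> /andP[]; lra.
have s0:=coneR_ge0 S.
rewrite /phi -mulrBr.
have [xy|xy]:=leP x y.
 have /andP[h1 h2]:=coneW_step mS cS x0 xy. have p: 0<=(y^+d-x^+d)*coneR S.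
  by rewrite mulr_ge0// subr_ge0 lerXn2r// nnegrE ltW. have w0:=wrad_le d (ltW x0) xy.
 rewrite [coneR S*_]mulrC (ger0_norm p) (ler0_norm (_: wrad d y-wrad d x<=0)) ?subr_le0//.
 move: p h1 h2; set P:=(_*coneR S)=> p h1 h2. have: 0<=(wrad d x-wrad d y)*P by rewrite mulr_ge0// subr_ge0.
 by move=> h3; rewrite ler_norml; bsplit; lra.
have /andP[h1 h2]:=coneW_step mS cS y0 (ltW xy).
have p: 0<=(x^+d-y^+d)*coneR S.
 by rewrite mulr_ge0// subr_ge0 lerXn2r// ?nnegrE ltW.
have w0:=wrad_le d (ltW y0) (ltW xy).
rewrite [coneR S*_]mulrC -(opprB (x^+d)) mulNr normrN (ger0_norm p).
rewrite (ger0_norm (_: 0<=wrad d y-wrad d x)) ?subr_ge0//.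
move: p h1 h2; set P:=(_*coneR S)=> p h1 h2.
have: 0<=(wrad d y-wrad d x)*P by rewrite mulr_ge0// subr_ge0.
by move=> h3; rewrite ler_norml; bsplit; lra.
Qed.

(* F = frad is a concave function of the weighted volume W = coneW; this is its tangent inequality at r0. *)
Lemma frad_tangent (r0 r: R): (2<=d)%N -> 0<r0 -> 0<r -> r0^+2<=d%:R*(d%:R-2) -> r^+2<=d%:R*(d%:R-2) ->
 coneR S*frad d r<=coneR S*frad d r0-crad d r0*coneW S r0+crad d r0*coneW S r.
move=> d2 r00 r1 h0 h1; set c:=crad d r0.
pose G y:=c*coneW S y-coneR S*frad d y.
pose dG y:=wrad d y*(coneR S*(d%:R*y^+n))*(c-crad d y).
have hG (y: R): 0<y -> is_derive y 1 G (dG y).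
 move=> y0. have k1:=@is_deriveZ R R^o R^o _ c y 1 _ (is_derive_coneW y0).
 have k2:=@is_deriveZ R R^o R^o _ (coneR S) y 1 _ (is_derive_frad n y).
 have:=@is_deriveB R R^o R^o _ _ y 1 _ _ k1 k2. congr (is_derive _ _ _ _); rewrite /dG /GRing.scale/=; ring.
have pos (y: R): 0<y -> 0<=wrad d y*(coneR S*(d%:R*y^+n)).
 move=> y0; rewrite mulr_ge0 ?(ltW (wrad_gt0 _ _))// mulr_ge0 ?coneR_ge0// mulr_ge0//.
 by rewrite exprn_ge0// ltW.
suff: G r0<=G r by rewrite /G; lra.
have [rr|rr]:=leP r0 r.
 apply: (le_of_derive rr (df:=dG))=> y /andP[y1 y2].
  by apply: hG; exact: lt_le_trans y1. have y0:=lt_le_trans r00 y1.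
 rewrite mulr_ge0 ?pos// subr_ge0 crad_le// ?(ltW r00)//.
 by apply: le_trans h1; rewrite ler_sqr ?nnegrE// ?(ltW y0) ?(ltW r1).
rewrite -lerN2; apply: (@le_of_derive (fun y=> - G y) (fun y=> - dG y) r r0 (ltW rr))=> y /andP[y1 y2].
 by have:=@is_deriveN R R^o R^o _ y 1 _ (hG y (lt_le_trans r1 y1)).
have y0:=lt_le_trans r1 y1.
by rewrite -mulrN mulr_ge0 ?pos// opprB subr_ge0 crad_le// ltW.
Qed.

(** Limit of the tangent inequality as r tends to 0: the tangent line at r0 is nonnegative at volume
    0. This makes [cone_excess] nonnegative on every cone. *)
Lemma frad_tangent0 (r0: R): (2<=d)%N -> 0<r0 -> r0^+2<=d%:R*(d%:R-2) ->
 0<=coneR S*frad d r0-crad d r0*coneW S r0.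
move=> d2 r00 h0; apply/ler_addgt0Pr=> e e0.
have c0:=crad_gt0 d r0; have s0:=coneR_ge0 S.
pose K:=crad d r0*coneR S+1.
have K0: 0<K by rewrite ltr_wpDl// mulr_ge0// ltW.
pose r:=Num.min (Num.min r0 1) (e/K).
have r1: 0<r by rewrite !lt_min r00 ltr01 divr_gt0.
have rr0: r<=r0 by rewrite /r !ge_min lexx.
have r11: r<=1 by rewrite /r !ge_min lexx orbT.
have rK: r<=e/K by rewrite /r ge_min lexx orbT.
have:=frad_tangent d2 r00 r1 h0 (le_trans _ h0); rewrite ler_sqr ?nnegrE ?(ltW r00) ?(ltW r1)// => /(_ rr0).
have F0: 0<=coneR S*frad d r.
 by rewrite mulr_ge0// /frad mulr_ge0 ?expR_ge0// exprn_ge0// ltW.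
have W1: coneW S r<=r*coneR S.
 have mSr: measurable (S `&` [set x | enorm x<=r]).
  by apply: measurableI=> //; exact: meas_eball.
 have [|_]:=@int_wsph_bounds n _ _ 0 1 mSr (leb_coneball mS cS r1) (lexx _) ler01.
  move=> x _; rewrite wsph_ge0/= wsph_wrad; apply: le_trans (wrad_le _ (lexx 0) (enorm_ge0 _)) _.
  by rewrite /wrad expr0n/= addr0 sqrtr1 invr1 expr1n.
 rewrite coneWE// lee_fin mul1r=> /le_trans; apply; apply: ler_wpM2r=> //.
 by rewrite exprS ler_piMr ?(ltW r1)// exprn_ile1// ltW.
have:=ler_wpM2l (ltW c0) W1; move: rK; rewrite ler_pdivlMr// /K; lra.
Qed.

End cone_inequality.

(* Bathtub principle: among sets of given weighted volume the ball has the least volume. *)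
Lemma leb_bathtub n (X: set 'rV[R]_n.+1) (r: R): 0<r -> measurable X -> (leb n.+1 X < +oo)%E ->
 let B := [set x: 'rV[R]_n.+1 | enorm x<=r] in
 (\int[leb n.+1]_(x in X) (wsph x)%:E = \int[leb n.+1]_(x in B) (wsph x)%:E)%E ->
 (leb n.+1 B<=leb n.+1 X)%E /\ (leb n.+1 B = leb n.+1 X -> leb n.+1 (X `\` B) = 0%E).
move=> r0 mX fX B EX; have mB: measurable B by exact: meas_eball.
have fB: (leb n.+1 B < +oo)%E by exact: (@leb_lty _ _ _ r).
have mw D: measurable_fun D (fun x: 'rV[R]_n.+1=> (wsph x)%:E).
 by apply: measurable_funTS; apply/mEFP; exact: meas_wsph.
have w0 x: (0<=(wsph x)%:E :> \bar R)%E by rewrite lee_fin wsph_ge0.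
have fin (A: set 'rV[R]_n.+1) C: measurable A -> A `<=` C -> measurable C -> (leb n.+1 C < +oo)%E ->
  leb n.+1 A = (fine (leb n.+1 A))%:E.
 move=> mA AC mC fC; rewrite fineK// ge0_fin_numE//; apply: le_lt_trans fC.
 by apply: le_measure; rewrite ?inE.
have mXB: measurable (X `\` B) by exact: measurableD.
have mBX: measurable (B `\` X) by exact: measurableD.
have mI: measurable (X `&` B) by exact: measurableI.
have eXB:=fin _ _ mXB (@subDsetl _ X B) mX fX; have eBX:=fin _ _ mBX (@subDsetl _ B X) mB fB.
have eI:=fin _ _ mI (@subIsetl _ X B) mX fX.
set a:=fine _ in eXB; set b:=fine _ in eBX; set m:=fine _ in eI.
have dj (A C: set 'rV[R]_n.+1): (A `&` C) `&` (A `\` C) = set0.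
 by rewrite setDE setIACA setICr setI0.
have lsplit (A C: set 'rV[R]_n.+1): measurable A -> measurable C ->
  leb n.+1 A = (leb n.+1 (A `&` C)+leb n.+1 (A `\` C))%E.
 move=> mA mC; rewrite -measureU ?setUIDK ?dj//; [exact: measurableI|exact: measurableD].
have isplit (A C: set 'rV[R]_n.+1): measurable A -> measurable C ->
  (\int[leb n.+1]_(x in A) (wsph x)%:E = \int[leb n.+1]_(x in A `&` C) (wsph x)%:E +
   \int[leb n.+1]_(x in A `\` C) (wsph x)%:E)%E.
 move=> mA mC; rewrite -{1}(setUIDK A C) ge0_integral_setU//;
  first [exact: measurableI | exact: measurableD | exact/disj_set2P/dj].
have lX: leb n.+1 X = (m+a)%:E by rewrite (lsplit X B)// eI eXB.
have lB: leb n.+1 B = (m+b)%:E by rewrite (lsplit B X)// (setIC B) eI eBX.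
pose w:=wrad n.+1 r; have wr0: 0<w:=wrad_gt0 _ _.
have lo x: B x -> w<=wsph x by move=> xr; rewrite wsph_wrad wrad_le// enorm_ge0.
have hi x: ~ B x -> wsph x<w.
 by move=> /negP; rewrite -ltNge=> xr; rewrite wsph_wrad wrad_lt// ltW.
have hi1 (x: 'rV[R]_n.+1): wsph x<=1.
 rewrite wsph_wrad; apply: le_trans (wrad_le _ (lexx 0) (enorm_ge0 _)) _.
 by rewrite /wrad expr0n/= addr0 sqrtr1 invr1 expr1n.
have [|_ h1]:=int_wsph_bounds mXB eXB (lexx 0) (ltW wr0).
 by move=> x [_ /hi/ltW ->]; rewrite wsph_ge0.
have [|h2 h3]:=int_wsph_bounds mBX eBX (ltW wr0) ler01.
 by move=> x [/lo -> _]; rewrite hi1.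
have [|_ h4]:=int_wsph_bounds mI eI (lexx 0) ler01.
 by move=> x _; rewrite hi1 wsph_ge0.
have EE: (\int[leb n.+1]_(x in X `\` B) (wsph x)%:E = \int[leb n.+1]_(x in B `\` X) (wsph x)%:E)%E.
 move: EX; rewrite (isplit X B)// (isplit B X)// (setIC B).
 have: (0 <= \int[leb n.+1]_(x in X `&` B) (wsph x)%:E)%E by exact: integral_ge0.
 move: h4; case: (integral _ (X `&` B) _)=> [i| |]// _ _.
 have: (0 <= \int[leb n.+1]_(x in X `\` B) (wsph x)%:E)%E by exact: integral_ge0.
 have: (0 <= \int[leb n.+1]_(x in B `\` X) (wsph x)%:E)%E by exact: integral_ge0.
 case: (integral _ (X `\` B) _)=> [x| |]//; case: (integral _ (B `\` X) _)=> [y| |]// _ _ [] /addrI ->.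
 by [].
have ba: b<=a by move: (le_trans h2 (le_trans (le_refl _) (eq_ind _ (fun z=> (z<=_)%E) h1 _ EE))); rewrite lee_fin ler_pM2l.
rewrite lX lB; split; first by rewrite lee_fin lerD2l.
move=> [/addrI ab]; rewrite eXB.
have [p _ _]: [/\ (\int[leb n.+1]_(x in X `\` B) (wsph x)%:E = (w*a)%:E)%E, True & True].
 by split=> //; apply/eqP; rewrite eq_le h1/= EE -ab.
have pos: (\int[leb n.+1]_(x in X `\` B) `|(w-wsph x)%:E| = 0)%E.
 have: ((w*a)%:E + \int[leb n.+1]_(x in X `\` B) `|(w-wsph x)%:E| = (w*a)%:E)%E.
  rewrite -{1}p -ge0_integralD//; last first.
   apply: mcomp=> //; apply/mEFP. by apply: measurable_funTS; apply: measurable_funB=> //; exact: meas_wsph.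
  rewrite EFinM -eXB -integral_cst//; apply: eq_integral=> x /set_mem[_ /hi xw] /=.
  by rewrite ger0_norm ?subr_ge0 ?ltW// -EFinD addrC subrK.
 by case: (integral _ _ _)=> [x| |]// [] /eqP; rewrite -subr_eq0 addrAC subrr add0r=> /eqP ->.
have mf: measurable_fun (X `\` B) (fun x=> (w-wsph x)%:E).
 apply/mEFP; apply: measurable_funTS; apply: measurable_funB=> //; exact: meas_wsph.
have [N [mN N0 sN]]:=(ae_eq_integral_abs (leb n.+1) mXB mf).1 pos.
apply/eqP; rewrite eq_le -eXB measure_ge0 andbT -N0; apply: le_measure; rewrite ?inE// => x XBx.
apply: sN=> /= h; have:=h XBx; move=> [/eqP]; rewrite subr_eq0=> /eqP ww.
by have [_ /hi]:=XBx; rewrite -ww ltxx.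
Qed.
End RadialCalculus.

(** * Second-order contact at Aleksandrov points *)

Section Osculation.
Context {R: realType}.

Lemma derive_approx (f: R -> R) (e: R): is_derive (0: R) 1 f 1 -> f 0 = 0 -> 0<e ->
 exists2 delta: R, 0<delta & forall z, `|z| < delta -> `|f z-z| <= e * `|z|.
move=> [df dv] f0 e0.
have c: (fun h: R=> h^-1*:(f (h*:(1: R)+0)-f 0)) @ 0^' --> (1: R).
 suff: (fun h: R=> h^-1*:(f (h*:(1: R)+0)-f 0)) @ 0^' --> 'D_1 f 0 by rewrite dv. exact: df.
move/cvgrPdist_le: c=> /(_ _ e0); rewrite near_withinE=> /nbhs_ballP[delta /= d0 h].
exists delta=> // z zd; have [->|z0]:=eqVneq z 0; first by rewrite f0 subrr normr0 mulr0.
have:=h z; rewrite /ball/= sub0r normrN=> /(_ zd z0).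
rewrite f0 subr0 addr0 /GRing.scale/= mulr1=> k.
rewrite (_: f z-z = - (z*(1-z^-1*f z))); last by field.
by rewrite normrN normrM mulrC ler_pM2r// normr_gt0.
Qed.

Definition quadf n (kap: 'I_n -> R) (t: 'rV[R]_n): R := \sum_i kap i*t 0 i^+2.

Lemma quadfZ n (kap: 'I_n -> R) a t: quadf kap (a*:t) = a^+2*quadf kap t.
Proof. by rewrite /quadf mulr_sumr; apply: eq_bigr=> i _; rewrite mxE; ring. Qed.

Lemma quadf_le n (kap: 'I_n -> R) t: `|quadf kap t| <= (\sum_i `|kap i|)*enorm t^+2.
rewrite /quadf mulr_suml; apply: (le_trans (ler_norm_sum _ _ _)); apply: ler_sum=> i _.
rewrite normrM ler_wpM2l// normrX ler_pXn2r ?nnegrE ?enorm_ge0//; exact: coord_le_enorm.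
Qed.

Lemma quadf_delta n (kap: 'I_n -> R) a i: quadf kap (a*:delta_mx 0 i) = a^+2*kap i.
rewrite quadfZ /quadf (bigD1 i)//= big1 ?addr0=> [|j ji].
 by rewrite mxE !eqxx expr1n mulr1.
by rewrite mxE (negPf ji) andbF expr0n/= mulr0.
Qed.

(** [principal_curvatures] uses geodesic coordinates: an angle |w| along the supporting great
    hypersphere and an angular height f(w). Here they become central coordinates, |t| = tan|w| and s
    = tan(f w) sqrt(1 + |t|^2). Since tan and atan have derivative 1 at 0, the quadratic expansion
    keeps its form. *)
Lemma graph_height n (kap: 'I_n -> R) (f: 'rV[R]_n -> R) (r: R): 0<r ->
 (forall e: R, 0<e -> exists2 delta: R, 0<delta &
   forall w, enorm w<delta -> `|f w-2^-1*quadf kap w| <= e*enorm w^+2) ->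
 forall e: R, 0<e -> exists2 delta: R, 0<delta & forall t: 'rV[R]_n, enorm t<delta ->
  let w:=(atan (enorm t)/enorm t)*:t in [/\ enorm w<r, `|f w| < r &
    `|tan (f w)*Num.sqrt (1+enorm t^+2)-2^-1*quadf kap t| <= e*enorm t^+2].
move=> r0 hf e0 e00.
pose k := \sum_i `|kap i|.
have k0: 0<=k by exact: sumr_ge0.
pose e:=Num.min 1 (e0/(8*k+16)).
have c0: 0<8*k+16 by lra.
have e1: e<=1 by rewrite /e ge_min lexx.
have e2: e*(8*k+16)<=e0 by rewrite -ler_pdivlMr// /e ge_min lexx orbT.
have ep: 0<e by rewrite /e lt_min ltr01 divr_gt0.
clearbody e.
have at0: is_derive (0: R) 1 (@atan R) 1.
 by have:=is_derive1_atan (0: R); rewrite expr0n/= addr0 invr1.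
have ta0: is_derive (0: R) 1 (@tan R) 1.
 have c0': cos (0: R) != 0 by rewrite cos0 oner_eq0. by have:=is_derive_tan c0'; rewrite cos0 expr1n invr1.
have [d1 d10 h1]:=derive_approx at0 (@atan0 R) ep.
have [d2 d20 h2]:=derive_approx ta0 (@tan0 R) ep.
have [d3 d30 h3]:=hf _ ep.
pose m:=Num.min d2 r.
have m0: 0<m by rewrite /m lt_min d20.
pose delta:=Num.min (Num.min e d1) (Num.min (Num.min (d3/2) (r/2)) (m/(2*k+5))).
have cc0: 0<2*k+5 by lra.
exists delta; first pos.
move=> t; rewrite /delta !lt_min=> /andP[/andP[ae ad1] /andP[/andP[ad3 ar] am]].
cbv zeta; set rho:=atan (enorm t)/enorm t; set w:=rho*:t.
have a0:=enorm_ge0 t; set a:=enorm t in a0 ae ad1 ad3 ar am rho w *.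
have Qk: `|quadf kap t| <= k*a^+2 by exact: quadf_le.
have ra: `|rho*a-a| <= e*a.
 rewrite /rho; have [->|an0]:=eqVneq a 0; first by rewrite !mulr0 subrr normr0.
 by rewrite divfK// -[X in _<=_*X](ger0_norm a0) h1// ger0_norm.
have Ew: enorm w = `|rho*a| by rewrite enormZ -/a [RHS]normrM (ger0_norm a0).
have wa: enorm w<=2*a.
 rewrite Ew; move: ra; rewrite ler_norml=> /andP[]; set X:=rho*a=> u1 u2.
 have ea: e*a<=a by rewrite ler_piMl. by rewrite ler_norml; bsplit; lra.
have a2: a^+2<=a by rewrite expr2 ler_piMl// (le_trans (ltW ae)).
have sq0:=sqr_ge0 a.
have w2: enorm w^+2<=4*a^+2.
 have:=enorm_ge0 w=> w0. have -> : 4*a^+2 = (2*a)^+2 by ring. by rewrite ler_pXn2r ?nnegrE// (le_trans w0).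
have rho2: `|rho^+2*quadf kap t-quadf kap t| <= 3*e*k*a^+2.
 have [a00|an0]:=eqVneq a 0.
  move: Qk; rewrite a00 expr0n/= !mulr0 normr_le0=> /eqP ->. by rewrite mulr0 subrr normr0.
 have ap: 0<a by rewrite lt_def an0. have r1: `|rho-1| <= e.
  by rewrite -(ler_pM2r ap) -{1}(ger0_norm a0) -normrM mulrBl mul1r. have r2: `|rho+1| <= 3.
  have -> : rho+1 = (rho-1)+2 by ring. by rewrite (le_trans (ler_normD _ _))// [X in _+X]ger0_norm//; lra.
 have -> : rho^+2*quadf kap t-quadf kap t = (rho-1)*(rho+1)*quadf kap t by ring.
 rewrite !normrM (_: 3*e*k*a^+2 = (e*3)*(k*a^+2)); last by ring. by rewrite ler_pM ?mulr_ge0// ler_pM.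
have rho2': `|rho^+2*quadf kap t| <= 4*(k*a^+2).
 have ek: e*(k*a^+2)<=k*a^+2 by rewrite ler_piMl// mulr_ge0.
 have -> : rho^+2*quadf kap t = (rho^+2*quadf kap t-quadf kap t)+quadf kap t by ring.
 rewrite (le_trans (ler_normD _ _))//; move: rho2 Qk ek.
 rewrite (_: 3*e*k*a^+2 = 3*(e*(k*a^+2))); last by ring. by set X:=e*_; set Y:=k*_=> *; lra.
have hw: `|f w-2^-1*(rho^+2*quadf kap t)| <= 4*e*a^+2.
 have: enorm w<d3 by rewrite (le_lt_trans wa)//; lra. move=> /h3; rewrite quadfZ=> /le_trans; apply.
 have:=ler_wpM2l (ltW ep) w2; lra.
set z:=f w in hw *.
have za: `|z| <= (2*k+4)*a^+2.
 have -> : z = (z-2^-1*(rho^+2*quadf kap t))+2^-1*(rho^+2*quadf kap t) by ring.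
 rewrite (le_trans (ler_normD _ _))// [X in _+X]normrM ger0_norm//. have: e*a^+2<=a^+2 by rewrite ler_piMl.
 move: hw rho2'; rewrite (_: 4*e*a^+2 = 4*(e*a^+2)); last by ring. set X:=e*_=> *; lra.
have zm: `|z| < m.
 rewrite (le_lt_trans za)//; apply: (@le_lt_trans _ _ ((2*k+5)*a)).
  apply: (@le_trans _ _ ((2*k+4)*a)); first by rewrite ler_pM2l//; lra. by rewrite ler_wpM2r//; lra.
 by rewrite mulrC -ltr_pdivlMr.
move: zm; rewrite /m lt_min=> /andP[zd zr].
have tz:=h2 _ zd.
split=> //; first by rewrite (le_lt_trans wa)//; lra.
have S1: 1<=Num.sqrt (1+a^+2) by rewrite -{1}(sqrtr1 R) ler_wsqrtr// lerDl.
have S2: Num.sqrt (1+a^+2)-1<=e.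
 have: Num.sqrt (1+a^+2)<=1+a^+2.
  rewrite -[leRHS]ger0_norm ?addr_ge0// -sqrtr_sqr ler_wsqrtr//.
  by rewrite expr2 ler_peMl ?addr_ge0// lerDl. lra.
set S:=Num.sqrt _ in S1 S2 *.
have tz2: `|tan z| <= 2 * `|z|.
 have ez: e * `|z| <= `|z| by rewrite ler_piMl.
 by rewrite -[tan z](subrK z) (le_trans (ler_normD _ _))//; lra.
have -> : tan z*S-2^-1*quadf kap t = tan z*(S-1)+(tan z-z) +
  (z-2^-1*(rho^+2*quadf kap t))+2^-1*(rho^+2*quadf kap t-quadf kap t) by ring.
apply: (le_trans (ler_normD _ _)); apply: (@le_trans _ _ ((e*((4*k+8)*a^+2) +
  e*((2*k+4)*a^+2)+4*e*a^+2)+2^-1*(3*e*k*a^+2))); last first.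
 have -> : (e*((4*k+8)*a^+2)+e*((2*k+4)*a^+2)+4*e*a^+2) + 2^-1*(3*e*k*a^+2) = (e*(15/2*k+16))*a^+2 by field.
 rewrite ler_wpM2r// (le_trans _ e2)// ler_pM2l//; lra.
apply: lerD; last by rewrite normrM ger0_norm// ler_pM2l.
apply: (le_trans (ler_normD _ _)); apply: lerD=> //.
apply: (le_trans (ler_normD _ _)); apply: lerD.
 rewrite normrM mulrC [X in X*_]ger0_norm ?subr_ge0// ler_pM ?subr_ge0//. by rewrite (le_trans tz2)//; lra.
by rewrite (le_trans tz)// ler_pM2l.
Qed.

(** Second-order contact in central coordinates x + t E^T + s nu, with nu the inner normal: s =
    q(t)/2 + o(|t|^2), where q has eigenvalues [kap]. The third clause provides points of K on which
    support inequalities are tested; the fourth controls every boundary point near x. *)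
Definition osculates n (K: set 'rV[R]_n.+2) (x nu: 'rV[R]_n.+2) (E: 'M[R]_(n.+2, n))
  (kap: 'I_n -> R): Prop := [/\ tframe x nu E, forall v, K v -> 0<=dot v nu,
   forall e: R, 0<e -> exists2 delta: R, 0<delta & forall t: 'rV[R]_n, enorm t<delta ->
    exists s v: R, [/\ `|s-2^-1*quadf kap t| <= e*enorm t^+2, 0<v & K (v*:(x+t *m E^T+s*:nu))] &
   forall e: R, 0<e -> exists2 delta: R, 0<delta & forall y, sboundary K y -> enorm (y-x)<delta ->
    0<dot y x /\ let t:=(dot y x)^-1*:(y *m E) in
    `|(dot y x)^-1*dot y nu-2^-1*quadf kap t| <= e*enorm t^+2].

(** The outer normal of [principal_curvatures] changes sign, and its local graph supplies points for
    the third clause of [osculates]; in the fourth, a nearby boundary point is written in normal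
    coordinates with height asin(y.nu). *)
Lemma osculates_exists n (K: set 'rV[R]_n.+2) x (kap: 'I_n -> R) :
 K `<=` sphere -> closed K -> sboundary K x -> @principal_curvatures R n.+1 K x kap ->
 exists nu E, osculates K x nu E kap.
move=> KS Kc bx [nu [e [f [[nn xn hn] he [r r0 hr] hf]]]].
have bK y: sboundary K y -> K y by move=> [+ _]; move/closure_id: Kc=> <-.
have xx: dot x x = 1 by apply: KS; exact: bK.
pose E: 'M[R]_(n.+2, n) := \matrix_(i, j) e j 0 i.
have mE (w: 'rV[R]_n.+2) j: (w *m E) 0 j = dot w (e j).
 by rewrite mxE; apply: eq_bigr=> i _; rewrite mxE.
have xE: x *m E = 0 by apply/rowP=> j; rewrite mE mxE; have []:=he j.
have nE: nu *m E = 0 by apply/rowP=> j; rewrite mE mxE; have []:=he j.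
have EE: E^T *m E = 1%:M.
 apply/matrixP=> i j; have [_ _ /(_ j)]:=he i; rewrite [_%:M i j]mxE=> <-.
 by rewrite mxE; apply: eq_bigr=> k _; rewrite !mxE.
have tE: tframe x (- nu) E by split; rewrite ?dotNl ?dotNr ?opprK ?xn ?oppr0 ?mulNmx ?nE ?oppr0.
have EtE (t: 'rV[R]_n): t *m E^T *m E = t by rewrite -mulmxA EE mulmx1.
have xEt (t: 'rV[R]_n): dot x (t *m E^T) = 0 by rewrite dotC dot_mulmx trmxK xE dot0r.
have nEt (t: 'rV[R]_n): dot nu (t *m E^T) = 0 by rewrite dotC dot_mulmx trmxK nE dot0r.
have enE (t: 'rV[R]_n): enorm (t *m E^T) = enorm t.
 by rewrite /enorm dot_mulmx trmxK EtE.
pose g (t: 'rV[R]_n):=f (t *m E^T).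
have hg (eps: R): 0<eps -> exists2 delta: R, 0<delta &
   forall w, enorm w<delta -> `|g w-2^-1*quadf kap w| <= eps*enorm w^+2.
 move=> /hf[delta d0 h]; exists delta=> // w wd; have:=h (w *m E^T) (xEt _) (nEt _).
 rewrite enE=> /(_ wd); congr (`|_-_*_| <= _); apply: eq_bigr=> i _. by rewrite -mE EtE.
have gh:=graph_height r0 hg.
have nc (t: 'rV[R]_n) (z: R): let w:=(atan (enorm t)/enorm t)*:t in let S:=Num.sqrt (1+enorm t^+2) in
  0<S /\ normal_coord x nu (w *m E^T) z = (cos z/S)*:(x+t *m E^T)+sin z *: - nu.
 move=> w S; have S0: 0<S by rewrite sqrtr_gt0 ltr_pwDl// sqr_ge0.
 split=> //; rewrite /normal_coord /sexp scalerN; congr (_-_).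
 have cS: cos (atan (enorm t)) = S^-1 by rewrite cos_atan. have [t0|t0]:=eqVneq t 0.
  have w0: w = 0 by rewrite /w t0 scaler0. rewrite w0 mul0mx enorm0 cos0 scale1r scaler0 t0 mul0mx !addr0.
  by rewrite /S t0 enorm0 expr0n/= addr0 sqrtr1 invr1 mulr1. have tp: 0<enorm t by rewrite enorm_gt0.
 have ap: 0<atan (enorm t) by rewrite -(@atan0 R) lt_atan. have -> : enorm (w *m E^T) = atan (enorm t).
  by rewrite enE /w enormZ normrM normfV !gtr0_norm// divfK// gt_eqF.
 have sA: sin (atan (enorm t)) = enorm t*S^-1.
  by rewrite -cS -{2}(atanK (enorm t)) /tan divfK// cS invr_neq0// gt_eqF.
 rewrite -scalemxAl scalerDr scalerDr !scalerA cS sA; congr (_*:_+_*:_). by field; rewrite !gt_eqF.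
pose S (t: 'rV[R]_n):=Num.sqrt (1+enorm t^+2).
have S0 (t: 'rV[R]_n): 0<S t by rewrite sqrtr_gt0 ltr_pwDl// sqr_ge0.
pose w (t: 'rV[R]_n):=(atan (enorm t)/enorm t)*:t.
pose r':=Num.min r 1.
have r'0: 0<r' by rewrite lt_min r0 ltr01.
have gh':=graph_height r'0 hg.
have cpos (z: R): `|z| < 1 -> 0<cos z.
 move=> z1; apply: cos_gt0_pihalf; have p1:=@pihalf_ge1 R.
 by move: z1; rewrite ltr_norml=> /andP[? ?]; bsplit; lra.
exists (- nu), E; split=> //.
- by move=> v Kv; rewrite dotNr oppr_ge0; exact: hn.
- move=> eps /gh'[delta d0 h]; exists delta=> // t /h[].
 rewrite !lt_min -/(w t)=> /andP[wr _] /andP[gr g1] ge.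
 exists (tan (g (w t))*S t), (cos (g (w t))/S t); split=> //.
  by rewrite divr_gt0// cpos. have [_]:=nc t (g (w t)); rewrite -/(S t) -/(w t)=> E1.
 have: K (normal_coord x nu (w t *m E^T) (g (w t))).
  by apply: bK; apply/hr; rewrite ?xEt ?nEt ?enE.
 rewrite E1; congr K; rewrite [RHS]scalerDr scalerA; congr (_+_*:_).
 by rewrite /tan; field; rewrite !gt_eqF ?cpos.
- move=> eps /gh'[delta d0 h].
 have c0: -1<(0: R)<1 by rewrite ltrN10 ltr01.
 have /cvgrPdist_lt/(_ _ r'0)/nbhs_ballP[d1 /= d10 h1]:=continuous_asin c0.
 pose dl:=Num.min (Num.min 2^-1 (delta/2)) d1. exists dl=> [|y yb]; first pos.
 rewrite !lt_min=> /andP[/andP[y1 y2] y3]. have yy: dot y y = 1 by apply: KS; exact: bK.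
 have dx (v: 'rV[R]_n.+2): dot v v = 1 -> `|dot (y-x) v| <= enorm (y-x).
  by move=> vv; rewrite (le_trans (dot_le _ _))// (enorm_unit vv) mulr1.
 have nnN: dot (- nu) (- nu) = 1 by rewrite dotNl dotNr opprK.
 have xnN: dot x (- nu) = 0 by rewrite dotNr xn oppr0. have as0: asin (0: R) = 0.
  by rewrite -{1}(@sin0 R) sinK// in_itv/= oppr_le0 andbb divr_ge0// ltW// pi_gt0.
 have:=dx _ xx; have:=dx _ nnN; rewrite !dotBl xx xnN subr0.
 set al:=dot y x; set be:=dot y (- nu)=> hbe hal.
 have al2: 2^-1<al by move: hal; rewrite ler_norml=> /andP[? ?]; lra. have al0: 0<al by lra.
 split=> //; set t:=al^-1*:(y *m E); cbv zeta. have td: enorm t<delta.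
  have yE: enorm (y *m E)<=enorm (y-x).
   by rewrite -[y *m E]subr0 -xE -mulmxBl; exact: enorm_tframe tE.
  rewrite /t enormZ gtr0_norm ?invr_gt0// mulrC ltr_pdivrMr// (le_lt_trans yE)//.
  by rewrite (lt_trans y2)// ltr_pM2l//. have be1: `|be| < 1 by lra.
 have be2: -1<=be<=1 by rewrite -ler_norml ltW.
 have:=h1 be; rewrite /ball/= sub0r normrN as0 sub0r normrN=> /(_ (le_lt_trans hbe y3)).
 set z:=asin be=> zr. have sz: sin z = be by rewrite /z asinK// in_itv/=.
 have [zr1 z1]: `|z| < r /\ `|z| < 1 by move: zr; rewrite lt_min=> /andP[].
 have yt: y = al*:(x+t *m E^T)+be*:(- nu).
  rewrite {1}(tframeE y tE) -/al -/be scalerDr -addrA (addrC (be*:_)) addrA; congr (_+_+_).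
  by rewrite /t -scalemxAl scalerA divff ?gt_eqF// scale1r. have aS: cos z = al*S t.
  have: cos z^+2 = (al*S t)^+2.
   rewrite cos2sin2 sz exprMn sqr_sqrtr ?addr_ge0// ?sqr_ge0//.
   have:=yy; rewrite (tframe_dot y y tE) -/al -/be enormE /t dotZl dotZr=> H.
   set D:=dot _ _ in H *; have -> : al^+2*(1+al^-1*(al^-1*D)) = al*al+D.
    by field; rewrite gt_eqF. by rewrite -H; ring.
  move/eqP; rewrite eqrXn2 ?(ltW (cpos _ z1))// ?mulr_ge0 ?ltW//. by move/eqP.
 have [_]:=nc t z; rewrite -/(S t) -/(w t)=> E1.
 have:=h _ td; rewrite -/(w t)=> -[+ _]; rewrite lt_min=> /andP[wr _].
 have: sboundary K (normal_coord x nu (w t *m E^T) z).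
  by rewrite E1 aS mulfK ?gt_eqF// sz -yt. move/hr; rewrite ?xEt ?nEt ?enE=> /(_ erefl erefl wr zr1) zf.
 suff -> : al^-1*be = tan (g (w t))*S t by []. by rewrite /g -zf /tan sz aS; field; rewrite !gt_eqF.
Qed.

(** Points of K have nonnegative height over the supporting hypersphere; take one over a small
    multiple of the i-th basis vector. *)
Lemma osculates_ge0 n (K: set 'rV[R]_n.+2) x nu (E: 'M[R]_(n.+2, n)) kap i :
 osculates K x nu E kap -> 0<=kap i.
move=> [tE Kn hK _]; apply/ler_addgt0Pr=> e e0.
have [delta d0 h]:=hK (e/2) (divr_gt0 e0 (ltr0n _ 2)).
pose t: 'rV[R]_n:=(delta/2)*:delta_mx 0 i.
have et: enorm t = delta/2.
 rewrite /t enormZ gtr0_norm ?divr_gt0// /enorm /dot (bigD1 i)//= big1=> [|j ji].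
  by rewrite mxE !eqxx addr0 mulr1 sqrtr1 mulr1. by rewrite mxE (negPf ji) andbF mul0r.
have [|s [v [hs v0 Kv]]]:=h t; first by rewrite et ltr_pdivrMr// ltr_pMr// ltr1n.
have [xx nn xn xE [nE EE]]:=tE.
have:=Kn _ Kv; rewrite dotZl !dotDl xn add0r dot_mulmx trmxK nE dot0r add0r dotZl nn mulr1.
rewrite pmulr_rge0// => s0.
move: hs; rewrite quadf_delta et ler_norml=> /andP[_ hs].
have q0: 0<(delta/2)^+2 by rewrite exprn_gt0// divr_gt0.
rewrite -(pmulr_rge0 _ q0); lra.
Qed.

End Osculation.

(** * Differentiability of the Gauss map at Aleksandrov points *)

Section GaussMap.
Context {R: realType}.

(** A point of K with an inner unit normal of a supporting great hypersphere through it. The normal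
    is an independent variable, since a point may have many. *)
Definition normal_pair n (K: set 'rV[R]_n.+2) (y mu: 'rV[R]_n.+2): Prop :=
 [/\ K y, dot y y = 1, dot mu mu = 1, dot y mu = 0 & forall v, K v -> 0<=dot v mu].

(** First-order expansion of the possibly multivalued Gauss map at x: in the frame its derivative is
    minus the diagonal matrix of the curvatures, and both displacements are tangential up to the
    relative error. *)
Definition gauss_expansion n (K: set 'rV[R]_n.+2) x nu (E: 'M[R]_(n.+2, n)) kap (e delta: R) :=
 forall y mu, normal_pair K y mu -> y <> x -> enorm (y-x)<delta -> enorm (mu-nu)<delta ->
  [/\ forall l, `|((mu-nu) *m E) 0 l+kap l*((y-x) *m E) 0 l| <= e*enorm (y-x),
    `|dot (y-x) nu| <= e*enorm (y-x) & `|dot (mu-nu) x| <= 2*e*enorm (y-x)].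

Lemma normal_pair_boundary n (K: set 'rV[R]_n.+2) y mu: normal_pair K y mu -> sboundary K y.
move=> [Ky yy mm ym Kmu]; split; first exact: subset_closure.
move=> [_ /nbhs_ballP[e /= e0 hK]].
pose t: R:=Num.min (e/3) 1.
have t0: 0<t by rewrite lt_min ltr01 divr_gt0.
have t1: t<=1 by rewrite ge_min lexx orbT.
have te: t<=e/3 by rewrite ge_min lexx.
pose q: R:=Num.sqrt (1-t^+2); pose p:=q*:y-t*:mu.
have t2: t^+2<=t by rewrite expr2 ler_piMl// ltW.
have u0: 0<=1-t^+2 by rewrite subr_ge0 (le_trans t2).
have t20:=sqr_ge0 t.
have q1: q<=1 by rewrite -(sqrtr1 R) ler_wsqrtr// gerBl.
have q2: 1-t^+2<=q.
 by rewrite -[leLHS]ger0_norm// -sqrtr_sqr ler_wsqrtr// expr2 ler_piMl// gerBl.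
have pp: dot p p = 1.
 rewrite /p dotBl !dotBr !dotZl !dotZr yy mm (dotC mu) ym !mulr0 !mulr1 subr0 sub0r opprK -!expr2.
 by rewrite sqr_sqrtr// subrK.
have: K p.
 apply: hK=> //; split=> // i j; rewrite ord1 /ball/= -normrN opprB.
 have -> : p 0 j-y 0 j = (p-y) 0 j by rewrite !mxE. apply: (le_lt_trans (coord_le_enorm _ _)).
 have -> : p-y = (q-1)*:y+(- t)*:mu by rewrite /p scalerBl scale1r scaleNr addrAC.
 rewrite (le_lt_trans (enormD _ _))// !enormZ (enorm_unit yy) (enorm_unit mm) !mulr1 normrN.
 rewrite (gtr0_norm t0) ler0_norm ?subr_le0//; lra.
move=> /Kmu; rewrite /p dotBl !dotZl ym mulr0 mm mulr1 sub0r oppr_ge0; lra.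
Qed.

(** The hypersphere with normal mu touches K at y, whose height over x is known to second order, and
    it supports K at the points over t + tau e_l, whose heights are also known to second order.
    Subtracting leaves an inequality linear in tau up to O(tau^2); both signs of tau determine the
    l-th component of mu. *)
Lemma gauss_near n (K: set 'rV[R]_n.+2) x nu (E: 'M[R]_(n.+2, n)) kap (e0: R) :
 osculates K x nu E kap -> 0<e0 -> exists2 delta: R, 0<delta & gauss_expansion K x nu E kap e0 delta.
move=> osc e00; have kge:=fun i=> osculates_ge0 i osc.
have [tE Kn hA hB]:=osc; have [xx nn xn xE [nE EE]]:=tE.
pose k := \sum_i `|kap i|; have k0: 0<=k by exact: sumr_ge0.
have kl l: kap l<=k by rewrite /k (bigD1 l)//= (ger0_norm (kge l)) lerDl sumr_ge0.
pose th:=Num.min (1/2) (Num.min (e0/(5*k+10)) e0).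
have c0: 0<5*k+10 by lra.
have th0: 0<th by rewrite !lt_min e00 !divr_gt0.
have th1: th<=1/2 by rewrite ge_min lexx.
have the: th*(5*k+10)<=e0 by rewrite -ler_pdivlMr// !ge_min lexx orbT.
have the': th<=e0 by rewrite !ge_min lexx !orbT.
clearbody th.
have th20: 0<th^+2 by rewrite exprn_gt0.
have [da da0 ha]:=hA _ th20; have [db db0 hb]:=hB _ th20.
exists (Num.min th (Num.min (da/4) db)); first by rewrite !lt_min th0 db0 divr_gt0.
move=> y mu pm /eqP yx; rewrite !lt_min=> /and3P[Dth Dda Ddb] /and3P[Gth _ _].
have [Ky yy mm ym Kmu]:=pm; have yb:=normal_pair_boundary pm.
have D0: 0<enorm (y-x) by rewrite enorm_gt0 subr_eq0.
have [al0]:=hb _ yb Ddb; cbv zeta.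
have unit_le (z v: 'rV[R]_n.+2): dot v v = 1 -> `|dot z v| <= enorm z.
 by move=> vv; rewrite (le_trans (dot_le _ _))// (enorm_unit vv) mulr1.
have:=unit_le (y-x) _ xx; rewrite dotBl xx.
have:=unit_le (mu-nu) _ nn; rewrite dotBl nn.
have G0:=enorm_ge0 (mu-nu).
set D:=enorm (y-x) in Dth Dda Ddb D0 *; set G:=enorm (mu-nu) in Gth G0 *.
set al:=dot y x in al0 *; set m:=dot mu nu=> hm hal.
set t:=al^-1*:(y *m E); set s:=al^-1*dot y nu=> hs.
have al1: 1/2<=al by move: hal; rewrite ler_norml=> /andP[? ?]; lra.
have m1: 1/2<=m by move: hm; rewrite ler_norml=> /andP[? ?]; lra.
have m0: 0<=m by apply: le_trans m1; rewrite divr_ge0.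
have m2: m<=1.
 by rewrite /m (le_trans (dot_le_enorm _ _))// (enorm_unit mm) (enorm_unit nn) mulr1.
have al2: al<=1.
 by rewrite /al (le_trans (dot_le_enorm _ _))// (enorm_unit xx) (enorm_unit yy) mulr1.
have yEt: y *m E = al*:t by rewrite /t scalerA divff ?gt_eqF// scale1r.
have td: enorm t<=2*D.
 rewrite /t enormZ gtr0_norm ?invr_gt0// ler_pdivrMl//.
 have yE: enorm (y *m E)<=D by rewrite -[y *m E]subr0 -xE -mulmxBl; exact: enorm_tframe tE.
 by rewrite (le_trans yE)// mulrA ler_peMl ?(ltW D0)//; lra.
have t0:=enorm_ge0 t.
have td2: enorm t^+2<=4*D^+2.
 have -> : 4*D^+2 = (2*D)^+2 by ring. by rewrite ler_pXn2r ?nnegrE// (le_trans t0).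
have my: dot mu x+dot (mu *m E) t+s * m = 0.
 have e1: dot y mu = al*(dot mu x+dot (mu *m E) t+s * m).
  rewrite (tframe_dot y mu tE) yEt dotZl -/al /s (dotC (mu *m E)) -/m; field. by rewrite gt_eqF.
 by move: ym; rewrite e1=> /eqP; rewrite mulf_eq0 gt_eqF//= => /eqP.
(* All heights are known up to th^2 D^2, so a step tau of size th D leaves an error of size th D
   after division by tau. *)
have key l (tau: R): `|tau| = 2*th*D -> 0<=tau*((mu *m E) 0 l+m*kap l*t 0 l)+th^+2*D^+2*(2*kap l+20).
 move=> htau; pose t':=t+tau*:delta_mx 0 l. have et: enorm (delta_mx 0 l: 'rV[R]_n) = 1.
  rewrite /enorm /dot (bigD1 l)//= big1=> [|j jl].
   by rewrite mxE !eqxx addr0 mulr1 sqrtr1. by rewrite mxE (negPf jl) andbF mul0r.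
 have thD: th*D<=D by rewrite ler_piMl ?(ltW D0)//; lra. have t'd: enorm t'<=4*D.
  by rewrite (le_trans (enormD _ _))// enormZ et mulr1 htau; lra.
 have [|s' [v [hs' v0 Kv]]]:=ha t'; first by lra. have t'2: enorm t'^+2<=16*D^+2.
  have -> : 16*D^+2 = (4*D)^+2 by ring. by rewrite ler_pXn2r ?nnegrE ?enorm_ge0// (le_trans (enorm_ge0 t')).
 have:=Kmu _ Kv; rewrite dotZl pmulr_rge0// dotC !dotDr dotZr -/m.
 have -> : dot mu (t' *m E^T) = dot (mu *m E) t+tau*(mu *m E) 0 l.
  rewrite (_: dot mu (t' *m E^T) = dot (mu *m E) t'); last by rewrite [RHS]dot_mulmx.
  rewrite dotDr dotZr; congr (_+_*_).
  rewrite /dot (bigD1 l)//= big1=> [|j jl]; first by rewrite [delta_mx _ _ _ _]mxE !eqxx addr0 mulr1.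
  by rewrite [delta_mx _ _ _ _]mxE (negPf jl) andbF mulr0.
 have qE: quadf kap t' = quadf kap t+kap l*(2*tau*t 0 l+tau^+2).
  rewrite /quadf (bigD1 l)//= [in RHS](bigD1 l)//= -addrA [X in _ = _+X]addrC addrA.
  congr (_+_); first by rewrite !mxE !eqxx mulr1; ring.
  by apply: eq_bigr=> j jl; rewrite !mxE (negPf jl) andbF mulr0 addr0. have tau2: tau^+2 = 4*(th^+2*D^+2).
  by rewrite -(real_normK (num_real tau)) htau; ring.
 move: hs' hs; rewrite qE tau2 !ler_norml=> /andP[_ h1] /andP[h2 _] h3.
 have P0: 0<=th^+2*D^+2 by rewrite mulr_ge0// sqr_ge0.
 have h4:=ler_wpM2l (ltW th20) t'2; have h5:=ler_wpM2l (ltW th20) td2.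
 rewrite (mulrCA _ 16) in h4; rewrite (mulrCA _ 4) in h5.
 set X: R:=th^+2*enorm t'^+2 in h1 h4; set Y: R:=th^+2*enorm t^+2 in h2 h5.
 set P: R:=th^+2*D^+2 in P0 h1 h2 h3 h4 h5 *. have h6: s'-s<=kap l*tau*t 0 l+P*(2*kap l+20).
  by clear-h1 h2 h4 h5 P0; lra. have h7: m*(s'-s)<=m*(kap l*tau*t 0 l)+P*(2*kap l+20).
  rewrite (le_trans (ler_wpM2l m0 h6))//. rewrite mulrDr lerD2l ler_piMl// mulr_ge0// addr_ge0// mulr_ge0//.
 by move: my h3 h7; rewrite mulrBr; clear; lra.
have kn l: 0<=kap l:=kge l.
have E2: `|dot y nu| <= e0*D.
 rewrite (_: dot y nu = al*s); last by rewrite /s mulVKf// gt_eqF.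
 rewrite normrM (ger0_norm (ltW al0)) (le_trans (ler_piMl _ al2))//.
 have q:=quadf_le kap t; rewrite -/k in q. have q2: k*enorm t^+2<=k*(4*D^+2) by rewrite ler_wpM2l.
 have h5:=ler_wpM2l (ltW th20) td2. have th21: th^+2<=1 by rewrite expr_le1 ?(ltW th0)//; clear-th1; lra.
 have D2: 0<=D^+2 by exact: sqr_ge0. have h6: th^+2*(4*D^+2)<=4*D^+2 by rewrite ler_piMl// mulr_ge0.
 have: `|s| <= (2*k+4)*D^+2.
  by move: hs q q2 h5 h6; clear; rewrite !ler_norml=> /andP[? ?] /andP[? ?] ? ? ?; bsplit; lra.
 move/le_trans; apply; rewrite expr2 mulrA ler_wpM2r ?(ltW D0)//.
 apply: le_trans the; rewrite mulrC; apply: ler_pM; rewrite ?(ltW D0) ?(ltW Dth)//; clear-k0; lra.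
split=> [l||].
- have X1: `|(mu *m E) 0 l+m*kap l*t 0 l| <= th*D*(kap l+10).
  have p0: 0<2*th*D by rewrite !mulr_gt0. have h1:=key l (2*th*D) (gtr0_norm p0).
  have h2:=key l (- (2*th*D)); rewrite normrN in h2; have {}h2:=h2 (gtr0_norm p0).
  rewrite -(ler_pM2l p0) -{1}(gtr0_norm p0) -normrM ler_norml; move: h1 h2; clear=> h1 h2. by bsplit; lra.
 rewrite mulmxBl nE subr0 mulmxBl xE subr0 yEt [(al*:t) 0 l]mxE. have -> : (mu *m E) 0 l+kap l*(al*t 0 l) =
   ((mu *m E) 0 l+m*kap l*t 0 l)+kap l*t 0 l*(al-m) by ring.
 rewrite (le_trans (ler_normD _ _))// !normrM (ger0_norm (kn l)). have am: `|al-m| <= 2*th.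
  by move: hal hm Dth Gth; clear; rewrite !ler_norml=> /andP[? ?] /andP[? ?] ? ?; bsplit; lra.
 have tl: `|t 0 l| <= 2*D by rewrite (le_trans (coord_le_enorm _ _)).
 have h3: kap l * `|t 0 l| * `|al-m| <= kap l*(2*D)*(2*th).
  by rewrite ler_pM ?mulr_ge0// ler_wpM2l.
 apply: (@le_trans _ _ (th*(5*k+10)*D)); last by rewrite ler_wpM2r// ltW.
 have: (th*D)*kap l<=(th*D)*k by rewrite ler_wpM2l// mulr_ge0// ltW. by move: X1 h3; clear; lra.
- by rewrite dotBl xn subr0.
rewrite dotBl (dotC nu) xn subr0 (_: dot mu x = - (dot (mu-nu) (y-x)+dot y nu)); last first.
 by rewrite dotBl !dotBr (dotC mu y) ym (dotC nu x) xn (dotC nu y); ring.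
rewrite normrN (le_trans (ler_normD _ _))// -mulrA mulrDl !mul1r lerD//.
rewrite (le_trans (dot_le _ _))// -/G -/D ler_wpM2r ?(ltW D0)//; lra.
Qed.

(** Expansions at different points x, each in its own frame, become a single statement in the frame
    of a nearby reference point u0, so that all pairs of one cell can be compared with each
    other. *)
Definition transfers n (k eps eta: R): Prop :=
 forall K x nu (E: 'M[R]_(n.+2, n)) kap u0 nu0 (E0: 'M[R]_(n.+2, n)) kap0 delta y mu,
 tframe x nu E -> (forall l, k^-1<=kap l<=k) -> gauss_expansion K x nu E kap eps delta ->
 normal_pair K y mu -> enorm (y-x)<delta -> enorm (mu-nu)<delta ->
 enorm (y-x)<=1/2 -> enorm (mu-nu)<=1 -> (y = x -> mu = nu) -> enorm (x-u0)<=eps -> enorm (nu-nu0)<=eps ->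
 (forall i l, `|E i l-E0 i l| <= eps) -> (forall l, `|kap l-kap0 l| <= eps) ->
 [/\ forall l, `|((mu-nu) *m E0) 0 l+kap0 l*((y-x) *m E0) 0 l| <= eta*enorm (y-x),
   `|dot (y-x) nu0| <= eta*enorm (y-x) & `|dot (mu-nu) u0| <= eta*enorm (mu-nu)].

(** With curvatures between 1/k and k, the displacements |mu - nu| and |y - x| bound each other
    ([GD], [DG]), so errors relative to one can be expressed in the other. Changing frame and
    curvatures by eps costs a multiple of eps. *)
Lemma gauss_transfer n (k eta: R): 0<k -> 0<eta -> exists2 eps: R, 0<eps & transfers n k eps eta.
move=> k0 eta0; pose N: R:=n%:R; have N0: 0<=N by [].
pose C:=2*(2+N*(k+1)); pose q:=(N+2)*(C+k)+1.
have Nk: 0<=N*k by rewrite mulr_ge0// ltW.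
have C0: 0<=C by rewrite /C; lra.
have q1: 1<=q by rewrite /q lerDr mulr_ge0// addr_ge0// ltW.
pose eps:=Num.min (1/(8*(N*k+1))) (Num.min (eta/(8*(N*k+1))) (eta/(3*q))).
have p0: 0<8*(N*k+1) by lra.
have q0: 0<3*q by lra.
have eps0: 0<eps by rewrite !lt_min !divr_gt0.
have e1: eps*(8*(N*k+1))<=1 by rewrite -ler_pdivlMr// ge_min lexx.
have e2: eps*(8*(N*k+1))<=eta by rewrite -ler_pdivlMr// !ge_min lexx !orbT.
have e3: eps*(3*q)<=eta by rewrite -ler_pdivlMr// !ge_min lexx !orbT.
clearbody eps; exists eps=> // K x nu E kap u0 nu0 E0 kap0 delta y mu.
have eN: 0<=eps*(N*k) by rewrite mulr_ge0// ltW.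
have eq: eps<=eps*q by rewrite ler_peMr// ltW.
move=> tE hk ge pm Dd Gd D1 G1 yxmu xu nun EE kk.
have [xx nn xn xE [nE _]]:=tE; have [_ yy mm ym _]:=pm.
have [yx|/eqP yx]:=eqVneq y x.
 rewrite yx (yxmu yx) !subrr enorm0 !dot0l !mulr0 normr0 lexx; split=> // l.
 by rewrite !mul0mx !mxE mulr0 addr0 normr0.
have [g1 g2 g3]:=ge _ _ pm yx Dd Gd.
set D:=enorm (y-x) in Dd D1 g1 g2 g3 *; set G:=enorm (mu-nu) in Gd G1 *.
have D0: 0<=D by exact: enorm_ge0.
have G0: 0<=G by exact: enorm_ge0.
have sum_le (z: 'rV[R]_n.+2): enorm z <= `|dot z x| + `|dot z nu| + \sum_l `|(z *m E) 0 l|.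
 rewrite {1}(tframeE z tE) (le_trans (enormD _ _))// lerD//; last first.
  apply: le_trans (enorm_le_sum _); rewrite /enorm dot_mulmx trmxK.
  by have [_ _ _ _ [_ EE1]]:=tE; rewrite -mulmxA EE1 mulmx1.
 by rewrite (le_trans (enormD _ _))// !enormZ (enorm_unit xx) (enorm_unit nn) !mulr1.
have sqE (a b: 'rV[R]_n.+2): dot a a = 1 -> dot b b = 1 -> `|dot (a-b) b| = enorm (a-b)^+2/2.
 move=> aa bb; rewrite enormE -[dot (a-b) b]opprK normrN. have -> : - dot (a-b) b = dot (a-b) (a-b)/2.
  by rewrite dotBr !dotBl aa bb (dotC b a); field. by rewrite ger0_norm// divr_ge0// dot_ge0.
have kD l: `|((mu-nu) *m E) 0 l| <= (k+eps)*D.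
 have /andP[k1 k2]:=hk l. have c1: `|((y-x) *m E) 0 l| <= D.
  by rewrite (le_trans (coord_le_enorm _ _))//; exact: enorm_tframe tE.
 have -> : ((mu-nu) *m E) 0 l = (((mu-nu) *m E) 0 l+kap l*((y-x) *m E) 0 l) -
   kap l*((y-x) *m E) 0 l by rewrite addrK.
 rewrite (le_trans (ler_normB _ _))// mulrDl addrC lerD// normrM ger0_norm; last first.
  by rewrite (le_trans _ k1)// invr_ge0 ltW. by rewrite ler_pM// (le_trans _ k1)// invr_ge0 ltW.
have GD: G<=C*D.
 have:=sum_le (mu-nu); rewrite (sqE _ _ mm nn) -/G=> h.
 have s1: \sum_l `|((mu-nu) *m E) 0 l| <= N*((k+eps)*D).
  apply: (le_trans (ler_sum _ (fun l _=> kD l))). by rewrite sumr_const card_ord -[leLHS]mulr_natl.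
 have G2: G^+2<=G by rewrite expr2 ler_piMl. have ep1: eps<=1 by move: e1 eN; clear; lra.
 have h3: eps*D<=D by rewrite ler_piMl. have h4: N*((k+eps)*D)<=N*(k+1)*D.
  by rewrite mulrA ler_wpM2r// ler_wpM2l// lerD2l. by rewrite /C; move: h s1 G2 h3 h4 g2 g3; clear; lra.
have DG: D<=2*(N*k)*G.
 have:=sum_le (y-x); rewrite (sqE _ _ yy xx) -/D=> h.
 have s1: \sum_l `|((y-x) *m E) 0 l| <= N*(k*(G+eps*D)).
  apply: (@le_trans _ _ (\sum_(l<n) k*(G+eps*D))); last first.
   by rewrite sumr_const card_ord -[leLHS]mulr_natl. apply: ler_sum=> l _; have /andP[k1 k2]:=hk l.
  rewrite -ler_pdivrMl//. have kl0: 0<=kap l by rewrite (le_trans _ k1)// invr_ge0 ltW.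
  apply: (@le_trans _ _ (kap l * `|((y-x) *m E) 0 l|)); first by rewrite ler_wpM2r.
  rewrite -(ger0_norm kl0) -normrM.
  have -> : kap l*((y-x) *m E) 0 l = (((mu-nu) *m E) 0 l+kap l*((y-x) *m E) 0 l) -
   ((mu-nu) *m E) 0 l by rewrite addrAC subrr add0r.
  rewrite (le_trans (ler_normB _ _))// addrC lerD// (le_trans (coord_le_enorm _ _))//.
  exact: enorm_tframe tE. have D2: D^+2<=D/2 by rewrite expr2 ler_wpM2l//; move: D1; clear; lra.
 have h2: eps*(N*k)*D<=1/8*D by rewrite ler_wpM2r//; move: e1 eps0; clear; lra.
 have h3: eps*D<=1/8*D by rewrite ler_wpM2r//; move: e1 eN; clear; lra.
 have: N*(k*(G+eps*D)) = N*k*G+eps*(N*k)*D by ring. by move: h s1 D2 h2 h3 g2; clear; lra.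
have colE l: enorm (\row_i (E0 i l-E i l))<=(N+2)*eps.
 rewrite (le_trans (enorm_le_sum _))//; apply: (@le_trans _ _ (\sum_(i<n.+2) eps)).
  by apply: ler_sum=> i _; rewrite mxE distrC.
 by rewrite sumr_const card_ord -[leLHS]mulr_natl -addn2 natrD.
have dE (z: 'rV[R]_n.+2) l: (z *m E0) 0 l = (z *m E) 0 l+dot z (\row_i (E0 i l-E i l)).
 rewrite !mxE /dot -big_split/=; apply: eq_bigr=> i _; rewrite mxE; ring.
have dE' (z: 'rV[R]_n.+2) l: `|dot z (\row_i (E0 i l-E i l))| <= (N+2)*eps*enorm z.
 by rewrite (le_trans (dot_le _ _))// mulrC ler_wpM2r ?enorm_ge0.
split.
- move=> l; have /andP[k1 k2]:=hk l; rewrite !dE.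
 have kl0: 0<=kap l by rewrite (le_trans _ k1)// invr_ge0 ltW.
 have a1:=dE' (mu-nu) l; have a2:=dE' (y-x) l; rewrite -/D in a2; rewrite -/G in a1.
 set r1:=dot (mu-nu) _ in a1 *; set r2:=dot (y-x) _ in a2 *.
 have c1: `|((y-x) *m E0) 0 l| <= (1+(N+2)*eps)*D.
  rewrite dE (le_trans (ler_normD _ _))// mulrDl mul1r lerD//.
  by rewrite (le_trans (coord_le_enorm _ _))//; exact: enorm_tframe tE. rewrite dE -/r2 in c1.
 set m1:=((mu-nu) *m E) 0 l in g1 *; set y1:=((y-x) *m E) 0 l in c1 *.
 have c1': `|y1| <= D by rewrite (le_trans (coord_le_enorm _ _))//; exact: enorm_tframe tE.
 have key: `|(m1+r1)+kap0 l*(y1+r2)| <= eps*D+(N+2)*eps*G+eps*((1+(N+2)*eps)*D) + k*((N+2)*eps*D).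
  have -> : (m1+r1)+kap0 l*(y1+r2) = (m1+kap l*y1)+r1+(- (kap l-kap0 l)*(y1+r2)) + kap l*r2 by ring.
  apply: (le_trans (ler_normD _ _)); apply: lerD; last by rewrite normrM (ger0_norm kl0) ler_pM.
  apply: (le_trans (ler_normD _ _)); apply: lerD; last by rewrite normrM normrN ler_pM.
  by apply: (le_trans (ler_normD _ _)); apply: lerD=> //; exact: g1. apply: (le_trans key).
 have h1: (N+2)*eps*G<=(N+2)*eps*(C*D) by rewrite ler_wpM2l// mulr_ge0 ?addr_ge0// ltW.
 have ep1: eps<=1 by move: e1 eN; clear; lra. have h2: eps*((1+(N+2)*eps)*D)<=eps*((1+(N+2))*D).
  by rewrite ler_wpM2l ?(ltW eps0)// ler_wpM2r// lerD2l ler_piMr// addr_ge0.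
 have h3: eps*(3*q)*D<=eta*D by rewrite ler_wpM2r. have h4: 0<=(N+2)*((2*C-1)+2*k)*(eps*D).
  rewrite mulr_ge0//; last by rewrite mulr_ge0// ltW.
  have hC: 0<=(2*C-1)+2*k by rewrite /C; move: N0 Nk k0; clear; lra. by rewrite mulr_ge0// addr_ge0.
 have h5: 0<=eps*D by rewrite mulr_ge0// ltW. by move: h1 h2 h3 h4 h5; rewrite /q; clear; lra.
- have -> : dot (y-x) nu0 = dot (y-x) nu-dot (y-x) (nu-nu0) by rewrite dotBr; ring.
 rewrite (le_trans (ler_normB _ _))//; have:=dot_le (y-x) (nu-nu0); rewrite -/D=> h.
 have h1:=ler_wpM2l D0 nun; have h2: eps*D*2<=eta*D by rewrite -mulrA (mulrC D) mulrA ler_wpM2r//; move: e3 eps0 eq; clear; lra.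
 by move: h h1 h2 g2; clear; lra.
- have -> : dot (mu-nu) u0 = dot (mu-nu) x-dot (mu-nu) (x-u0) by rewrite dotBr; ring.
 rewrite (le_trans (ler_normB _ _))//; have:=dot_le (mu-nu) (x-u0); rewrite -/G=> h.
 have h1:=ler_wpM2l G0 xu. have h2: 2*eps*D<=2*eps*(2*(N*k)*G) by rewrite ler_wpM2l// mulr_ge0// ltW.
 have h3: (eps*(4*(N*k)+1))*G<=eta*G by rewrite ler_wpM2r//; move: e2 eN eps0; clear; lra.
 by move: h h1 h2 h3 g3; clear; lra.
Qed.

End GaussMap.

(** * Continuity, and Borel images of compact sets *)

Section Continuity.
Context {R: realType}.

Lemma cont_fun_rV (T: topologicalType) n (f: T -> 'rV[R]_n) :
 (forall i, continuous (fun x=> f x 0 i)) -> continuous f.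
move=> fi x; apply/cvg_ballP=> e e0.
have h: \forall y \near x, forall i, ball (f x 0 i) e (f y 0 i).
 by apply: filter_forall=> i; move/cvg_ballP: (fi i x)=> /(_ _ e0).
by apply: filterS h=> y hy; split=> // i j; rewrite ord1; exact: hy.
Qed.

Lemma cont_cst_rV (T: topologicalType) n (b: 'rV[R]_n): continuous (fun _: T=> b).
Proof. by apply: cont_fun_rV=> i; exact: cst_continuous. Qed.

Lemma cont_addR (T: topologicalType) (f g: T -> R) :
 continuous f -> continuous g -> continuous (fun x=> f x+g x).
Proof. by move=> cf cg x; apply: (@continuousD _ _ _ f g x); [exact: cf|exact: cg]. Qed.

Lemma cont_mulR (T: topologicalType) (f g: T -> R) :
 continuous f -> continuous g -> continuous (fun x=> f x*g x).
Proof. by move=> cf cg x; apply: (@continuousM _ _ f g x); [exact: cf|exact: cg]. Qed.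

Lemma cont_mulmxr n p (M: 'M[R]_(n, p)): continuous (fun x: 'rV[R]_n=> x *m M).
apply: cont_fun_rV=> j.
rewrite (_: (fun x: 'rV[R]_n=> _) = dot (col j M)^T).
 exact: cont_dotr.
by apply/funext=> x; rewrite mxE; apply: eq_bigr=> i _; rewrite !mxE mulrC.
Qed.

Lemma cont_rVB (T: topologicalType) n (f g: T -> 'rV[R]_n) :
 continuous f -> continuous g -> continuous (fun x=> f x-g x).
move=> cf cg x; apply: (@continuousB _ _ _ f g x); [exact: cf|exact: cg].
Qed.

Lemma cont_dot (T: topologicalType) n (f g: T -> 'rV[R]_n) :
 continuous f -> continuous g -> continuous (fun x=> dot (f x) (g x)).
move=> cf cg.
have cadd: continuous (fun z: R*R=> z.1+z.2) by exact: add_continuous.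
have:=@continuous_big R 'I_n +%R 0 xpredT cadd T (index_enum _) (fun i z=> f z 0 i*g z 0 i).
apply=> i _ y; apply: continuousM.
 by apply: (@continuous_comp _ _ _ f (fun z=> z 0 i)); [exact: cf|exact: coord_continuous].
by apply: (@continuous_comp _ _ _ g (fun z=> z 0 i)); [exact: cg|exact: coord_continuous].
Qed.

Lemma cont_enorm (T: topologicalType) n (f: T -> 'rV[R]_n) :
 continuous f -> continuous (fun x=> enorm (f x)).
move=> cf x; apply: (@continuous_comp _ _ _ (fun x=> dot (f x) (f x)) Num.sqrt).
 exact: cont_dot.
exact: sqrt_continuous.
Qed.

Lemma cont_coordfun (T: topologicalType) n (f: T -> 'rV[R]_n) i :
 continuous f -> continuous (fun x=> f x 0 i).
by move=> cf x; apply: (@continuous_comp _ _ _ f (fun z=> z 0 i)); [exact: cf|exact: coord_continuous].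
Qed.

Lemma closed_le_fun (T: topologicalType) (f g: T -> R) :
 continuous f -> continuous g -> closed [set x | f x<=g x].
move=> cf cg; rewrite (_: mkset _ = (g \- f) @^-1` [set r | 0<=r]).
 by apply: closed_comp=> [x _|]; [apply: continuousB; [exact: cg|exact: cf]|exact: closed_ge].
by seteq=> x /=; rewrite subr_ge0.
Qed.

Lemma compact_rV n (A: set 'rV[R]_n) (r: R): closed A -> (forall x, A x -> enorm x<=r) -> compact A.
move=> cA hA; apply: bounded_closed_compact=> //; exists r; split; first exact: num_real.
move=> M rM x Ax; rewrite /= [`|x|]/Num.norm/= mx_normrE.
apply: bigmax_le=> [|[i j] _]/=.
 by rewrite (le_trans _ (ltW rM))// (le_trans (enorm_ge0 x))// hA.
by rewrite ord1 (le_trans (coord_le_enorm _ _))// (le_trans (hA _ Ax))// ltW.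
Qed.

Lemma compact_meas_rV n (A: set 'rV[R]_n): compact A -> measurable A.
by move=> cA; apply: measV_closed; apply: compact_closed=> //; exact: norm_hausdorff.
Qed.

(** Injectivity turns the image of a difference into a difference of compact images. *)
Lemma meas_image_diff a b (f: 'rV[R]_a -> 'rV[R]_b) (Z W: set 'rV[R]_a) :
 continuous f -> compact Z -> closed W ->
 (forall z w, Z z -> Z w -> f z = f w -> z = w) -> measurable (f @` (Z `\` W)).
move=> cf cZ cW inj; have cZW:=compact_closedI cZ cW.
have mim A: compact A -> measurable (f @` A).
 move=> cA; apply: compact_meas_rV; apply: continuous_compact=> //. exact: continuous_subspaceT.
rewrite (_: _ @` _ = (f @` Z) `\` (f @` (Z `&` W))).
 by apply: measurableD; exact: mim.
seteq=> [_ [z [Zz Wz] <-]|_ [[z Zz <-] h]].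
 split; first by []. by move=> [w [Zw Ww] e]; apply: Wz; rewrite -(inj _ _ Zw Zz e).
by exists z=> //; split=> // Wz; apply: h; exists z.
Qed.

(** The same for truncated cones: distinct points span distinct rays. The apex is added by s = 0 to
    make the cones compact and is removed afterwards. *)
Lemma meas_cone_diff a b (f: 'rV[R]_a -> 'rV[R]_b) (Z W: set 'rV[R]_a) :
 continuous f -> compact Z -> closed W -> (forall z, Z z -> f z != 0) ->
 (forall z w (r: R), Z z -> Z w -> 0<r -> f z = r*:f w -> z = w) ->
 measurable [set p | exists z (s: R), [/\ (Z `\` W) z, 0<s, s<=1 & p = s*:f z]].
move=> cf cZ cW f0 inj; have cZW:=compact_closedI cZ cW.
pose g (z: R * 'rV[R]_a):=z.1*:f z.2.
have cg: continuous g.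
 apply: cont_fun_rV=> i.
 rewrite (_: (fun x=> _) = fun x=> x.1*f x.2 0 i); last by apply/funext=> x; rewrite mxE.
 apply: cont_mulR; first by move=> x; exact: cvg_fst. apply: cont_coordfun=> x.
 by apply: (@continuous_comp _ _ _ snd f); [exact: cvg_snd|exact: cf].
have mim A: compact A -> measurable (g @` (`[0, 1] `*` A)).
 move=> cA; apply: compact_meas_rV; apply: continuous_compact; first exact: continuous_subspaceT.
 by apply: compact_setX=> //; exact: segment_compact.
rewrite (_: mkset _ = (g @` (`[0, 1] `*` Z)) `\` (g @` (`[0, 1] `*` (Z `&` W))) `\` [set 0]).
 apply: measurableD; first by apply: measurableD; exact: mim.
 by apply: measV_closed; apply: accessible_closed_set1; apply: hausdorff_accessible; exact: norm_hausdorff.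
seteq=> p /=.
 move=> [z [s [[Zz Wz] s0 s1 ->]]]; split; last first.
  by move/eqP; rewrite scaler_eq0 gt_eqF//= (negPf (f0 _ Zz)).
 split; first by exists (s, z)=> //; split=> //=; rewrite in_itv/= ltW.
 move=> [[t w] [/= + [Zw Ww]]]; rewrite in_itv/= /g/= => /andP[t0 t1] e.
 move: t0; rewrite le_eqVlt=> /predU1P[t0|t0].
  by move: e; rewrite -t0 scale0r=> /esym/eqP; rewrite scaler_eq0 gt_eqF//= (negPf (f0 _ Zz)).
 have zw: z = w.
  apply: (inj _ _ (t/s))=> //; first pos. by rewrite mulrC -scalerA e scalerA mulVf ?gt_eqF// scale1r.
 by apply: Wz; rewrite zw.
move=> [[[[s z] [/= + Zz] <-] h] p0]; rewrite in_itv/= => /andP[s0 s1].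
have s00: 0<s.
 rewrite lt_def s0 andbT; apply/eqP=> s00; apply: p0; by rewrite /g/= s00 scale0r.
exists z, s; split=> //; split=> // Wz; apply: h; exists (s, z)=> //; split=> //=.
by rewrite in_itv/= s0.
Qed.

End Continuity.

(** * Closed pieces of the graph of the Gauss map *)

Section Pieces.
Context {R: realType} (n: nat).
Local Notation V := 'rV[R]_n.+2.
Implicit Types (z w: 'rV[R]_(n.+2+n.+2)).

(** If x and x' are seen from o in the same direction with ratio r > 1, then r x' = x + b o with b >
    0. Pairing with mu' gives 0 on the left and a positive number on the right. For r = 1 the norms
    decide. The argument is symmetric in points and normals, so it also applies to normals. *)
Lemma radial_inj (o: V) To (x x' mu mu': V) (r: R): splits o To ->
 dot x x = 1 -> dot x' x' = 1 -> 0<dot x o -> 0<dot x' o -> 0<dot mu o -> 0<dot mu' o ->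
 dot x mu = 0 -> dot x' mu' = 0 -> 0<=dot x' mu -> 0<=dot x mu' -> 0<r -> x *m To = r*:(x' *m To) -> x = x'.
wlog: x x' mu mu' r/1<=r.
 move=> H so xx xx' xo xo' mo mo' xm xm' h1 h2 r0 e. have [r1|r1]:=leP 1 r; first exact: (H x x' mu mu' r).
 apply/esym; apply: (H x' x mu' mu r^-1)=> //; first by rewrite invf_ge1// ltW.
  pos. by rewrite e scalerA mulVf ?gt_eqF// scale1r.
move=> r1 so xx xx' xo xo' mo mo' xm xm' h1 h2 r0 e.
have e2: dot x o^+2+r^+2*dot (x' *m To) (x' *m To) = 1.
 by rewrite -xx (splits_dot x x so) e dotZl dotZr; ring.
have e3: dot x' o^+2+dot (x' *m To) (x' *m To) = 1.
 by rewrite -xx' (splits_dot x' x' so); ring.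
have D0:=dot_ge0 (x' *m To).
have le: dot x o<=dot x' o.
 rewrite -ler_sqr ?nnegrE ?(ltW xo) ?(ltW xo')//.
 have: dot (x' *m To) (x' *m To)<=r^+2*dot (x' *m To) (x' *m To).
  by rewrite ler_peMl// exprn_ege1. move: e2 e3; clear; lra.
move: r1; rewrite le_eqVlt=> /predU1P[r1|r1].
 rewrite (splitsE x so) (splitsE x' so) e -r1 scale1r; congr (_*:_+_).
 apply/eqP; rewrite -(eqrXn2 (ltn0Sn 1)) ?ltW//; apply/eqP. by move: e2 e3; rewrite -r1; clear; lra.
exfalso; pose b:=r*dot x' o-dot x o.
have b0: 0<b by rewrite subr_gt0 (le_lt_trans le)// ltr_pMl.
have xE: r*:x' = x+b*:o.
 rewrite {1}(splitsE x' so) {1}(splitsE x so) e scalerDr !scalerA -scalemxAl /b scalerBl.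
 by rewrite addrAC addrCA subrr addr0.
have: dot (r*:x') mu' = 0 by rewrite dotZl xm' mulr0.
rewrite xE dotDl dotZl=> h; have: 0<b*dot o mu' by rewrite mulr_gt0// dotC.
move: h h2; clear; lra.
Qed.

Definition flat_pair (eta: R) (u nu: V) (E: 'M[R]_(n.+2, n)) (kap: 'I_n -> R) z w: Prop :=
 [/\ forall l, `|((rsubmx z-rsubmx w) *m E) 0 l+kap l*((lsubmx z-lsubmx w) *m E) 0 l|
    <= eta*enorm (lsubmx z-lsubmx w), `|dot (lsubmx z-lsubmx w) nu| <= eta*enorm (lsubmx z-lsubmx w) &
   `|dot (rsubmx z-rsubmx w) u| <= eta*enorm (rsubmx z-rsubmx w)].

(** An element of [Z] is a pair (point, normal) written as one row vector. As the normal is a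
    coordinate, all conditions are closed, so pieces are compact although the choice of normals has
    no regularity. *)
Definition piece (K: set V) (eta: R) u nu E kap (Z: set 'rV[R]_(n.+2+n.+2)): Prop := [/\ closed Z,
   forall z, Z z -> [/\ normal_pair K (lsubmx z) (rsubmx z),
    enorm (lsubmx z-u)<=eta & enorm (rsubmx z-nu)<=eta] &
   forall z w, Z z -> Z w -> flat_pair eta u nu E kap z w].

Section ClosedRelations.
Variables (T: topologicalType) (p q: T -> V).
Hypotheses (cp: continuous p) (cq: continuous q).

Lemma closed_flat_rel eta u nu (E: 'M[R]_(n.+2, n)) (kap: 'I_n -> R) (a b: V): closed [set y |
 [/\ forall l, `|((b-q y) *m E) 0 l+kap l*((a-p y) *m E) 0 l| <= eta*enorm (a-p y),
   `|dot (a-p y) nu| <= eta*enorm (a-p y) & `|dot (b-q y) u| <= eta*enorm (b-q y)]].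
have cc (c: V): continuous (fun y: T=> c) by exact: cont_cst_rV.
have cr (c: R): continuous (fun y: T=> c) by exact: cst_continuous.
have c1: continuous (fun y=> a-p y):=cont_rVB (cc _) cp.
have c2: continuous (fun y=> b-q y):=cont_rVB (cc _) cq.
have cn1:=cont_mulR (cr eta) (cont_enorm c1).
have cn2:=cont_mulR (cr eta) (cont_enorm c2).
have cA (f: T -> R): continuous f -> continuous (fun y=> `|f y|).
 by move=> cf y; apply: continuous_comp; [exact: cf|exact: norm_continuous].
have cmul (f: T -> V) l: continuous f -> continuous (fun y=> (f y *m E) 0 l).
 move=> cf; apply: cont_coordfun=> y.
 by apply: (@continuous_comp _ _ _ f (fun v=> v *m E)); [exact: cf|exact: cont_mulmxr].
rewrite (_: mkset _ = (\bigcap_l [set y | `|((b-q y) *m E) 0 l+kap l*((a-p y) *m E) 0 l| <=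
  eta*enorm (a-p y)]) `&` [set y | `|dot (a-p y) nu| <= eta*enorm (a-p y)] `&`
  [set y | `|dot (b-q y) u| <= eta*enorm (b-q y)]); last first.
 seteq=> y /= => [[k ? ?]|[[k ?] ?]]; split=> //; last by move=> l; exact: k. by split=> // l _; exact: k.
apply: closedI; first apply: closedI.
- apply: closed_bigI=> l _; apply: closed_le_fun=> //; apply: cA.
 exact: (cont_addR (cmul _ l c2) (cont_mulR (cr (kap l)) (cmul _ l c1))).
- by apply: closed_le_fun=> //; apply: cA; exact: (cont_dot c1 (cc nu)).
- by apply: closed_le_fun=> //; apply: cA; exact: (cont_dot c2 (cc u)).
Qed.

Lemma closed_near_pair (K: set V) eta u nu: closed K -> closed [set y |
 [/\ normal_pair K (p y) (q y), enorm (p y-u)<=eta & enorm (q y-nu)<=eta]].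
move=> cK.
have cc (c: V): continuous (fun y: T=> c) by exact: cont_cst_rV.
have cr (c: R): continuous (fun y: T=> c) by exact: cst_continuous.
have eqs (f: T -> R) a: continuous f -> closed [set y | f y = a].
 by move=> cf; apply: (@closed_comp _ _ f [set a])=> [y _|]; [exact: cf|exact: closed_eq].
rewrite (_: mkset _ = (p @^-1` K) `&` [set y | dot (p y) (p y) = 1] `&`
  [set y | dot (q y) (q y) = 1] `&` [set y | dot (p y) (q y) = 0] `&`
  (\bigcap_(v in K) [set y | 0<=dot v (q y)]) `&` [set y | enorm (p y-u)<=eta] `&`
  [set y | enorm (q y-nu)<=eta]); last first.
 by seteq=> y /= => [[[? ? ? ? h] ? ?]|[[[[[[? ?] ?] ?] h] ?] ?]]; repeat split=> //.
apply: closedI; last first.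
 by apply: closed_le_fun=> //; exact: (cont_enorm (cont_rVB cq (cc nu))).
apply: closedI; last first.
 by apply: closed_le_fun=> //; exact: (cont_enorm (cont_rVB cp (cc u))).
apply: closedI; last first.
 by apply: closed_bigI=> v _; apply: closed_le_fun=> //; exact: (cont_dot (cc v) cq).
apply: closedI; last by apply: eqs; exact: cont_dot.
apply: closedI; last by apply: eqs; exact: cont_dot.
apply: closedI; last by apply: eqs; exact: cont_dot.
by apply: closed_comp=> // y _; exact: cp.
Qed.

End ClosedRelations.

(** The binary relation is closed in each variable and symmetric, so it passes to the closure in one
    variable and then in the other. *)
Lemma closure_piece K eta u nu E kap P: closed K ->
 (forall z, P z -> [/\ normal_pair K (lsubmx z) (rsubmx z),
    enorm (lsubmx z-u)<=eta & enorm (rsubmx z-nu)<=eta]) ->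
 (forall z w, P z -> P w -> flat_pair eta u nu E kap z w) -> piece K eta u nu E kap (closure P).
move=> cK h1 h2.
have cl:=@continuous_lsubmx R 1 n.+2 n.+2; have cr:=@continuous_rsubmx R 1 n.+2 n.+2.
have clo (A B: set 'rV[R]_(n.+2+n.+2)): closed B -> A `<=` B -> closure A `<=` B.
 by move=> cB AB; rewrite [in X in _ `<=` X](_: B = closure B); [exact: closure_subset|exact/closure_id].
have cflat z: closed (flat_pair eta u nu E kap z) by exact: (closed_flat_rel cl cr).
have sflat z w: flat_pair eta u nu E kap z w -> flat_pair eta u nu E kap w z.
 have sw (x y: V): y-x = - (x-y) by rewrite opprB.
 move=> [a b c]; split; rewrite ?(sw (lsubmx z)) ?(sw (rsubmx z)) ?dotNl ?normrN ?enormN//.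
 move=> l; rewrite ?(sw (lsubmx z)) ?(sw (rsubmx z)) ?enormN !mulNmx.
 rewrite [(- (_ *m _)) 0 l]mxE [X in _*X]mxE mulrN -opprD normrN; exact: a.
split; first exact: closed_closure.
 have H:=clo P _ (@closed_near_pair _ _ _ cl cr K eta u nu cK). by move=> z Pz; exact: (H h1 z Pz).
move=> z w Pz Pw.
have s1 z': P z' -> flat_pair eta u nu E kap z' w.
 by move=> Pz'; apply: (clo P _ (cflat z')) Pw=> w'; exact: h2.
by apply: (sflat w z); apply: (clo P _ (cflat w)) Pz=> z' Pz'; apply: (sflat z' w); exact: s1.
Qed.

End Pieces.

(** * The arithmetic-geometric mean inequality on one piece *)

Section Scalars.
Context {R: realType}.

(** Tangent of exp at the weighted mean m of the logarithms. *)
Lemma weighted_amgm (d: nat) (a b lam: R): 0<a -> 0<b -> 0<lam ->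
 (a^+d*b) `^ (d.+1%:R^-1)<=d%:R/d.+1%:R * lam*a+lam^-d/d.+1%:R*b.
move=> a0 b0 l0; pose x:=ln (lam*a); pose y:=ln (lam^-d*b).
have D0: 0<d.+1%:R :> R by rewrite ltr0n.
have p1: 0<lam*a by rewrite mulr_gt0.
have p2: 0<lam^-d*b by rewrite mulr_gt0// invr_gt0 exprn_gt0.
have ex: expR x = lam*a by rewrite lnK.
have ey: expR y = lam^-d*b by rewrite lnK.
have -> : a^+d*b = expR (d%:R*x+y).
 rewrite expRD ey -mulr_natl mulr_natl expRM_natl ex exprMn; field. by rewrite expf_neq0// gt_eqF.
pose m:=(d%:R*x+y)/d.+1%:R.
have -> : expR (d%:R*x+y) `^ d.+1%:R^-1 = expR m by rewrite -expRM.
have e1: expR m*(1+(x-m))<=expR x.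
 by rewrite -[leRHS](_: expR m*expR (x-m) = _) ?ler_pM2l ?expR_gt0 ?expR_ge1Dx// -expRD addrC subrK.
have e2: expR m*(1+(y-m))<=expR y.
 by rewrite -[leRHS](_: expR m*expR (y-m) = _) ?ler_pM2l ?expR_gt0 ?expR_ge1Dx// -expRD addrC subrK.
have -> : d%:R/d.+1%:R * lam*a+lam^-d/d.+1%:R*b = (d%:R*expR x+expR y)/d.+1%:R.
 by rewrite ex ey; field; rewrite gt_eqF// expf_neq0// gt_eqF.
rewrite ler_pdivlMr//; apply: le_trans (lerD (ler_wpM2l (ler0n R d) e1) e2).
have hm: d.+1%:R * m = d%:R*x+y by rewrite /m mulrC divfK// gt_eqF.
have -> : d%:R*(expR m*(1+(x-m)))+expR m*(1+(y-m)) = expR m*(d%:R+1+(d%:R*x+y-(d%:R+1) * m)) by ring.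
by rewrite natr1 -hm subrr addr0.
Qed.

Lemma frad_shrink (d: nat) (r1 r0: R): (0<d)%N -> 0<r1 -> r1<=r0 -> frad d r0<=(r0/r1)^+d*frad d r1.
move=> d0 r10 r1r0; rewrite /frad mulrA -exprMn divfK ?gt_eqF//.
have r00:=lt_le_trans r10 r1r0.
rewrite ler_pM2l ?exprn_gt0// ler_expR !mulNr lerN2 ler_wpM2l//.
 rewrite divr_ge0 ?mulr_ge0// subr_ge0 -natrX ler1n expn_gt0 d0//.
have s1: 0<1+r1^+2 by rewrite ltr_pwDl// sqr_ge0.
have s0: 0<1+r0^+2 by rewrite ltr_pwDl// sqr_ge0.
by rewrite ler_ln ?posrE// lerD2l ler_sqr ?nnegrE// ltW.
Qed.

Lemma frad_base (d: nat) (p q: R): (0<d)%N -> 0<p -> 0<q -> p^+2+q^+2 = 1 ->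
 frad d (q/p) = q^+d*expR (- (d%:R^-1 * ln p)).
move=> d0 p0 q0 pq; rewrite /frad expr_div_n.
have -> : 1+(q/p)^+2 = p^-2.
 rewrite (_: p^-2 = (p^+2+q^+2)/p^+2); last by rewrite pq mul1r.
 by rewrite expr_div_n; field; rewrite gt_eqF.
rewrite lnV ?posrE ?exprn_gt0// lnXn// -mulrA; congr (_*_).
rewrite -{1}(lnK (_: p \in Num.pos)) ?posrE// -expRM_natl -expRN -expRD; congr expR.
rewrite /aexp -mulr_natl; field; rewrite pnatr_eq0; lia.
Qed.

Lemma le_inv1B (x y: R): 0<=x -> x<=y -> y<1 -> 1+x<=(1-y)^-1.
move=> x0 xy y1; rewrite -[leRHS]mul1r ler_pdivlMr ?subr_gt0//.
have: 0<=x*y by rewrite mulr_ge0// (le_trans x0).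
lra.
Qed.

(** Bookkeeping for one piece. [h0] and [t0] are the flat areas of points and normals, [rA] and [rN]
    the volumes of the cones over them, [sR] the solid angle, [ds] the dual volume; [p] and [v] are
    the cosines of point and normal with o, [P] is the curvature product, [D] the dimension, and
    powers of [md] collect error factors near 1. The choice a = v p^(-1/d), b = P p v^(-d) satisfies
    a^d b = P and turns a h0 into solid angle times F, and b h0 into dual volume. *)
Lemma piece_scalars (d: nat) (md P p v x q h0 t0 rA rN ds sR F1 D lam: R) :
 1<=md -> 0<P -> 0<p -> 0<v -> 0<x -> 0<=h0 -> 0<=t0 -> 0<=ds -> 0<=sR ->
 0<=F1 -> 0<=D -> 0<lam -> x^+d = p^-1 -> v*h0<=md^+2*D*rA -> p*t0<=md^+2*D*rN -> P*h0<=md*t0 ->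
 rA<=q * md*sR -> rN<=v^+d * md*ds -> q*x<=md^+2*F1 ->
 P `^ d.+1%:R^-1*h0<=md^+7*D*(d%:R/d.+1%:R * lam*(sR*F1)+lam^-d/d.+1%:R*ds).
move=> m1 P0 p0 v0 x0 h00 t00 ds0 sR0 F10 D0 lam0 xd S1 S2 cmp rbA rbN qx.
have m0: 0<md:=lt_le_trans ltr01 m1.
have mk k: 0<=md^+k by rewrite exprn_ge0// ltW.
have mkD k: 0<=md^+k*D by rewrite mulr_ge0.
pose a:=v*x; pose b:=P * p/v^+d.
have a0: 0<a by rewrite mulr_gt0.
have b0: 0<b by rewrite divr_gt0 ?mulr_gt0 ?exprn_gt0.
have ab: a^+d*b = P.
 by rewrite /a /b exprMn xd; field; rewrite expf_neq0 !gt_eqF.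
have ag:=weighted_amgm d a0 b0 lam0; rewrite ab in ag.
have fa: a*h0<=md^+5*D*(sR*F1).
 have -> : a*h0 = x*(v*h0) by rewrite /a; ring.
 have s1: v*h0<=md^+2*D*(q * md*sR) by rewrite (le_trans S1)// ler_wpM2l.
 apply: (le_trans (ler_wpM2l (ltW x0) s1)). have -> : x*(md^+2*D*(q * md*sR)) = (md^+3*D*sR)*(q*x) by ring.
 have -> : md^+5*D*(sR*F1) = (md^+3*D*sR)*(md^+2*F1) by ring. by rewrite ler_wpM2l// mulr_ge0.
have fb: b*h0<=md^+4*D*ds.
 have vd0: 0<v^+d by rewrite exprn_gt0. have -> : b*h0 = (P*h0) * p/v^+d by rewrite /b; ring.
 rewrite ler_pdivrMr//. have s1: P*h0 * p<=md*(p*t0).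
  rewrite (_: md*(p*t0) = (md*t0) * p); last by ring. by rewrite ler_pM2r. apply: (le_trans s1).
 have s2: p*t0<=md^+2*D*(v^+d * md*ds) by rewrite (le_trans S2)// ler_wpM2l.
 apply: (le_trans (ler_wpM2l (ltW m0) s2)); eqle; ring.
have c10: 0<=d%:R/d.+1%:R * lam by rewrite mulr_ge0 ?divr_ge0 ?(ltW lam0).
have c20: 0<=lam^-d/d.+1%:R by rewrite divr_ge0 ?invr_ge0 ?exprn_ge0 ?(ltW lam0).
apply: (le_trans (ler_wpM2r h00 ag)).
rewrite mulrDl.
have m57: md^+5*D*(sR*F1)<=md^+7*D*(sR*F1).
 by rewrite ler_wpM2r ?mulr_ge0// ler_wpM2r// ler_weXn2l.
have m47: md^+4*D*ds<=md^+7*D*ds by rewrite ler_wpM2r// ler_wpM2r// ler_weXn2l.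
have -> : d%:R/d.+1%:R * lam*a*h0+lam^-d/d.+1%:R*b*h0 =
 (d%:R/d.+1%:R * lam)*(a*h0)+(lam^-d/d.+1%:R)*(b*h0) by ring.
have -> : md^+7*D*(d%:R/d.+1%:R * lam*(sR*F1)+lam^-d/d.+1%:R*ds) =
 (d%:R/d.+1%:R * lam)*(md^+7*D*(sR*F1))+(lam^-d/d.+1%:R)*(md^+7*D*ds) by ring.
by apply: lerD; apply: ler_wpM2l=> //; [apply: le_trans m57|apply: le_trans m47].
Qed.

End Scalars.

Section PieceBound.
Context {R: realType} (n: nat).
Local Notation V := 'rV[R]_n.+2.
Local Notation d := n.+1.
Variables (K: set V) (o: V) (To: 'M[R]_(n.+2, n.+1)) (c: R).
Hypotheses (so: splits o To) (c0: 0<c) (c1: c<=1).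
Hypothesis hK: forall y mu, normal_pair K y mu -> c<=dot y o /\ c<=dot mu o.

Definition pcone (A: set V): set 'rV[R]_n.+1 := [set p | exists x (s: R), [/\ A x, 0<s & p = s*:(x *m To)]].

(** For an inner normal x of K, the vector -x/(x.o), projected to the hyperplane orthogonal to o, is
    a point of the polar body of X; the segments to these points sweep out part of that body
    ([dcone_polar]). *)
Definition dcone (N: set V): set 'rV[R]_n.+1 :=
 [set p | exists x (s: R), [/\ N x, 0<s, s<=1 & p = s*:(- (dot x o)^-1*:(x *m To))]].

(** As x.mu = 0, the components orthogonal to o have product -(x.o)(mu.o), of size at least c^2, so
    neither of them is small. *)
Lemma tail_ge (x mu: V): normal_pair K x mu -> c^+2<=enorm (x *m To) /\ c^+2<=enorm (mu *m To).
move=> pm; have [xo mo]:=hK pm; have [_ xx mm xm _]:=pm.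
have e:=splits_dot x mu so; rewrite xm in e.
have h: c^+2 <= `|dot (x *m To) (mu *m To)|.
 rewrite (_: dot (x *m To) _ = - (dot x o*dot mu o)); last by move: e; lra.
 by rewrite normrN ger0_norm ?mulr_ge0 ?(le_trans (ltW c0))// expr2 ler_pM// ltW.
have u1 (y: V): dot y y = 1 -> enorm (y *m To)<=1.
 by move=> yy; rewrite -(enorm_unit yy); exact: enorm_splits so.
have:=dot_le (x *m To) (mu *m To); have h1:=u1 _ xx; have h2:=u1 _ mm.
have h3:=ler_piMr (enorm_ge0 (x *m To)) h2; have h4:=ler_piMl (enorm_ge0 (mu *m To)) h1.
by move: h h3 h4; split; lra.
Qed.

Variables (eta k: R) (u nu: V) (E: 'M[R]_(n.+2, n)) (kap: 'I_n -> R).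
Variables (Z W: set 'rV[R]_(n.+2+n.+2)).
Hypotheses (pZ: piece K eta u nu E kap Z) (tE: tframe u nu E) (cW: closed W).
Hypotheses (un: normal_pair K u nu) (eta0: 0<eta) (k0: 0<k) (kk: forall l, k^-1<=kap l).

(** One parameter dominating three errors: the slab estimates, the linearisation of the Gauss map,
    and the variation over the piece of the components along and across o. *)
Let xi:=eta*(8*(1+c^-1)+2*n%:R*k+c^-2).
Hypothesis xi1: xi<1.
Let Mx:=(1-xi)^-1.

Let ci1: 1<=c^-1. Proof. by rewrite invf_ge1. Qed.
Let ci2: 1<=c^-2. Proof. by rewrite -exprVn exprn_ege1. Qed.
Let nk0: 0<=2*n%:R*k. Proof. by rewrite !mulr_ge0// ltW. Qed.

Let xi0: 0<xi.
Proof. by rewrite mulr_gt0//; move: ci1 ci2 nk0; lra. Qed.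

Let Mx1: 1<=Mx.
Proof. rewrite /Mx invf_ge1 ?subr_gt0//; move: xi0; lra. Qed.

Let xi_le (b: R): b<=8*(1+c^-1)+2*n%:R*k+c^-2 -> eta*b<=xi.
Proof. by move=> h; rewrite /xi ler_pM2l. Qed.

Let eta1: eta<=1/2.
have:=@xi_le 2 _; move: ci1 ci2 nk0 xi1; set X:=c^-1; set Y:=c^-2; set t:=2*n%:R*k.
by move=> a1 a2 a3 a4 /(_ ltac:(lra)) ?; lra.
Qed.

Let D:=Z `\` W.
Let A:=lsubmx @` D.
Let N:=rsubmx @` D.

Let sw:=tframe_swap tE.

Let AS x: A x -> dot x x = 1.
Proof. by have [_ h _]:=pZ; move=> [z [/h[[]]]] ? ? ? ? ? ? ? ? <-. Qed.
Let NS x: N x -> dot x x = 1.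
Proof. by have [_ h _]:=pZ; move=> [z [/h[[]]]] ? ? ? ? ? ? ? ? <-. Qed.
Let Au x: A x -> enorm (x-u)<=eta.
Proof. by have [_ h _]:=pZ; move=> [z [/h[]]] ? ? ? ? <-. Qed.
Let Nu x: N x -> enorm (x-nu)<=eta.
Proof. by have [_ h _]:=pZ; move=> [z [/h[]]] ? ? ? ? <-. Qed.

Let expl z w: Z z -> Z w -> enorm (lsubmx z-lsubmx w)<=2*enorm ((lsubmx z-lsubmx w) *m E).
have [_ h hp]:=pZ=> Zz Zw.
have:=@flat_expand R n u nu E (lsubmx @` Z) eta tE eta0 eta1.
have H1 x: (lsubmx @` Z) x -> dot x x = 1 by move=> [y /h[[]]] ? ? ? ? ? ? ? <-.
have H2 x: (lsubmx @` Z) x -> enorm (x-u)<=eta by move=> [y /h[]] ? ? ? <-.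
have H3 x y: (lsubmx @` Z) x -> (lsubmx @` Z) y -> `|dot (x-y) nu| <= eta*enorm (x-y).
 by move=> [x' Zx <-] [y' Zy <-]; have []:=hp _ _ Zx Zy.
move=> /(_ H1 H2 H3 (lsubmx z) (lsubmx w)) /(_ (imageP _ Zz) (imageP _ Zw)) /le_trans; apply.
rewrite ler_wpM2r ?enorm_ge0//.
have: eta^+2<=1/4.
 rewrite expr2 (_: 1/4 = 1/2*(1/2) :> R); last by field. by rewrite ler_pM// ltW.
by lra.
Qed.

Let expr_ z w: Z z -> Z w -> enorm (rsubmx z-rsubmx w)<=2*enorm ((rsubmx z-rsubmx w) *m E).
have [_ h hp]:=pZ=> Zz Zw.
have:=@flat_expand R n nu u E (rsubmx @` Z) eta sw eta0 eta1.
have H1 x: (rsubmx @` Z) x -> dot x x = 1 by move=> [y /h[[]]] ? ? ? ? ? ? ? <-.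
have H2 x: (rsubmx @` Z) x -> enorm (x-nu)<=eta by move=> [y /h[]] ? ? ? <-.
have H3 x y: (rsubmx @` Z) x -> (rsubmx @` Z) y -> `|dot (x-y) u| <= eta*enorm (x-y).
 by move=> [x' Zx <-] [y' Zy <-]; have []:=hp _ _ Zx Zy.
move=> /(_ H1 H2 H3 (rsubmx z) (rsubmx w)) /(_ (imageP _ Zz) (imageP _ Zw)) /le_trans; apply.
rewrite ler_wpM2r ?enorm_ge0//.
have: eta^+2<=1/4.
 rewrite expr2 (_: 1/4 = 1/2*(1/2) :> R); last by field. by rewrite ler_pM// ltW.
by lra.
Qed.

(** The linear model of the Gauss map in principal coordinates, up to sign. [gauss_f] says that
    actual normals deviate from it by the relative error [xi]. *)
Let f (z: 'rV[R]_(n.+2+n.+2)): 'rV[R]_n:=dilate (\row_i kap i) (lsubmx z *m E).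
Let kap0 l: 0<kap l. Proof. by rewrite (lt_le_trans _ (kk l))// invr_gt0. Qed.

Let fE z w: f z-f w = dilate (\row_i kap i) ((lsubmx z-lsubmx w) *m E).
Proof. by apply/rowP=> i; rewrite mulmxBl !mxE mulrBr. Qed.

Let f_le z w: enorm ((lsubmx z-lsubmx w) *m E)<=k*enorm (f z-f w).
rewrite fE; set v:=_ *m E; rewrite -(ger0_norm (ltW k0)) -enormZ /enorm ler_wsqrtr//.
apply: ler_sum=> i _; rewrite !mxE -!expr2 mulrA exprMn ler_peMl ?sqr_ge0//.
by rewrite exprn_ege1// -ler_pdivrMl ?mulr1.
Qed.

Let gauss_f z w: Z z -> Z w -> enorm ((rsubmx z-rsubmx w) *m E+(f z-f w))<=xi*enorm (f z-f w).
have [_ h hp]:=pZ=> Zz Zw; have [g1 _ _]:=hp _ _ Zz Zw.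
apply: (le_trans (enorm_le_sum _)).
apply: (@le_trans _ _ (\sum_(l<n) eta*enorm (lsubmx z-lsubmx w))).
 by apply: ler_sum=> l _; have:=g1 l; rewrite fE !mxE.
rewrite sumr_const card_ord -[leLHS]mulr_natl.
apply: (@le_trans _ _ ((eta*(2*n%:R*k))*enorm (f z-f w))); last first.
 by rewrite ler_wpM2r ?enorm_ge0//; apply: xi_le; move: ci1 ci2; lra.
have e1:=expl Zz Zw; have e2:=f_le z w.
have e3: enorm (lsubmx z-lsubmx w)<=2*(k*enorm (f z-f w)) by move: e1 e2; lra.
have: (n%:R*eta)*enorm (lsubmx z-lsubmx w)<=(n%:R*eta)*(2*(k*enorm (f z-f w))).
 by rewrite ler_wpM2l// mulr_ge0// ltW.
by lra.
Qed.

Let f_r z w: Z z -> Z w -> enorm (f z-f w)<=Mx*enorm (rsubmx z *m E-rsubmx w *m E).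
move=> Zz Zw; rewrite /Mx ler_pdivlMl ?subr_gt0// -mulmxBl.
have:=gauss_f Zz Zw; have:=lerB_enorm (f z-f w) (- ((rsubmx z-rsubmx w) *m E)).
by rewrite enormN opprK [f z-f w+_]addrC; lra.
Qed.

Let injl z w: Z z -> Z w -> lsubmx z = lsubmx w -> z = w.
move=> Zz Zw e; have:=gauss_f Zz Zw; rewrite fE e subrr mul0mx.
have d0: dilate (\row_i kap i) (0: 'rV[R]_n) = 0 by apply/rowP=> i; rewrite !mxE mulr0.
rewrite d0 addr0 enorm0 mulr0=> h; have:=expr_ Zz Zw.
have -> : enorm ((rsubmx z-rsubmx w) *m E) = 0 by apply/le_anti; rewrite h enorm_ge0.
rewrite mulr0=> h2; have: enorm (rsubmx z-rsubmx w) == 0 by apply/eqP/le_anti; rewrite h2 enorm_ge0.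
rewrite enorm_eq0 subr_eq0=> /eqP e2.
by rewrite -(hsubmxK z) -(hsubmxK w) e e2.
Qed.

Let injr z w: Z z -> Z w -> rsubmx z = rsubmx w -> z = w.
move=> Zz Zw e; have:=f_r Zz Zw; rewrite e subrr enorm0 mulr0=> h.
have e2:=f_le z w; have e1:=expl Zz Zw.
have z0: enorm (f z-f w) = 0 by apply/le_anti; rewrite h enorm_ge0.
rewrite z0 mulr0 in e2.
have: enorm (lsubmx z-lsubmx w) == 0.
 by apply/eqP/le_anti; rewrite enorm_ge0 andbT; move: e1 e2; lra.
rewrite enorm_eq0 subr_eq0=> /eqP e3.
by rewrite -(hsubmxK z) -(hsubmxK w) e e3.
Qed.

Let dotp z: Z z -> 0<dot (lsubmx z) o /\ 0<dot (rsubmx z) o.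
by have [_ h _]:=pZ; move=> /h[/hK[a b] _ _]; split; apply: lt_le_trans c0 _.
Qed.

Let radl z w (r: R): Z z -> Z w -> 0<r -> lsubmx z *m To = r*:(lsubmx w *m To) -> z = w.
have [_ h _]:=pZ=> Zz Zw r0 e; apply: injl=> //.
have [[a1 a2 a3 a4 a5] _ _]:=h _ Zz; have [[b1 b2 b3 b4 b5] _ _]:=h _ Zw.
have [? ?]:=dotp Zz; have [? ?]:=dotp Zw.
by apply: (radial_inj (mu:=rsubmx z) (mu':=rsubmx w) (r:=r) so)=> //; [exact: a5|exact: b5].
Qed.

Let radr z w (r: R): Z z -> Z w -> 0<r -> rsubmx z *m To = r*:(rsubmx w *m To) -> z = w.
have [_ h _]:=pZ=> Zz Zw r0 e; apply: injr=> //.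
have [[a1 a2 a3 a4 a5] _ _]:=h _ Zz; have [[b1 b2 b3 b4 b5] _ _]:=h _ Zw.
have [? ?]:=dotp Zz; have [? ?]:=dotp Zw.
apply: (radial_inj (mu:=lsubmx z) (mu':=lsubmx w) (r:=r) so)=> //; rewrite dotC//.
 exact: b5.
exact: a5.
Qed.

Let tail0 z: Z z -> lsubmx z *m To != 0 /\ rsubmx z *m To != 0.
have [_ h _]:=pZ; move=> /h[/tail_ge[a b] _ _].
by split; rewrite -enorm_gt0; [apply: lt_le_trans a|apply: lt_le_trans b]; rewrite exprn_gt0.
Qed.

Let cZ: compact Z.
have [clZ h _]:=pZ; apply: (compact_rV (r:=2) clZ)=> z /h[[_ ll rr _ _] _ _].
have -> : enorm z = Num.sqrt (dot (lsubmx z) (lsubmx z)+dot (rsubmx z) (rsubmx z)).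
 rewrite /enorm /dot big_split_ord/=; congr (Num.sqrt (_+_)); apply: eq_bigr=> i _; by rewrite mxE.
by rewrite ll rr -[leRHS]ger0_norm// -sqrtr_sqr ler_wsqrtr//; lra.
Qed.

Let cl:=@continuous_lsubmx R 1 n.+2 n.+2.
Let cr:=@continuous_rsubmx R 1 n.+2 n.+2.
Let cmul (g: 'rV[R]_(n.+2+n.+2) -> V) p (M: 'M[R]_(n.+2, p)): continuous g ->
 continuous (fun z: 'rV[R]_(n.+2+n.+2)=> g z *m M).
by move=> cg z; apply: (@continuous_comp _ _ _ g (fun v=> v *m M)); [exact: cg|exact: cont_mulmxr].
Qed.

Let tauAE: (fun x=> x *m E) @` A = (fun z=> lsubmx z *m E) @` D.
Proof. by rewrite /A image_comp. Qed.
Let tauNE: (fun x=> x *m E) @` N = (fun z=> rsubmx z *m E) @` D.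
Proof. by rewrite /N image_comp. Qed.

Let mtA: measurable ((fun x=> x *m E) @` A).
rewrite tauAE; apply: (meas_image_diff (@cmul _ _ E cl) cZ cW).
move=> z w Zz Zw e; apply: injl=> //; apply/eqP; rewrite -subr_eq0 -enorm_eq0.
apply/eqP/le_anti; rewrite enorm_ge0 andbT (le_trans (expl Zz Zw))// mulmxBl e subrr enorm0 mulr0//.
Qed.

Let mtN: measurable ((fun x=> x *m E) @` N).
rewrite tauNE; apply: (meas_image_diff (@cmul _ _ E cr) cZ cW).
move=> z w Zz Zw e; apply: injr=> //; apply/eqP; rewrite -subr_eq0 -enorm_eq0.
apply/eqP/le_anti; rewrite enorm_ge0 andbT (le_trans (expr_ Zz Zw))// mulmxBl e subrr enorm0 mulr0//.
Qed.

Let mrA: measurable (rcone To A).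
rewrite (_: rcone To A = [set p | exists z (s: R), [/\ D z, 0<s, s<=1 & p = s*:(lsubmx z *m To)]]).
 by apply: (meas_cone_diff (@cmul _ _ To cl) cZ cW); [move=> z /tail0[]|exact: radl].
seteq=> p; first by move=> [_ [s [[z Dz <-] s0 s1 ->]]]; exists z, s.
by move=> [z [s [Dz s0 s1 ->]]]; exists (lsubmx z), s; split=> //; exists z.
Qed.

Let mrN: measurable (rcone To N).
rewrite (_: rcone To N = [set p | exists z (s: R), [/\ D z, 0<s, s<=1 & p = s*:(rsubmx z *m To)]]).
 by apply: (meas_cone_diff (@cmul _ _ To cr) cZ cW); [move=> z /tail0[]|exact: radr].
seteq=> p; first by move=> [_ [s [[z Dz <-] s0 s1 ->]]]; exists z, s.
by move=> [z [s [Dz s0 s1 ->]]]; exists (rsubmx z), s; split=> //; exists z.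
Qed.

Lemma meas_dcone: measurable (dcone N).
(* This is max(t, c). It agrees with the identity on the values taken on the piece and makes the map
   [g] continuous on the whole space. *)
pose m (t: R):=(t+c + `|t-c|)/2.
have mge t: c<=m t by rewrite /m; case: ger0P; lra.
have mt t: c<=t -> m t = t by move=> ct; rewrite /m ger0_norm ?subr_ge0//; field.
pose g (z: 'rV[R]_(n.+2+n.+2)): 'rV[R]_d := - (m (dot (rsubmx z) o))^-1*:(rsubmx z *m To).
have cg: continuous g.
 apply: cont_fun_rV=> i.
 rewrite (_: (fun z=> _) = fun z=> - (m (dot (rsubmx z) o))^-1*(rsubmx z *m To) 0 i); last first.
  by apply/funext=> z; rewrite mxE.
 apply: cont_mulR; last by apply: cont_coordfun; exact: (@cmul _ _ To cr).
 have cd: continuous (fun z: 'rV[R]_(n.+2+n.+2)=> dot (rsubmx z) o) by apply: (cont_dot cr); exact: cont_cst_rV.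
 have cm: continuous (fun z: 'rV[R]_(n.+2+n.+2)=> m (dot (rsubmx z) o)).
  apply: cont_mulR; last exact: cst_continuous.
  apply: cont_addR; first by apply: cont_addR=> //; exact: cst_continuous.
  move=> z; apply: (@continuous_comp _ _ _ (fun z: 'rV[R]_(n.+2+n.+2)=> dot (rsubmx z) o-c) Num.norm); last exact: norm_continuous.
  by apply: (cont_addR cd); exact: cst_continuous.
 rewrite (_: (fun z=> _) = fun z: 'rV[R]_(n.+2+n.+2)=> -1*(m (dot (rsubmx z) o))^-1); last first.
  by apply/funext=> z; rewrite mulN1r. apply: cont_mulR; first exact: cst_continuous.
 move=> z; apply: (@continuousV R _ (fun z: 'rV[R]_(n.+2+n.+2)=> m (dot (rsubmx z) o)) z); last exact: cm.
 by rewrite gt_eqF// (lt_le_trans c0).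
rewrite (_: dcone N = [set p | exists z (s: R), [/\ D z, 0<s, s<=1 & p = s*:g z]]).
 have mZ z: Z z -> m (dot (rsubmx z) o) = dot (rsubmx z) o.
  by have [_ h _]:=pZ; move=> /h[/hK[_ b] _ _]; exact: mt. apply: (meas_cone_diff cg cZ cW).
  move=> z Zz; have [_ t0]:=tail0 Zz; have [_ p]:=dotp Zz.
  by rewrite /g mZ// scaler_eq0 oppr_eq0 invr_eq0 gt_eqF.
 move=> z w r Zz Zw r0; rewrite /g !mZ// => /eqP; rewrite !scaleNr scalerN eqr_opp=> /eqP e.
 have [_ p1]:=dotp Zz; have [_ p2]:=dotp Zw.
 apply: (radr (r:=dot (rsubmx z) o*(r/dot (rsubmx w) o)))=> //; first by rewrite mulr_gt0// divr_gt0.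
 rewrite -[LHS](_: dot (rsubmx z) o*:((dot (rsubmx z) o)^-1*:(rsubmx z *m To)) = _).
  by rewrite e !scalerA mulrA. by rewrite scalerA divff ?scale1r// gt_eqF.
have mD z: D z -> m (dot (rsubmx z) o) = dot (rsubmx z) o.
 by have [_ h _]:=pZ; move=> [/h[/hK[_ b] _ _] _]; exact: mt.
seteq=> p.
 by move=> [_ [s [[z Dz <-] s0 s1 ->]]]; exists z, s; rewrite /g mD.
by move=> [z [s [Dz s0 s1 ->]]]; exists (rsubmx z), s; rewrite /g mD//; split=> //; exists z.
Qed.

Lemma meas_pcone: measurable (pcone A).
rewrite (_: pcone A = \bigcup_j ((fun p=> j.+1%:R^-1*:p) @^-1` rcone To A)).
 apply: bigcup_measurable=> j _; rewrite -measTI. have mm: mfunT (fun p: 'rV[R]_d=> j.+1%:R^-1*:p).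
  by apply: (meas_rVZ (f:=fun=> j.+1%:R^-1) (g:=id)); [exact: measurable_cst|exact: measurable_id].
 exact: (mm measurableT _ mrA).
seteq=> p.
 move=> [x [s [Ax s0 ->]]]; exists (Num.truncn s)=> //; exists x, ((Num.truncn s).+1%:R^-1*s).
 split=> //; rewrite ?scalerA//; first by rewrite mulr_gt0// invr_gt0.
 by rewrite mulrC ler_pdivrMr// mul1r ltW// truncnS_gt.
move=> [j _ [x [s [Ax s0 s1 e]]]]; exists x, (j.+1%:R*s); split=> //; first by rewrite mulr_gt0.
by rewrite -scalerA -e scalerA divff ?scale1r// pnatr_eq0.
Qed.

Lemma meas_pieceA: measurable A.
Proof. exact: (meas_image_diff cl cZ cW injl). Qed.

Lemma pcone_scale (s: R) p: 0<s -> pcone A p -> pcone A (s*:p).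
Proof. by move=> s0 [x [t [Ax t0 ->]]]; exists x, (s*t); rewrite mulr_gt0// scalerA. Qed.

(** Slab estimates for the points and, with the roles of u and nu exchanged, for the normals; the
    Jacobian comparison [cmp] links the two areas and [piece_scalars] concludes. The radius in
    [frad] is slightly below the tangent of the polar angle of every point of the piece, so that the
    sector of that radius lies inside X. *)
Lemma piece_bound (lam: R): 0<lam -> (((\prod_l kap l) `^ (n.+2%:R^-1))%:E*hausdorff n A <=
  (Mx^+(8*d)*hratio n*d%:R)%:E * ((d%:R/d.+1%:R * lam*(coneR (pcone A) *
    frad d ((enorm (u *m To)-eta)/(dot u o+eta))))%:E + (lam^-d/d.+1%:R)%:E * leb d (dcone N)))%E.
move=> lam0; have [uo no]:=hK un; have [q0 _]:=tail_ge un.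
have p00: 0<dot u o:=lt_le_trans c0 uo.
have n00: 0<dot nu o:=lt_le_trans c0 no.
have c20: 0<c^+2 by rewrite exprn_gt0.
have q00: 0<enorm (u *m To):=lt_le_trans c20 q0.
have Mx0: 0<Mx:=lt_le_trans ltr01 Mx1.
have eM (e: R): e<=xi -> (1-e)^-1<=Mx /\ 0<(1-e)^-1.
 move=> h; have e1: e<1:=le_lt_trans h xi1.
 by rewrite /Mx lef_pV2 ?posrE ?subr_gt0// lerD2l lerN2 invr_gt0 subr_gt0.
have ecu (y: V): c<=dot o y -> 8*eta*(1+(dot o y)^-1)<=xi.
 move=> cy; have y0:=lt_le_trans c0 cy. have iy: (dot o y)^-1<=c^-1 by rewrite lef_pV2 ?posrE.
 have -> : 8*eta*(1+(dot o y)^-1) = eta*(8*(1+(dot o y)^-1)) by ring. by apply: xi_le; move: ci2 nk0; lra.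
have on: c<=dot o nu by rewrite dotC.
have ou: c<=dot o u by rewrite dotC.
have [MA MA0]:=eM _ (ecu _ on); have [MN MN0]:=eM _ (ecu _ ou).
have eA1: 8*eta*(1+(dot o nu)^-1)<1:=le_lt_trans (ecu _ on) xi1.
have eN1: 8*eta*(1+(dot o u)^-1)<1:=le_lt_trans (ecu _ ou) xi1.
have on0:=lt_le_trans c0 on; have ou0:=lt_le_trans c0 ou.
have Anu x y: A x -> A y -> `|dot (x-y) nu| <= eta*enorm (x-y).
 by have [_ _ hp]:=pZ; move=> [z [Zz _] <-] [w [Zw _] <-]; have []:=hp _ _ Zz Zw.
have Nnu x y: N x -> N y -> `|dot (x-y) u| <= eta*enorm (x-y).
 by have [_ _ hp]:=pZ; move=> [z [Zz _] <-] [w [Zw _] <-]; have []:=hp _ _ Zz Zw.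
have Ainj x y s: A x -> A y -> 0<s -> x *m To = s*:(y *m To) -> x = y.
 by move=> [z [Zz _] <-] [w [Zw _] <-] s0 /(radl Zz Zw s0) ->.
have Ninj x y s: N x -> N y -> 0<s -> x *m To = s*:(y *m To) -> x = y.
 by move=> [z [Zz _] <-] [w [Zw _] <-] s0 /(radr Zz Zw s0) ->.
have Ane x: A x -> x *m To != 0 by move=> [z [/tail0[]]] ? ? ? <-.
have Nne x: N x -> x *m To != 0 by move=> [z [/tail0[]]] ? ? ? <-.
have H1:=haus_upper tE on0 eta0 eta1 AS Au Anu mtA eA1.
have S1:=slab_upper so tE on0 eta0 eta1 AS Au Anu Ainj Ane mtA mrA eA1.
have S2:=slab_upper so sw ou0 eta0 eta1 NS Nu Nnu Ninj Nne mtN mrN eN1.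
have unit_tail (y: V) p (M: 'M[R]_(n.+2, p)): (forall z, enorm (z *m M)<=enorm z) -> dot y y = 1 -> enorm (y *m M)<=1.
 by move=> h yy; rewrite -(enorm_unit yy).
have nE z: enorm (z *m E)<=enorm z by exact: enorm_tframe tE.
have nT z: enorm (z *m To)<=enorm z by exact: enorm_splits so.
have fA: (leb n ((fun x=> x *m E) @` A) < +oo)%E.
 by apply: (leb_lty (r:=1))=> // _ [x Ax <-]; exact: (unit_tail _ _ _ nE (AS Ax)).
have fN: (leb n ((fun x=> x *m E) @` N) < +oo)%E.
 by apply: (leb_lty (r:=1))=> // _ [x Ax <-]; exact: (unit_tail _ _ _ nE (NS Ax)).
have rb (B: set V): (forall x, B x -> dot x x = 1) -> forall p, rcone To B p -> enorm p<=1.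
 move=> BS p [x [s [Bx s0 s1 ->]]]; rewrite enormZ gtr0_norm// mulr_ile1 ?enorm_ge0 ?(ltW s0)//.
 exact: (unit_tail _ _ _ nT (BS _ Bx)).
have frA: (leb n.+1 (rcone To A) < +oo)%E by apply: (leb_lty (r:=1))=> //; apply: rb.
have frN: (leb n.+1 (rcone To N) < +oo)%E by apply: (leb_lty (r:=1))=> //; apply: rb.
have dotN x: N x -> c<=dot x o by have [_ h _]:=pZ; move=> [z [/h[/hK[_ b] _ _] _] <-].
have fD: (leb n.+1 (dcone N) < +oo)%E.
 apply: (leb_lty (r:=c^-1)); last exact: meas_dcone.
 move=> p [x [s [Nx s0 s1 ->]]]; have xo:=lt_le_trans c0 (dotN _ Nx).
 rewrite !enormZ normrN normfV (gtr0_norm s0) (gtr0_norm xo). have t1:=unit_tail _ _ _ nT (NS Nx).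
 have i1: (dot x o)^-1<=c^-1 by rewrite lef_pV2 ?posrE ?dotN.
 have i2: 0<=(dot x o)^-1 by rewrite invr_ge0 ltW. have h1: (dot x o)^-1*enorm (x *m To)<=c^-1.
  by rewrite -[leRHS]mulr1; apply: ler_pM=> //; exact: enorm_ge0.
 apply: le_trans h1; rewrite ler_piMl// mulr_ge0//; exact: enorm_ge0.
have PP0: 0 < \prod_l kap l by rewrite prodr_gt0.
(* The product of curvatures is the Jacobian of the linear model, and passing from the model to the
   actual normals costs the factor [Mx] to the power n. *)
have cmp: ((\prod_l kap l)%:E * leb n ((fun x=> x *m E) @` A) <=
  (Mx^+n)%:E * leb n ((fun x=> x *m E) @` N))%E. have kr i: 0<(\row_i kap i: 'rV[R]_n) 0 i by rewrite mxE.
 have preE: (fun x=> x *m E) @` A = dilate (\row_i kap i) @^-1` (f @` D).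
  have dinj x y: dilate (\row_i kap i) x = dilate (\row_i kap i) y -> x = y :> 'rV[R]_n.
   move=> e; apply/rowP=> i; have /rowP/(_ i):=e; rewrite !mxE. by move/mulfI; apply; rewrite gt_eqF.
  rewrite tauAE; seteq=> p.
   by move=> [z Dz <-]; exists z. by move=> [z Dz /dinj <-]; exists z. have cf: continuous f.
  apply: cont_fun_rV=> i.
  rewrite (_: (fun z=> _) = fun z=> kap i*(lsubmx z *m E) 0 i); last by apply/funext=> z; rewrite !mxE.
  apply: cont_mulR; first exact: cst_continuous. by apply: cont_coordfun; exact: (@cmul _ _ E cl).
 have mfD: measurable (f @` D).
  apply: (meas_image_diff cf cZ cW)=> z w Zz Zw e; apply: injl=> //.
  apply/eqP; rewrite -subr_eq0 -enorm_eq0; apply/eqP/le_anti; rewrite enorm_ge0 andbT.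
  have:=f_le z w; rewrite e subrr enorm0 mulr0=> h; have:=expl Zz Zw; move: h; lra.
 have:=leb_setdilate kr mfD; rewrite -preE (eq_bigr kap)=> [->|i _]; last by rewrite mxE.
 rewrite tauNE; apply: leb_compare=> //; first by rewrite -tauNE. by move=> z w [Zz _] [Zw _]; exact: f_r.
have rbA: (leb n.+1 (rcone To A)<=((enorm (u *m To)+eta)^+d*coneR (pcone A))%:E)%E.
 rewrite -leb_coneball; [|exact: meas_pcone|exact: pcone_scale|by rewrite addr_gt0].
 apply: le_measure; rewrite ?inE//.
  by apply: measurableI; [exact: meas_pcone|exact: meas_eball].
 move=> p [x [s [Ax s0 s1 ->]]]; split; first by exists x, s.
 rewrite /= enormZ gtr0_norm//; apply: (@le_trans _ _ (enorm (x *m To))); first by rewrite ler_piMl ?enorm_ge0.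
 rewrite -(subrK (u *m To) (x *m To)) addrC (le_trans (enormD _ _))// lerD2l -mulmxBl.
 exact: le_trans (nT _) (Au Ax).
(* Reflect [dcone N] and dilate it by nu.o + eta: it then contains the cone over the normals,
   because x.o <= nu.o + eta for each normal x of the piece. *)
have rbN: (leb n.+1 (rcone To N)<=((dot nu o+eta)^+d)%:E * leb n.+1 (dcone N))%E.
 have mp: 0<dot nu o+eta by rewrite addr_gt0.
 have mpre (r: R) (B: set 'rV[R]_d): measurable B -> measurable ((fun x=> r*:x) @^-1` B).
  move=> mB; rewrite -measTI. have mm: mfunT (fun p: 'rV[R]_d=> r*:p).
   by apply: (meas_rVZ (f:=fun=> r) (g:=id)); [exact: measurable_cst|exact: measurable_id].
  exact: (mm measurableT _ mB).
 have oppE: leb n.+1 (dcone N) = leb n.+1 (-%R @^-1` dcone N) by rewrite leb_setN//; exact: meas_dcone.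
 have mo: measurable ((-%R: 'rV[R]_d -> 'rV[R]_d) @^-1` dcone N).
  rewrite (_: _ @^-1` _ = (fun x=> (-1)*:x) @^-1` dcone N); first by apply: mpre; exact: meas_dcone.
  by seteq=> x /=; rewrite scaleN1r. rewrite oppE; set B:=_ @^-1` dcone N in mo *.
 have mi:=mpre (dot nu o+eta)^-1 _ mo. have h:=leb_setZ mp mi.
 have e2: (fun x=> (dot nu o+eta)*:x) @^-1` ((fun x=> (dot nu o+eta)^-1*:x) @^-1` B) = B.
  by seteq=> x; rewrite /preimage/= scalerA mulVf ?scale1r// gt_eqF.
 rewrite e2 in h; rewrite h; apply: le_measure; rewrite ?inE//.
 move=> p [x [s [Nx s0 s1 ->]]]; rewrite /B /=. have xo:=lt_le_trans c0 (dotN _ Nx).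
 have xn: dot x o<=dot nu o+eta.
  have -> : dot x o = dot nu o+dot (x-nu) o by rewrite dotBl; ring.
  rewrite lerD2l (le_trans (dot_le_enorm _ _))//; have [oo _ _]:=so; rewrite (enorm_unit oo) mulr1.
  exact: Nu. exists x, (s*(dot x o/(dot nu o+eta))); split=> //.
 - by rewrite mulr_gt0// divr_gt0.
 - have f1: dot x o/(dot nu o+eta)<=1 by rewrite ler_pdivrMr// mul1r.
  have f0: 0<=dot x o/(dot nu o+eta) by rewrite divr_ge0// ltW. by apply: mulr_ile1=> //; exact: ltW.
 - rewrite !scalerA -scaleNr; congr (_*:_); field; by rewrite !gt_eqF.
have hr0: 0 < @hratio R n by exact: hratio_gt0.
pose h0:=fine (leb n ((fun x=> x *m E) @` A)); pose t0:=fine (leb n ((fun x=> x *m E) @` N)).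
pose rA:=fine (leb n.+1 (rcone To A)); pose rN:=fine (leb n.+1 (rcone To N)).
pose ds:=fine (leb n.+1 (dcone N)).
have finE p (B: set 'rV[R]_p): (leb p B < +oo)%E -> leb p B = (fine (leb p B))%:E.
 by move=> h; rewrite fineK// ge0_fin_numE.
have h0E:=finE _ _ fA; have t0E:=finE _ _ fN; have rAE:=finE _ _ frA; have rNE:=finE _ _ frN; have dsE:=finE _ _ fD.
rewrite -/h0 in h0E; rewrite -/t0 in t0E; rewrite -/rA in rAE; rewrite -/rN in rNE; rewrite -/ds in dsE.
have h00: 0<=h0 by exact: fine_ge0.
have t00: 0<=t0 by exact: fine_ge0.
have rA0: 0<=rA by exact: fine_ge0.
have rN0: 0<=rN by exact: fine_ge0.
have ds0: 0<=ds by exact: fine_ge0.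
have sR0:=coneR_ge0 (pcone A).
apply: (le_trans (lee_wpmul2l _ H1)); first by rewrite lee_fin powR_ge0.
have fin (A' B C' X Y': R): A'*(B*h0)<=C'*(X+Y'*ds) -> (A'%:E*(B%:E*h0%:E)<=C'%:E*(X%:E+Y'%:E*ds%:E))%E.
 by move=> h; rewrite -(EFinM B) -(EFinM A') -(EFinM Y') -EFinD -EFinM lee_fin.
rewrite h0E dsE; apply: fin; move: S1 S2 cmp rbA rbN.
rewrite h0E t0E rAE rNE dsE -!EFinM !lee_fin.
set sR:=coneR _ in sR0 *; 
set mA:=(1-8*eta*(1+(dot o nu)^-1))^-1 in MA MA0 *.
set mN:=(1-8*eta*(1+(dot o u)^-1))^-1 in MN MN0 *.
set q:=enorm (u *m To) in q0 q00 *; set p:=dot u o in uo p00 *; set v:=dot nu o in no n00 *.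
have ov: dot o nu = v by rewrite dotC.
have op: dot o u = p by rewrite dotC.
rewrite ov op; set P := \prod_l kap l in PP0 *.
have d0: 0<d%:R :> R by rewrite ltr0n.
pose md:=Mx^+d; have md1: 1<=md by rewrite exprn_ege1.
have md0: 0<md:=lt_le_trans ltr01 md1.
have mn1: Mx^+n<=md by rewrite /md exprS ler_peMl// exprn_ge0// ltW.
have mn0: 0<=Mx^+n by rewrite exprn_ge0// ltW.
have ge1B x: 0<=x -> x<=xi -> 1+x<=Mx by move=> x0 xx; exact: le_inv1B.
have eta_c2: eta*c^-2<=xi by apply: xi_le; move: ci1 nk0; lra.
have eta_le (y: R): c^+2<=y -> eta/y<=xi.
 move=> cy; apply: le_trans eta_c2; rewrite ler_pM2l// lef_pV2 ?posrE//; exact: lt_le_trans cy.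
have c2c: c^+2<=c by rewrite expr2 ler_piMl// ltW.
have scl (y: R): c^+2<=y -> (y+eta)^+d<=y^+d * md.
 move=> cy; have y0:=lt_le_trans c20 cy.
 rewrite /md -exprMn lerXn2r ?nnegrE ?addr_ge0 ?mulr_ge0 ?(ltW y0) ?(ltW Mx0) ?(ltW eta0)//.
 have -> : y+eta = y*(1+eta/y) by field; rewrite gt_eqF. have a1: 0<=eta/y by apply: divr_ge0; exact: ltW.
 by rewrite ler_pM2l// ge1B// eta_le.
move=> S1 S2 cmp rbA rbN.
have MAd: mA^+(d+d)<=md * md.
 by rewrite exprD ler_pM ?exprn_ge0 ?(ltW MA0)// lerXn2r ?nnegrE ?(ltW MA0) ?(ltW Mx0).
have MNd: mN^+(d+d)<=md * md.
 by rewrite exprD ler_pM ?exprn_ge0 ?(ltW MN0)// lerXn2r ?nnegrE ?(ltW MN0) ?(ltW Mx0).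
have MAn: mA^+n<=md.
 by apply: le_trans mn1; rewrite lerXn2r ?nnegrE ?(ltW MA0) ?(ltW Mx0).
(* This is p^(-1/d), so that [frad] at the tangent q/p of the polar angle of u equals q^d x. *)
pose x:=expR (- (d%:R^-1 * ln p)); have x0: 0<x by exact: expR_gt0.
have pq: p^+2+q^+2 = 1.
 by have [uu _ _ _ _]:=tE; rewrite -uu (splits_dot u u so) /p /q enormE expr2.
have F0: frad d (q/p) = q^+d*x by rewrite frad_base.
set rho:=(q-eta)/(p+eta).
have qe: 0<q-eta.
 have:=eta_le _ q0; rewrite ler_pdivrMr// => h; rewrite subr_gt0 (le_lt_trans h)//.
 by rewrite -[ltRHS]mul1r ltr_pM2r.
have rho0: 0<rho by rewrite divr_gt0// addr_gt0.
have rq: rho<=q/p.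
 have pe: 0<p+eta by rewrite addr_gt0.
 apply: ler_pM; [exact: ltW|by rewrite invr_ge0 ltW|by rewrite gerBl ltW|].
 by rewrite lef_pV2 ?posrE// lerDl ltW.
have F1:=@frad_shrink R d _ _ (ltn0Sn n) rho0 rq.
have F10: 0<=frad d rho by rewrite mulr_ge0 ?exprn_ge0 ?expR_ge0 ?(ltW rho0).
have rat: (q/p/rho)^+d<=md * md.
 have -> : q/p/rho = (q/(q-eta))*(1+eta/p) by rewrite /rho; field; rewrite !gt_eqF// addr_gt0.
 have r1: 0<=q/(q-eta) by apply: divr_ge0; exact: ltW. have r3: 0<=eta/p by apply: divr_ge0; exact: ltW.
 have r2: 0<=1+eta/p by rewrite addr_ge0.
 rewrite exprMn; apply: ler_pM; [exact: exprn_ge0|exact: exprn_ge0| |].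
  rewrite lerXn2r ?nnegrE ?(ltW Mx0)//. rewrite ler_pdivrMr// /Mx ler_pdivlMl ?subr_gt0//.
  have h:=eta_le _ q0; rewrite ler_pdivrMr// in h. by rewrite mulrBl mul1r lerD2l lerN2.
 rewrite lerXn2r ?nnegrE ?(ltW Mx0)//. by rewrite ge1B// eta_le// (le_trans c2c).
have xd: x^+d = p^-1.
 by rewrite /x -expRM_natl -mulr_natl mulrN mulrA divff ?gt_eqF// mul1r expRN lnK.
have key: P `^ d.+1%:R^-1*h0<=md^+7*d%:R*(d%:R/d.+1%:R * lam*(sR*frad d rho)+lam^-d/d.+1%:R*ds).
 have g1: mA^+(d+d)*d%:R<=md^+2*d%:R by rewrite expr2 ler_pM2r.
 have g2: mN^+(d+d)*d%:R<=md^+2*d%:R by rewrite expr2 ler_pM2r.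
 have f1: v*h0<=md^+2*d%:R*rA:=le_trans S1 (ler_wpM2r rA0 g1).
 have f2: p*t0<=md^+2*d%:R*rN:=le_trans S2 (ler_wpM2r rN0 g2).
 have f3: P*h0<=md*t0:=le_trans cmp (ler_wpM2r t00 mn1).
 have f4: rA<=q^+d * md*sR:=le_trans rbA (ler_wpM2r sR0 (scl _ q0)).
 have f5: rN<=v^+d * md*ds:=le_trans rbN (ler_wpM2r ds0 (scl _ (le_trans c2c no))).
 have f6: q^+d*x<=md^+2*frad d rho.
  by rewrite -F0 expr2; exact: (le_trans F1 (ler_wpM2r F10 rat)).
 exact: (@piece_scalars R d md P p v x (q^+d) h0 t0 rA rN ds sR (frad d rho) d%:R lam
  md1 PP0 p00 n00 x0 h00 t00 ds0 sR0 F10 (ltW d0) lam0 xd f1 f2 f3 f4 f5 f6).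
rewrite mulnC exprM -/md.
have -> : P `^ d.+1%:R^-1*(mA^+n*hratio n*h0) = mA^+n*(hratio n*(P `^ d.+1%:R^-1*h0)) by ring.
rewrite (_: md^+8*_*_*_ = md*(hratio n*(md^+7*d%:R *
  (d%:R/d.+1%:R * lam*(sR*frad d rho)+lam^-d/d.+1%:R*ds)))); last by ring.
apply: ler_pM.
- by apply: exprn_ge0; exact: ltW.
- by rewrite mulr_ge0 ?(ltW hr0)// mulr_ge0// powR_ge0.
- exact: MAn.
- by rewrite ler_pM2l.
Qed.

End PieceBound.

(** * Geometry of spherical convex bodies *)

Section BodyGeometry.
Context {R: realType} (n: nat).
Local Notation V := 'rV[R]_n.+2.
Variables (K: set V).

(** In the orthonormal basis u, e of the plane of u and v, the minimal arc consists of cos(s) u +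
    sin(s) e with s from 0 to [th]. The normalised combination has angle [ph] from u, and [ph] <=
    [th] since cos is decreasing and [cx] holds. *)
Lemma body_conv (u v: V) (a b: R): spherical_convex_body (d:=n.+1) K -> v != - u -> K u -> K v ->
 0<a -> 0<b -> K (nrm (a*:u+b*:v)).
move=> [KS _ _ hK] vu Ku Kv a0 b0.
have uu: dot u u = 1 by exact: KS.
have vv: dot v v = 1 by exact: KS.
have nz (w: V) (r: R): dot w w = 1 -> 0<r -> nrm (r*:w) = w.
 move=> ww r0; rewrite /nrm enormZ (enorm_unit ww) mulr1 gtr0_norm// scalerA mulVf ?scale1r//. pos.
have [<-|uv]:=eqVneq u v; first by rewrite -scalerDl nz// addr_gt0.
pose c:=dot u v.
have c2: c^+2<1.
 have: c^+2<=1 by rewrite (le_trans (dot_sqr_le u v))// uu vv mulr1.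
 rewrite le_eqVlt=> /predU1P[c21|//]; exfalso. have c3: (c-1)*(c+1) = c^+2-1 by ring.
 have: (c-1)*(c+1) = 0 by rewrite c3 c21 subrr.
 move/eqP; rewrite mulf_eq0=> /orP[]; rewrite ?subr_eq0 ?addr_eq0=> /eqP c1.
  move: uv; rewrite -subr_eq0 -dot_eq0 dotBl !dotBr uu vv (dotC v) -/c c1; move/eqP; apply; ring.
 move: vu; rewrite -subr_eq0 opprK -dot_eq0 dotDl !dotDr uu vv (dotC v) -/c c1; move/eqP; apply; ring.
have cm: -1<=c<=1 by rewrite -ler_norml -ler_sqr ?nnegrE// real_normK ?num_real// expr1n ltW.
have /andP[cm1 cm2]:=cm.
pose th:=acos c; pose s:=Num.sqrt (1-c^+2).
have s0: 0<s by rewrite sqrtr_gt0 subr_gt0.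
have s2: s^+2 = 1-c^+2 by rewrite sqr_sqrtr// subr_ge0 ltW.
have cth: cos th = c by rewrite acosK// in_itv.
have sth: sin th = s by rewrite /th sin_acos.
have th0: 0<th.
 rewrite lt_def acos_ge0// andbT; apply/eqP=> t0; move: sth; rewrite t0 sin0=> e. by rewrite -e ltxx in s0.
pose e:=s^-1*:(v-c*:u).
have ue: dot u e = 0 by rewrite /e dotZr dotBr dotZr uu -/c mulr1 subrr mulr0.
have ee: dot e e = 1.
 rewrite /e dotZl dotZr dotBl !dotBr !dotZl !dotZr uu vv (dotC v) -/c.
 rewrite (_: _-_ = s^+2); last by rewrite s2; ring. by field; rewrite gt_eqF.
have vE: v = c*:u+s*:e by rewrite /e scalerA divff ?gt_eqF// scale1r addrC subrK.
pose q:=nrm (a*:u+b*:v); rewrite -/q.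
pose r:=enorm (a*:u+b*:v).
have r2: r^+2 = a^+2+b^+2+2*a*b*c.
 by rewrite /r enormE dotDl !dotDr !dotZl !dotZr uu vv (dotC v) -/c; ring.
have r0: 0<r.
 rewrite lt_def enorm_ge0 andbT; apply/eqP=> rz; move: r2; rewrite rz expr0n/= => /esym.
 have -> : a^+2+b^+2+2*a*b*c = (a+b*c)^+2+b^+2*(1-c^+2) by ring.
 move/eqP; rewrite paddr_eq0 ?sqr_ge0// ?mulr_ge0 ?sqr_ge0 ?subr_ge0 ?ltW// => /andP[_].
 by rewrite mulf_eq0 sqrf_eq0 gt_eqF//= subr_eq0 gt_eqF.
have qE: q = (r^-1*(a+b*c))*:u+(r^-1*(b*s))*:e.
 have abE: a*:u+b*:v = (a+b*c)*:u+(b*s)*:e.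
  by rewrite {1}vE scalerDr !scalerA addrA -scalerDl. by rewrite /q /nrm -/r abE scalerDr !scalerA.
pose x:=r^-1*(a+b*c); pose y:=r^-1*(b*s).
have y0: 0<y by rewrite !mulr_gt0// invr_gt0.
have xy: x^+2+y^+2 = 1.
 rewrite /x /y !exprMn s2 (_: _+_ = r^-1^+2*r^+2); first by rewrite -exprMn mulVf ?expr1n// gt_eqF.
 by rewrite r2; ring.
have xm: -1<=x<=1.
 rewrite -ler_norml -ler_sqr ?nnegrE// real_normK ?num_real// expr1n -xy lerDl sqr_ge0//.
have rle: r<=a+b.
 rewrite (le_trans (enormD _ _))// !enormZ (enorm_unit uu) (enorm_unit vv) !mulr1. by rewrite !gtr0_norm.
have rge: b-a<=r.
 have:=lerB_enorm (b*:v) (- (a*:u)); rewrite enormN !enormZ (enorm_unit uu) (enorm_unit vv) !mulr1.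
 by rewrite !gtr0_norm// opprK addrC [b*:v+_]addrC addrC.
have cx: c<=x.
 rewrite /x ler_pdivlMl//; have [cge|clt]:=leP 0 c.
  have:=ler_wpM2l cge rle; have:=ler_wpM2l (ltW a0) cm2; lra. have nc: 0 <= - c by rewrite oppr_ge0 ltW.
 have:=ler_wpM2l nc rge; have:=ler_wpM2l (ltW a0) cm1; lra.
pose ph:=acos x.
have cph: cos ph = x by rewrite acosK// in_itv.
have sph: sin ph = y.
 rewrite /ph sin_acos// (_: 1-x^+2 = y^+2); last by rewrite -xy; ring. by rewrite sqrtr_sqr gtr0_norm.
have pht: ph<=th.
 rewrite leNgt; apply/negP=> lt; move: cx; rewrite -cth -cph leNgt=> /negP; apply.
 by rewrite ltr_cos// ?in_itv/= ?acos_ge0 ?acos_lepi.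
have ph0: 0<ph.
 rewrite lt_def acos_ge0// andbT; apply/eqP=> t0; move: sph; rewrite t0 sin0=> e'.
 by rewrite -e' ltxx in y0.
have en (t: R): 0<t -> enorm (t*:e) = t.
 by move=> t0; rewrite enormZ (enorm_unit ee) mulr1 gtr0_norm.
have sx (t: R): 0<t -> sexp u (t*:e) = cos t*:u+sin t*:e.
 by move=> t0; rewrite /sexp en// scalerA divfK// gt_eqF.
apply: (hK u v Ku Kv vu); exists (th*:e); split.
- by rewrite dotZr ue mulr0.
- by rewrite en.
- by rewrite sx// cth sth -vE.
exists (ph/th); first by rewrite divr_ge0 ?(ltW ph0) ?(ltW th0)//= ler_pdivrMr// mul1r.
by rewrite scalerA divfK ?gt_eqF// sx// cph sph qE.
Qed.

Lemma near_center (A: set V) (o: V): dot o o = 1 -> sinterior (d:=n.+1) A o ->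
 exists2 t: R, 0<t<1 & forall v, dot v v = 1 -> A (nrm (o-t*:v)).
move=> oo [_ /nbhs_ballP[e /= e0 hA]].
pose t: R:=Num.min (e/3) (1/2).
have t0: 0<t by rewrite lt_min !divr_gt0.
have te: t<=e/3 by rewrite ge_min lexx.
have t1: t<=1/2 by rewrite ge_min lexx orbT.
exists t; first by rewrite t0/=; lra.
move=> v vv; set z:=o-t*:v.
have zt: enorm (z - o) = t.
 by rewrite /z addrAC subrr add0r enormN enormZ (enorm_unit vv) mulr1 gtr0_norm.
have z1: `|1-enorm z| <= t.
 have h1:=lerB_enorm z o; have h2:=lerB_enorm o z.
 rewrite enormB (enorm_unit oo) zt in h2; rewrite (enorm_unit oo) zt in h1.
 by rewrite ler_norml; bsplit; lra.
have z0: 0<enorm z by move: z1; rewrite ler_norml=> /andP[? ?]; lra.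
have nz: enorm (nrm z-z) = `|1-enorm z|.
 have -> : nrm z-z = ((enorm z)^-1-1)*:z by rewrite /nrm scalerBl scale1r.
 by rewrite enormZ -{2}(gtr0_norm z0) -normrM mulrBl mulVf ?mul1r// gt_eqF.
apply: hA; last by rewrite /sphere/= nrm_unit// -enorm_gt0.
split=> // i j; rewrite ord1 /ball/= -normrN opprB.
have -> : nrm z 0 j - o 0 j = (nrm z - o) 0 j by rewrite !mxE.
apply: (le_lt_trans (coord_le_enorm _ _)).
have -> : nrm z - o = (nrm z-z)+(z - o) by rewrite addrA subrK.
by rewrite (le_lt_trans (enormD _ _))// nz zt; lra.
Qed.

(** As o is interior, K contains the normalisation of o - t mu for every unit mu, with a fixed t;
    the support inequality there gives mu.o >= t. The same argument in the dual body bounds y.o. *)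
Lemma uniform_center (o: V): dot o o = 1 ->
 sinterior (d:=n.+1) K o -> sinterior (d:=n.+1) (dual_body (d:=n.+1) K) o ->
 exists2 c: R, 0<c<1 & forall y mu, normal_pair K y mu -> c<=dot y o /\ c<=dot mu o.
move=> oo /(near_center oo)[t1 /andP[t10 t11] h1] /(near_center oo)[t2 /andP[t20 t21] h2].
exists (Num.min t1 t2); first by rewrite lt_min t10 t20/= gt_min t11.
have key (t: R) v: 0<t<1 -> dot v v = 1 -> 0<=dot (nrm (o-t*:v)) v -> t<=dot v o.
 move=> /andP[t0 tl] vv; rewrite /nrm dotZl dotBl dotZl vv mulr1 dotC. have z0: 0<(enorm (o-t*:v))^-1.
  rewrite invr_gt0; have:=lerB_enorm o (t*:v).
  by rewrite (enorm_unit oo) enormZ (enorm_unit vv) mulr1 gtr0_norm//; lra.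
 by rewrite pmulr_rge0// subr_ge0.
move=> y mu [Ky yy mm ym Kmu]; rewrite !ge_min; split; apply/orP; [right|left].
 apply: key; rewrite ?t20//; have [_ h]:=h2 _ yy; exact: h.
by apply: key; rewrite ?t10//; apply: Kmu; exact: h1.
Qed.

Lemma osculates_pair x nu (E: 'M[R]_(n.+2, n)) kap: K x -> osculates K x nu E kap -> normal_pair K x nu.
Proof. by move=> Kx [[xx nn xn _ _] Kn _ _]; split. Qed.

(** Support by mu is tested at points of K over small steps tau in both directions of each axis.
    Their heights are O(tau^2), so mu has no tangential component and equals nu or -nu; the sign of
    its product with o decides. *)
Lemma osculates_normal_unique x nu (E: 'M[R]_(n.+2, n)) kap (o mu: V) :
 osculates K x nu E kap -> 0<dot nu o -> 0<dot mu o -> normal_pair K x mu -> mu = nu.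
move=> osc no mo [Kx xx mm xm Kmu]; have [tE _ hA _]:=osc; have [_ nn xn xE [nE EE]]:=tE.
have mE: mu *m E = 0.
 apply/rowP=> l; rewrite [RHS]mxE; apply/eqP; rewrite -normr_le0. apply/ler_addgt0Pr=> e e0; rewrite add0r.
 pose C := `|kap l| / 2+1; have C1: 1<=C by rewrite /C lerDr divr_ge0. have C0: 0<C by lra.
 have [delta d0 hd]:=hA 1 ltr01. pose tau:=Num.min (delta/2) (e/C).
 have tau0: 0<tau by rewrite lt_min !divr_gt0.
 have taue: C*tau<=e by rewrite mulrC -ler_pdivlMr// ge_min lexx orbT.
 have taud: tau<=delta/2 by rewrite ge_min lexx. have ab: `|dot mu nu| <= 1.
  by rewrite (le_trans (dot_le _ _))// (enorm_unit mm) (enorm_unit nn) mulr1.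
 have key (t: R): `|t| = tau -> - (C*tau^+2)<=t*(mu *m E) 0 l.
  move=> tt. have et: enorm (t*:delta_mx 0 l: 'rV[R]_n) = tau.
   rewrite enormZ tt /enorm /dot (bigD1 l)//= big1=> [|j jl].
    by rewrite mxE !eqxx addr0 mulr1 sqrtr1 mulr1. by rewrite mxE (negPf jl) andbF mul0r.
  have [|s [v [hs v0 Kv]]]:=hd (t*:delta_mx 0 l); first by rewrite et; lra.
  have t2: t^+2 = tau^+2 by rewrite -(real_normK (num_real t)) tt. rewrite et quadf_delta t2 mul1r in hs.
  have sC: `|s| <= C*tau^+2.
   have -> : s = (s-2^-1*(tau^+2*kap l))+2^-1*(tau^+2*kap l) by rewrite subrK.
   rewrite (le_trans (ler_normD _ _))// [X in _+X]normrM [X in _+_*X]normrM.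
   rewrite (ger0_norm (sqr_ge0 tau)) (ger0_norm (_: 0<=2^-1 :> R)) ?invr_ge0//.
   by rewrite /C; move: hs; lra.
  have:=Kmu _ Kv; rewrite dotZl pmulr_rge0// dotC !dotDr (dotC mu x) xm add0r dotZr.
  have -> : dot mu (t*:delta_mx 0 l *m E^T) = t*(mu *m E) 0 l.
   rewrite (_: dot mu _ = dot (mu *m E) (t*:delta_mx 0 l)); last by rewrite [RHS]dot_mulmx.
   rewrite dotZr /dot (bigD1 l)//= big1=> [|j jl]; first by rewrite [delta_mx _ _ _ _]mxE !eqxx addr0 mulr1.
   by rewrite [delta_mx _ _ _ _]mxE (negPf jl) andbF mulr0.
  have: `|s*dot mu nu| <= C*tau^+2 by rewrite normrM (le_trans (ler_piMr _ ab)).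
  by rewrite ler_norml=> /andP[_ ?] ?; lra. have k1:=key tau (gtr0_norm tau0).
 have k2:=key (- tau); rewrite normrN in k2; have {}k2:=k2 (gtr0_norm tau0).
 apply: le_trans taue; rewrite ler_norml; bsplit; rewrite -(ler_pM2l tau0); move: k1 k2; rewrite expr2; lra.
have muE: mu = dot mu nu*:nu.
 by rewrite {1}(tframeE mu tE) (dotC mu x) xm scale0r add0r mE mul0mx addr0.
have sq: dot mu nu^+2 = 1 by rewrite -mm {2}muE dotZl dotC expr2 dotC.
have pos: 0<dot mu nu.
 by have:=mo; rewrite muE dotZl dotZl nn mulr1 pmulr_lgt0.
rewrite muE (_: dot mu nu = 1) ?scale1r//.
by apply/eqP; rewrite -(eqrXn2 (ltn0Sn 1)) ?ltW// sq expr1n.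
Qed.

(** If nu were also normal at another point y, the arc from x to y would stay in the great
    hypersphere orthogonal to nu, hence in the boundary. Close to x this contradicts positive
    curvature, because all heights on the arc vanish while the quadratic form is positive
    definite. *)
Lemma osculates_point_unique x nu (E: 'M[R]_(n.+2, n)) kap (o y: V) : spherical_convex_body (d:=n.+1) K ->
 osculates K x nu E kap -> (forall l, 0<kap l) -> K x -> 0<dot x o -> 0<dot y o ->
 normal_pair K y nu -> y = x.
move=> cK osc kap0 Kx xo yo [Ky yy nn yn Knu]; have [tE _ _ hB]:=osc; have [xx _ xn xE [nE EE]]:=tE.
have KS: K `<=` @sphere R n.+1 by have []:=cK.
apply/eqP; apply: contraT=> yx.
have yNx: y != - x.
 by apply/eqP=> e; move: yo; rewrite e dotNl oppr_gt0=> h; have:=lt_trans h xo; rewrite ltxx.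
pose kmin:=(1 + \sum_l (kap l)^-1)^-1.
have sk: 0 <= \sum_l (kap l)^-1 by apply: sumr_ge0=> l _; rewrite invr_ge0 ltW.
have km0: 0<kmin by rewrite invr_gt0 ltr_pwDl.
have kml l: kmin<=kap l.
 rewrite /kmin -[leRHS]invrK lef_pV2 ?posrE ?invr_gt0 ?ltr_pwDl// (bigD1 l)//= addrCA lerDl addr_ge0//.
 by apply: sumr_ge0=> i _; rewrite invr_ge0 ltW.
have [delta d0 hd]:=hB (kmin/4) (divr_gt0 km0 (ltr0n _ 4)).
pose D:=enorm (y-x); have D0: 0<D by rewrite enorm_gt0 subr_eq0.
pose tau:=Num.min (1/4) (delta/(4*D)).
have t0: 0<tau by rewrite lt_min !divr_gt0// mulr_gt0.
have t1: tau<=1/4 by rewrite ge_min lexx.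
have t2: tau*(4*D)<=delta by rewrite -ler_pdivlMr ?mulr_gt0// ge_min lexx orbT.
have D2: D<=2.
 by rewrite (le_trans (enormD _ _))// enormN (enorm_unit xx) (enorm_unit yy).
pose z:=(1-tau)*:x+tau*:y.
have zx: enorm (z-x) = tau*D.
 have -> : z-x = tau*:(y-x) by apply/rowP=> i; rewrite !mxE; ring. by rewrite enormZ gtr0_norm.
have z1: `|1-enorm z| <= tau*D.
 have h1:=lerB_enorm z x; have h2:=lerB_enorm x z.
 rewrite enormB (enorm_unit xx) zx in h2; rewrite (enorm_unit xx) zx in h1.
 by rewrite ler_norml; bsplit; lra.
have tD: tau*D<=1/2.
 have:=ler_pM (ltW t0) (ltW D0) t1 D2; lra.
have z0: 0<enorm z by move: z1; rewrite ler_norml=> /andP[? ?]; lra.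
have Kp: K (nrm z) by apply: (body_conv cK); rewrite // subr_gt0; lra.
have zn: dot (nrm z) nu = 0 by rewrite /nrm /z dotZl dotDl !dotZl xn yn !mulr0 addr0 mulr0.
have pp: dot (nrm z) (nrm z) = 1 by exact: KS.
have bp: sboundary (d:=n.+1) K (nrm z) by apply: (normal_pair_boundary (mu:=nu)); split.
have px: enorm (nrm z-x)<delta.
 have -> : nrm z-x = (nrm z-z)+(z-x) by rewrite addrA subrK. have nz: enorm (nrm z-z) = `|1-enorm z|.
  have -> : nrm z-z = ((enorm z)^-1-1)*:z by rewrite /nrm scalerBl scale1r.
  by rewrite enormZ -{2}(gtr0_norm z0) -normrM mulrBl mulVf ?mul1r// gt_eqF.
 rewrite (le_lt_trans (enormD _ _))// nz zx. have: 0<tau*D by rewrite mulr_gt0. move: z1 t2; lra.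
have [al0]:=hd _ bp px; cbv zeta; rewrite zn mulr0 sub0r normrN.
set t:=_*:_=> ht.
have Qt: kmin*enorm t^+2<=quadf kap t.
 rewrite enormE /dot mulr_sumr; apply: ler_sum=> l _. by rewrite -expr2 ler_wpM2r ?sqr_ge0.
have t00: enorm t = 0.
 apply/eqP; rewrite -sqrf_eq0; apply/eqP/le_anti; rewrite sqr_ge0 andbT. rewrite -(pmulr_rle0 _ km0).
 move: ht; rewrite ler_norml=> /andP[_]; lra.
have pE: nrm z *m E = 0.
 have: t = 0 by apply/eqP; rewrite -enorm_eq0 t00.
 by move/eqP; rewrite scaler_eq0 invr_eq0 gt_eqF//= => /eqP.
have pxE: nrm z = dot (nrm z) x*:x.
 by rewrite {1}(tframeE (nrm z) tE) zn scale0r addr0 pE mul0mx addr0.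
have yE0: y *m E = 0.
 have: z *m E = 0.
  have: (enorm z)^-1*:(z *m E) = 0 by rewrite scalemxAl.
  by move/eqP; rewrite scaler_eq0 invr_eq0 gt_eqF//= => /eqP.
 rewrite /z mulmxDl -!scalemxAl xE scaler0 add0r=> /eqP. by rewrite scaler_eq0 gt_eqF//= => /eqP.
have yxE: y = dot y x*:x by rewrite {1}(tframeE y tE) yn scale0r addr0 yE0 mul0mx addr0.
have sq: dot y x^+2 = 1 by rewrite -yy {2}yxE dotZl dotC expr2 dotC.
have pos: 0<dot y x by have:=yo; rewrite yxE dotZl dotZl xx mulr1 pmulr_lgt0.
exfalso; move/eqP: yx; apply; rewrite yxE (_: dot y x = 1) ?scale1r//.
by apply/eqP; rewrite -(eqrXn2 (ltn0Sn 1)) ?ltW// sq expr1n.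
Qed.

End BodyGeometry.

(** * Summation over disjoint cones *)

Section DisjointSums.
Context {R: realType} (n: nat).
Local Notation d := n.+1.
Local Notation V := 'rV[R]_n.+2.

Lemma sum_disjoint_le (N: nat) (F: nat -> set 'rV[R]_d) (Y: set 'rV[R]_d) :
 (forall i, (i<N)%N -> measurable (F i)) -> measurable Y -> (forall i, (i<N)%N -> F i `<=` Y) ->
 (forall i j, (i<j)%N -> (j<N)%N -> F i `&` F j = set0) -> (\sum_(i<N) leb d (F i)<=leb d Y)%E.
move=> mF mY FY dF.
suff: forall k, (k<=N)%N -> measurable (\big[setU/set0]_(i<k) F i) /\
  (\sum_(i<k) leb d (F i) = leb d (\big[setU/set0]_(i<k) F i))%E.
 move=> /(_ N (leqnn N))[mU ->]; apply: le_measure; rewrite ?inE//.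
 by elim/big_ind: _=> //= [A B AY BY x [/AY|/BY]//|i _]; exact: FY.
elim=> [_|k IH kN]; first by rewrite !big_ord0 measure0.
have [mU eU]:=IH (ltnW kN); rewrite !big_ord_recr/=; split; first by apply: measurableU=> //; exact: mF.
rewrite measureU ?eU//; first exact: mF.
rewrite big_distrl/=; apply: big1=> i _; apply: dF=> //; exact: ltn_ord.
Qed.

(** Upper bound for the integral of F over the directions in S, obtained by linearising F at r0 in
    terms of weighted volume. It depends on S only through volumes and is therefore additive. For
    the whole space, with r0 the radius of the ball of equal weighted volume, it reduces to the
    volume of the unit ball times F(r0). *)
Definition cone_excess (X: set 'rV[R]_d) (r0: R) (S: set 'rV[R]_d): R :=
 coneR S*frad d r0-crad d r0*coneW S r0 + crad d r0*fine (\int[leb d]_(x in S `&` X) (wsph x)%:E).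

Let mw D: measurable_fun D (fun x: 'rV[R]_d=> (wsph x)%:E).
Proof. by apply: measurable_funTS; apply/mEFP; exact: meas_wsph. Qed.
Let w0 (x: 'rV[R]_d): (0<=(wsph x)%:E :> \bar R)%E.
Proof. by rewrite lee_fin wsph_ge0. Qed.

Lemma int_wsph_lty (B: set 'rV[R]_d): measurable B -> (leb d B < +oo)%E ->
 (\int[leb d]_(x in B) (wsph x)%:E < +oo)%E.
move=> mB fB; apply: le_lt_trans fB; rewrite -[leRHS]mul1e -integral_cst//.
apply: ge0_le_integral=> // x _; rewrite lee_fin /wsph exprn_ile1 ?invr_ge0// invf_le1.
 by rewrite -{1}(sqrtr1 R) ler_wsqrtr// lerDl dot_ge0.
by rewrite sqrtr_gt0 ltr_pwDl// dot_ge0.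
Qed.

Let fineU (B S S': set 'rV[R]_d): measurable B -> measurable S -> measurable S' -> (leb d B < +oo)%E ->
 S `&` S' = set0 -> fine (leb d ((S `|` S') `&` B)) = fine (leb d (S `&` B))+fine (leb d (S' `&` B)) /\
 fine (\int[leb d]_(x in (S `|` S') `&` B) (wsph x)%:E) =
 fine (\int[leb d]_(x in S `&` B) (wsph x)%:E)+fine (\int[leb d]_(x in S' `&` B) (wsph x)%:E).
move=> mB mS mS' fB dS; rewrite setIUl.
have m1: measurable (S `&` B) by exact: measurableI.
have m2: measurable (S' `&` B) by exact: measurableI.
have fin (A: set 'rV[R]_d): measurable A -> (leb d (A `&` B) < +oo)%E.
 move=> mA; apply: le_lt_trans fB; have mAB: measurable (A `&` B) by exact: measurableI.
 by apply: le_measure; rewrite ?inE.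
have dj: (S `&` B) `&` (S' `&` B) = set0 by rewrite setIACA dS set0I.
have fl:=fin _ mS; have fr:=fin _ mS'.
have il:=int_wsph_lty m1 fl; have ir:=int_wsph_lty m2 fr.
split; first by rewrite measureU// fineD// ge0_fin_numE.
rewrite ge0_integral_setU//; last by rewrite disj_set2E dj.
by rewrite fineD// ge0_fin_numE//; apply: integral_ge0.
Qed.

Variables (X: set 'rV[R]_d) (r0: R).
Hypotheses (mX: measurable X) (fX: (leb d X < +oo)%E) (d2: (2<=d)%N) (r00: 0<r0).
Hypothesis hr0: r0^+2<=d%:R*(d%:R-2).

Let fB (r: R): (leb d [set x: 'rV[R]_d | (enorm x<=r)%R] < +oo)%E.
Proof. by apply: (@leb_lty _ _ _ r)=> //; exact: meas_eball. Qed.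

Lemma cone_excessU S S': measurable S -> measurable S' -> S `&` S' = set0 ->
 cone_excess X r0 (S `|` S') = cone_excess X r0 S+cone_excess X r0 S'.
move=> mS mS' dS; rewrite /cone_excess /coneR /coneW.
have mE (r: R): measurable [set x: 'rV[R]_d | enorm x<=r] by exact: meas_eball.
have [-> _]:=fineU (mE 1) mS mS' (fB 1) dS.
have [_ ->]:=fineU (mE r0) mS mS' (fB r0) dS.
have [_ ->]:=fineU mX mS mS' fX dS.
by ring.
Qed.

Lemma cone_excess_ge0 (S: set 'rV[R]_d): measurable S -> (forall (s: R) x, 0<s -> S x -> S (s*:x)) ->
 0<=cone_excess X r0 S.
move=> mS cS; apply: addr_ge0; first exact: frad_tangent0.
by rewrite mulr_ge0 ?(ltW (crad_gt0 _ _))// fine_ge0// integral_ge0.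
Qed.

(** The complement of the union is again a cone, and its excess is nonnegative by
    [frad_tangent0]. *)
Lemma sum_cone_excess (N: nat) (S: nat -> set 'rV[R]_d) : (forall i, (i<N)%N -> measurable (S i)) ->
 (forall i, (i<N)%N -> forall (s: R) x, 0<s -> S i x -> S i (s*:x)) ->
 (forall i j, (i<j)%N -> (j<N)%N -> S i `&` S j = set0) ->
 \sum_(i<N) cone_excess X r0 (S i)<=cone_excess X r0 setT.
move=> mS cS dS.
suff: forall k, (k<=N)%N -> let U := \big[setU/set0]_(i<k) S i in
  [/\ measurable U, forall (s: R) x, 0<s -> U x -> U (s*:x) &
  \sum_(i<k) cone_excess X r0 (S i) = cone_excess X r0 U].
 move=> /(_ N (leqnn N)); set U := \big[_/_]_(_<_) _; move=> [mU cU ->].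
 have mC: measurable (~` U) by exact: measurableC.
 rewrite -(setUv U) cone_excessU ?setICr// lerDl cone_excess_ge0// => s x s0 Ux /(cU s^-1).
 by rewrite invr_gt0 scalerA mulVf ?gt_eqF// scale1r=> /(_ s0).
elim=> [_|k IH kN] U.
 rewrite /U !big_ord0; split=> //; rewrite /cone_excess /coneR /coneW !set0I measure0 !integral_set0/=.
 by rewrite mul0r !mulr0 subrr addr0.
have [mU cU eU]:=IH (ltnW kN).
have dj: (\big[setU/set0]_(i<k) S i) `&` S k = set0.
 by rewrite big_distrl/=; apply: big1=> i _; apply: dS=> //; exact: ltn_ord.
rewrite /U !big_ord_recr/=; split.
- by apply: measurableU=> //; exact: mS.
- by move=> s x s0 [/(cU _ _ s0)|/(cS _ kN _ _ s0)]; [left|right].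
- by rewrite eU cone_excessU//; exact: mS.
Qed.

Lemma cone_excess_tangent (S: set 'rV[R]_d) (r: R): measurable S -> (forall (s: R) x, 0<s -> S x -> S (s*:x)) ->
 0<r -> r^+2<=d%:R*(d%:R-2) -> S `&` [set x | enorm x<=r] `<=` X -> coneR S*frad d r<=cone_excess X r0 S.
move=> mS cS r1 hr SX; apply: (le_trans (frad_tangent mS cS d2 r00 r1 hr0 hr)).
rewrite /cone_excess lerD2l ler_wpM2l ?(ltW (crad_gt0 _ _))// /coneW.
have m1: measurable (S `&` X) by exact: measurableI.
have mB: measurable [set x: 'rV[R]_d | enorm x<=r] by exact: meas_eball.
have m2: measurable (S `&` [set x | enorm x<=r]) by exact: measurableI.
have f1: (leb d (S `&` X) < +oo)%E.
 by apply: le_lt_trans fX; apply: le_measure; rewrite ?inE//; exact: subIsetr.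
have f2: (leb d (S `&` [set x | (enorm x<=r)%R]) < +oo)%E.
 by apply: le_lt_trans (fB r); apply: le_measure; rewrite ?inE//; exact: subIsetr.
have i1:=int_wsph_lty m1 f1; have i2:=int_wsph_lty m2 f2.
apply: fine_le; rewrite ?ge0_fin_numE ?integral_ge0//.
by apply: ge0_subset_integral=> // x [Sx xr]; split=> //; apply: SX.
Qed.

End DisjointSums.

Section FinitePieces.
Context {R: realType} (n: nat).
Local Notation d := n.+1.
Local Notation V := 'rV[R]_n.+2.
Variables (K: set V) (o: V) (To: 'M[R]_(n.+2, n.+1)) (c: R).
Hypotheses (cK: spherical_convex_body (d:=n.+1) K) (so: splits o To) (Ko: K o).
Hypotheses (c0: 0<c) (c1: c<=1).
Hypothesis hK: forall y mu, normal_pair K y mu -> c<=dot y o /\ c<=dot mu o.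
Hypothesis ha: forall x, K x -> 0<dot x o /\ dot (x *m To) (x *m To)<=d%:R*(d%:R-2)*dot x o^+2.
Local Notation X := (gno o To K).
Hypotheses (d2: (2<=d)%N).

(** The frame, the curvatures and the mesh are hidden. What remains visible is [L], which bounds the
    total error factor, and the curvature product [P]. *)
Definition good_piece (L: R) (Z: set 'rV[R]_(n.+2+n.+2)) (P: R): Prop := exists eta k u nu E kap,
  [/\ piece K eta u nu E kap Z, tframe u nu E, normal_pair K u nu & [/\ 0<eta, 0<k, forall l, k^-1<=kap l &
   [/\ eta*(8*(1+c^-1)+2*n%:R*k+c^-2)<1,
   (1-eta*(8*(1+c^-1)+2*n%:R*k+c^-2))^-1^+(8*d)<=L & P = \prod_l kap l]]].

(** The point lies on the segment from the origin to the gnomonic image of x: lifted to the body it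
    is the normalisation of s x + (1 - s x.o) o, a positive combination of x and o. *)
Lemma gno_ray (x: V) (s: R): K x -> 0<s -> s*dot x o<=1 -> X (s*:(x *m To)).
move=> Kx s0 s1; have [oo _ _]:=so; have [KS _ _ _]:=cK.
have [xo _]:=ha Kx; have xx: dot x x = 1 by exact: KS.
rewrite /gno/=.
have sxE: s*:x = (s*dot x o)*:o+(s*:(x *m To)) *m To^T.
 by rewrite {1}(splitsE x so) scalerDr scalerA scalemxAl.
have -> : o+(s*:(x *m To)) *m To^T = s*:x+(1-s*dot x o)*:o.
 by rewrite sxE scalerBl scale1r [RHS]addrC addrA subrK.
move: s1; rewrite le_eqVlt=> /predU1P[->|s1].
 by rewrite subrr scale0r addr0 nrmZ// nrm_id.
apply: (body_conv cK)=> //; last by rewrite subr_gt0.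
apply/eqP=> e; have:=xo; rewrite -[x]opprK -e dotNl oo; lra.
Qed.

Lemma good_piece_bound L Z P W (lam r0: R): good_piece L Z P -> closed W -> 0<lam -> 0<r0 ->
 r0^+2<=d%:R*(d%:R-2) -> measurable X -> (leb d X < +oo)%E ->
 let A:=lsubmx @` (Z `\` W) in let N:=rsubmx @` (Z `\` W) in
 [/\ measurable A, measurable (dcone o To N), measurable (pcone To A) &
  ((P `^ (n.+2%:R^-1))%:E*hausdorff n A<=(L*hratio n*d%:R)%:E *
   ((d%:R/d.+1%:R * lam*cone_excess X r0 (pcone To A))%:E + (lam^-d/d.+1%:R)%:E * leb d (dcone o To N)))%E].
move=> [eta [k [u [nu [E [kap [pZ tE un [eta0 k0 kk [xi1 ML ->]]]]]]]]] cW lam0 r00 hr0 mX fX A N.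
have mA: measurable A:=meas_pieceA c0 c1 pZ tE cW eta0 k0 kk xi1.
have mD:=meas_dcone so c0 c1 hK pZ tE cW eta0 k0 kk xi1.
have mP:=meas_pcone so c0 c1 hK pZ tE cW eta0 k0 kk xi1.
have B:=piece_bound so c0 c1 hK pZ tE cW un eta0 k0 kk xi1 lam0.
split=> //; apply: (le_trans B).
have hr: 0 < @hratio R n by exact: hratio_gt0.
set xi:=eta*_ in xi1 ML *.
have M0: 0<=(1-xi)^-1^+(8*d) by rewrite exprn_ge0// invr_ge0 subr_ge0 ltW.
have eta_le: eta*c^-2<=xi.
 rewrite /xi ler_pM2l// lerDr addr_ge0 ?mulr_ge0 ?addr_ge0 ?invr_ge0// ltW//.
have [q0 _]:=tail_ge so c0 hK un; have [uo no]:=hK un.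
have p0:=lt_le_trans c0 uo.
have c20: 0<c^+2 by rewrite exprn_gt0.
set q:=enorm (u *m To) in q0 *; set p:=dot u o in uo p0 *.
have qe: eta<q.
 rewrite (lt_le_trans _ q0)// -[ltRHS]mul1r -ltr_pdivrMr//; exact: le_lt_trans eta_le xi1.
have pe: 0<p+eta by rewrite addr_gt0.
have rho0: 0<(q-eta)/(p+eta) by rewrite divr_gt0 ?subr_gt0.
have [Ku _ _ _ _]:=un; have [_ hu]:=ha Ku.
have q00: 0<=q:=enorm_ge0 _.
(* Containment of K in the ball of radius alpha_d enters here: it keeps the radius in the range
   where the tangent inequality for [frad] is valid. *)
have rho2: ((q-eta)/(p+eta))^+2<=d%:R*(d%:R-2).
 have h1: (q-eta)/(p+eta)<=q/p.
  rewrite ler_pdivrMr// mulrAC ler_pdivlMr//.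
  by rewrite mulrBl mulrDr lerD2l// -subr_ge0 opprK addr_ge0 ?mulr_ge0// ltW.
 apply: (@le_trans _ _ ((q/p)^+2)).
  have qp0: 0<=q/p by rewrite divr_ge0// ltW. by rewrite ler_sqr ?nnegrE// ltW.
 by rewrite expr_div_n ler_pdivrMr ?exprn_gt0// /q enormE.

have B0: (0<=(d%:R/d.+1%:R * lam*(coneR (pcone To A)*frad d ((q-eta)/(p+eta))))%:E +
  (lam^-d/d.+1%:R)%:E * leb d (dcone o To N))%E.
 apply: adde_ge0; last by rewrite mule_ge0// lee_fin divr_ge0// invr_ge0 exprn_ge0// ltW.
 rewrite lee_fin mulr_ge0//; first pos.
 by rewrite mulr_ge0 ?coneR_ge0// mulr_ge0 ?expR_ge0// exprn_ge0// ltW.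
apply: lee_pmul=> //.
- pos.
- by rewrite lee_fin ler_wpM2r// ler_wpM2r// ltW.
apply: leeD=> //; rewrite lee_fin ler_wpM2l//; first pos.
apply: cone_excess_tangent=> //; first by move=> s x; exact: pcone_scale.
move=> y [[x [s [[z [Zz _] <-] s0 ->]]] /=]; rewrite enormZ gtr0_norm// => hs.
have [_ hZ _]:=pZ; have [pm zu _]:=hZ _ Zz.
have [Kx _ _ _ _]:=pm; have [xq _]:=tail_ge so c0 hK pm.
apply: gno_ray=> //.
have tq: q-eta<=enorm (lsubmx z *m To).
 have h:=lerB_enorm (u *m To) (lsubmx z *m To); rewrite -mulmxBl -/q in h.
 have h2:=enorm_splits (u-lsubmx z) so; rewrite enormB in zu; lra.
have tp: dot (lsubmx z) o<=p+eta.
 have -> : dot (lsubmx z) o = p+dot (lsubmx z-u) o by rewrite dotBl /p; ring.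
 rewrite lerD2l (le_trans (dot_le_enorm _ _))//; have [oo _ _]:=so. by rewrite (enorm_unit oo) mulr1.
have [zo _]:=ha Kx; have t0:=lt_le_trans c20 xq.
move: hs; rewrite ler_pdivlMr// => hs.
rewrite -(ler_pM2r t0) mul1r.
have h1:=ler_wpM2l (mulr_ge0 (ltW s0) (ltW t0)) tp.
by move: hs h1 tq; set a:=enorm _; set b:=dot _ o; lra.
Qed.

Lemma dcone_polar (N: set V): (forall x, N x -> 0<dot x o /\ forall v, K v -> 0<=dot v x) ->
 dcone o To N `<=` polar X.
move=> hN y [x [s [Nx s0 s1 ->]]] p Xp; have [xo hx]:=hN _ Nx; have [oo _ _]:=so.
have z0: 0<enorm (o+p *m To^T).
 rewrite enorm_gt0; apply/eqP=> e; have: dot (o+p *m To^T) o = 0 by rewrite e dot0l.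
 by rewrite dotDl oo (splits_perp _ so) addr0=> /eqP; rewrite oner_eq0.
have:=hx _ Xp; rewrite /nrm dotZl pmulr_rge0 ?invr_gt0// dotDl dot_mulmx trmxK (dotC o)=> h.
rewrite !dotZr mulNr mulrN -mulrN.
have: - ((dot x o)^-1*dot p (x *m To))<=1.
 by rewrite -mulrN ler_pdivrMl// mulr1; move: h; lra.
move=> h2; have [t0|t0]:=leP 0 (- ((dot x o)^-1*dot p (x *m To))).
 by rewrite mulr_ile1// ltW.
apply: (@le_trans _ _ 0)=> //; rewrite nmulr_lle0// ltW//.
Qed.

Lemma piece_compact eta u nu E kap Z: piece K eta u nu E kap Z -> compact Z.
move=> [clZ h _]; apply: (compact_rV (r:=2) clZ)=> z /h[[_ ll rr _ _] _ _].
have -> : enorm z = Num.sqrt (dot (lsubmx z) (lsubmx z)+dot (rsubmx z) (rsubmx z)).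
 by rewrite /enorm /dot big_split_ord/=; congr (Num.sqrt (_+_)); apply: eq_bigr=> i _; rewrite !mxE.
by rewrite ll rr -[leRHS]ger0_norm// -sqrtr_sqr ler_wsqrtr//; lra.
Qed.

(** Closures of disjoint cells may overlap. A pair is discarded when its point or its normal already
    occurs in an earlier piece, which makes both the cones over the points and the dual cones
    disjoint. *)
Definition shared (Z: nat -> set 'rV[R]_(n.+2+n.+2)) (i: nat): set 'rV[R]_(n.+2+n.+2) :=
 [set z | exists j w, [/\ (j<i)%N, Z j w & lsubmx z = lsubmx w \/ rsubmx z = rsubmx w]].

Lemma closed_shared (Z: nat -> set 'rV[R]_(n.+2+n.+2)) i :
 (forall j, (j<i)%N -> compact (Z j)) -> closed (shared Z i).
move=> cZ; rewrite (_: shared Z i = \bigcup_(j<i)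
  (lsubmx @^-1` (lsubmx @` Z j) `|` rsubmx @^-1` (rsubmx @` Z j))); last first. seteq=> z.
  by move=> [j [w [ji Zw [e|e]]]]; exists j=> //; [left|right]; exists w.
 by move=> [j ji [[w Zw e]|[w Zw e]]]; exists j, w; split=> //; [left|right].
rewrite bigcup_mkord; elim/big_ind: _=> [|A B cA cB|j _]; [exact: closed0|exact: closedU|].
have mim f: continuous f -> closed (f @^-1` ((f: _ -> V) @` Z j)).
 move=> cf; apply: closed_comp=> [y _|]; first exact: cf.
 apply: compact_closed; first exact: norm_hausdorff.
 by apply: continuous_compact; [exact: continuous_subspaceT|exact/cZ/ltn_ord].
by apply: closedU; apply: mim; [exact: continuous_lsubmx|exact: continuous_rsubmx].
Qed.

(** By [radial_inj] a ray common to two cones would produce a common point, or a common normal,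
    which [shared] has removed. Hence the excesses add up to at most that of the whole space, and
    the dual cones fill at most the polar body. *)
Lemma finite_pieces (N: nat) (Z: nat -> set 'rV[R]_(n.+2+n.+2)) (P: nat -> R) (L lam r0: R) :
 (forall i, (i<N)%N -> good_piece L (Z i) (P i)) -> 0<L -> 0<lam -> 0<r0 ->
 r0^+2<=d%:R*(d%:R-2) -> measurable X -> (leb d X < +oo)%E -> measurable (polar X) ->
 (forall i, (i<N)%N -> measurable (lsubmx @` (Z i `\` shared Z i))) /\
 (\sum_(i<N) (P i `^ (n.+2%:R^-1))%:E*hausdorff n (lsubmx @` (Z i `\` shared Z i)) <=
  (L*hratio n*d%:R)%:E*((d%:R/d.+1%:R * lam*cone_excess X r0 setT)%:E +
   (lam^-d/d.+1%:R)%:E * leb d (polar X)))%E.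
move=> gp L0 lam0 r00 hr0 mX fX mpX.
pose A i:=lsubmx @` (Z i `\` shared Z i); pose Nn i:=rsubmx @` (Z i `\` shared Z i).
have cW i: (i<N)%N -> closed (shared Z i).
 move=> iN; apply: closed_shared=> j ji; have [eta [k [u [nu [E [kap [pZ _ _ _]]]]]]]:=gp j (ltn_trans ji iN).
 exact: piece_compact pZ.
have B i (iN: (i<N)%N):=good_piece_bound (gp i iN) (cW i iN) lam0 r00 hr0 mX fX.
have np i z: (i<N)%N -> Z i z -> normal_pair K (lsubmx z) (rsubmx z).
 by move=> iN Zz; have [eta [k [u [nu [E [kap [[_ h _] _ _ _]]]]]]]:=gp i iN; have []:=h _ Zz.
split; first by move=> i iN; have []:=B i iN.
have hr: 0 < @hratio R n by exact: hratio_gt0.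
pose C:=L*hratio n*d%:R; have C0: 0<=C.
 pos.
pose a:=d%:R/d.+1%:R * lam; have a0: 0<=a by rewrite mulr_ge0 ?divr_ge0// ltW.
pose b:=lam^-d/d.+1%:R; have b0: 0<=b by rewrite divr_ge0// invr_ge0 exprn_ge0// ltW.
apply: (@le_trans _ _ (\sum_(i<N) C%:E*((a*cone_excess X r0 (pcone To (A i)))%:E +
  b%:E * leb d (dcone o To (Nn i))))%E). by apply: lee_sum=> i _; have []:=B i (ltn_ord i).
have ex0 i: (i<N)%N -> 0<=cone_excess X r0 (pcone To (A i)).
 move=> iN; have [_ _ mP _]:=B i iN; apply: cone_excess_ge0=> //. by move=> s x; exact: pcone_scale.
rewrite -ge0_sume_distrr; last first.
 move=> i _; apply: adde_ge0; first by rewrite lee_fin mulr_ge0// ex0. by rewrite mule_ge0// lee_fin.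
apply: lee_wpmul2l; first by [].
rewrite big_split/=; apply: leeD.
 rewrite sumEFin lee_fin -mulr_sumr ler_wpM2l//.
 apply: (sum_cone_excess (S:=fun i=> pcone To (A i)) mX fX d2 r00 hr0).
 - by move=> i iN; have []:=B i iN.
 - by move=> i iN s x; exact: pcone_scale.
 move=> i j ij jN; seteq=> // p [] [_ [s [[z [Zz Wz] <-] s0 pz]]] [_ [t [[w [Zw Ww] <-] t0 pw]]].
 have iN:=ltn_trans ij jN. have nz:=np _ _ iN Zz; have nw:=np _ _ jN Zw.
 have [z1 z2]:=hK nz; have [w1 w2]:=hK nw. have [a1 a2 a3 a4 a5]:=nz; have [b1 b2 b3 b4 b5]:=nw.
 have r1: lsubmx z *m To = (s^-1*t)*:(lsubmx w *m To).
  have: s*:(lsubmx z *m To) = t*:(lsubmx w *m To) by rewrite -pz -pw.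
  by move/(congr1 (fun v=> s^-1*:v)); rewrite !scalerA mulVf ?gt_eqF// scale1r.
 have st: 0<s^-1*t by rewrite mulr_gt0// invr_gt0. apply: Ww; exists i, z; split=> //; left; apply/esym.
 exact: (radial_inj so a2 b2 (lt_le_trans c0 z1) (lt_le_trans c0 w1) (lt_le_trans c0 z2)
  (lt_le_trans c0 w2) a4 b4 (a5 _ b1) (b5 _ a1) st r1).
rewrite -ge0_sume_distrr//; apply: lee_wpmul2l; first by [].
apply: (sum_disjoint_le (F:=fun i=> dcone o To (Nn i)))=> //.
- by move=> i iN; have []:=B i iN.
- move=> i iN; apply: dcone_polar=> _ [z [Zz _] <-].
 have nz:=np _ _ iN Zz; have [_ z2]:=hK nz; have [_ _ _ _ a5]:=nz. by split=> //; exact: lt_le_trans z2.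
move=> i j ij jN; seteq=> // p [] [_ [s [[z [Zz Wz] <-] s0 s1 pz]]] [_ [t [[w [Zw Ww] <-] t0 t1 pw]]].
have iN:=ltn_trans ij jN.
have nz:=np _ _ iN Zz; have nw:=np _ _ jN Zw.
have [z1 z2]:=hK nz; have [w1 w2]:=hK nw.
have [a1 a2 a3 a4 a5]:=nz; have [b1 b2 b3 b4 b5]:=nw.
have zo:=lt_le_trans c0 z2; have wo:=lt_le_trans c0 w2.
pose s':=s/dot (rsubmx z) o; pose t':=t/dot (rsubmx w) o.
have s'0: 0<s' by rewrite divr_gt0.
have t'0: 0<t' by rewrite divr_gt0.
have r1: rsubmx z *m To = (s'^-1*t')*:(rsubmx w *m To).
 have: s'*:(rsubmx z *m To) = t'*:(rsubmx w *m To).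
  have: s*:(- (dot (rsubmx z) o)^-1*:(rsubmx z *m To)) = t*:(- (dot (rsubmx w) o)^-1*:(rsubmx w *m To)).
   by rewrite -pz -pw. by rewrite !scaleNr !scalerN !scalerA=> /eqP; rewrite eqr_opp=> /eqP.
 by move/(congr1 (fun v=> s'^-1*:v)); rewrite !scalerA mulVf ?gt_eqF// scale1r.
have st: 0<s'^-1*t' by rewrite mulr_gt0// invr_gt0.
apply: Ww; exists i, z; split=> //; right; apply/esym.
have a4': dot (rsubmx z) (lsubmx z) = 0 by rewrite dotC.
have b4': dot (rsubmx w) (lsubmx w) = 0 by rewrite dotC.
have a5': 0<=dot (rsubmx w) (lsubmx z) by rewrite dotC; exact: b5.
have b5': 0<=dot (rsubmx z) (lsubmx w) by rewrite dotC; exact: a5.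
exact: (radial_inj so a3 b3 zo wo (lt_le_trans c0 z1) (lt_le_trans c0 w1) a4' b4' a5' b5' st r1).
Qed.

End FinitePieces.

(** * Exhaustion of the boundary by cells and the upper bound for the floating area *)

Section AreaIntegral.
Context {R: realType}.

Lemma ge0_le_int_any d (T: measurableType d) (mu: {measure set T -> \bar R}) (D: set T) (f g: T -> \bar R) :
 (forall x, D x -> (0<=f x)%E) -> (forall x, (0<=g x)%E) -> (forall x, D x -> (f x<=g x)%E) ->
 (\int[mu]_(x in D) f x <= \int[mu]_x g x)%E.
move=> f0 g0 fg; rewrite integral_mkcond.
have p0 x: (0<=(f \_ D) x)%E by rewrite patchE; case: ifPn=> // /[!inE] /f0.
rewrite !ge0_integralTE//; apply: ereal_sup_le=> _ [h hf <-]; exists h=> // x.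
apply: le_trans (hf x) _; rewrite patchE; case: ifPn=> [/[!inE]/fg//|_]; exact: g0.
Qed.

Lemma limn_einf_ge (u: (\bar R)^nat) (l: \bar R) (m: nat) :
 (forall k, (m<=k)%N -> (l<=u k)%E) -> (l<=limn_einf u)%E.
move=> h; rewrite limn_einf_lim; apply: lime_ge; first exact: is_cvg_einfs.
near=> j; apply: le_ereal_inf_tmp=> _ [k /= jk <-]; apply: h; apply: leq_trans jk.
by near: j; exists m.
Unshelve. all: by end_near. Qed.

Lemma limn_einf_le (u: (\bar R)^nat) (l: \bar R): (forall k, (u k<=l)%E) -> (limn_einf u<=l)%E.
move=> h; rewrite limn_einf_lim; apply: lime_le; first exact: is_cvg_einfs.
by apply: nearW=> j; apply: le_trans (h j); apply: ereal_inf_lbound; exists j=> /=.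
Qed.

Definition grid_code (tau: R) a b (M: 'M[R]_(a, b)): 'M[int]_(a, b) := map_mx (fun r=> Num.floor (r/tau)) M.

Lemma grid_code_near (tau: R) a b (M M': 'M[R]_(a, b)) i j: 0<tau ->
 grid_code tau M = grid_code tau M' -> `|M i j-M' i j| <= tau.
move=> t0 /matrixP/(_ i j); rewrite !mxE=> e.
have /andP[a1 a2]:=floor_itv (M i j/tau).
have /andP[b1 b2]:=floor_itv (M' i j/tau).
move: a1 a2; rewrite e=> a1 a2.
have -> : M i j-M' i j = (M i j/tau-M' i j/tau)*tau by rewrite mulrBl !divfK// gt_eqF.
rewrite normrM (gtr0_norm t0) ler_piMl ?(ltW t0)//.
rewrite intrD in a2 b2; rewrite ler_norml; bsplit; lra.
Qed.

Lemma grid_code_enorm (tau: R) p (x y: 'rV[R]_p): 0<tau ->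
 grid_code tau x = grid_code tau y -> enorm (x-y)<=p%:R*tau.
move=> t0 e; apply: (le_trans (enorm_le_sum _)).
rewrite mulr_natl -[X in _ *+ X]card_ord -sumr_const; apply: ler_sum=> i _.
by rewrite !mxE; exact: grid_code_near.
Qed.

End AreaIntegral.

Section AreaBound.
Context {R: realType} (n: nat).
Local Notation d := n.+1.
Local Notation V := 'rV[R]_n.+2.
Variables (K: set V) (o: V) (To: 'M[R]_(n.+2, n.+1)) (c: R).
Hypotheses (cK: spherical_convex_body (d:=n.+1) K) (so: splits o To) (Ko: K o).
Hypotheses (c0: 0<c) (c1: c<=1).
Hypothesis hK: forall y mu, normal_pair K y mu -> c<=dot y o /\ c<=dot mu o.
Hypothesis ha: forall x, K x -> 0<dot x o /\ dot (x *m To) (x *m To)<=d%:R*(d%:R-2)*dot x o^+2.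
Local Notation X := (gno o To K).
Hypotheses (d2: (2<=d)%N).

Let KS: K `<=` @sphere R n.+1. Proof. by have []:=cK. Qed.
Let Kc: closed K. Proof. by have []:=cK. Qed.
Let bK x: sboundary (d:=n.+1) K x -> K x.
Proof. by move=> [+ _]; move/closure_id: Kc=> <-. Qed.

(** At all other boundary points the integrand of the floating area is 0. *)
Definition regular (x: V): Prop:=sboundary (d:=n.+1) K x /\ gauss_kronecker (d:=n.+1) K x != 0.

(** A choice of normal, frame and curvatures at every regular point. Curvatures are nonnegative with
    nonzero product, hence positive. *)
Lemma regular_data: exists (nuf: V -> V) (Ef: V -> 'M[R]_(n.+2, n)) (kf: V -> 'I_n -> R),
 forall x, regular x -> [/\ osculates K x (nuf x) (Ef x) (kf x),
  gauss_kronecker (d:=n.+1) K x = \prod_l kf x l & forall l, 0<kf x l].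
pose Q (x: V) (t: V * 'M[R]_(n.+2, n)*('I_n -> R)):=regular x -> [/\ osculates K x t.1.1 t.1.2 t.2,
  gauss_kronecker (d:=n.+1) K x = \prod_l t.2 l & forall l, 0<t.2 l].
have: forall x, exists t, Q x t.
 move=> x; have [rx|nrx]:=pselect (regular x); last by exists (0, 0, fun=> 0).
 have [bx gx]:=rx; move: gx; rewrite /gauss_kronecker; case: xgetP; last by rewrite eqxx.
 move=> _ -> [kap pk e] g0; have [nu [E osc]]:=osculates_exists KS Kc bx pk.
 exists (nu, E, kap)=> _; split=> //=. move=> l; rewrite lt_def (osculates_ge0 _ osc) andbT; apply/eqP=> kl.
 by move: g0; rewrite -e (bigD1 l)//= kl mul0r eqxx.
move=> /choice[t ht]; exists (fun x=> (t x).1.1), (fun x=> (t x).1.2), (fun x=> (t x).2).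
by [].
Qed.

Variables (nuf: V -> V) (Ef: V -> 'M[R]_(n.+2, n)) (kf: V -> 'I_n -> R).
Hypothesis hdat: forall x, regular x -> [/\ osculates K x (nuf x) (Ef x) (kf x),
  gauss_kronecker (d:=n.+1) K x = \prod_l kf x l & forall l, 0<kf x l].
Variables (L: R) (epsf tauf: nat -> nat -> R).

Let index:=(nat*nat * 'M[int]_(1, n.+2) * 'M[int]_(1, n.+2) * 'M[int]_(n.+2, n) * 'M[int]_(1, n))%type.

(** [k] bounds the curvatures and their inverses, 1/(m+1) is a scale on which the Gauss expansion at
    x is valid, and the four codes fix point, normal, frame and curvatures up to [tauf]. There are
    countably many indices. *)
Definition cell_of (t: index): set 'rV[R]_(n.+2+n.+2) := let: (k, m, ca, cb, cC, cg):=t in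
 [set z | exists x, [/\ regular x, z = row_mx x (nuf x), forall l, k.+1%:R^-1<=kf x l<=k.+1%:R,
   gauss_expansion K x (nuf x) (Ef x) (kf x) (epsf k m) m.+1%:R^-1 &
   [/\ grid_code (tauf k m) x = ca, grid_code (tauf k m) (nuf x) = cb,
     grid_code (tauf k m) (Ef x) = cC & grid_code (tauf k m) (\row_l kf x l) = cg]]].

Definition cell (i: nat): set 'rV[R]_(n.+2+n.+2) :=
 if (unpickle i: option index) is Some t then cell_of t else set0.

Lemma regular_pair x: regular x -> normal_pair K x (nuf x).
Proof. by move=> rx; have [osc _ _]:=hdat rx; apply: osculates_pair osc; case: rx=> /bK. Qed.

(** At a regular point the normal is unique, and that normal occurs at no other point. A pair
    sharing either component with a regular pair is therefore that pair. *)
Lemma regular_unique x w: regular x -> normal_pair K (lsubmx w) (rsubmx w) ->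
 lsubmx w = x \/ rsubmx w = nuf x -> w = row_mx x (nuf x).
move=> rx nw e; have [osc _ k0]:=hdat rx; have Kx: K x by case: rx=> /bK.
have [xo no]:=hK (regular_pair rx); have [wo wn]:=hK nw.
have [p1 p2]:=(lt_le_trans c0 xo, lt_le_trans c0 no).
have [p3 p4]:=(lt_le_trans c0 wo, lt_le_trans c0 wn).
rewrite -(hsubmxK w); case: e=> e.
 by rewrite e in nw *; rewrite (osculates_normal_unique osc p2 p4 nw).
by rewrite e in nw *; rewrite (osculates_point_unique cK osc k0 Kx p1 p3 nw).
Qed.

Hypotheses (eps0: forall k m, 0<epsf k m) (tau0: forall k m, 0<tauf k m).
Hypothesis epsm: forall k m, epsf k m = epsf k 0.

Lemma cell_cover x: regular x -> exists i, cell i (row_mx x (nuf x)).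
move=> rx; have [osc _ kp]:=hdat rx.
pose S := \sum_l (kf x l+(kf x l)^-1).
have Sl l: kf x l+(kf x l)^-1<=S.
 by rewrite /S (bigD1 l)//= lerDl sumr_ge0// => j _; rewrite addr_ge0// ?invr_ge0 ltW.
pose k:=Num.truncn S.
have kS: S<=k.+1%:R by rewrite ltW// truncnS_gt.
have hk l: k.+1%:R^-1<=kf x l<=k.+1%:R.
 have i0: 0<(kf x l)^-1 by rewrite invr_gt0. have h:=le_trans (Sl l) kS; bsplit; last by move: h i0; lra.
 rewrite -[leRHS]invrK lef_pV2 ?posrE//; move: h (kp l); lra.
have [delta d0 hd]:=gauss_near osc (eps0 k 0).
pose m:=Num.truncn (delta^-1).
have mS: m.+1%:R^-1<=delta.
 by rewrite -[leRHS]invrK lef_pV2 ?posrE ?invr_gt0// ltW// truncnS_gt.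
pose t: index:=(k, m, grid_code (tauf k m) x, grid_code (tauf k m) (nuf x),
  grid_code (tauf k m) (Ef x), grid_code (tauf k m) (\row_l kf x l)).
exists (pickle t); rewrite /cell pickleK /cell_of/=; exists x; split=> //.
move=> y mu pm yx h1 h2; rewrite epsm; apply: hd=> //; exact: lt_le_trans mS.
Qed.

Hypothesis L1: 1<L.
Hypothesis tau_eps: forall k m, tauf k m<=epsf k m.
Hypothesis tau_small: forall k m, n.+2%:R*tauf k m<=epsf k m /\
 n.+2%:R*tauf k m<m.+1%:R^-1 /\ n.+2%:R*tauf k m<=1/2.
Hypothesis tau_prod: forall k m, (1+k.+1%:R*tauf k m)^+n<=L.
Hypothesis trans: forall k, exists eta, [/\ 0<eta, eta*(8*(1+c^-1)+2*n%:R*k.+1%:R+c^-2)<1,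
 (1-eta*(8*(1+c^-1)+2*n%:R*k.+1%:R+c^-2))^-1^+(8*d)<=L, (forall m, n.+2%:R*tauf k m<=eta) &
 forall m, transfers n k.+1%:R (epsf k m) eta].

(** Any member u of the cell serves as reference, with [P] its curvature product. The mesh is so
    fine that curvature products within the cell exceed [P] at most by the factor [L]. *)
Lemma cell_good i: cell i !=set0 -> exists P: R, [/\ 0<=P, good_piece K c L (closure (cell i)) P &
 forall x, regular x -> cell i (row_mx x (nuf x)) -> gauss_kronecker (d:=n.+1) K x<=L*P].
rewrite /cell; case: unpickle=> [[[[[[k m] ca] cb] cC] cg]|]; last by move=> [].
move=> [_ [u [ru _ hu gu [ua ub uC ug]]]].
have [eta [eta0 eta1 etaL etat htr]]:=trans k; rewrite /transfers in htr.
have [oscu gku ku]:=hdat ru; have [tE _ _ _]:=oscu.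
have [t1 [t2 t3]]:=tau_small k m; have t0:=tau0 k m.
have near a b (M M': 'M[R]_(a, b)) cc: grid_code (tauf k m) M = cc -> grid_code (tauf k m) M' = cc ->
  forall i' j', `|M i' j'-M' i' j'| <= tauf k m.
 by move=> e e' i' j'; apply: grid_code_near=> //; rewrite e e'.
have near2 (x y: V) cc: grid_code (tauf k m) x = cc -> grid_code (tauf k m) y = cc ->
  enorm (x-y)<=n.+2%:R*tauf k m. by move=> e e'; apply: grid_code_enorm=> //; rewrite e e'.
have kk (x y: V): grid_code (tauf k m) (\row_l kf x l) = cg -> grid_code (tauf k m) (\row_l kf y l) = cg ->
  forall l, `|kf x l-kf y l| <= tauf k m. by move=> e e' l; have:=near _ _ _ _ _ e e' 0 l; rewrite !mxE.
exists (\prod_l kf u l); split; first by rewrite prodr_ge0// => l _; exact/ltW.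
 exists eta, k.+1%:R, u, (nuf u), (Ef u), (kf u).
 split=> //; [|exact: regular_pair|split=> // l; by have /andP[]:=hu l]. apply: closure_piece=> //.
  move=> z [x [rx -> hx gx [xa xb xC xg]]]; rewrite row_mxKl row_mxKr; split; first exact: regular_pair.
   exact: le_trans (near2 _ _ _ xa ua) (etat m). exact: le_trans (near2 _ _ _ xb ub) (etat m).
 move=> z w [y [ry -> hy gy [ya yb yC yg]]] [x [rx -> hx gx [xa xb xC xg]]].
 rewrite /flat_pair !row_mxKl !row_mxKr; have [oscx _ _]:=hdat rx; have [tx _ _ _]:=oscx.
 have te:=tau_eps k m. have r1:=near2 _ _ _ ya xa; have r2:=near2 _ _ _ yb xb.
 apply: (htr m K x (nuf x) (Ef x) (kf x) u (nuf u) (Ef u) (kf u) m.+1%:R^-1)=> //.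
 - exact: regular_pair.
 - exact: le_lt_trans t2.
 - exact: le_lt_trans t2.
 - exact: le_trans t3.
 - by apply: (le_trans r2); apply: (le_trans t3); lra.
 - by move=> ->.
 - exact: le_trans (near2 _ _ _ xa ua) t1.
 - exact: le_trans (near2 _ _ _ xb ub) t1.
 - by move=> i' l; apply: le_trans te; exact: near xC uC i' l.
 - by move=> l; apply: le_trans te; exact: kk.
move=> x rx [x' [rx' e hx gx [xa xb xC xg]]]; have [exx _]:=eq_row_mx e; rewrite -exx in xa xb xC xg hx.
have [_ -> kx]:=hdat rx.
apply: (@le_trans _ _ (\prod_l ((1+k.+1%:R*tauf k m)*kf u l))).
 apply: ler_prod=> l _; rewrite (ltW (kx l))/=.
 have:=kk _ _ xg ug l; have /andP[k1 _]:=hu l; rewrite ler_norml=> /andP[_ h].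
 have: tauf k m<=k.+1%:R*tauf k m*kf u l.
  rewrite -mulrA mulrCA ler_peMr// ?(ltW t0)// -ler_pdivrMl// mulr1//. by move: h; lra.
rewrite big_split/= prodr_const card_ord ler_wpM2r//.
by rewrite prodr_ge0// => l _; exact/ltW.
Qed.

End AreaBound.

Section AreaLe.
Context {R: realType} (n: nat).
Local Notation d := n.+1.
Local Notation V := 'rV[R]_n.+2.
Variables (K: set V) (o: V) (To: 'M[R]_(n.+2, n.+1)) (c: R).
Hypotheses (cK: spherical_convex_body (d:=n.+1) K) (so: splits o To) (Ko: K o).
Hypotheses (c0: 0<c) (c1: c<=1).
Hypothesis hK: forall y mu, normal_pair K y mu -> c<=dot y o /\ c<=dot mu o.
Hypothesis ha: forall x, K x -> 0<dot x o /\ dot (x *m To) (x *m To)<=d%:R*(d%:R-2)*dot x o^+2.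
Local Notation X := (gno o To K).
Hypotheses (d2: (2<=d)%N).

(** Order of choice: [eta] from L and k, then the expansion error from [eta] by [gauss_transfer],
    then the mesh, which also depends on m. *)
Lemma grid_parameters (L: R): 1<L -> exists (epsf tauf: nat -> nat -> R),
 [/\ forall k m, 0<epsf k m, forall k m, 0<tauf k m, forall k m, epsf k m = epsf k 0 &
 [/\ forall k m, tauf k m<=epsf k m, forall k m, n.+2%:R*tauf k m<=epsf k m /\
   n.+2%:R*tauf k m<m.+1%:R^-1 /\ n.+2%:R*tauf k m<=1/2, forall k m, (1+k.+1%:R*tauf k m)^+n<=L &
  forall k, exists eta, [/\ 0<eta, eta*(8*(1+c^-1)+2*n%:R*k.+1%:R+c^-2)<1,
 (1-eta*(8*(1+c^-1)+2*n%:R*k.+1%:R+c^-2))^-1^+(8*d)<=L, (forall m, n.+2%:R*tauf k m<=eta) &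
 forall m, transfers n k.+1%:R (epsf k m) eta]]].
move=> L1; have [x0 /andP[x00 x01] hx0]:=exists_small_error (8*d) L1.
have [x1 /andP[x10 x11] hx1]:=exists_small_error n L1.
pose B (k: nat): R:=8*(1+c^-1)+2*n%:R*k.+1%:R+c^-2.
have B0 k: 0<B k.
 have ci: 0<c^-1 by rewrite invr_gt0. have ci2: 0<c^-2 by rewrite invr_gt0 exprn_gt0.
 have nk: 0<=2*n%:R*k.+1%:R :> R by []. by rewrite /B; lra.
pose eta k:=x0/B k; have eta0 k: 0<eta k by rewrite divr_gt0.
have etaB k: eta k*B k = x0 by rewrite divfK// gt_eqF.
have tr k:=@gauss_transfer R n k.+1%:R (eta k) (ltr0Sn R k) (eta0 k).
have [eps heps]:=choice (fun k=> (fun p=> let: ex_intro2 e e0 h:=p in ex_intro (fun e=> 0<e /\ _) e (conj e0 h)) (tr k)).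
pose t (k m: nat): R:=Num.min (Num.min (eps k) (eta k)) (Num.min (m.+1%:R^-1/2) (x1/k.+1%:R))/n.+2%:R.

have t0 k m: 0<t k m.
 by rewrite divr_gt0// !lt_min eta0 !divr_gt0 ?invr_gt0// !andbT; have []:=heps k.
have tn k m: n.+2%:R*t k m = Num.min (Num.min (eps k) (eta k)) (Num.min (m.+1%:R^-1/2) (x1/k.+1%:R)).
 by rewrite /t mulrC divfK// gt_eqF.
have tle k m: t k m<=n.+2%:R*t k m by rewrite ler_peMl ?(ltW (t0 k m))// ler1n.
have le1 k m: n.+2%:R*t k m<=eps k by rewrite tn !ge_min lexx.
have le2 k m: n.+2%:R*t k m<=eta k by rewrite tn !ge_min lexx !orbT.
have le3 k m: n.+2%:R*t k m<=m.+1%:R^-1/2 by rewrite tn !ge_min lexx !orbT.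
have le4 k m: n.+2%:R*t k m<=x1/k.+1%:R by rewrite tn !ge_min lexx !orbT.
exists (fun k _=> eps k), t; split=> //; first by move=> k m; have []:=heps k.
split.
- by move=> k m; apply: le_trans (le1 k m).
- move=> k m; split; first exact: le1.
 have m0: 0<m.+1%:R^-1 :> R by []. have m1: m.+1%:R^-1<=1 :> R by rewrite invf_le1// ler1n.
 have h2: m.+1%:R^-1/2<m.+1%:R^-1 :> R by rewrite ltr_pdivrMr// ltr_pMr// ltr1n.
 split; first exact: le_lt_trans (le3 k m) h2. by apply: le_trans (le3 k m) _; rewrite ler_pM2r// invr_gt0.
- move=> k m; apply: le_trans (hx1 x1 _); last by rewrite (ltW x10) lexx.
 have h: k.+1%:R*t k m<=x1 by rewrite mulrC -ler_pdivlMr// (le_trans (tle _ _)).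
 have p0: 0<=k.+1%:R*t k m by rewrite mulr_ge0// ltW.
 rewrite lerXn2r ?nnegrE ?addr_ge0 ?invr_ge0 ?subr_ge0 ?(ltW x11)//. exact: le_inv1B.
move=> k; exists (eta k); rewrite -/(B k) etaB; split=> //.
 by apply: hx0; rewrite (ltW x00) lexx.
by move=> m; have [_]:=heps k.
Qed.

(** For every N the nonempty cells among the first N give a finite family of pieces and a measurable
    step function [g N] whose integral is bounded by [finite_pieces]. At each point the integrand is
    at most [g N] once N is large, and Fatou's lemma passes to the limit. *)
Lemma area_le (L lam r0: R): 1<L -> 0<lam -> 0<r0 ->
 r0^+2<=d%:R*(d%:R-2) -> measurable X -> (leb d X < +oo)%E -> measurable (polar X) ->
 (floating_area (d:=n.+1) K <= L%:E*((L*hratio n*d%:R)%:E*((d%:R/d.+1%:R * lam*cone_excess X r0 setT)%:E +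
   (lam^-d/d.+1%:R)%:E * leb d (polar X))))%E.
move=> L1 lam0 r00 hr0 mX fX mpX.
have L0: 0<L by rewrite (lt_trans ltr01).
have [nuf [Ef [kf hdat]]]:=regular_data cK.
have [epsf [tauf [eps0 tau0 epsm [tau_eps tau_small tau_prod trans]]]]:=grid_parameters L1.
pose cl i:=cell K nuf Ef kf epsf tauf i.
have good i: exists P: R, cl i !=set0 -> [/\ 0<=P, good_piece K c L (closure (cl i)) P &
  forall x, regular K x -> cl i (row_mx x (nuf x)) -> gauss_kronecker (d:=n.+1) K x<=L*P].
 have [ci|nci]:=pselect (cl i !=set0); last by exists 0.
 have [P hP]:=cell_good cK hdat tau0 tau_eps tau_small tau_prod trans ci. by exists P.
have [P hP]:=choice good.
(* Cells are taken in decreasing order of [P]. When a point lies in several closures it is kept by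
   the first one, whose [P] is the largest, so the curvature at the point is still at most L times
   that value. *)
pose s N:=sort (fun i j=> P j<=P i) [seq i <- iota 0 N | `[< cl i !=set0 >]].
pose Z N j:=closure (cl (nth 0 (s N) j)).
pose Q N j:=P (nth 0 (s N) j).
pose A N j:=lsubmx @` (Z N j `\` shared (Z N) j).
have mems N j: (j<size (s N))%N -> cl (nth 0 (s N) j) !=set0.
 by move/(mem_nth 0); rewrite mem_sort mem_filter=> /andP[/asboolP].
have goods N j: (j<size (s N))%N -> good_piece K c L (Z N j) (Q N j).
 by move=> /mems/hP[].
have fp N:=finite_pieces cK so Ko c0 c1 hK ha d2 (goods N) L0 lam0 r00 hr0 mX fX mpX.
set C:=(X in (L%:E*X)%E) in fp *.
pose gam: R:=n.+2%:R^-1.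
have gam0: 0<=gam by rewrite invr_ge0.
pose mu:=hausdorff_measure R n.+2 n.
have mA N j: (j<size (s N))%N -> measurable (A N j: set (caratheodory_type (hausdorff_outer R n.+2 n))).
 by move=> jN; apply: caratheodory_rV; have [h _]:=fp N; exact: h.
pose g N (x: caratheodory_type (hausdorff_outer R n.+2 n)): \bar R :=
 (\sum_(j<size (s N)) (L*Q N j `^ gam)%:E*(\1_(A N j) x)%:E)%E.
have cc0 N j: 0<=L*Q N j `^ gam by rewrite mulr_ge0 ?(ltW L0)// powR_ge0.
have term0 N j x: (0<=(L*Q N j `^ gam)%:E*(\1_(A N j) x)%:E)%E by rewrite mule_ge0 ?lee_fin.
have g0 N x: (0<=g N x)%E by apply: sume_ge0=> j _; exact: term0.
have mind N (j: 'I_(size (s N))): measurable_fun setT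
  (fun x: caratheodory_type (hausdorff_outer R n.+2 n)=> (\1_(A N j) x)%:E: \bar R).
 by apply/mEFP; apply: measurable_indic; exact: mA.
have mterm N (j: 'I_(size (s N))): measurable_fun setT
  (fun x: caratheodory_type (hausdorff_outer R n.+2 n)=> (L*Q N j `^ gam)%:E*(\1_(A N j) x)%:E: \bar R)%E.
 by apply: measurable_funeM; exact: mind.
have mg N: mfunT (g N) by apply: emeasurable_sum=> j; exact: mterm.
have intg N: (\int[mu]_x g N x<=L%:E*C)%E.
 rewrite ge0_integral_sum//.
 rewrite (eq_bigr (fun j: 'I_(size (s N))=> (L%:E*((Q N j `^ gam)%:E*hausdorff n (A N j)))%E)); last first.
  move=> j _; rewrite ge0_integralZl//; last pos. rewrite integral_indic//; last exact: mA.
  by rewrite setIT EFinM -muleA.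
 rewrite -ge0_sume_distrr; last by move=> j _; rewrite mule_ge0 ?lee_fin ?powR_ge0// hausdorff_ge0.
 by apply: lee_wpmul2l; [rewrite lee_fin ltW|have [_]:=fp N].
(* By Fatou the lower limit of the [g N] has integral within the bound; the rest of the proof
   compares it with the integrand pointwise. *)
apply: (@le_trans _ _ (\int[mu]_x limn_einf (g^~ x))%E); last first.
 by apply: (le_trans (fatou _ measurableT mg _))=> //; exact: limn_einf_le.
have lg0 x: (0<=limn_einf (g^~ x))%E by apply: (limn_einf_ge (m:=0))=> k _; exact: g0.
apply: (@ge0_le_int_any _ _ _ mu (sboundary (d:=n.+1) K)
  (fun u=> (gauss_kronecker (d:=n.+1) K u `^ gam)%:E) (fun x=> limn_einf (g^~ x)) _ lg0).
 by move=> x _; rewrite lee_fin powR_ge0.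
move=> x bx; have [g0x|gn]:=eqVneq (gauss_kronecker (d:=n.+1) K x) 0.
 by rewrite g0x powR0 ?invr_neq0 ?pnatr_eq0.
have rx: regular K x by split.
have [i ci]:=cell_cover hdat tauf eps0 epsm rx.
apply: (limn_einf_ge (m:=i.+1))=> N iN.
have cine: cl i !=set0 by exists (row_mx x (nuf x)).
have isN: i \in s N by rewrite mem_sort mem_filter; bsplit; [exact/asboolP|rewrite mem_iota add0n].
pose p0:=index i (s N); have p0N: (p0<size (s N))%N by rewrite index_mem.
have np0: nth 0 (s N) p0 = i by rewrite nth_index.
(* The least such [j] is the piece that keeps x: by [regular_unique] its witness is the regular pair
   of x, and no earlier piece contains the point or the normal. *)
pose Hit j := `[< (j<size (s N))%N /\ exists w, Z N j w /\ (lsubmx w = x \/ rsubmx w = nuf x) >].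
have h0: exists j, Hit j.
 exists p0; apply/asboolP; split=> //; exists (row_mx x (nuf x)).
 by rewrite /Z np0 row_mxKl; split; [exact: subset_closure|left].
have [j /asboolP[jN [w [Zw hw]]] jmin]:=ex_minnP h0.
have jp: (j<=p0)%N.
 apply: jmin; apply/asboolP; split=> //; exists (row_mx x (nuf x)).
 by rewrite /Z np0 row_mxKl; split; [exact: subset_closure|left].
have nw: normal_pair K (lsubmx w) (rsubmx w).
 by have [eta [k [u [nu [E [kap [[_ h _] _ _ _]]]]]]]:=goods N j jN; have []:=h _ Zw.
have wE:=regular_unique cK c0 hK hdat rx nw hw.
have Ax: A N j x.
 exists w; last by rewrite wE row_mxKl. split=> // -[j' [w' [j'j Zw' e]]].
 have: (j<=j')%N; last by rewrite leqNgt j'j. apply: jmin; apply/asboolP; split; first exact: ltn_trans jN.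
 by exists w'; split=> //; move: e; rewrite wE row_mxKl row_mxKr=> -[<-|<-]; [left|right].
have QP: P i<=Q N j.
 rewrite -np0; have tot: total (fun i j=> P j<=P i) by move=> a b; exact: le_total.
 have:=sort_sorted tot [seq i <- iota 0 N | `[< cl i !=set0 >]].
 have tr: transitive (fun i j=> P j<=P i) by move=> a b e ab bc; exact: le_trans bc ab.
 have rf: reflexive (fun i j=> P j<=P i) by []. by move/(sorted_leq_nth tr rf 0); apply; rewrite ?inE.
have [_ _ /(_ x rx ci) gP]:=hP i cine.
have [_ gk kp]:=hdat x rx.
have gk0: 0<=gauss_kronecker (d:=n.+1) K x by rewrite gk prodr_ge0// => l _; exact/ltW.
have [Q0 _ _]:=hP _ (mems N j jN); rewrite -/(Q N j) in Q0.
apply: (@le_trans _ _ ((L*Q N j `^ gam)%:E*(\1_(A N j) x)%:E)%E).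
 rewrite indicE mem_set// mule1 lee_fin. apply: (@le_trans _ _ ((L*Q N j) `^ gam)).
  apply: ge0_ler_powR; rewrite ?nnegrE ?mulr_ge0 ?(ltW L0)//. by rewrite (le_trans gP)// ler_pM2l.
 rewrite powRM ?(ltW L0)// ler_wpM2r ?powR_ge0//.
 by rewrite -[leRHS]powRr1 ?(ltW L0)// ler_powR ?(ltW L1)// invf_le1// ler1n.
rewrite /g (bigD1 (Ordinal jN))//= leeDl// sume_ge0// => j' _; exact: term0.
Qed.

End AreaLe.

(** * The gnomonic image of the body and its centroid *)

Section BodyGno.
Context {R: realType} (n: nat).
Local Notation d := n.+1.
Local Notation V := 'rV[R]_n.+2.
Variables (K: set V) (o: V) (To: 'M[R]_(n.+2, n.+1)).
Hypotheses (cK: spherical_convex_body (d:=n.+1) K) (so: splits o To).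
Local Notation X := (gno o To K).
Local Notation lift y := (o + y *m To^T).

Let oo: dot o o = 1. Proof. by have []:=so. Qed.

Lemma lift_dot (y: 'rV[R]_d): dot (lift y) o = 1.
Proof. by rewrite dotDl oo splits_perp// addr0. Qed.

Lemma lift_tail (y: 'rV[R]_d): lift y *m To = y.
Proof. by have [_ h _]:=so; rewrite mulmxDl h add0r (splits_tr _ so). Qed.

Lemma lift_norm (y: 'rV[R]_d): dot (lift y) (lift y) = 1+dot y y.
Proof. by rewrite (splits_dot _ _ so) lift_dot lift_tail mulr1. Qed.

Lemma lift_enorm_ge1 (y: 'rV[R]_d): 1<=enorm (lift y).
rewrite -(@ler_pXn2r _ 2)// ?nnegrE ?enorm_ge0// expr1n enormE lift_norm lerDl.
by rewrite -enormE sqr_ge0.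
Qed.

Lemma lift_neq0 (y: 'rV[R]_d): lift y != 0.
Proof. by rewrite -enorm_gt0 (lt_le_trans ltr01)// lift_enorm_ge1. Qed.

Lemma closed_gno: closed X.
have [_ clK _ _]:=cK.
apply: (@closed_comp _ _ (fun y: 'rV[R]_d=> nrm (lift y)))=> // y _.
have cl: continuous (fun y: 'rV[R]_d=> lift y).
 rewrite (_: (fun y=> _) = (fun y: 'rV[R]_d=> o-y *m (- To^T))); last first.
  by apply/funext=> z; rewrite mulmxN opprK. by apply: cont_rVB; [exact: cont_cst_rV|exact: cont_mulmxr].
move: y; apply: cont_fun_rV=> i.
rewrite (_: (fun y=> _) = (fun y: 'rV[R]_d=> (enorm (lift y))^-1*(lift y) 0 i)); last first.
 by apply/funext=> z; rewrite /nrm mxE.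
apply: cont_mulR; last exact: cont_coordfun.
move=> y; apply: (@continuousV _ _ (fun y: 'rV[R]_d=> enorm (lift y))).
 by rewrite gt_eqF// (lt_le_trans ltr01)// lift_enorm_ge1.
exact: (cont_enorm cl).
Qed.

Hypothesis iKo: sinterior (d:=n.+1) K o.

Lemma sinterior_mem: K o.
Proof. by have [oS h]:=iKo; exact: (nbhs_singleton h). Qed.

Lemma gno_star y (t: R): X y -> 0<=t<=1 -> X (t*:y).
have Ko:=sinterior_mem.
move=> Xy /andP[t0 t1]; rewrite /gno/=.
have [->|tn0]:=eqVneq t 0; first by rewrite scale0r mul0mx addr0 nrm_id.
have [->|tn1]:=eqVneq t 1; first by rewrite scale1r.
have tp: 0<t by rewrite lt_neqAle eq_sym tn0.
have t1p: 0<1-t by rewrite subr_gt0 lt_neqAle tn1.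
have e0: 0<enorm (lift y) by rewrite enorm_gt0 lift_neq0.
have -> : o+t*:y *m To^T = (1-t)*:o+(t*enorm (lift y))*:nrm (lift y).
 rewrite /nrm scalerA -mulrA divff ?gt_eqF// mulr1 scalerDr addrA scalerBl scale1r.
 by rewrite -scalemxAl subrK.
apply: body_conv=> //; last pos.
apply/eqP=> h; have: dot (nrm (lift y)) o = -1 by rewrite h dotNl oo.
rewrite /nrm dotZl lift_dot mulr1=> h1; have: 0<(enorm (lift y))^-1 by rewrite invr_gt0.
by rewrite h1 ltr0N1.
Qed.

Lemma gno_ball: exists2 r, 0<r & forall y, enorm y<=r -> X y.
have [t /andP[t0 t1] ht]:=near_center oo iKo; exists t=> // y yt.
have [->|yn0]:=eqVneq y 0.
 by rewrite /gno/= mul0mx addr0 nrm_id//; exact: sinterior_mem.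
have y0: 0<enorm y by rewrite enorm_gt0.
have -> : y = (enorm y/t)*:((t/enorm y)*:y).
 by rewrite scalerA mulrA divfK ?gt_eqF// divff ?scale1r// gt_eqF.
apply: gno_star; last by rewrite divr_ge0 ?(ltW t0) ?(ltW y0)//= ler_pdivrMr// mul1r.
pose v := - ((enorm y)^-1*:y *m To^T).
have vv: dot v v = 1.
 by rewrite -enormE enormN -scalemxAl enormZ (enorm_splits_tr _ so) gtr0_norm ?invr_gt0// mulVf ?gt_eqF// expr1n.
have:=ht v vv; rewrite /gno/=; congr (K (nrm _)).
by rewrite /v scalerN opprK -!scalemxAl scalerA.
Qed.

Variable tau: R.
Hypothesis ha: forall x, K x -> 0<dot x o /\ dot (x *m To) (x *m To)<=tau*dot x o^+2.

Lemma gno_bounded y: X y -> dot y y<=tau.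
move=> /ha[_]; rewrite /nrm -scalemxAl !dotZl dotZr lift_tail lift_dot mulr1 mulrA -expr2.
by rewrite mulrC ler_pM2r// exprn_gt0// invr_gt0 enorm_gt0 lift_neq0.
Qed.

Lemma starbody_gno: starbody X.
split; [exact: closed_gno|by move=> *; exact: gno_star|exact: gno_ball|].
exists (Num.sqrt tau)=> y /gno_bounded h; rewrite /enorm ler_wsqrtr//.
Qed.

Lemma gnomonic_image: gnomonic (d:=n.+1) o @` K = (fun y: 'rV[R]_d=> y *m To^T) @` X.
have [KS _ _ _]:=cK; seteq=> [_ [x Kx <-]|_ [y Xy <-]].
 have [x0 _]:=ha Kx; have xx: dot x x = 1 by exact: KS.
 have xE: gnomonic (d:=n.+1) o x = ((dot x o)^-1*:x *m To) *m To^T.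
  rewrite /gnomonic {2}(splitsE x so) scalerDr scalerA mulVf ?gt_eqF// scale1r.
  by rewrite addrC addKr -!scalemxAl. exists ((dot x o)^-1*:x *m To)=> //.
 by rewrite /gno/= -xE /gnomonic addrCA subrr addr0 nrmZ ?invr_gt0// nrm_id.
exists (nrm (lift y))=> //; rewrite /gnomonic /nrm dotZl lift_dot mulr1 invrK scalerA.
by rewrite divff ?scale1r ?enorm_eq0 ?lift_neq0// addrC addKr.
Qed.

(** The map y -> y To^T is an isometry onto the hyperplane orthogonal to o, so Hausdorff measure
    there is [hratio d] times the image of [leb]. The identity map [idm] passes from the
    Caratheodory to the Borel sigma-algebra. *)
Lemma int_gnomonic (h: V -> \bar R): mfunT h -> (forall x, (0<=h x)%E) ->
 (\int[hausdorff_measure R n.+2 d]_(x in gnomonic (d:=n.+1) o @` K) h x =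
  (hratio d)%:E * \int[leb d]_(y in X) h (y *m To^T))%E.
move=> mh h0; rewrite gnomonic_image; set phi:=fun y: 'rV[R]_d=> y *m To^T.

have cX: compact X.
 apply: (compact_rV (r:=Num.sqrt tau) closed_gno)=> y /gno_bounded k. by rewrite /enorm ler_wsqrtr.
have cphi: continuous phi by exact: cont_mulmxr.
have mphi: mfunT phi by exact: meas_mulmx.
have mG: measurable (phi @` X).
 apply: compact_meas_rV; apply: continuous_compact=> //. by apply: continuous_subspaceT.
have phiI: injective phi by move=> y z /(congr1 (fun v=> v *m To)); rewrite /phi !(splits_tr _ so).
have preG: phi @^-1` (phi @` X) = X.
 seteq=> [y [z Xz /phiI <-]//|y Xy]; exact: imageP.
pose mu:=hausdorff_measure R n.+2 d.
pose idm: caratheodory_type (hausdorff_outer R n.+2 d) -> V:=id.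
have midm: mfunT idm.
 by move=> _ A mA; rewrite setTI; exact: caratheodory_rV.
have h1:=@ge0_integral_pushforward _ _ _ _ R idm midm mu (phi @` X) h mG
 (measurable_funS measurableT (@subsetT _ _) mh) (fun x _=> h0 x).
rewrite -[LHS]h1.
have h2:=@ge0_integral_pushforward _ _ _ _ R phi mphi (leb d) (phi @` X) h mG
 (measurable_funS measurableT (@subsetT _ _) mh) (fun x _=> h0 x).
rewrite preG in h2; rewrite -[X in (_*X)%E]h2.
have hr0:=@hratio_gt0 R d.
have h3:=@ge0_integral_mscale _ _ _ (pushforward (leb d) phi) (phi @` X) mG (NngNum (ltW hr0)) h
 (measurable_funS measurableT (@subsetT _ _) mh) (fun x _=> h0 x).
rewrite -[RHS]h3.
apply: eq_measure_integral=> A mA AG.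
change (hausdorff d A = (hratio d)%:E * leb d (phi @^-1` A))%E.
have {1}-> : A = phi @` (phi @^-1` A).
 seteq=> [x Ax|_ [y Ay <-]//]; have [y Xy yx]:=AG _ Ax. by exists y=> //; rewrite /preimage/= yx.
rewrite -haus_leb; last by rewrite -measTI; exact: mphi.
apply: haus_isometry=> y z _ _.
by rewrite /phi -mulmxBl (enorm_splits_tr _ so).
Qed.

Lemma leb_gno_lty: (leb d X < +oo)%E.
apply: (@leb_lty R d X (Num.sqrt tau)); last exact: measV_closed closed_gno.
by move=> y /gno_bounded h; rewrite /enorm ler_wsqrtr.
Qed.

Lemma sube_fin_eq0 (a b: \bar R): b \is a fin_num -> (a-b = 0)%E -> a = b.
by case: a b=> [a| |] [b| |]//= _ []; move/eqP; rewrite subr_eq0=> /eqP ->.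
Qed.

Lemma leb_eball_gt0 k (r: R): 0<r -> (0<leb k.+1 [set x: 'rV[R]_k.+1 | (enorm x<=r)%R])%E.
move=> r0; have k0: 0<k.+1%:R :> R by [].
have rk: 0<r/k.+1%:R by rewrite divr_gt0.
apply: (@lt_le_trans _ _ (leb k.+1 (cube 0 (r/k.+1%:R)))).
 by rewrite leb_cube ?(ltW rk)// lte_fin exprn_gt0// mulr_gt0.
apply: le_measure; rewrite ?inE; [exact: meas_cube|exact: meas_eball|].
move=> x hx /=; apply: (le_trans (enorm_le_sum x)).
apply: (@le_trans _ _ (\sum_(i<k.+1) r/k.+1%:R)).
 by apply: ler_sum=> i _; have:=hx i; rewrite mxE subr0.
by rewrite sumr_const card_ord -(mulr_natr (r/_)) divfK// gt_eqF.
Qed.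

Lemma leb_gno_gt0: (0<leb d X)%E.
have [r r0 hr]:=gno_ball.
have mB: measurable [set x: 'rV[R]_d | (enorm x<=r)%R] by exact: meas_eball.
have mX: measurable X by exact: measV_closed closed_gno.
apply: (@lt_le_trans _ _ (leb d [set x: 'rV[R]_d | (enorm x<=r)%R])).
 exact: leb_eball_gt0.
by apply: le_measure; rewrite ?inE// => x; exact: hr.
Qed.

Hypothesis cen: centroid (d:=n.+1) (gnomonic (d:=n.+1) o @` K) = 0.

Lemma integrable_lin (f: 'rV[R]_d -> R) (M: R): mfunT f ->
 (forall y, X y -> `|f y| <= M) -> (leb d).-integrable X (EFin \o f).
move=> mf hf; have mX: measurable X by exact: measV_closed closed_gno.
apply: (@le_integrable _ _ _ (leb d) X mX _ (EFin \o cst M)).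
- by apply/mEFP; exact: measurable_funS mf.
- by move=> y Xy /=; rewrite lee_fin (le_trans (hf y Xy))// ler_norm.
apply/integrableP; split; first by apply/mEFP; exact: measurable_cst.
rewrite (eq_integral (cst `|M|%:E)) ?integral_cst//.
by apply: lte_mul_pinfty=> //; exact: leb_gno_lty.
Qed.

(** The centroid is a quotient that would also vanish for a zero denominator. The positive, finite
    volume of X excludes this, so the first moments themselves vanish. *)
Lemma centroid_coord i: (\int[leb d]_(y in X) ((y *m To^T) 0 i)%:E = 0)%E.
have mX: measurable X by exact: measV_closed closed_gno.
have hr0:=@hratio_gt0 R d.
pose f (x: V):=(x 0 i)%:E; pose mu:=hausdorff_measure R n.+2 d.
have mfi: mfunT f by apply/mEFP; exact: meas_coord.
have if_: (leb d).-integrable X (fun y=> f (y *m To^T)).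
 apply: (@integrable_lin (fun y=> (y *m To^T) 0 i) (Num.sqrt tau)).
  by apply: (mcomp (meas_coord i)); exact: meas_mulmx.
 move=> y /gno_bounded h; apply: (le_trans (coord_le_enorm _ _)).
 by rewrite (enorm_splits_tr _ so) /enorm ler_wsqrtr.
have key: (\int[mu]_(x in gnomonic (d:=n.+1) o @` K) f x =
  (hratio d)%:E * \int[leb d]_(y in X) f (y *m To^T))%E. rewrite integralE int_gnomonic; first last.
 - by [].
 - exact: measurable_funepos.
 rewrite int_gnomonic; first last.
 - by [].
 - exact: measurable_funeneg.
 have nf:=integrable_neg_fin_num mX if_. set a:=(X in ((hratio d)%:E*X-_ = _)%E).
 set b:=(X in (_-(hratio d)%:E*X = _)%E). have eb: b \is a fin_num.
  move: nf; congr (_ \is a fin_num); apply: eq_integral=> y _. by rewrite !funenegE.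
 have -> : (\int[leb d]_(y in X) f (y *m To^T) = a-b)%E.
  rewrite integralE; congr (_-_)%E; apply: eq_integral=> y _; first by rewrite !funeposE.
  by rewrite !funenegE.
 by move: a b eb=> a b eb; apply/esym/muleBr=> //; rewrite fin_num_adde_defl// fin_numN.
have:=congr1 (fun v: V=> v 0 i) cen; rewrite !mxE=> /eqP.
rewrite mulf_eq0 invr_eq0=> /orP[/eqP|/eqP]; last first.
 rewrite gnomonic_image (_: hausdorff d _ = hausdorff d X); last first.
  by apply: haus_isometry=> y z _ _; rewrite -mulmxBl (enorm_splits_tr _ so).
 have l0:=leb_gno_gt0; have l1:=leb_gno_lty. rewrite haus_leb//; move: l0 l1; set l:=leb d X=> l0 l1.
 have lf: l \is a fin_num by rewrite ge0_fin_numE// ltW.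
 rewrite fineM// => /eqP; rewrite mulf_eq0 (gt_eqF hr0)/= => fl.
 by have:=@fine_gt0 _ l; rewrite l0 l1 (eqP fl) ltxx=> /(_ isT).
rewrite /Rintegral key.
have fn:=integrable_fin_num mX if_.
rewrite fineM// => /eqP; rewrite mulf_eq0 (gt_eqF hr0)/= => /eqP h.
by rewrite -(fineK fn) h.
Qed.

(** A coordinate in the chart is a linear combination of ambient coordinates, so its integral is 0;
    in terms of positive and negative parts this is the hypothesis of [blaschke_santalo]. *)
Lemma centroid_balance j: (\int[leb d]_(y in X) (Num.max (1*y 0 j) 0)%:E =
 \int[leb d]_(y in X) (Num.max (-1*y 0 j) 0)%:E)%E.
have mX: measurable X by exact: measV_closed closed_gno.
have mc i: mfunT (fun y: 'rV[R]_d=> (y *m To^T) 0 i).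
 by apply: (mcomp (meas_coord i)); exact: meas_mulmx.
have bd i y: X y -> `|(y *m To^T) 0 i| <= Num.sqrt tau.
 move=> /gno_bounded h; apply: (le_trans (coord_le_enorm _ _)).
 by rewrite (enorm_splits_tr _ so) /enorm ler_wsqrtr.
have ii i: (leb d).-integrable X (EFin \o (fun y=> (y *m To^T) 0 i)).
 by apply: (integrable_lin (mc i))=> y; exact: bd.
have ij: (leb d).-integrable X (EFin \o (fun y: 'rV[R]_d=> y 0 j)).
 apply: (@integrable_lin _ (Num.sqrt tau)); first exact: meas_coord.
 move=> y /gno_bounded h; apply: (le_trans (coord_le_enorm _ _)). by rewrite /enorm ler_wsqrtr.
have z: (\int[leb d]_(y in X) (y 0 j)%:E = 0)%E.
 rewrite (eq_integral (fun y=> \sum_(i<n.+2) ((To i j)%:E*((y *m To^T) 0 i)%:E))%E); last first.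
  move=> y _; rewrite -{1}(splits_tr y so) mxE sumEFin; congr EFin. by apply: eq_bigr=> i _; rewrite mulrC.
 rewrite integral_sum//; last by move=> i; exact: integrableZl (ii i).
 rewrite big1// => i _; rewrite integralZl//; last exact: ii. by rewrite centroid_coord mule0.
have:=z; rewrite integralE.
have pf:=integrable_pos_fin_num mX ij; have nf:=integrable_neg_fin_num mX ij.
move=> /(sube_fin_eq0 nf) h.
transitivity (\int[leb d]_(x in X) (EFin \o (fun y: 'rV[R]_d=> y 0%R j))^\+ x)%E.
 by apply: eq_integral=> y _; rewrite funeposE mul1r EFin_max.
rewrite [LHS]h; apply: eq_integral=> y _.
by rewrite funenegE mulN1r EFin_max.
Qed.

End BodyGno.

(** * Spherical caps: curvature and floating area *)

Section Cap.
Context {R: realType}.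

Lemma cos_half (z: R): cos z = 1-2*sin (z/2)^+2.
rewrite {1}(_: z = (z/2) *+ 2) ?cos_mulr2n ?cos2sin2; last by rewrite -mulr_natr divfK.
by rewrite -mulr_natr; ring.
Qed.

Lemma sin_half (z: R): sin z = 2*(cos (z/2)*sin (z/2)).
rewrite {1}(_: z = (z/2) *+ 2) ?sin_mulr2n; last by rewrite -mulr_natr divfK.
by rewrite -mulr_natr; ring.
Qed.

Lemma sumsq_bounds (a b: R): 0<a -> 0<b -> a^+2+b^+2 = 1 -> [/\ a<1, b<1 & b^+2 = 1-a^+2].
move=> a0 b0 ab; have a2: 0<a^+2 by rewrite exprn_gt0.
have b2: 0<b^+2 by rewrite exprn_gt0.
by split; [rewrite -(@expr_lt1 _ 2) ?ltW// ; lra|rewrite -(@expr_lt1 _ 2) ?ltW//; lra|lra].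
Qed.

(** The quadratic has the roots (b - D)/(A + a) and (b + D)/(A + a); the smallness assumption
    excludes the second. *)
Lemma cap_root (a b A D tau: R): 0<a -> 0<A -> 0<b -> 0<D -> D^+2 = b^+2-(a^+2-A^+2) -> (A+a)*tau<b ->
 (A+a)*tau^+2-2*b*tau+(a-A) = 0 <-> tau = (b-D)/(A+a).
move=> a0 A0 b0 D0 DE small; have s0: A+a != 0 by rewrite gt_eqF// addr_gt0.
have fac: (A+a)*((A+a)*tau^+2-2*b*tau+(a-A)) = ((A+a)*tau-b-D)*((A+a)*tau-b+D).
 have bE: b^+2 = D^+2+(a^+2-A^+2) by lra. by ring: bE.
split=> [q0|tE].
 move: fac; rewrite q0 mulr0=> /esym/eqP; rewrite mulf_eq0=> /orP[/eqP h|/eqP h].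
  by exfalso; lra. by apply: (mulfI s0); rewrite mulrCA divff// mulr1; lra.
apply: (mulfI s0); rewrite fac mulr0 tE mulrCA divff// mulr1.
by rewrite (_: b-D-b+D = 0) ?mulr0//; ring.
Qed.

(** In normal coordinates at a boundary point, the boundary of the cap is cos(t) cos(r) a + sin(t) b
    = a. The substitution tan(t/2) makes this the quadratic of [cap_root], so the height is twice an
    arctangent; its expansion shows the curvature a/b, the cotangent of the radius. *)
Lemma cap_height (a b: R): 0<a -> 0<b -> a^+2+b^+2 = 1 ->
 exists f: R -> R, (exists2 r0, 0<r0 & forall r t, 0<=r -> r<r0 -> `|t| < r0 ->
   (cos t*cos r*a+sin t*b = a <-> t = f r)) /\
  forall e, 0<e -> exists2 delta, 0<delta & forall r, 0<=r -> r<delta -> `|f r-2^-1*(a/b)*r^+2| <= e*r^+2.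
move=> a0 b0 ab.
have [/ltW a1 /ltW b1 bE]:=sumsq_bounds a0 b0 ab.
have sin0': is_derive (0: R) 1 (@sin R) 1 by have:=is_derive_sin (0: R); rewrite cos0.
have at0: is_derive (0: R) 1 (@atan R) 1.
 by have:=is_derive1_atan (0: R); rewrite expr0n/= addr0 invr1.
have ta0: is_derive (0: R) 1 (@tan R) 1.
 have c0': cos (0: R) != 0 by rewrite cos0 oner_neq0. by have:=is_derive_tan c0'; rewrite cos0 expr1n invr1.
have [d1 d10 h1]:=derive_approx sin0' (@sin0 R) (@ltr01 R).
have [d2 d20 h2]:=derive_approx ta0 (@tan0 R) (@ltr01 R).
pose D (r: R):=Num.sqrt (b^+2-(a^+2-(a*cos r)^+2)).
pose tau (r: R):=(b-D r)/(a*cos r+a).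
pose r0:=Num.min (Num.min d1 d2) (b/4).
have r00: 0<r0 by rewrite !lt_min d10 d20 divr_gt0.
have [rd1 rd2 rb]: [/\ r0<=d1, r0<=d2 & r0<=b/4].
 by rewrite /r0 !ge_min !lexx !orbT.
move: r0 r00 rd1 rd2 rb=> r0 r00 rd1 rd2 rb.
have pi1: 1<=pi/2 :> R by have:=@pi_ge2 R; lra.
have cpos (r: R): `|r| <= 1/2 -> 0<cos r.
 by rewrite ler_norml=> /andP[? ?]; apply: cos_gt0_pihalf; lra.
have Dfact r: 0<=r -> r<r0 -> [/\ D r^+2 = b^+2-(a^+2-(a*cos r)^+2), b/2<=D r, D r<=b,
  0<cos r & b^+2-D r^+2<=4*r^+2]. move=> rp rr; have cr: 0<cos r by apply: cpos; rewrite ger0_norm//; lra.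
 have sr: `|sin r| <= 2*r.
  have:=h1 r; rewrite ger0_norm// => /(_ (lt_le_trans rr rd1)).
  by rewrite ler_norml=> /andP[? ?]; rewrite ler_norml; bsplit; lra. have s2: sin r^+2<=4*r^+2.
  have: `|sin r| ^+ 2<=(2*r)^+2 by rewrite ler_pXn2r ?nnegrE// mulr_ge0.
  by rewrite real_normK ?num_real// exprMn; lra.
 have cE: (a*cos r)^+2 = a^+2-a^+2*sin r^+2 by rewrite exprMn cos2sin2; ring.
 have a21: a^+2<=1 by rewrite expr_le1// ltW. have as2: a^+2*sin r^+2<=4*r^+2.
  by apply: le_trans s2; rewrite ler_piMl// sqr_ge0.
 have as0: 0<=a^+2*sin r^+2 by rewrite mulr_ge0// sqr_ge0. have r2: 4*r^+2<=b^+2/4.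
  have: r^+2<=(b/4)^+2 by rewrite ler_pXn2r ?nnegrE ?divr_ge0 ?(ltW b0)//; lra. by rewrite expr_div_n; lra.
 have b2: 0<b^+2 by rewrite exprn_gt0.
 have DE: D r^+2 = b^+2-(a^+2-(a*cos r)^+2) by rewrite /D sqr_sqrtr// cE; lra.
 split=> //; last by rewrite DE cE; lra.
  rewrite -(@ler_pXn2r _ 2)// ?nnegrE ?sqrtr_ge0 ?divr_ge0 ?(ltW b0)//. by rewrite DE cE expr_div_n; lra.
 rewrite -(@ler_pXn2r _ 2)// ?nnegrE ?sqrtr_ge0 ?(ltW b0)//. by rewrite DE cE; lra.
exists (fun r=> 2*atan (tau r)); split.
 exists r0=> // r t rp rr tr. have [DE Dlo _ cr _]:=Dfact r rp rr.
 have t2: `|t/2| < r0/2 by rewrite normrM (@gtr0_norm _ 2^-1) ?invr_gt0// ltr_pM2r// invr_gt0.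
 have ct: 0<cos (t/2) by apply: cpos; lra. have ctn: cos (t/2) != 0 by rewrite gt_eqF.
 have tt: `|tan (t/2)| < b/4.
  have td2: `|t/2| < d2 by lra. have:=h2 (t/2) td2; rewrite mul1r=> k.
  by rewrite -[tan _](subrK (t/2)) (le_lt_trans (ler_normD _ _))//; lra.
 have A0: 0<a*cos r by rewrite mulr_gt0. have Aa: a*cos r<=a by rewrite ler_piMr ?(ltW a0) ?cos_le1.
 have small: (a*cos r+a)*tan (t/2)<b.
  apply: (le_lt_trans (ler_norm _)); rewrite normrM gtr0_norm ?addr_gt0//.
  apply: (@le_lt_trans _ _ (2 * `|tan (t/2)|)); last lra. by rewrite ler_wpM2r//; lra.
 have D0: 0<D r by apply: lt_le_trans Dlo; rewrite divr_gt0. have [q1 q2]:=cap_root a0 A0 b0 D0 DE small.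
 set T:=tan (t/2) in q1 q2 *. have cT: cos (t/2)^+2*(1+T^+2) = 1.
  by rewrite /T -cos2_tan2// divff// expf_neq0.
 have sT: sin (t/2) = cos (t/2)*T by rewrite /T /tan mulrCA divff// mulr1.
 have rel: cos t*cos r*a+sin t*b-a =
   - cos (t/2)^+2*((a*cos r+a)*T^+2-2*b*T+(a-a*cos r)).
  rewrite (cos_half t) (sin_half t) sT; set c:=cos (t/2) in cT *.
  transitivity ((c^+2*(1+T^+2)-2*(c*T)^+2)*cos r*a+2*(c*(c*T))*b-a*(c^+2*(1+T^+2))).
   by rewrite cT; ring. by ring. split=> [E|tE]. have: T = tau r.
   apply: q1; apply: (mulfI (_: - cos (t/2)^+2 != 0)); first by rewrite oppr_eq0 expf_neq0.
   by rewrite -rel E mulr0 subrr. move=> <-; rewrite /T tanK; first by field.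
  by rewrite in_itv/=; move: t2 rb pi1 b1; clear; rewrite ltr_norml=> /andP[? ?] *; bsplit; lra.
 have: T = tau r by rewrite /T tE mulrAC divff// mul1r atanK.
 by move=> /q2 qq; apply/eqP; rewrite -subr_eq0 rel qq mulr0.
move=> e e0; pose k:=a/b; have k0: 0<k by rewrite divr_gt0.
pose et: R:=Num.min 3^-1 (e/(5*k)).
have et0: 0<et by rewrite lt_min invr_gt0 ltr0n divr_gt0// mulr_gt0.
have et1: et<=3^-1 by rewrite ge_min lexx.
have et3: et<=e/(5*k) by rewrite ge_min lexx orbT.
have et2: 5*k*et<=e.
 have k5: 0<5*k by rewrite mulr_gt0. by rewrite mulrC; move: et3; rewrite (ler_pdivlMr _ _ k5).
have [d3 d30 h3]:=derive_approx sin0' (@sin0 R) et0.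
have [d4 d40 h4]:=derive_approx at0 (@atan0 R) et0.
pose m: R:=Num.min (Num.min r0 d3) (Num.min 1 (Num.min (d4/k) (et*b^+2/4))).
exists m.
 by rewrite !lt_min r00 d30 ltr01 !divr_gt0 ?mulr_gt0 ?exprn_gt0.
move=> r rp; rewrite !lt_min=> /andP[/andP[rr0 rd3] /and3P[r1 rd4 rb2]].
have [DE Dlo Dhi cr D4]:=Dfact r rp rr0.
pose dl:=1-cos r; pose z:=r/2.
have z0: 0<=z by rewrite divr_ge0.
have dlE: dl = 2*sin z^+2 by rewrite /dl cos_half; ring.
have dl0: 0<=dl by rewrite dlE mulr_ge0// sqr_ge0.
have sz: `|sin z-z| <= et*z.
 by have:=h3 z; rewrite ger0_norm//; apply; rewrite /z; lra.
have z2E: r^+2 = 4*z^+2 by rewrite /z; field.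
have ez: et*z<=z by rewrite ler_piMl//; lra.
have dlr: `|dl-r^+2/2| <= (3/2)*et*r^+2.
 rewrite dlE z2E (_: _-_ = 2*((sin z-z)*(sin z+z))); last by field.
 rewrite normrM (ger0_norm (_: 0<=2))// normrM. have s3: `|sin z+z| <= 3*z.
  by move: sz ez z0; clear; rewrite !ler_norml=> /andP[? ?] *; bsplit; lra.
 apply: (@le_trans _ _ (2*((et*z)*(3*z)))).
  by rewrite ler_pM2l// ler_pM. by eqle; field.
have r20: 0<=r^+2 by rewrite sqr_ge0.
have etr: et*r^+2<=3^-1*r^+2 by rewrite ler_wpM2r.
have dlr1: dl<=r^+2 by move: dlr; rewrite ler_norml=> /andP[_ ?]; lra.
have Dp: 0<D r by apply: lt_le_trans Dlo; rewrite divr_gt0.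
have tE: tau r = a*dl/(b+D r).
 have s1: a*cos r+a != 0 by rewrite gt_eqF// addr_gt0// mulr_gt0.
 have s2: b+D r != 0 by rewrite gt_eqF// addr_gt0. rewrite /tau; apply/eqP; rewrite eqr_div//; apply/eqP.
 transitivity (b^+2-D r^+2); first by ring. by rewrite DE /dl; ring.
have t0: 0<=tau r by rewrite tE; apply: divr_ge0; [apply: mulr_ge0=> //; exact: ltW|apply: addr_ge0; exact: ltW].
have tk: tau r<=k*dl.
 rewrite tE /k mulrAC; apply: ler_wpM2r=> //; rewrite ler_pM2l//; first by rewrite lef_pV2 ?posrE ?addr_gt0// lerDl ltW.
have bD: b-D r<=4*r^+2/b.
 rewrite ler_pdivlMr//; apply: le_trans D4. rewrite (_: b^+2-D r^+2 = (b-D r)*(b+D r)); last by ring.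
 by rewrite ler_wpM2l ?subr_ge0// lerDl ltW.
have err1: `|2*tau r-k*dl| <= et*(k*dl).
 have -> : 2*tau r-k*dl = k*dl*((b-D r)/(b+D r)).
  by rewrite tE /k; field; rewrite !gt_eqF ?addr_gt0. have kd: 0<=k*dl by apply: mulr_ge0=> //; exact: ltW.
 rewrite normrM (ger0_norm kd) mulrC; apply: ler_wpM2r=> //.
 rewrite ger0_norm; last by apply: divr_ge0; [rewrite subr_ge0|apply: addr_ge0; exact: ltW].
 apply: (@le_trans _ _ ((4*r^+2/b)/b)).
  apply: ler_pM=> //; first by rewrite subr_ge0.
   pos. by rewrite lef_pV2 ?posrE ?addr_gt0// lerDl ltW. have b2: 0<b^+2 by rewrite exprn_gt0.
 rewrite -mulrA -invfM -expr2 ler_pdivrMr//. have: r^+2<=r by rewrite expr2 ler_piMl// ltW. by lra.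
have tr: tau r<=k*r^+2 by apply: (le_trans tk); rewrite ler_pM2l.
have td: tau r<d4.
 apply: (le_lt_trans tr); rewrite mulrC -ltr_pdivlMr//; apply: le_lt_trans rd4.
 by rewrite expr2 ler_piMl// ltW.
have err2: `|atan (tau r)-tau r| <= et*tau r.
 by have:=h4 (tau r); rewrite ger0_norm//; apply.
have kr0: 0<=k*r^+2 by rewrite mulr_ge0// ltW.
have ekr: et*(k*dl)<=et*(k*r^+2) by rewrite ler_pM2l// ler_pM2l.
have etr2: et*tau r<=et*(k*r^+2) by rewrite ler_pM2l.
have err3: `|k*dl-k*(r^+2/2)| <= (3/2)*(et*(k*r^+2)).
 rewrite -mulrBr normrM (gtr0_norm k0). apply: (@le_trans _ _ (k*(3/2*et*r^+2))); first by rewrite ler_pM2l.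
 by eqle; field.
have fin: 5*(et*(k*r^+2))<=e*r^+2.
 by rewrite (_: 5*_ = 5*k*et*r^+2) ?ler_wpM2r//; ring.
have fin0: 0<=et*(k*r^+2) by rewrite mulr_ge0// ltW.
rewrite (_: 2^-1*(a/b)*r^+2 = k*(r^+2/2)); last by rewrite /k; ring.
move: err1 err2 err3 fin ekr etr2 fin0.
set u1:=atan (tau r); set u2:=tau r; set u3:=k*dl; set u4:=k*(r^+2/2).
set u5:=et*u3; set u6:=et*u2; set u7:=et*(k*r^+2); set u8:=e*r^+2.
clear; move: u1 u2 u3 u4 u5 u6 u7 u8=> u1 u2 u3 u4 u5 u6 u7 u8; clear.
rewrite !ler_norml=> /andP[? ?] /andP[? ?] /andP[? ?] ? ? ? ?.
by bsplit; lra.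
Qed.


Variable n: nat.
Local Notation V := 'rV[R]_n.+2.
Variables (o: V) (To: 'M[R]_(n.+2, n.+1)) (a b: R).
Hypotheses (so: splits o To) (a0: 0<a) (b0: 0<b) (ab: a^+2+b^+2 = 1).

Definition cap: set V := [set u | dot u u = 1 /\ a<=dot u o].

Let oo: dot o o = 1. Proof. by have []:=so. Qed.

Lemma closed_cap: closed cap.
have cc (c: R): continuous (fun y: V=> c) by exact: cst_continuous.
have ci: continuous (fun y: V=> y) by move=> ?.
have cdd: continuous (fun y: V=> dot y y) by exact: cont_dot.
have cdo: continuous (fun y: V=> dot y o) by apply: cont_dot=> //; exact: cont_cst_rV.
rewrite (_: cap = [set u | dot u u<=1] `&` [set u | 1<=dot u u] `&` [set u | a<=dot u o]).
 by apply: closedI; [apply: closedI|]; exact: closed_le_fun.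
seteq=> [u [/= uu ua]|u [[/= h1 h2] h3]]; first by rewrite /= uu.
by split=> //; apply/eqP; rewrite eq_le h1 h2.
Qed.

Lemma sinterior_cap u: dot u u = 1 -> a<dot u o -> sinterior (d:=n.+1) cap u.
move=> uu au; split=> //.
have cdo: continuous (fun y: V=> dot y o).
 by apply: cont_dot=> //; [move=> ?|exact: cont_cst_rV].
have: nbhs u ((fun y: V=> dot y o) @^-1` [set r | a<r]).
 by apply: (cdo u); apply: open_nbhs_nbhs; split; [exact: open_gt|exact: au].
by apply: filterS=> v /= av sv; split=> //; exact: ltW.
Qed.

Lemma sboundary_cap: sboundary (d:=n.+1) cap = [set u | dot u u = 1 /\ dot u o = a].
have [a1 _ bE]:=sumsq_bounds a0 b0 ab.
rewrite /sboundary -(closure_id _).1; last exact: closed_cap.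
seteq=> [u [[uu ua] nint]|u [uu ua]].
 split=> //; apply/eqP; rewrite eq_le ua andbT leNgt; apply/negP=> au; apply: nint. exact: sinterior_cap.
split; first by rewrite /cap/= uu ua.
move=> /(near_center uu)[t /andP[t0 t1]] /(_ o oo)[_].
rewrite /nrm dotZl dotDl dotNl dotZl ua oo mulr1=> h.
move: h; set z: V:=u-t*:o=> h.
have zz: enorm z^+2 = 1-2*t*a+t^+2.
 rewrite enormE /z dotDl !dotDr !dotNl !dotNr !dotZl !dotZr uu oo (dotC o u) ua; ring.
have z0: 0<enorm z.
 have a21: a^+2<1 by rewrite expr_lt1// ltW. have: 0<enorm z^+2 by rewrite zz; have:=sqr_ge0 (t-a); lra.
 by rewrite enorm_gt0; apply: contraTneq=> ->; rewrite enorm0 expr0n/= ltxx.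
move: h; rewrite mulrC ler_pdivlMr// => h.
have at0: 0<a-t by apply: lt_le_trans h; rewrite mulr_gt0.
have: (a*enorm z)^+2<=(a-t)^+2 by rewrite ler_pXn2r ?nnegrE ?mulr_ge0 ?enorm_ge0 ?(ltW a0) ?(ltW at0).
rewrite exprMn zz=> k.
have k2: 0<t*b^+2*(2*a-t) by rewrite !mulr_gt0 ?exprn_gt0//; lra.
by move: k2; rewrite bE=> k2; lra.
Qed.

Definition cap_normal (u: V): V:=b^-1*:(o-a*:u).

Lemma cap_normal_spec u: dot u u = 1 -> dot u o = a ->
 [/\ dot (cap_normal u) (cap_normal u) = 1, dot u (cap_normal u) = 0,
   dot (cap_normal u) o = b & o = a*:u+b*:cap_normal u].
move=> uu ua; have bn: b != 0 by rewrite gt_eqF.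
have [_ _ bE]:=sumsq_bounds a0 b0 ab.
rewrite /cap_normal; split.
- rewrite dotZl dotZr dotDl !dotDr !dotNl !dotNr !dotZl !dotZr uu oo (dotC o u) ua.
 rewrite (_: _+_ = b^+2); last by rewrite bE; ring. by rewrite mulrA -expr2 -exprMn mulVf// expr1n.
- by rewrite dotZr dotDr dotNr dotZr uu ua mulr1 subrr mulr0.
- rewrite dotZl dotDl dotNl dotZl oo ua -expr2 -bE expr2 mulKf//.
- by rewrite scalerA divff// scale1r addrC subrK.
Qed.

Lemma cap_supported u v: dot u u = 1 -> dot u o = a -> cap v -> 0<=dot v (cap_normal u).
move=> uu ua [vv va]; rewrite /cap_normal dotZr mulr_ge0 ?invr_ge0 ?(ltW b0)//.
rewrite dotDr dotNr dotZr subr_ge0; apply: le_trans va.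
have:=dot_le_enorm v u; rewrite (enorm_unit vv) (enorm_unit uu) mulr1=> h.
by rewrite ler_piMr// ltW.
Qed.

Lemma cap_principal u: dot u u = 1 -> dot u o = a -> @principal_curvatures R n.+1 cap u (fun=> a/b).
move=> uu ua; have [nn un no oE]:=cap_normal_spec uu ua.
have sup v:=@cap_supported u v uu ua; move: (cap_normal u) nn un no oE sup=> nu nn un no oE sup.
have [E tE]:=tframe_exists uu nn un; have [_ _ _ uE [nE EE]]:=tE.
have [f [[r r0 hr] hf]]:=cap_height a0 b0 ab.
have dE (w: V) (i: 'I_n): dot w (\row_j E j i) = (w *m E) 0 i.
 by rewrite /dot mxE; apply: eq_bigr=> j _; rewrite mxE.
have fN w: dot u w = 0 -> dot (- nu) w = 0 -> dot w u = 0 /\ dot w nu = 0.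
 by rewrite dotNl=> h /eqP; rewrite oppr_eq0=> /eqP k; rewrite dotC h dotC k.
exists (- nu), (fun i=> \row_j E j i), (fun w=> f (enorm w)); split.
- split; [by rewrite dotNl dotNr opprK nn|by rewrite dotNr un oppr0|].
 by move=> v Cv; rewrite dotNr oppr_le0; exact: sup.
- move=> i; split; [by rewrite dE uE mxE|by rewrite dE mulNmx nE oppr0 mxE|].
 move=> j; rewrite dE; have:=congr1 (fun M: 'M[R]_n=> M i j) EE; rewrite !mxE=> <-.
 by apply: eq_bigr=> k _; rewrite !mxE.
- exists r=> // w t /fN h /h[wu wn] wr tr; rewrite sboundary_cap.

 have [h1 h2]:=hr (enorm w) t (enorm_ge0 w) wr tr. set y:=normal_coord _ _ _ _.
 have yE: y = cos t*:sexp u w+sin t*:nu by rewrite /y /normal_coord scalerN opprK.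
 set s:=sin (enorm w)/enorm w.
 have su: dot (sexp u w) u = cos (enorm w) by rewrite /sexp dotDl !dotZl uu wu mulr1 mulr0 addr0.
 have sn: dot (sexp u w) nu = 0 by rewrite /sexp dotDl !dotZl un wn !mulr0 addr0.
 have ss: dot (sexp u w) (sexp u w) = 1.
  rewrite {1}/sexp dotDl !dotZl (dotC u) su (dotC w) /sexp dotDl !dotZl (dotC u) wu mulr0 add0r.
  rewrite -enormE -/s; have [w0|w0]:=eqVneq (enorm w) 0.
   by rewrite /s w0 sin0 cos0 expr0n/= mul0r !mul0r addr0 mulr1.
  rewrite (_: s*(s*enorm w^+2) = sin (enorm w)^+2); last by rewrite /s; field. by rewrite -expr2 cos2Dsin2.
 have yy: dot y y = 1.
  rewrite yE dotDl !dotDr !dotZl !dotZr ss nn (dotC nu) sn !mulr0 addr0 add0r !mulr1.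
  by rewrite -!expr2 cos2Dsin2. have yo: dot y o = cos t*cos (enorm w)*a+sin t*b.
  rewrite yE dotDl !dotZl no; congr (_+_); rewrite oE dotDr !dotZr su sn mulr0 addr0; ring.
 split=> [[_]|tf]; first by rewrite yo. by split=> //; rewrite yo; exact: h2.
- move=> e e0; have [delta d0 hd]:=hf e e0; exists delta=> // w /fN h /h[wu wn] wd.
 have:=hd _ (enorm_ge0 w) wd; congr (`|_-_| <= _).
 rewrite -mulr_sumr [RHS]mulrA; suff -> : enorm w^+2 = \sum_i dot w (\row_j E j i)^+2 by [].
 rewrite enormE (tframe_dot w w tE) wu wn !mulr0 !add0r /dot.
 by apply: eq_bigr=> i _; rewrite -/(dot w _) dE expr2.
Qed.

(** [gauss_kronecker] selects some admissible system of curvatures, so the bound is needed for every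
    system. It is read off from the osculation at explicit boundary points of the cap. *)
Lemma cap_curvature u nu (E: 'M[R]_(n.+2, n)) kap i :
 dot u u = 1 -> dot u o = a -> nu = cap_normal u -> osculates cap u nu E kap -> a/b<=kap i.
move=> uu ua nuE [tE _ _ hb].
have [nn un no oE]:=cap_normal_spec uu ua; rewrite -nuE in nn un no oE.
have [_ _ _ uE [nE EE]]:=tE.
set k:=a/b; have k0: 0<k by rewrite divr_gt0.
apply/ler_addgt0Pr=> e e0.
have [delta d0 hd]:=hb (e/4) (divr_gt0 e0 (ltr0n _ 4)).
have [/ltW a1 /ltW b1 bE]:=sumsq_bounds a0 b0 ab.
pose q: R:=Num.min (1/2) (Num.min (delta/8) (e/(4*k))).
have q0: 0<q by rewrite !lt_min !divr_gt0// mulr_gt0.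
have [q1 q2 q3]: [/\ q<=1/2, q<=delta/8 & q<=e/(4*k)].
 by rewrite /q !ge_min !lexx !orbT.
pose D:=(1+q^+2)^-1; have p0: 0<1+q^+2 by rewrite addr_gt0 ?exprn_gt0.


(* Rational parametrisation, with q the tangent of the half-angle, of the circle in the boundary of
   the cap that leaves u in the i-th direction. *)
pose y: V:=(1-2*b^+2*q^+2*D)*:u+(2*a*b*q^+2*D)*:nu
  + (2*b*q*D)*:(delta_mx 0 i *m E^T).
have ee: dot (delta_mx 0 i: 'rV[R]_n) (delta_mx 0 i) = 1.
 rewrite /dot (bigD1 i)//= big1=> [|j ji]; first by rewrite mxE !eqxx mulr1 addr0.
 by rewrite mxE (negPf ji) andbF mul0r.
have Eu: dot (delta_mx 0 i *m E^T) u = 0 by rewrite dot_mulmx trmxK uE dot0r.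
have En: dot (delta_mx 0 i *m E^T) nu = 0 by rewrite dot_mulmx trmxK nE dot0r.
have yu: dot y u = 1-2*b^+2*q^+2*D.
 by rewrite /y !dotDl !dotZl uu (dotC nu) un Eu; ring.
have yn: dot y nu = 2*a*b*q^+2*D.
 by rewrite /y !dotDl !dotZl nn un En; ring.
have yE: y *m E = (2*b*q*D)*:delta_mx 0 i.
 by rewrite /y !mulmxDl -!scalemxAl uE nE !scaler0 !add0r -mulmxA EE mulmx1.
have yy: dot y y = 1.
 rewrite (tframe_dot y y tE) yu yn yE dotZl dotZr ee mulr1.

 rewrite (_: _+_ = 1+4*b^+2*q^+2*D*(D*(1+q^+2*(a^+2+b^+2))-1)); last by ring.
 by rewrite ab mulr1 /D mulVf ?gt_eqF// subrr mulr0 addr0.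
have yo: dot y o = a by rewrite oE dotDr !dotZr yu yn; ring.
have yb: sboundary (d:=n.+1) cap y by rewrite sboundary_cap.
move: y yu yn yE yy yo yb=> y yu yn yE yy yo yb.
have D1: D<=1 by rewrite invf_le1// lerDl sqr_ge0.
have b20: 0<=b^+2 by exact: sqr_ge0.
have b21: b^+2<=1 by rewrite expr_le1// ltW.
have q20: 0<q^+2 by rewrite exprn_gt0.
have q2q: q^+2<=q/2 by rewrite expr2 ler_pM2l//; lra.
have bq: b^+2*q^+2<=q^+2 by rewrite ler_piMl// ltW.
have bqD: b^+2*q^+2*D<=q^+2 by rewrite (le_trans _ bq)// ler_piMr// mulr_ge0// ltW.
have ydist: enorm (y-u)<delta.
 have: enorm (y-u)^+2<=(4*q)^+2.
  rewrite enormE dotDl !dotDr !dotNl !dotNr yy uu (dotC u y) yu. by have:=bqD; rewrite exprMn; lra.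
 rewrite ler_pXn2r ?nnegrE ?enorm_ge0 ?mulr_ge0 ?(ltW q0)// => h. by apply: (le_lt_trans h); lra.
have [yup ht]:=hd y yb ydist; move: ht; cbv zeta.
rewrite yE scalerA quadf_delta enormZ.
have -> : enorm (delta_mx 0 i: 'rV[R]_n) = 1 by rewrite /enorm ee sqrtr1.
rewrite mulr1 yu yn in yup *; rewrite real_normK ?num_real//; set P:=(X in X^-1) in yup *.
rewrite -/P in yup; move=> h.
pose T:=P^-1*(2*b*q*D); have T0: 0<T by rewrite !mulr_gt0 ?invr_gt0.
have hE: P^-1*(2*a*b*q^+2*D) = T^+2*(k/2*(P*(1+q^+2))).
 by rewrite /T /k /D; field; rewrite !gt_eqF.
move: h; rewrite -/T hE (_: 2^-1*(T^+2*kap i) = T^+2*(kap i/2)) -?mulrBr; last by ring.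
rewrite normrM ger0_norm ?sqr_ge0// mulrC ler_pM2r ?exprn_gt0// ler_norml=> /andP[_ h2].
have PE: P*(1+q^+2) = 1+q^+2-2*b^+2*q^+2.
 by rewrite /P /D; field; rewrite gt_eqF.
have: k/2*(1-q^+2)<=k/2*(P*(1+q^+2)).
 by rewrite ler_pM2l ?divr_gt0// PE; lra.
have kq: k*q^+2<=e/4.
 apply: (@le_trans _ _ (k*(e/(4*k)))); first by rewrite ler_pM2l//; lra. by eqle; field; rewrite gt_eqF.
by move: h2 kq; set Y:=k/2*(P*_); set Z:=k*q^+2; rewrite mulrBr mulr1 (_: k/2*q^+2 = Z/2); [lra|rewrite /Z; field].
Qed.

(** [cap_principal] shows that curvatures exist, so the default value 0 is not taken; each factor of
    the selected product is then bounded below by [cap_curvature]. *)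
Lemma cap_gauss_kronecker u: dot u u = 1 -> dot u o = a -> (a/b)^+n<=gauss_kronecker (d:=n.+1) cap u.
move=> uu ua; rewrite /gauss_kronecker.
have [kap pk <-]:=@xgetI _ 0 [set \prod_i kappa i | kappa in @principal_curvatures R n.+1 cap u] _
 (ex_intro2 _ _ _ (cap_principal uu ua) erefl).
have Cu: sboundary (d:=n.+1) cap u by rewrite sboundary_cap.
have [nu [E osc]]: exists nu E, osculates cap u nu E kap.
 by apply: osculates_exists pk=> //; [move=> v []|exact: closed_cap].
have [nn un no oE]:=cap_normal_spec uu ua.
have np: normal_pair cap u (cap_normal u).
 by split=> //; [rewrite /cap/= uu ua|move=> v; exact: cap_supported].
have nuo: 0<dot nu o.
 have [[_ nunu unu _ _] sup _ _]:=osc. have oC: sinterior (d:=n.+1) cap o.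
  by apply: sinterior_cap=> //; rewrite oo; have []:=sumsq_bounds a0 b0 ab.
 have [t /andP[t0 t1] /(_ nu nunu) /sup]:=near_center oo oC. rewrite /nrm dotZl; set z: V:=o-t*:nu.
 have z0: 0<enorm z.
  rewrite enorm_gt0; apply: contraTneq t1=> /eqP; rewrite subr_eq0=> /eqP oz.
  have: enorm o = 1 by rewrite enorm_unit.
  by rewrite oz enormZ gtr0_norm// (enorm_unit nunu) mulr1=> ->; rewrite ltxx.
 rewrite pmulr_rge0 ?invr_gt0// dotDl dotNl dotZl nunu mulr1 subr_ge0 dotC. exact: lt_le_trans.
have nuE:=osculates_normal_unique osc nuo _ np.
have -> : (a/b)^+n = \prod_(i<n) (a/b) by rewrite prodr_const card_ord.
apply: ler_prod=> i _; rewrite divr_ge0 ?(ltW a0) ?(ltW b0)//=.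
by apply: (cap_curvature i uu ua _ osc); rewrite nuE// no.
Qed.

Lemma geodesic_ball_cap beta: 0<=beta<=pi ->
 geodesic_ball (d:=n.+1) o beta = [set u | dot u u = 1 /\ cos beta<=dot u o].
move=> bpi; apply/seteqP.
have key u: dot u u = 1 -> (sdist o u<=beta) = (cos beta<=dot u o).
 move=> uu; have h: -1<=dot o u<=1.
  rewrite -ler_norml; apply: (le_trans (dot_le _ _)). by rewrite (enorm_unit oo) (enorm_unit uu) mulr1.
 rewrite /sdist leNgt -ltr_cos ?in_itv//=; last by rewrite acos_ge0// acos_lepi.
 by rewrite acosK ?in_itv// -leNgt dotC.
by split=> u [uu h]; split=> //; move: h; rewrite key.
Qed.

End Cap.

Section CapArea.
Context {R: realType} (m: nat).
Local Notation n := m.+1.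
Local Notation V := 'rV[R]_n.+2.
Variables (o: V) (To: 'M[R]_(n.+2, n.+1)) (a b: R).
Hypotheses (so: splits o To) (a0: 0<a) (b0: 0<b) (ab: a^+2+b^+2 = 1).

Let oo: dot o o = 1. Proof. by have []:=so. Qed.

(** The boundary contains a copy, scaled by b, of the unit sphere of the hyperplane orthogonal to o.
    The measure of that sphere comes from [svol_cone], and the curvature on it is at least
    (a/b)^n. *)
Lemma floating_area_cap : (((((a/b)^+n) `^ n.+2%:R^-1*b^+n)*(hratio n*n.+1%:R))%:E *
   leb n.+1 [set x | (enorm x<=1)%R]<=floating_area (d:=n.+1) (cap o a))%E.
pose S:=sboundary (d:=n.+1) (cap o a).
pose sph := [set z: 'rV[R]_n.+1 | dot z z = 1].
have cid k: continuous (fun y: 'rV[R]_k=> dot y y) by apply: cont_dot=> ?.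
have csph k: closed [set z: 'rV[R]_k | dot z z = 1].
 have -> : [set z: 'rV[R]_k | dot z z = 1] = [set u | dot u u<=1] `&` [set u | 1<=dot u u].
  by seteq=> [u /= ->|u [/= h1 h2]] //; apply/eqP; rewrite eq_le h1 h2.
 have c1: continuous (fun _: 'rV[R]_k=> 1: R) by exact: cst_continuous.
 by apply: closedI; [exact: (closed_le_fun (cid k) c1)|exact: (closed_le_fun c1 (cid k))].
have mS: measurable (S: set V).
 apply: measV_closed; rewrite /S (sboundary_cap so a0 b0 ab).
 have -> : [set u: V | dot u u = 1 /\ dot u o = a] =
   [set u: V | dot u u = 1] `&` [set u | dot u o<=a] `&` [set u | a<=dot u o].
  by seteq=> [u [/= -> ->]|u [[/= -> h1] h2]] //; split=> //; apply/eqP; rewrite eq_le h1 h2.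
 have cdo: continuous (fun y: V=> dot y o).
  by apply: cont_dot=> //; [move=> ?|exact: cont_cst_rV].
 by apply: closedI; [apply: closedI=> //|]; apply: closed_le_fun=> //; exact: cst_continuous.
have mS': measurable (S: set (caratheodory_type (hausdorff_outer R n.+2 n))).
 exact: caratheodory_rV.
set cc:=_ `^ _; have cc0: 0<=cc by exact: powR_ge0.
have st1: (cc%:E*hausdorff n S<=floating_area (d:=n.+1) (cap o a))%E.
 rewrite -[leLHS](integral_cst (hausdorff_measure R n.+2 n) mS').
 rewrite /floating_area [leRHS]integral_mkcond.
 apply: (@ge0_le_int_any _ _ _ (hausdorff_measure R n.+2 n) S (cst cc%:E))=> [x _|x|x Sx].
 - by [].
 - by rewrite patchE; case: ifPn=> // _; rewrite lee_fin powR_ge0.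
 have Sx': x \in sboundary (d:=n.+1) (cap o a) by rewrite inE.
 rewrite patchE Sx' lee_fin; apply: ge0_ler_powR; rewrite ?nnegrE ?invr_ge0//.
 - pos.
 - rewrite (le_trans _ (cap_gauss_kronecker so a0 b0 ab _ _))//; first pos.
   by move: Sx; rewrite /S (sboundary_cap so a0 b0 ab)=> -[].
  by move: Sx; rewrite /S (sboundary_cap so a0 b0 ab)=> -[].
 - by apply: (cap_gauss_kronecker so a0 b0 ab); move: Sx; rewrite /S (sboundary_cap so a0 b0 ab)=> -[].
apply: (le_trans _ st1).
pose psi (z: 'rV[R]_n.+1): V:=a*:o+b*:(z *m To^T).
have psiS: psi @` sph `<=` S.
 move=> _ [z zz <-]; rewrite /S (sboundary_cap so a0 b0 ab); split.
  rewrite /psi dotDl !dotDr !dotZl !dotZr oo (dotC o) splits_perp// !mulr0 addr0 add0r.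
  by rewrite -enormE (enorm_splits_tr _ so) enormE (zz: dot z z = 1) !mulr1 -!expr2.
 by rewrite /psi dotDl !dotZl oo splits_perp// mulr1 mulr0 addr0.
have st2: ((b^+n)%:E*hausdorff n sph<=hausdorff n S)%E.
 have bn0: 0<b^+n by rewrite exprn_gt0. have bi: 0<b^-1 by rewrite invr_gt0.
 have:=@haus_expand R n n.+1 n.+2 psi sph b^-1 bi; rewrite exprVn=> h.
 rewrite muleC -lee_pdivlMr// muleC; apply: (le_trans (h _))=> [x y _ _|].
  have -> : psi x-psi y = b*:((x-y) *m To^T).
   by rewrite /psi mulmxBl scalerBr opprD addrACA subrr add0r.
  by rewrite enormZ (enorm_splits_tr _ so) gtr0_norm// mulKf// gt_eqF.
 by apply: lee_wpmul2l; [rewrite lee_fin ltW// invr_gt0|exact: le_hausdorff].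
have msph: measurable sph by apply: measV_closed; exact: csph.
rewrite -(mulrA cc) (EFinM cc) -muleA; apply: lee_wpmul2l; first by [].
apply: (le_trans _ st2); rewrite EFinM -muleA; apply: lee_wpmul2l; first pos.
rewrite (svol_cone msph); last by [].
apply: lee_wpmul2l; first by rewrite lee_fin mulr_ge0// ltW// hratio_gt0.
have mc1: measurable (cone1 sph) by exact: meas_cone1.
have mB: measurable [set x: 'rV[R]_n.+1 | enorm x<=1] by exact: meas_eball.
have mq:=@meas_cube R n.+1 0 0.
apply: (@le_trans _ _ (leb n.+1 (cone1 sph `|` cube 0 0))).
 apply: le_measure; rewrite ?inE//; first exact: measurableU.
 move=> x /= x1; have [->|x0]:=eqVneq x 0; first by right=> i; rewrite !mxE subrr normr0.
 by left; split=> //; rewrite /sph/= nrm_unit.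
have lq: leb m.+2 (cube (0: 'rV[R]_m.+2) 0) = 0%E by rewrite leb_cube// mulr0 expr0n.
apply: (@le_trans _ _ (leb m.+2 (cone1 sph)+0)%E); last by rewrite adde0.
by rewrite -lq; exact: (@measureU2 _ _ _ (leb m.+2) _ _ mc1 mq).
Qed.

End CapArea.

(** * The final comparison *)

Section Constants.
Context {R: realType}.
Implicit Types a b r lam: R.

Lemma fine_lty (x: \bar R): (0<=x)%E -> (x < +oo)%E -> x = (fine x)%:E.
Proof. by case: x=> [x| |]. Qed.

Lemma EFin_le (A E: \bar R) (x w: R): A = x%:E -> E = w%:E -> (A<=E)%E -> x<=w.
Proof. by move=> -> ->; rewrite lee_fin. Qed.

Lemma EFin_mul_le (A P E: \bar R) (x p w: R): A = x%:E -> P = p%:E -> E = w%:E ->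
 (A*P<=E*E)%E -> x * p<=w*w.
Proof. by move=> -> -> ->; rewrite -!EFinM lee_fin. Qed.

(** C may depend on all the data, so the gap v < w is enough: C is chosen with (1 - C D^2) w = v.
    For D = 0 the factor is 1 and any C serves. *)
Lemma choose_constant (k M: \bar R) (v w D: R): (0<=k)%E -> (k<=v%:E)%E -> (w%:E<=M)%E ->
 0<w -> v<=w -> (D != 0 -> v<w) -> exists2 C: R, 0<C & (k<=(1-C*D^+2)%:E*M)%E.
move=> k0 kv wM w0 vw Dvw; have [D0|D0]:=eqVneq D 0.
 exists 1=> //; rewrite D0 expr0n/= mulr0 subr0 mul1e.
 by apply: (le_trans kv); apply: le_trans wM; rewrite lee_fin.
have D2: 0<D^+2 by rewrite lt_neqAle sqr_ge0 andbT eq_sym expf_neq0.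
have v0: 0<=v by rewrite -lee_fin (le_trans k0).
have wv: 0<w-v by rewrite subr_gt0 Dvw.
exists ((w-v)/(w*D^+2)); first pos.
have -> : 1-(w-v)/(w*D^+2)*D^+2 = v/w by field; rewrite D0 gt_eqF.
apply: (le_trans kv); apply: (@le_trans _ _ ((v/w)%:E*w%:E)%E).
 by rewrite -EFinM divfK// gt_eqF.
by apply: lee_wpmul2l=> //; rewrite lee_fin divr_ge0// ltW.
Qed.

Lemma frad_exp n r: frad n.+1 r^+n.+1 = r^+(n.+1*n.+1)*(Num.sqrt (1+r^+2))^-1^+(n*n.+2).
rewrite /frad exprMn exprM -expRM_natl invsqrt_exp ?onesqr_gt0//; congr (_*expR _).
rewrite mulrA; congr (_*_); have e1: n.+1%:R = n%:R+1 :> R by rewrite -natr1.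
have e2: n.+2%:R = n%:R+2 :> R by rewrite -addn2 natrD.
by rewrite /aexp natrM e1 e2; field; rewrite -e1 pnatr_eq0.
Qed.

(** The value of lam for which the two terms balance on the ball of radius r, from lam^(d+1) =
    r^(-d)/F(r). Their common value is the integrand of the floating area of the cap times b^n. *)
Lemma optimal_multiplier n a b: 0<a -> 0<b -> a^+2+b^+2 = 1 -> let r:=b/a in
 exists2 lam, 0<lam & lam^-n.+1*r^-n.+1 = lam*frad n.+1 r /\
  lam*frad n.+1 r = ((a/b)^+n) `^ n.+2%:R^-1*b^+n.
move=> a0 b0 ab r; have r0: 0<r by rewrite divr_gt0.
have F0: 0<frad n.+1 r by rewrite /frad mulr_gt0 ?exprn_gt0// expR_gt0.
set F:=frad n.+1 r in F0 *.
have q0: 0<r^-n.+1/F by rewrite divr_gt0// invr_gt0 exprn_gt0.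
pose lam:=(r^-n.+1/F) `^ n.+2%:R^-1.
have lam0: 0<lam by rewrite powR_gt0.
have root (x: R): 0<=x -> (x `^ n.+2%:R^-1)^+n.+2 = x.
 by move=> x0; rewrite -powR_mulrn ?powR_ge0// -powRrM mulVf ?powRr1// pnatr_eq0.
have lamE: lam^+n.+2 = r^-n.+1/F by rewrite root// ltW.
exists lam=> //; split.
 have -> : r^-n.+1 = lam^+n.+2*F by rewrite lamE divfK// gt_eqF.
 by rewrite [lam^+n.+2]exprSr -mulrA mulKf// expf_neq0// gt_eqF.
have ba0: 0<=(a/b)^+n by rewrite exprn_ge0// divr_ge0 ?ltW.
have l1: 0<=lam*F by rewrite mulr_ge0 ?(ltW lam0) ?(ltW F0).
have l2: 0<=((a/b)^+n) `^ n.+2%:R^-1*b^+n by rewrite mulr_ge0 ?powR_ge0 ?exprn_ge0 ?(ltW b0).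
apply/eqP; rewrite -(eqrXn2 (ltn0Sn n.+1) l1 l2); apply/eqP.
have Fn: F != 0 by rewrite gt_eqF.
rewrite [LHS]exprMn [RHS]exprMn lamE root// [F^+n.+2]exprS mulrA divfK// frad_exp.
have -> : (Num.sqrt (1+r^+2))^-1 = a.
 have -> : 1+r^+2 = a^-2.
  by rewrite /r expr_div_n -[X in X+_](@divff _ (a^+2)) ?expf_neq0 ?gt_eqF// -mulrDl ab mul1r.
 by rewrite -exprVn sqrtr_sqr ger0_norm ?invrK// invr_ge0 ltW.
have an: a != 0 by rewrite gt_eqF.
have bn: b != 0 by rewrite gt_eqF.
rewrite -exprM (_: n.+1*n.+1 = n.+1+n.+1*n)%N; last by rewrite mulnS.
have rn: r^+n.+1 != 0 by rewrite expf_neq0// mulf_neq0// invr_neq0.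
have -> : r^+(n.+1+n.+1*n) = r^+n.+1*r^+(n.+1*n) by rewrite exprD.
rewrite -!mulrA mulKf//.
rewrite (_: n*n.+2 = n.+1*n+n)%N; last by rewrite mulnC mulSn addnC.
rewrite /r !exprMn !exprD !exprVn.
by field; rewrite !expf_neq0.
Qed.

End Constants.

Section Assembly.
Context {R: realType} (n: nat).
Local Notation d := n.+1.
Local Notation V := 'rV[R]_n.+2.
Implicit Types (r s beta: R).

Let cT (s: R) (x: 'rV[R]_d): 0<s -> [set: 'rV[R]_d] x -> [set: 'rV[R]_d] (s*:x).
Proof. by []. Qed.

Local Notation B r := [set x : 'rV[R]_d | (enorm x <= r)%R].
Local Notation omega := (coneR [set: 'rV[R]_d]).
Local Notation W := (coneW [set: 'rV[R]_d]).

Lemma leb_eball r: 0<r -> leb d (B r) = (r^+d * omega)%:E.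
Proof. by move=> r0; rewrite -(leb_coneball measurableT cT r0) setTI. Qed.

Lemma omega_gt0: 0<omega.
have:=@leb_eball_gt0 R n 1 ltr01; rewrite leb_eball ?ltr01// expr1n mul1r.
by [].
Qed.

Lemma int_eball r: (\int[leb d]_(x in B r) (wsph x)%:E = (W r)%:E)%E.
Proof. by rewrite -(coneWE measurableT r) setTI. Qed.

Lemma wsph_le1 (x: 'rV[R]_d): wsph x<=1.
rewrite /wsph exprn_ile1// ?invr_ge0 ?sqrtr_ge0// invf_le1 ?sqrtr_gt0 ?ltr_pwDl// -?enormE ?sqr_ge0//.
by rewrite -{1}sqrtr1 ler_wsqrtr// lerDl sqr_ge0.
Qed.

Lemma int_null (A: set 'rV[R]_d): measurable A -> leb d A = 0%E -> (\int[leb d]_(x in A) (wsph x)%:E = 0)%E.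
move=> mA A0; have [|_]:=@int_wsph_bounds R n A 0 0 1 mA A0 (lexx _) ler01.
 by move=> x _; rewrite wsph_ge0 wsph_le1.
rewrite mulr0=> h; apply/eqP; rewrite eq_le h integral_ge0// => x _.
by rewrite lee_fin wsph_ge0.
Qed.

Lemma int_null_symdiff (A C: set 'rV[R]_d): measurable A -> measurable C -> (leb d A < +oo)%E ->
 leb d A = leb d C -> leb d (A `\` C) = 0%E ->
 (\int[leb d]_(x in (A `\` C) `|` (C `\` A)) (wsph x)%:E = 0)%E.
move=> mA mC fA AC nA.
have mAC: measurable (A `\` C) by exact: measurableD.
have mCA: measurable (C `\` A) by exact: measurableD.
apply: int_null; first exact: measurableU.
have fI: leb d (A `&` C) \is a fin_num.
 rewrite ge0_fin_numE//; apply: le_lt_trans fA.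
 by apply: le_measure; [rewrite inE; exact: measurableI|rewrite inE|exact: subIsetl].
have h1: leb d A = (leb d (A `\` C)+leb d (A `&` C))%E by exact: measureDI.
have h2: leb d C = (leb d (C `\` A)+leb d (C `&` A))%E by exact: measureDI.
have nC: leb d (C `\` A) = 0%E.
 move: h1; rewrite nA add0e AC h2 (setIC C).
 move: (leb d (C `\` A)) (leb d (A `&` C)) fI=> u [w| |]// _; case: u=> [u| |]//= [] /eqP.
 by rewrite -subr_eq0 addrK=> /eqP ->.
apply/eqP; rewrite eq_le measure_ge0 andbT.
apply: (@le_trans _ _ (leb d (A `\` C)+leb d (C `\` A))%E); first exact: (@measureU2 _ _ _ (leb d)).
by rewrite nA nC adde0.
Qed.

Lemma coneW_le r: 0<r -> W r<=r^+d * omega.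
move=> r0; have [|_]:=@int_wsph_bounds R n (B r) _ 0 1 (meas_eball r) (leb_eball r0) (lexx _) ler01.
 by move=> x _; rewrite wsph_ge0 wsph_le1.
by rewrite int_eball mul1r lee_fin.
Qed.

Lemma coneW_lt r s: 0<r -> r<s -> W r<W s.
move=> r0 rs; have /andP[h _]:=coneW_step measurableT cT r0 (ltW rs).
rewrite -subr_gt0; apply: lt_le_trans h; apply: mulr_gt0; first exact: wrad_gt0.
apply: mulr_gt0; last exact: omega_gt0.
by rewrite subr_gt0 ltrXn2r// ?nnegrE ltW// (lt_trans r0).
Qed.

Lemma coneW_ivt r s (v: R): 0<r -> r<=s -> W r<=v -> v<=W s -> exists2 t, r<=t<=s & W t = v.
move=> r0 rs h1 h2; have [|//|t]:=@IVT R W r s v rs.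
- apply: derivable_within_continuous=> x; rewrite in_itv/= => /andP[rx _].
 have []:=is_derive_coneW measurableT cT (lt_le_trans r0 rx)=> //.
- by rewrite ge_min h1/= le_max h2 orbT.
by rewrite in_itv/= => ht <-; exists t.
Qed.

Variables (o: V) (To: 'M[R]_(n.+2, n.+1)).
Hypothesis so: splits o To.

Lemma gno_cap a b: 0<a -> 0<b -> a^+2+b^+2 = 1 -> gno o To (cap o a) = B (b/a).
move=> a0 b0 ab.
have key (y: 'rV[R]_d): (a<=dot (nrm (o+y *m To^T)) o) = (enorm y<=b/a).
 have l0: 0<enorm (o+y *m To^T) by rewrite enorm_gt0 lift_neq0.
 rewrite /nrm dotZl lift_dot// mulr1 -[a in LHS]invrK lef_pV2 ?posrE ?invr_gt0//.
 rewrite -(@ler_pXn2r _ 2)// ?nnegrE ?enorm_ge0 ?invr_ge0 ?(ltW a0)// enormE lift_norm//.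
 rewrite -[RHS](@ler_pXn2r _ 2)// ?nnegrE ?enorm_ge0 ?divr_ge0 ?(ltW a0) ?(ltW b0)//.
 rewrite enormE expr_div_n exprVn. transitivity (1+dot y y<=1+b^+2/a^+2); last by rewrite lerD2l.
 congr (_<=_); rewrite -[X in X+_](@divff _ (a^+2)) ?expf_neq0 ?gt_eqF//. by rewrite -mulrDl ab mul1r.
seteq=> [y [_]|y h]; first by rewrite /= key.
by split; [apply: nrm_unit; exact: lift_neq0|rewrite key].
Qed.

Lemma svol_cap a b: 0<a -> 0<b -> a^+2+b^+2 = 1 -> hausdorff d (cap o a) = (hratio d*W (b/a))%:E.
move=> a0 b0 ab; have mc: measurable (cap o a) by apply: measV_closed; exact: closed_cap.
rewrite (svol_gno so mc); first by rewrite (gno_cap a0 b0 ab) int_eball EFinM.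
 by move=> x [].
by move=> x [_]; exact: lt_le_trans.
Qed.

Lemma svol_ball beta: 0<beta<pi/2 -> svol (d:=n.+1) (geodesic_ball o beta) = (hratio d*W (tan beta))%:E.
move=> bp; have /andP[b0 b1]:=bp.
have c0: 0<cos beta by apply: cos_gt0_pihalf; rewrite b1 andbT (lt_trans _ b0)// oppr_lt0 divr_gt0// pi_gt0.
have s0: 0<sin beta by exact: sin_gt0_pihalf.
rewrite (geodesic_ball_cap so); last first.
 by rewrite (ltW b0) (le_trans (ltW b1))// ler_pdivrMr// ler_peMr ?pi_ge0// ler1n.
exact: (svol_cap c0 s0 (cos2Dsin2 beta)).
Qed.

End Assembly.

Section Comparison.
Context {R: realType} (m: nat).
Local Notation n := m.+1.
Local Notation d := n.+1.
Local Notation V := 'rV[R]_n.+2.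
Variables (K: set V) (o: V) (alpha: R).
Hypotheses (m1: (0<m)%N) (cK: spherical_convex_body (d:=d) K) (gK: GHS_center (d:=d) K o).
Hypotheses (al: 0<alpha<pi/2) (tal: tan alpha = Num.sqrt (d%:R*(d%:R-2)))
 (Kal: K `<=` geodesic_ball (d:=d) o alpha).
Variable (To: 'M[R]_(n.+2, n.+1)).
Hypothesis so: splits o To.
Local Notation X := (gno o To K).
Local Notation B r := [set x : 'rV[R]_d | (enorm x <= r)%R].
Local Notation omega := (coneR [set: 'rV[R]_d]).
Local Notation W := (coneW [set: 'rV[R]_d]).

Let iKo: sinterior (d:=d) K o. Proof. by have []:=gK. Qed.

Let dd0: 0<d%:R*(d%:R-2) :> R.
Proof. by rewrite mulr_gt0// subr_gt0 ltr_nat !ltnS. Qed.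

Let tal0: 0<tan alpha. Proof. by rewrite tal sqrtr_gt0. Qed.

Let cos0 beta: 0<beta<pi/2 -> 0<cos beta :> R.
move=> /andP[b0 b1]; apply: cos_gt0_pihalf; rewrite b1 andbT (lt_trans _ b0)//.
by rewrite oppr_lt0 divr_gt0// pi_gt0.
Qed.

Let le_pi (beta: R): 0<=beta -> beta<pi/2 -> 0<=beta<=pi.
by move=> b0 b1; rewrite b0 (le_trans (ltW b1))// ler_pdivrMr// ler_peMr ?pi_ge0// ler1n.
Qed.

(** Containment gives x.o >= cos(alpha), and cos(alpha)^(-2) = 1 + tan(alpha)^2 = 1 + d(d-2). *)
Lemma body_tail x: K x -> 0<dot x o /\ dot (x *m To) (x *m To)<=(d%:R*(d%:R-2))*dot x o^+2.
have ca:=cos0 al; have /andP[a0 a1]:=al.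
move=> /Kal; rewrite (geodesic_ball_cap so); last exact: le_pi (ltW a0) a1.
move=> [/= xx cx]; have x0: 0<dot x o by exact: lt_le_trans cx.
split=> //.
have:=splits_dot x x so; rewrite xx -expr2=> e1.
have t2: tan alpha^+2 = d%:R*(d%:R-2) by rewrite tal sqr_sqrtr// ltW.
have:=cos2_tan2 (lt0r_neq0 ca); rewrite t2; set D:=d%:R*(d%:R-2)=> cD.
have c2: cos alpha^+2<=dot x o^+2 by rewrite ler_pXn2r ?nnegrE ?(ltW ca) ?(ltW x0).
have cp: 0<cos alpha^+2 by rewrite exprn_gt0.
have: cos alpha^+2*(1+D) = 1 by rewrite -cD divff// gt_eqF.
have D0: 0<1+D by rewrite addr_gt0.
have: cos alpha^+2*(1+D)<=dot x o^+2*(1+D) by rewrite ler_pM2r.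
by lra.
Qed.

Let mX: measurable X. Proof. by apply: measV_closed; exact: closed_gno. Qed.
Let fX: (leb d X < +oo)%E. Proof. exact: (leb_gno_lty cK so body_tail). Qed.
Let X0: (0<leb d X)%E. Proof. exact: (leb_gno_gt0 cK so iKo). Qed.

Let XB: X `<=` B (tan alpha).
move=> y /(gno_bounded so body_tail) h /=; rewrite tal.
by rewrite /enorm ler_wsqrtr.
Qed.

Let v:=fine (\int[leb d]_(y in X) (wsph y)%:E).

Let vE: (\int[leb d]_(y in X) (wsph y)%:E = v%:E)%E.
rewrite fineK// ge0_fin_numE; first exact: int_wsph_lty.
by apply: integral_ge0=> y _; rewrite lee_fin wsph_ge0.
Qed.

Let svolK: svol (d:=d) K = (hratio d*v)%:E.
have [KS KC _ _]:=cK.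
rewrite /svol (svol_gno so (measV_closed KC)); first by rewrite vE EFinM.
 by [].
by move=> x /body_tail[].
Qed.

Let v0: 0<v.
have lX:=fine_lty (measure_ge0 (leb d) X) fX.
have [|h _]:=@int_wsph_bounds R n X _ (wrad d (tan alpha)) 1 mX lX (ltW (wrad_gt0 _ _)) ler01.
 by move=> y /XB yt; rewrite wsph_wrad wrad_le ?enorm_ge0//= -wsph_wrad wsph_le1.
rewrite -lte_fin -vE; apply: lt_le_trans h; rewrite lte_fin mulr_gt0 ?wrad_gt0//.
by rewrite fine_gt0// X0.
Qed.

Let vW: v<=W (tan alpha).
rewrite -lee_fin -vE -int_eball; apply: ge0_subset_integral=> //.
- exact: meas_eball.
- by apply/mEFP; apply: measurable_funTS; exact: meas_wsph.
- by move=> y _; rewrite lee_fin wsph_ge0.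
Qed.

(** Lower end of the interval on which the volume of balls is inverted; differentiability of the
    weighted volume is available at positive radii. *)
Lemma small_radius: exists r, [/\ 0<r, r<=tan alpha & W r<v].
have w0:=@omega_gt0 R n.
pose r:=Num.min (Num.min 1 (tan alpha)) (v/(omega+1)).
have w1: 0<omega+1 by rewrite addr_gt0.
have r0: 0<r by rewrite !lt_min ltr01 tal0/=; exact: divr_gt0.
have [r1 ra rv]: [/\ r<=1, r<=tan alpha & r<=v/(omega+1)] by rewrite !ge_min !lexx !orbT.
exists r; split=> //; apply: (le_lt_trans (@coneW_le R n r r0)).
apply: (@le_lt_trans _ _ (v/(omega+1) * omega)).
 rewrite ler_wpM2r// ?(ltW w0)// (le_trans _ rv)// exprS ler_piMr ?exprn_ile1// ltW//.
have ww: omega<omega+1 by rewrite ltrDl.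
by rewrite mulrAC ltr_pdivrMr// ltr_pM2l.
Qed.

(** A radius of the right volume exists by the intermediate value theorem. The radius selected by
    [xget] could be another one, but monotonicity of the volume of balls confines it to the interval
    from 0, excluded, to alpha. *)
Lemma equivolume_radius: exists2 beta, 0<beta<pi/2 /\ tan beta<=tan alpha &
 equivolume_ball (d:=d) K o = geodesic_ball (d:=d) o beta /\ W (tan beta) = v.
have [r [r0 ra rv]]:=small_radius; have hr:=@hratio_gt0 R d.
have at0 (t: R): 0<t -> 0<atan t<pi/2.
 by move=> t0; rewrite atan_ltpi2 andbT -(@atan0 R) lt_atan.
have mono (beta beta': R): beta<=beta' ->
  (svol (d:=d) (geodesic_ball o beta)<=svol (d:=d) (geodesic_ball o beta'))%E.
 move=> bb; apply: le_hausdorff=> u [uu h]; split=> //; exact: le_trans bb.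
have [t /andP[rt ta] Wt]:=coneW_ivt r0 ra (ltW rv) vW.
have t0: 0<t by exact: lt_le_trans rt.
pose P := [set beta | 0<=beta<=pi /\ svol (d:=d) (geodesic_ball o beta) = svol (d:=d) K].
have [/= bpi bv]: P (xget 0 P).
 apply: xgetPex; exists (atan t); have /andP[h1 h2]:=at0 _ t0. split; first exact: le_pi (ltW h1) h2.
 by rewrite (svol_ball so (at0 _ t0)) svolK atanK Wt.
have /andP[a0 a1]:=al.
pose beta:=xget 0 P; rewrite -/beta in bpi bv.
have ba: beta<=alpha.
 (* [beta] might exceed pi/2, where [svol_ball] says nothing; [b'] lies strictly above alpha, below
    pi/2 and not above [beta]. *)
 rewrite leNgt; apply/negP=> ab. pose b':=Num.min beta ((alpha+pi/2)/2).
 have b'a: alpha<b' by rewrite lt_min ab/=; lra. have b'pi: 0<b'<pi/2.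
  by rewrite (lt_trans a0 b'a)/= gt_min; apply/orP; right; lra.
 have:=mono b' beta; rewrite ge_min lexx=> /(_ isT).
 rewrite (svol_ball so b'pi) bv svolK lee_fin ler_pM2l// leNgt=> /negP; apply.
 apply: (le_lt_trans vW); apply: coneW_lt=> //. have /andP[h1 h2]:=b'pi.
 by rewrite ltr_tan// in_itv/= ?h2 ?a1 andbT; apply: lt_trans a0 || apply: lt_trans h1; rewrite oppr_lt0 divr_gt0// pi_gt0.
have b0: 0<beta.
 rewrite lt_neqAle eq_sym; have /andP[-> _]:=bpi; rewrite andbT; apply/eqP=> be.
 have:=mono beta (atan r); rewrite be=> /(_ (ltW _)); have /andP[h1 _]:=at0 _ r0.
 move=> /(_ h1); rewrite -be (svol_ball so (at0 _ r0)) bv svolK atanK lee_fin ler_pM2l// leNgt.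
 by rewrite rv.
have bp: 0<beta<pi/2 by rewrite b0 (le_lt_trans ba).
exists beta.
 split=> //; rewrite le_eqVlt; have [->|bn]:=eqVneq beta alpha; first by rewrite eqxx.
 rewrite ltr_tan ?lt_neqAle ?bn ?ba ?orbT// in_itv/= ?a1 ?(le_lt_trans ba a1) andbT.
  by apply: lt_trans b0; rewrite oppr_lt0 divr_gt0// pi_gt0.
 by apply: lt_trans a0; rewrite oppr_lt0 divr_gt0// pi_gt0.
split=> //; move: bv; rewrite (svol_ball so bp) svolK=> -[] /(mulfI (lt0r_neq0 hr)).
by [].
Qed.

Lemma symdiff_null a b: 0<a -> 0<b -> a^+2+b^+2 = 1 ->
 leb d X = leb d (B (b/a)) -> leb d (X `\` B (b/a)) = 0%E -> svol (d:=d) (symdiff (d:=d) K (cap o a)) = 0%E.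
move=> a0 b0 ab eX nX; have [KS KC _ _]:=cK.
have mK:=measV_closed KC.
have mc: measurable (cap o a) by apply: measV_closed; exact: closed_cap.
have mB: measurable (B (b/a)) by exact: meas_eball.
rewrite /svol (svol_gno so).
- have -> : gno o To (symdiff (d:=d) K (cap o a)) = (X `\` B (b/a)) `|` (B (b/a) `\` X).
  by rewrite -(gno_cap so a0 b0 ab). by rewrite (int_null_symdiff mX mB fX eX nX) mule0.
- by apply: measurableU; exact: measurableD.
- by move=> x [[/KS]|[[]]].
- by move=> x [[Kx _]|[[_ h] _]]; [have []:=body_tail Kx|exact: lt_le_trans h].
Qed.

(** [area_le] with the error factor tending to 1. Since the ball of radius r has the weighted volume
    of X, the excess of the whole space is the volume of the unit ball times F(r). *)
Lemma floating_area_upper (r lam p: R): 0<r -> r^+2<=d%:R*(d%:R-2) -> 0<lam -> W r = v ->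
 measurable (polar X) -> 0<=p -> leb d (polar X) = p%:E ->
 (floating_area (d:=d) K<=(hratio n*d%:R*(d%:R/d.+1%:R * lam*(omega*frad d r) + lam^-d/d.+1%:R * p))%:E)%E.
move=> r0 hr lam0 Wr mP p0 pE; have [_ iKd _]:=gK; have [oo _ _]:=so.
have [c /andP[c0 c1] hK]:=uniform_center oo iKo iKd.
set A:=(X in (_<=X%:E)%E).
have ce: cone_excess X r setT = omega*frad d r.
 by rewrite /cone_excess setTI vE Wr/= subrK.
have key L: 1<L -> (floating_area (d:=d) K<=(L*L*A)%:E)%E.
 move=> L1; have:=area_le cK so (sinterior_mem iKo) c0 (ltW c1) hK body_tail isT L1 lam0 r0 hr mX fX mP.
 rewrite ce pE -[X in (_+X)%E]EFinM -EFinD -!EFinM=> h; apply: (le_trans h); rewrite lee_fin le_eqVlt.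
 by apply/orP; left; apply/eqP; rewrite /A; ring.
have O0: (0<=floating_area (d:=d) K)%E.
 by apply: integral_ge0=> x _; rewrite lee_fin powR_ge0.
have Of: floating_area (d:=d) K \is a fin_num.
 by rewrite ge0_fin_numE// (le_lt_trans (key 2 _)) ?ltry// ltr1n.
have hn:=@hratio_gt0 R n; have A0: 0<=A.
 rewrite /A mulr_ge0//; first pos. apply: addr_ge0; apply: mulr_ge0=> //.
 - pos.
 - by rewrite mulr_ge0 ?coneR_ge0// /frad mulr_ge0 ?exprn_ge0 ?expR_ge0// ltW.
 - by rewrite divr_ge0// invr_ge0 exprn_ge0// ltW.
rewrite -(fineK Of) lee_fin; apply: ler_mulgt1=> // L L1.
have s1: 1<Num.sqrt L by rewrite -{1}sqrtr1 ltr_sqrt// (lt_trans ltr01).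
have:=key _ s1; rewrite -(fineK Of) lee_fin -expr2 sqr_sqrtr//.
by rewrite (le_trans ler01)// ltW.
Qed.

Lemma comparison: exists2 C: R, 0<C & (floating_area (d:=d) K <=
   (1-C*fine (svol (d:=d) (symdiff (d:=d) K (equivolume_ball (d:=d) K o)))^+2)%:E
    * floating_area (d:=d) (equivolume_ball (d:=d) K o))%E.
have [beta [bp bt] [-> Wv]]:=equivolume_radius; have /andP[be0 be1]:=bp.
have a0:=cos0 bp; have b0:=sin_gt0_pihalf bp; have ab:=cos2Dsin2 beta.
rewrite (geodesic_ball_cap so (le_pi (ltW be0) be1)) -/(cap o (cos beta)).
move: a0 b0 ab bt Wv; rewrite /tan; set a:=cos beta; set b:=sin beta.
move: a b=> a b a0 b0 ab bt Wv; rewrite -/(tan alpha) in bt.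
set r:=b/a in bt Wv; have r0: 0<r by rewrite divr_gt0.
have hr: r^+2<=d%:R*(d%:R-2).
 have <- : tan alpha^+2 = d%:R*(d%:R-2) by rewrite tal sqr_sqrtr// ltW.
 by rewrite ler_pXn2r ?nnegrE ?(ltW r0) ?(ltW tal0).
have sX:=starbody_gno cK so iKo body_tail; have [_ _ cen]:=gK.
have [clP _ _ [rho hrho]]:=starbody_polar sX.
have mP: measurable (polar X) by exact: measV_closed.
have fP: (leb d (polar X) < +oo)%E by exact: (leb_lty hrho).
have sant:=blaschke_santalo sX (centroid_balance cK so iKo body_tail cen).
have [p p0 pE]: exists2 p, 0<=p & leb d (polar X) = p%:E.
 by exists (fine (leb d (polar X))); [apply: fine_ge0; exact: measure_ge0|exact: fine_lty (measure_ge0 (leb d) _) fP].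
have [x xE]: exists x, leb d X = x%:E.
 by exists (fine (leb d X)); exact: fine_lty (measure_ge0 (leb d) _) fX.
have [bl beq]:=leb_bathtub r0 mX fX (etrans vE (esym (etrans (@int_eball R n r) (congr1 EFin Wv)))).
have w0:=@omega_gt0 R n.
have eB:=@leb_eball R n r r0.
have {}bl:=EFin_le eB xE bl.
have e1:=@leb_eball R n 1 ltr01; rewrite expr1n mul1r in e1.
have {}sant:=EFin_mul_le xE pE e1 sant.
have [lam lam0 [lam1 lam2]]:=optimal_multiplier n a0 b0 ab; rewrite -/r in lam1 lam2.
have up:=floating_area_upper r0 hr lam0 Wv mP p0 pE.
have low:=floating_area_cap so a0 b0 ab; rewrite e1 -lam2 -EFinM in low.
have q0: 0<r^+d by rewrite exprn_gt0.
have F0: 0<frad d r by rewrite /frad mulr_gt0 ?expR_gt0.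
have hn:=@hratio_gt0 R n.
have c0: 0 < @hratio R n*d%:R by rewrite mulr_gt0.
have l0: 0<lam^-d/d.+1%:R by rewrite divr_gt0// invr_gt0 exprn_gt0.
(* At the value omega r^(-d), the volume of the polar of the ball, the two terms balance and the
   upper bound coincides with the lower bound for the cap. *)
have wE: lam*frad d r*(@hratio R n*d%:R) * omega =
  hratio n*d%:R*(d%:R/d.+1%:R * lam*(omega*frad d r)+lam^-d/d.+1%:R*(omega*r^-d)).
 have -> : lam^-d/d.+1%:R*(omega*r^-d) = (lam^-d*r^-d) * omega/d.+1%:R by ring.
 have e: d.+1%:R = d%:R+1 :> R by rewrite natr1. have en: d%:R+1 != 0 :> R by [].
 by rewrite lam1 e; move: (d%:R: R) en=> D en; field.
(* Santalo and the bathtub principle: vol(polar X) <= omega^2 / vol(X) <= omega r^(-d). *)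
have pq: p<=omega*r^-d.
 rewrite ler_pdivlMr//; have:=sant. have: r^+d * omega * p<=x * p by rewrite ler_wpM2r.
 by move=> h1 h2; rewrite -(ler_pM2r w0); lra.
apply: (choose_constant _ up low).
- by apply: integral_ge0=> y _; rewrite lee_fin powR_ge0.
- pos.
- by rewrite wE ler_pM2l// lerD2l ler_pM2l.
(* A nonzero symmetric difference excludes equality in the bathtub principle. Then vol(X) is
   strictly larger than the volume of the ball, and Santalo makes the polar volume strictly
   smaller. *)
move=> D0; rewrite wE ltr_pM2l// ltrD2l ltr_pM2l//.
have [xq|xq]:=eqVneq x (r^+d * omega).
 have eBX:=etrans xE (etrans (congr1 EFin xq) (esym eB)).
 case/eqP: D0; exact: (congr1 fine (symdiff_null a0 b0 ab eBX (beq (esym eBX)))).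
have {}xq: r^+d * omega<x by rewrite lt_neqAle eq_sym xq.
rewrite ltNge; apply/negP=> h.
have: omega*r^-d*x<=p*x by rewrite ler_wpM2r// (le_trans _ bl)// mulr_ge0 ?ltW.
have: omega*r^-d*(r^+d * omega)<omega*r^-d*x.
 by rewrite ltr_pM2l// divr_gt0.
rewrite (_: omega*r^-d*(r^+d * omega) = omega * omega); last by field; rewrite gt_eqF.
by move: sant; lra.
Qed.

End Comparison.

Theorem theorem1p2 (R : realType) (d : nat) (K : set 'rV[R]_d.+1)
    (o : 'rV[R]_d.+1) (alpha : R) :
  (3 <= d)%N ->
  spherical_convex_body K -> proper_body K -> GHS_center K o ->
  0 < alpha < pi / 2 -> tan alpha = Num.sqrt (d%:R * (d%:R - 2)) ->
  K `<=` geodesic_ball o alpha ->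
  exists2 C : R, 0 < C &
    (floating_area K <=
     (1 - C * fine (svol (symdiff K (equivolume_ball K o))) ^+ 2)%:E
       * floating_area (equivolume_ball K o))%E.
Proof.
case: d K o => [//|[//|m]] K o m3 cK _ gK al tal Kal.
have m1 : (0 < m)%N by [].
have [cS _ _ _] := cK; have [iKo _ _] := gK.
have oo : dot o o = 1 by exact: cS (sinterior_mem iKo).
have [To so] := splits_exists oo.
exact: (comparison m1 cK gK al tal Kal so).
Qed.
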